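(* Let $\kappa\in\{-1,0,1\}$, let $n\ge 3$ be an integer, and let $A$ be a real number with $A\in(0,\infty)$ if $\kappa=0$, $A\in(0,2\pi)$ if $\kappa=1$, and $A\in(0,(n-2)\pi)$ if $\kappa=-1$. Among all polygons with $n$ sides in $M^2_\kappa$ having area $A$, the perimeter minimizer is the regular $n$-gon; that is, a polygon in this family has least perimeter in the family if and only if it is a regular $n$-gon of area $A$.
   Context: $M^2_\kappa$ denotes the complete simply connected surface of constant curvature $\kappa$: the Euclidean plane for $\kappa=0$, the unit sphere $S^2\subset\mathbb{R}^3$ for $\kappa=1$, the hyperbolic plane for $\kappa=-1$. A line in $M^2_\kappa$ is a complete geodesic (a straight line, a great circle, a hyperbolic line respectively); connected subsets of lines are called geodesic segments. For $x\ne y$ (and $y\neq -x$ if $\kappa=1$), $[x,y]$ is the shortest geodesic segment joining $x$ and $y$. A polygon in $M^2_\kappa$ is a closed region whose boundary is a simple closed curve consisting of (finitely many) geodesic segments, called its sides. A point $p$ of the boundary is a vertex if the boundary intersected with some disc centered at $p$ consists of two radial geodesic segments which are not extensions of each other. The angle of the polygon at a vertex is its interior angle. A polygon $\wp$ is convex if $[x,y]\subset\wp$ for all distinct $x,y\in\wp$ (with $y\ne -x$ if $\kappa=1$). A polygon in $M^2_1$ is proper if it contains no pair of antipodal points. A polygon is equilateral if all its sides have the same length, equiangular if all its angles are equal, and regular if it is convex, equilateral and equiangular. A regular $n$-gon is a regular polygon (proper regular polygon if $\kappa=1$) with $n$ sides. *)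

(* Defs.v *)
From HB Require Import structures.
From mathcomp Require Import all_boot all_order all_algebra.
From mathcomp Require Import all_classical all_reals all_analysis.
Import Order.TTheory GRing.Theory Num.Theory.
Import numFieldNormedType.Exports.

Set Implicit Arguments.
Unset Strict Implicit.
Unset Printing Implicit Defensive.

Local Open Scope classical_set_scope.
Local Open Scope ring_scope.

(* The three surfaces are realised inside the space of triples ((x, y), z):
     curvature  1 : the unit sphere  x^2 + y^2 + z^2 = 1,
     curvature  0 : the plane  z = 1,
     curvature -1 : the hyperboloid sheet  z^2 = 1 + x^2 + y^2, z > 0,
   i.e. the points with  k (x^2 + y^2) + z^2 = 1  (and z > 0 when k <= 0).
   The Riemannian metric is the restriction of  dx^2 + dy^2 + k dz^2  to the
   tangent planes (Euclidean for k = 1, 0, Minkowski for k = -1). *)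

Inductive curvature := Hyperbolic | Flat | Spherical.

Section Geometry.
Variable R : realType.
Notation space := (R * R * R)%type.
Implicit Types (k : curvature) (p q x y u v : space) (P : set space).

Definition curv k : R :=
  match k with Hyperbolic => -1 | Flat => 0 | Spherical => 1 end.

Definition surface k : set space :=
  [set p | curv k * (p.1.1 ^+ 2 + p.1.2 ^+ 2) + p.2 ^+ 2 = 1 /\
           (k <> Spherical -> 0 < p.2)].

Definition metric k u v : R :=
  u.1.1 * v.1.1 + u.1.2 * v.1.2 + curv k * (u.2 * v.2).

(* u is in the kernel of the differential at p of the equation of the
   surface *)
Definition tangent k p u : Prop :=
  curv k * (p.1.1 * u.1.1 + p.1.2 * u.1.2) + p.2 * u.2 = 0.

Definition unit_tangent k p u : Prop := tangent k p u /\ metric k u u = 1.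

Definition gcos k (t : R) : R :=
  match k with
  | Hyperbolic => (expR t + expR (- t)) / 2
  | Flat => 1
  | Spherical => cos t
  end.

Definition gsin k (t : R) : R :=
  match k with
  | Hyperbolic => (expR t - expR (- t)) / 2
  | Flat => t
  | Spherical => sin t
  end.

(* The unit speed geodesic from the point p with initial velocity u.  As t
   ranges over R it describes a line, and as t ranges over an interval [0, l]
   a geodesic segment, of length l as long as it does not overlap itself. *)
Definition geodesic k p u (t : R) : space :=
  (gcos k t * p.1.1 + gsin k t * u.1.1,
   gcos k t * p.1.2 + gsin k t * u.1.2,
   gcos k t * p.2 + gsin k t * u.2).

Definition segment k p u (l : R) : set space :=
  [set geodesic k p u t | t in `[0, l]].

Definition radial k p u (r : R) : set space :=
  [set geodesic k p u t | t in `[0, r[].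

Definition disc k p (r : R) : set space :=
  [set q | exists2 u, unit_tangent k p u & radial k p u r q].

Definition joins k x u (l : R) y : Prop :=
  [/\ unit_tangent k x u, 0 <= l & geodesic k x u l = y].

(* the segment written [x, y] *)
Definition shortest_segment k x y : set space :=
  [set q | exists u l, [/\ joins k x u l y,
     forall u' l', joins k x u' l' y -> l <= l' & segment k x u l q]].

Definition convex k P : Prop :=
  forall x y, P x -> P y -> x <> y -> (k = Spherical -> y <> - x) ->
  shortest_segment k x y `<=` P.

Definition proper P : Prop := forall x, P x -> ~ P (- x).

(* For P included in the surface, interior and closure in the type
   [subspace (surface k)] are those of the relative topology. *)
Definition rel_interior k P : set space :=
  interior (P : set (subspace (surface k))).

Definition rel_closure k P : set space :=
  closure (P : set (subspace (surface k))).

Definition boundary k P : set space := rel_closure k P `\` rel_interior k P.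

(* the closure of a connected open subset of the surface *)
Definition closed_region k P : Prop :=
  [/\ P `<=` surface k,
      connected (rel_interior k P : set (subspace (surface k))) &
      P = rel_closure k (rel_interior k P)].

Definition is_vertex k P p : Prop :=
  boundary k P p /\
  exists (r : R) u v,
    [/\ 0 < r, unit_tangent k p u, unit_tangent k p v, u <> v /\ u <> - v &
        boundary k P `&` disc k p r = radial k p u r `|` radial k p v r].

(* Near p, the set P is the sector of opening a swept, in the direct sense
   of the tangent frame (e1, e2), from the direction of e1. *)
Definition interior_angle k P p (a : R) : Prop :=
  0 < a < 2 * pi /\
  exists (r : R) (e1 e2 : space),
    [/\ 0 < r, unit_tangent k p e1, unit_tangent k p e2, metric k e1 e2 = 0 &
        P `&` disc k p r =
        \bigcup_(phi in `[0, a])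
          radial k p (cos phi * e1.1.1 + sin phi * e2.1.1,
                      cos phi * e1.1.2 + sin phi * e2.1.2,
                      cos phi * e1.2 + sin phi * e2.2) r].

(* Riemannian area.  Over the points (x, y) with k (x^2 + y^2) < 1 the surface
   is made of the graphs of z = h (x, y) and, on the sphere, z = - h (x, y),
   where h (x, y) = sqrt (1 - k (x^2 + y^2)); the area element of each graph
   is dx dy / h (x, y).  The rest of the surface is empty if k <= 0, and is the
   equator, of area zero, if k = 1. *)
Definition height k (w : R * R) : R :=
  Num.sqrt (1 - curv k * (w.1 ^+ 2 + w.2 ^+ 2)).

Definition area k P : \bar R :=
  (\int[@lebesgue_measure R \x @lebesgue_measure R]_(w in
      [set w : R * R | curv k * (w.1 ^+ 2 + w.2 ^+ 2) < 1]%R)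
    (((\1_P (w, height k w) + \1_P (w, - height k w)) / height k w)%R)%:E)%E.

(* A polygon with n sides, its vertices being listed in cyclic order along the
   boundary.  Consecutive vertices need not determine the side between them (on
   the sphere a side may have length pi or more), so the i-th side is given by
   its origin [vtx i], its initial direction [dir i] and its length [len i].
   By [polygon_vertex] no angle is straight, so that the sides are maximal
   segments of the boundary. *)
Record polygon k (n : nat) := Polygon {
  region :> set space;
  vtx : 'I_n -> space;
  dir : 'I_n -> space;
  len : 'I_n -> R;
  polygon_region : closed_region k region;
  polygon_vtx : forall i, surface k (vtx i);
  polygon_dir : forall i, unit_tangent k (vtx i) (dir i);
  polygon_len : forall i, 0 < len i;
  polygon_next : forall i, geodesic k (vtx i) (dir i) (len i) = vtx (ordS i);
  polygon_simple : forall i j (s t : R), 0 <= s < len i -> 0 <= t < len j ->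
    geodesic k (vtx i) (dir i) s = geodesic k (vtx j) (dir j) t ->
    i = j /\ s = t;
  polygon_boundary :
    boundary k region = \bigcup_i segment k (vtx i) (dir i) (len i);
  polygon_vertex : forall i, is_vertex k region (vtx i)
}.

Definition perimeter k n (P : polygon k n) : R := \sum_(i < n) len P i.

Definition equilateral k n (P : polygon k n) : Prop :=
  forall i j, len P i = len P j.

Definition equiangular k n (P : polygon k n) : Prop :=
  exists a : R, forall i, interior_angle k P (vtx P i) a.

Definition regular_ngon k n (P : polygon k n) : Prop :=
  [/\ convex k P, equilateral P, equiangular P & k = Spherical -> proper P].

End Geometry.

(* Main.v *)
(* Cutting the region of a polygon by meridians shows that its area is the sum of
   the signed areas of the triangles spanned by a pole and the sides, once a
   motion has put all vertices in the open half-sphere around the pole (possible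
   since a closed curve shorter than a great circle lies in an open hemisphere).
   Among closed chains of n points in a large cap with area at least A, a shortest
   one exists by compactness. By the first variation its sides are equal and
   its turns are equal, so its vertices follow a circle in equal steps; comparing
   circles, the step 2 pi / n and the area A are optimal. For a polygon
   attaining the bound, the region is determined by its boundary, hence it is the
   regular n-gon; conversely the vertices of any regular n-gon form such a chain. *)
Require Import Defs.
From HB Require Import structures.
From mathcomp Require Import all_boot all_order all_algebra.
From mathcomp Require Import all_classical all_reals all_analysis.
From mathcomp Require Import measurable_realfun.
From mathcomp Require Import ring lra zify.
Import Order.TTheory GRing.Theory Num.Theory.
Import numFieldNormedType.Exports.

Set Implicit Arguments.
Unset Strict Implicit.
Unset Printing Implicit Defensive.

Local Open Scope classical_set_scope.
Local Open Scope ring_scope.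

(** The competitors are closed chains of [n] points rather than polygons: they may cross themselves
    or repeat points, and their area is the signed sum of [tri]. So limits and variations stay in
    the class, and the degenerate chains (repeated points, spikes) are excluded only for minimizers.
    The cap serves compactness alone. A closed chain can be recentred by a half-turn so that it fits
    strictly inside a cap whose size depends on its length, hence the cap is inactive in the first
    variation. The multiplier rule needs one motion that shortens the chain: the contraction towards
    the pole. The area formula avoids triangulations: in the coordinates x and longitude the area
    element is dx ds, a meridian slice is a signed sum of crossing abscissas, and the abscissa has
    an explicit primitive along each side. On the sphere, polygons of perimeter at least [2 * pi]
    need not fit into a half-sphere, but the regular n-gon is shorter than [2 * pi], so they cannot
    compete. A regular polygon must also be shown to go once around its circle: convexity excludes
    star-shaped chains. *)

Section Surface.
Context {R : realType}.
Notation space := (R * R * R)%type.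
Notation rT := (measurableTypeR R).
Notation K := (curv R).
Notation mu := (@lebesgue_measure R).
Implicit Types (k : curvature) (s t : R) (q : space) (n : nat) (F : set space).

Ltac between := apply/andP; split; lra.

(** * Differentiation rules *)

Section DerivationRules.
Implicit Types (f g : R -> R) (x c : R).

(* Not a class, unlike [is_derive], so that applying the rules never triggers
   an instance search. *)
Variant has_der f x d : Prop := HasDer of is_derive x 1 f d.

Lemma has_derP f x d : has_der f x d <-> is_derive x 1 f d.
Proof. by split=> [[]|]. Qed.

Lemma der_eq f x d d' : has_der f x d -> d = d' -> has_der f x d'.
Proof. by move=> ? <-. Qed.

Lemma derD f g x df dg : has_der f x df -> has_der g x dg ->
  has_der (fun t => f t + g t) x (df + dg).
Proof. by move=> [fd] [gd]; split; exact: (is_deriveD fd gd). Qed.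

Lemma derB f g x df dg : has_der f x df -> has_der g x dg ->
  has_der (fun t => f t - g t) x (df - dg).
Proof. by move=> [fd] [gd]; split; exact: (is_deriveB fd gd). Qed.

Lemma derN f x df : has_der f x df -> has_der (fun t => - f t) x (- df).
Proof. by move=> [fd]; split; exact: (is_deriveN fd). Qed.

Lemma derM f g x df dg : has_der f x df -> has_der g x dg ->
  has_der (fun t => f t * g t) x (df * g x + f x * dg).
Proof.
move=> [fd] [gd]; split; have := is_deriveM fd gd.
by rewrite /GRing.scale /= addrC [g x * _]mulrC.
Qed.

Lemma derV f x df : f x != 0 -> has_der f x df ->
  has_der (fun t => (f t)^-1) x (- df / f x ^+ 2).
Proof.
move=> f0 [fd]; split; apply: DeriveDef; first exact: derivableV.
by rewrite deriveV// derive_val /GRing.scale /= mulNr mulrC mulNr.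
Qed.

Lemma derX2 f x df : has_der f x df ->
  has_der (fun t => f t ^+ 2) x (2 * f x * df).
Proof.
move=> fd; rewrite (_ : (fun t => _) = fun t => f t * f t).
  have := derM fd fd; rewrite (_ : _ + _ = 2 * f x * df) //; ring.
by apply/funext => t; rewrite expr2.
Qed.

Lemma der_cst c x : has_der (fun=> c) x 0.
Proof. by split; exact: is_derive_cst. Qed.

Lemma der_id x : has_der (fun t => t) x 1.
Proof. by split; exact: is_derive_id. Qed.

Lemma der_comp f g x df dg : has_der f (g x) df -> has_der g x dg ->
  has_der (fun t => f (g t)) x (df * dg).
Proof. by move=> [fd] [gd]; split; exact: (is_derive1_comp fd gd). Qed.

Lemma der_sqrt f x df : 0 < f x -> has_der f x df ->
  has_der (fun t => Num.sqrt (f t)) x (df / (2 * Num.sqrt (f x))).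
Proof.
move=> f0 fd; have := der_comp (HasDer (is_derive1_sqrt f0)) fd.
by rewrite mulrC.
Qed.

Lemma has_der_continuous f x df : has_der f x df -> {for x, continuous f}.
Proof. by move=> [[fd _]]; apply/differentiable_continuous/derivable1_diffP. Qed.

Lemma der_expR x : has_der expR x (expR x).
Proof. by split; exact: is_derive_expR. Qed.

Lemma der_ln x : 0 < x -> has_der (@ln R) x x^-1.
Proof. by move=> x0; split; exact: is_derive1_ln. Qed.

Lemma der_sin x : has_der sin x (cos x).
Proof. by split; exact: is_derive_sin. Qed.

Lemma der_cos x : has_der cos x (- sin x).
Proof. by split; exact: is_derive_cos. Qed.

Lemma der_asin x : -1 < x < 1 -> has_der (@asin R) x (Num.sqrt (1 - x ^+ 2))^-1.
Proof. by move=> x1; split; exact: is_derive1_asin. Qed.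

Lemma der_atan x : has_der (@atan R) x (1 + x ^+ 2)^-1.
Proof. by split; exact: is_derive1_atan. Qed.

Lemma der_comb f g x df dg : has_der f x df -> has_der g x dg -> forall c c',
  has_der (fun t => f t * c + g t * c') x (df * c + dg * c').
Proof.
move=> hf hg c c'; apply: der_eq; first by apply: derD; apply: derM; [exact: hf|exact: der_cst|exact: hg|exact: der_cst].
by rewrite !mulr0 !addr0.
Qed.

End DerivationRules.

Lemma eq_space (p q : space) : p.1.1 = q.1.1 -> p.1.2 = q.1.2 -> p.2 = q.2 -> p = q.
Proof. by case: p q => [[? ?] ?] [[? ?] ?] /= -> -> ->. Qed.

Ltac coords := apply: eq_space => /=; ring.

(** * Trigonometry and metric geometry, uniformly in the curvature *)

Section Geometry.
Implicit Types (a b d e x : R) (p r u v w o : space) (P : set space).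

Lemma gcos0 k : gcos k 0 = 1 :> R.
Proof. by case: k => //=; [rewrite oppr0 expR0; lra|rewrite cos0]. Qed.

Lemma gsin0 k : gsin k 0 = 0 :> R.
Proof. by case: k => //=; [rewrite oppr0 subrr mul0r|rewrite sin0]. Qed.

Lemma gcosN k t : gcos k (- t) = gcos k t.
Proof. by case: k => //=; [rewrite opprK addrC|rewrite cosN]. Qed.

Lemma gsinN k t : gsin k (- t) = - gsin k t.
Proof. by case: k => //=; [rewrite opprK; ring|rewrite sinN]. Qed.

Lemma gcos2Dgsin2 k t : gcos k t ^+ 2 + K k * gsin k t ^+ 2 = 1.
Proof.
case: k => /=; last by rewrite mul1r cos2Dsin2.
  have := expRxMexpNx_1 t; nra.
by ring.
Qed.

Lemma gcosD k s t : gcos k (s + t) = gcos k s * gcos k t - K k * (gsin k s * gsin k t).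
Proof.
case: k => /=; last by rewrite mul1r cosD.
  by rewrite opprD !expRD; field.
by ring.
Qed.

Lemma gsinD k s t : gsin k (s + t) = gsin k s * gcos k t + gcos k s * gsin k t.
Proof.
case: k => /=; last by rewrite sinD.
  by rewrite opprD !expRD; field.
by ring.
Qed.

Lemma gsinB k s t : gsin k (s - t) = gsin k s * gcos k t - gcos k s * gsin k t.
Proof. by rewrite gsinD gcosN gsinN; ring. Qed.

Lemma gcos_half k t : gcos k t = 1 - 2 * K k * gsin k (t / 2) ^+ 2.
Proof.
rewrite [in LHS](splitr t) gcosD.
by have h := gcos2Dgsin2 k (t / 2); lra.
Qed.

Lemma gcos_half' k t : gcos k t = 2 * gcos k (t / 2) ^+ 2 - 1.
Proof. by rewrite gcos_half; have := gcos2Dgsin2 k (t / 2); nra. Qed.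

Lemma gsin_half k t : gsin k t = 2 * gsin k (t / 2) * gcos k (t / 2).
Proof. by rewrite [in LHS](splitr t) gsinD; ring. Qed.

Lemma der_gcos k t : has_der (gcos k) t (- K k * gsin k t).
Proof.
case: k => /=.
- apply: der_eq.
    apply: derM; last exact: der_cst.
    apply: derD; first exact: der_expR.
    by apply: (@der_comp expR); [exact: der_expR|apply: derN; exact: der_id].
  by rewrite /=; field.
- by apply: der_eq; [exact: der_cst|ring].
- by apply: der_eq; [exact: der_cos|ring].
Qed.

Lemma der_gsin k t : has_der (gsin k) t (gcos k t).
Proof.
case: k => /=.
- apply: der_eq.
    apply: derM; last exact: der_cst.
    apply: derB; first exact: der_expR.
    by apply: (@der_comp expR); [exact: der_expR|apply: derN; exact: der_id].
  by rewrite /=; field.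
- exact: der_id.
- exact: der_sin.
Qed.

Lemma continuous_gcos k : continuous (gcos k : R -> R).
Proof. by move=> t; apply: has_der_continuous (der_gcos k t). Qed.

Lemma continuous_gsin k : continuous (gsin k : R -> R).
Proof. by move=> t; apply: has_der_continuous (der_gsin k t). Qed.

Lemma gsin_gt0 k t : 0 < t -> (k = Spherical -> t < pi) -> 0 < gsin k t.
Proof.
case: k => //= t0 h.
- by rewrite divr_gt0// subr_gt0 ltr_expR; lra.
- by rewrite sin_gt0_pi// t0 h.
Qed.

Lemma gsin_ge0 k t : 0 <= t -> (k = Spherical -> t <= pi) -> 0 <= gsin k t.
Proof.
case: k => //= t0 h.
- by rewrite divr_ge0// subr_ge0 ler_expR; lra.
- by rewrite sin_ge0_pi// t0 h.
Qed.

Lemma gcos_gt0 k t : (k = Spherical -> - (pi / 2) < t < pi / 2) -> 0 < gcos k t.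
Proof.
case: k => //= h; first by rewrite divr_gt0// addr_gt0// expR_gt0.
by rewrite cos_gt0_pihalf// h.
Qed.

(* On the sphere the arguments are halves of lengths at most pi. *)
Definition quarter k t := k = Spherical -> - (pi / 2) <= t <= pi / 2.

Lemma ltr_gsin k s t : quarter k s -> quarter k t ->
  (gsin k s < gsin k t) = (s < t).
Proof.
case: k => //= hs ht.
- have e0 := expR_gt0.
  apply/idP/idP => [|st].
    apply: contraTT; rewrite -!leNgt => ts.
    by rewrite ler_pM2r// lerB// ler_expR; lra.
  by rewrite ltr_pM2r// ltrB// ltr_expR; lra.
- by rewrite ltr_sin// ?in_itv/= ?hs ?ht.
Qed.

Lemma ler_gsin k s t : quarter k s -> quarter k t ->
  (gsin k s <= gsin k t) = (s <= t).
Proof. by move=> hs ht; rewrite leNgt ltr_gsin// -leNgt. Qed.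

Lemma gsin_inj k s t : quarter k s -> quarter k t -> gsin k s = gsin k t -> s = t.
Proof.
move=> hs ht e; apply/le_anti.
by rewrite -(ler_gsin hs ht) -(ler_gsin ht hs) e lexx.
Qed.

Definition gasin k x : R := match k with
  | Hyperbolic => ln (x + Num.sqrt (1 + x ^+ 2))
  | Flat => x
  | Spherical => asin x
  end.

Lemma hyperbolic_sqrt_gt x : 0 < x + Num.sqrt (1 + x ^+ 2).
Proof.
have s0 : 0 <= Num.sqrt (1 + x ^+ 2) := sqrtr_ge0 _.
have := sqr_sqrtr (_ : 0 <= 1 + x ^+ 2).
move/(_ ltac:(nra)); nra.
Qed.

Lemma gasinK k x : (k = Spherical -> -1 <= x <= 1) -> gsin k (gasin k x) = x.
Proof.
case: k => //= h; last by rewrite asinK// in_itv/= h.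
rewrite expRN lnK ?posrE ?hyperbolic_sqrt_gt//.
have h0 := hyperbolic_sqrt_gt x.
have := sqr_sqrtr (_ : 0 <= 1 + x ^+ 2).
move/(_ ltac:(nra)); set r := Num.sqrt _ in h0 * => hr.
suff -> : (x + r)^-1 = r - x by field.
apply: (mulfI (lt0r_neq0 h0)); rewrite divff ?lt0r_neq0//; nra.
Qed.

Lemma gasin_quarter k x : (k = Spherical -> -1 <= x <= 1) -> quarter k (gasin k x).
Proof. by move=> h e; move: (h e); subst k => h'; rewrite asin_geNpi2// asin_lepi2. Qed.

Lemma gsinK k t : quarter k t -> gasin k (gsin k t) = t.
Proof.
move=> ht; have hs : k = Spherical -> -1 <= gsin k t <= 1.
  by move=> ->; rewrite sin_geN1 sin_le1.
by apply: (@gsin_inj k) => //; [exact: gasin_quarter|rewrite gasinK].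
Qed.

Lemma gasin0 k : gasin k 0 = 0.
Proof.
rewrite -[in LHS](gsin0 k) gsinK// => _; have := @pi_gt0 R; lra.
Qed.

Lemma ler_gasin k x y : (k = Spherical -> -1 <= x <= 1) ->
  (k = Spherical -> -1 <= y <= 1) -> (gasin k x <= gasin k y) = (x <= y).
Proof. by move=> hx hy; rewrite -(@ler_gsin k) ?gasinK//; exact: gasin_quarter. Qed.

Lemma ltr_gasin k x y : (k = Spherical -> -1 <= x <= 1) ->
  (k = Spherical -> -1 <= y <= 1) -> (gasin k x < gasin k y) = (x < y).
Proof. by move=> hx hy; rewrite ltNge ler_gasin// -ltNge. Qed.

Lemma gasin_ge0 k x : 0 <= x -> (k = Spherical -> x <= 1) -> 0 <= gasin k x.
Proof.
move=> x0 x1; rewrite -(gasin0 k) ler_gasin// => e; rewrite ?lexx ?x1//; lra.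
Qed.

Lemma der_gasin k x : (k = Spherical -> -1 < x < 1) ->
  has_der (gasin k) x (Num.sqrt (1 - K k * x ^+ 2))^-1.
Proof.
case: k => /= h.
- have h0 := hyperbolic_sqrt_gt x.
  have p0 : 0 < 1 + x ^+ 2 by nra.
  have s0 : 0 < Num.sqrt (1 + x ^+ 2) by rewrite sqrtr_gt0.
  apply: der_eq.
    apply: (@der_comp (@ln R)); first exact: der_ln.
    apply: derD; first exact: der_id.
    apply: der_sqrt; first exact: p0.
    by apply: derD; [exact: der_cst|apply: derX2; exact: der_id].
  rewrite /= mulN1r opprK; field.
  by rewrite !lt0r_neq0.
- by apply: der_eq; [exact: der_id|rewrite mul0r subr0 sqrtr1 invr1].
- by rewrite mul1r; apply: der_asin; exact: h.
Qed.

(** Converts the tangent of half an area into half the area. For nonzero curvature areas are angle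
    excesses or defects, hence the ordinary arctangent also in the hyperbolic case; the flat case is
    the limit of vanishing curvature. *)
Definition gatan k x : R := if k is Flat then x else atan x.

Lemma gatan0 k : gatan k 0 = 0.
Proof. by case: k => //=; rewrite atan0. Qed.

Lemma gatanN k x : gatan k (- x) = - gatan k x.
Proof. by case: k => //=; rewrite atanN. Qed.

Lemma ltr_gatan k x y : (gatan k x < gatan k y) = (x < y).
Proof.
case: k => //=; (apply/idP/idP; last exact: lt_atan);
  by apply: contraTT; rewrite -!leNgt; exact: le_atan.
Qed.

Lemma ler_gatan k x y : (gatan k x <= gatan k y) = (x <= y).
Proof. by rewrite leNgt ltr_gatan -leNgt. Qed.

Lemma der_gatan k x : has_der (gatan k) x (1 + (K k * x) ^+ 2)^-1.
Proof.
case: k => /=.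
- by rewrite mulN1r sqrrN; exact: der_atan.
- by rewrite mul0r expr0n addr0 invr1; exact: der_id.
- by rewrite mul1r; exact: der_atan.
Qed.

(* For curvature 1, 0, -1 this is cos, 1, cosh of the distance between two
   points of the surface. *)
Definition bil k p q : R := K k * (p.1.1 * q.1.1 + p.1.2 * q.1.2) + p.2 * q.2.

Definition det3 p q r : R :=
  p.1.1 * (q.1.2 * r.2 - q.2 * r.1.2) - p.1.2 * (q.1.1 * r.2 - q.2 * r.1.1)
  + p.2 * (q.1.1 * r.1.2 - q.1.2 * r.1.1).

(* The tangent vector u at p, turned by a right angle in the direct sense. *)
Definition trot k p u : space :=
  (p.1.2 * u.2 - p.2 * u.1.2, p.2 * u.1.1 - p.1.1 * u.2,
   K k * (p.1.1 * u.1.2 - p.1.2 * u.1.1)).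

Definition lin a p b q : space :=
  (a * p.1.1 + b * q.1.1, a * p.1.2 + b * q.1.2, a * p.2 + b * q.2).

(* Squared chord; it equals 4 sin^2, d^2, 4 sinh^2 of half the distance. *)
Definition chord2 k p q : R :=
  (p.1.1 - q.1.1) ^+ 2 + (p.1.2 - q.1.2) ^+ 2 + K k * (p.2 - q.2) ^+ 2.

Lemma geodesicE k p u t : geodesic k p u t = lin (gcos k t) p (gsin k t) u.
Proof. by []. Qed.

Lemma geodesic0 k p u : geodesic k p u 0 = p.
Proof. by rewrite geodesicE gcos0 gsin0; apply: eq_space => /=; ring. Qed.

Lemma curvK k : K k * K k * K k = K k.
Proof. by case: k => /=; ring. Qed.

Lemma bilC k p q : bil k p q = bil k q p.
Proof. by rewrite /bil; ring. Qed.

Lemma metricC k p q : metric k p q = metric k q p.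
Proof. by rewrite /metric; ring. Qed.

Lemma bil_linl k a p b q r : bil k (lin a p b q) r = a * bil k p r + b * bil k q r.
Proof. by rewrite /bil /=; ring. Qed.

Lemma chord2_metric k p q : chord2 k p q = metric k p p + metric k q q - 2 * metric k p q.
Proof. by rewrite /chord2 /metric; ring. Qed.

Lemma bil_linr k a p b q r : bil k r (lin a p b q) = a * bil k r p + b * bil k r q.
Proof. by rewrite /bil /=; ring. Qed.

Definition bil_lin := (bil_linl, bil_linr).

Lemma metric_linl k a p b q r :
  metric k (lin a p b q) r = a * metric k p r + b * metric k q r.
Proof. by rewrite /metric /=; ring. Qed.

Lemma metric_linr k a p b q r :
  metric k r (lin a p b q) = a * metric k r p + b * metric k r q.
Proof. by rewrite /metric /=; ring. Qed.

Lemma det3_lin1 a p b q r o : det3 (lin a p b q) r o = a * det3 p r o + b * det3 q r o.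
Proof. by rewrite /det3 /=; ring. Qed.

Lemma det3_lin2 a p b q r o : det3 r (lin a p b q) o = a * det3 r p o + b * det3 r q o.
Proof. by rewrite /det3 /=; ring. Qed.

Lemma det3_lin3 a p b q r o : det3 r o (lin a p b q) = a * det3 r o p + b * det3 r o q.
Proof. by rewrite /det3 /=; ring. Qed.

Lemma det3_cycle p q r : det3 p q r = det3 q r p.
Proof. by rewrite /det3; ring. Qed.

Lemma det3_swap p q r : det3 p q r = - det3 q p r.
Proof. by rewrite /det3; ring. Qed.

Lemma det3_swap23 p q r : det3 p q r = - det3 p r q.
Proof. by rewrite /det3; ring. Qed.

Lemma det3pp p q : det3 p p q = 0.
Proof. by rewrite /det3; ring. Qed.

Lemma det3_pqp p q : det3 p q p = 0.
Proof. by rewrite /det3; ring. Qed.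

Lemma det3_qpp p q : det3 q p p = 0.
Proof. by rewrite /det3; ring. Qed.

Lemma surface_bil k p : surface k p -> bil k p p = 1.
Proof. by rewrite /surface /bil /= => -[<- _]; ring. Qed.

Lemma surface_flat p : surface Flat p -> p.2 = 1.
Proof.
rewrite /surface /= mul0r add0r => -[/eqP z1 z0].
have {}z0 : 0 < p.2 by apply: z0.
by move: z1; rewrite sqrf_eq1 => /orP[/eqP//|/eqP e]; rewrite e in z0 *; lra.
Qed.

Lemma tangent_flat p u : surface Flat p -> tangent Flat p u -> u.2 = 0.
Proof. by move=> /surface_flat; rewrite /tangent/= => ->; lra. Qed.

Lemma tangentE k p u : tangent k p u = (bil k p u = 0).
Proof. by []. Qed.

Lemma metric_bil k p q : k <> Flat -> metric k p q = K k * bil k p q.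
Proof. by case: k => // _; rewrite /metric /bil /=; ring. Qed.

Lemma bil_metric k p q : k <> Flat -> bil k p q = K k * metric k p q.
Proof. by case: k => // _; rewrite /metric /bil /=; ring. Qed.

Lemma chord2C k p q : chord2 k p q = chord2 k q p.
Proof. by rewrite /chord2; ring. Qed.

Lemma chord2_bil k p q : surface k p -> surface k q ->
  K k * chord2 k p q = 2 * (K k * K k) * (1 - bil k p q).
Proof.
move=> /surface_bil + /surface_bil; rewrite /chord2 /bil.
by case: k => /= hp hq; lra.
Qed.

Lemma chord2_nonflat k p q : k <> Flat -> surface k p -> surface k q ->
  chord2 k p q = 2 * K k * (1 - bil k p q).
Proof. by move=> k0 /chord2_bil h /h; case: k k0 {h} => //= _ ; lra. Qed.

Lemma bil_chord2 k p q : surface k p -> surface k q ->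
  bil k p q = 1 - K k * chord2 k p q / 2.
Proof.
case: k => hp hq.
- by rewrite chord2_nonflat//=; lra.
- by rewrite /bil (surface_flat hp) (surface_flat hq)/=; lra.
- by rewrite chord2_nonflat//=; lra.
Qed.

(** Lagrange's identity in the tangent plane, with [det3 p] as its area form. For nonzero curvature
    the squared determinant is the Gram determinant of [p], [u], [w] for [bil], expanded along the
    row of [p]. *)
Lemma gram_tangent k p u w : surface k p -> tangent k p u -> tangent k p w ->
  metric k u u * metric k w w = metric k u w ^+ 2 + det3 p u w ^+ 2.
Proof.
case: (pselect (k = Flat)) => [-> hp hu hw|k0 /surface_bil hp].
  rewrite /metric /det3 (surface_flat hp) (tangent_flat hp hu) (tangent_flat hp hw).
  by rewrite /=; ring.
rewrite !tangentE => hu hw.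
have -> : det3 p u w ^+ 2 = bil k p p * (bil k u u * bil k w w - bil k u w ^+ 2)
   - bil k p u * (bil k p u * bil k w w - bil k p w * bil k u w)
   + bil k p w * (bil k p u * bil k u w - bil k p w * bil k u u).
  by case: k k0 {hp hu hw} => // _; rewrite /bil /det3 /=; ring.
rewrite hp hu hw !metric_bil//.
by case: k k0 {hp hu hw} => //= _; ring.
Qed.

Lemma cauchy_tangent k p u w : surface k p -> unit_tangent k p u ->
  unit_tangent k p w -> metric k u w ^+ 2 + det3 p u w ^+ 2 = 1.
Proof. by move=> hp [tu u1] [tw w1]; rewrite -(gram_tangent hp)// u1 w1 mulr1. Qed.

Lemma metric_tangent_le1 k p u w : surface k p -> unit_tangent k p u ->
  unit_tangent k p w -> -1 <= metric k u w <= 1.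
Proof. by move=> hp hu hw; have := cauchy_tangent hp hu hw; nra. Qed.

Lemma det3_rot_unit k p u : surface k p -> unit_tangent k p u ->
  det3 p u (trot k p u) = 1.
Proof.
case: (pselect (k = Flat)) => [-> hp [hu u1]|k0 /surface_bil hp].
  move: u1; rewrite /metric /det3 /= (surface_flat hp) (tangent_flat hp hu).
  by move=> u1; lra.
rewrite /unit_tangent !tangentE => -[hu]; rewrite metric_bil// => u1.
have -> : det3 p u (trot k p u) = K k * (bil k p p * bil k u u - bil k p u * bil k p u).
  by case: k k0 {hp u1 hu} => //= _; rewrite /det3 /bil /=; ring.
by rewrite hp hu mul1r mul0r subr0.
Qed.

Lemma frame_tangent k p u w : surface k p -> unit_tangent k p u -> tangent k p w ->
  w = lin (metric k u w) u (det3 p u w) (trot k p u).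
Proof.
move=> sp uu; have d1 := det3_rot_unit sp uu; move: sp uu d1.
case: (pselect (k = Flat)) => [-> hp [hu u1] _ hw|k0 /surface_bil hp].
  have := surface_flat hp; have := tangent_flat hp hu; have := tangent_flat hp hw.
  move: u1; rewrite /metric /det3 /lin /trot /=.
  case: p u w {hp hu hw} => [[x y] z] [[a b] c] [[d e] f] /= u1 -> -> ->.
  have u2 : a * a = 1 - b * b by lra.
  by apply: eq_space => /=; ring: u2.
rewrite /unit_tangent !tangentE => -[hu]; rewrite metric_bil// => u1 d1 hw.
have d2 : det3 w u (trot k p u) = 0.
  have -> : det3 w u (trot k p u) = K k * (bil k u u * bil k p w - bil k p u * bil k u w).
    by case: k k0 {hp u1 hu hw d1} => //= _; rewrite /det3 /bil /=; ring.
  by rewrite hw hu !(mulr0, mul0r, subr0).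
have d3 : det3 p w (trot k p u) = metric k u w.
  have -> : det3 p w (trot k p u) = K k * (bil k p p * bil k u w - bil k p u * bil k p w).
    by case: k k0 {hp u1 hu hw d1 d2} => //= _; rewrite /det3 /bil /=; ring.
  by rewrite hp hw mul1r mulr0 subr0 metric_bil.
(* Cramer's rule in the basis [p], [u], [trot k p u]; the coefficient of [p] is zero by [d2], since
   [w] is tangent. *)
have cramer : lin (det3 p u (trot k p u)) w 0 w =
  lin 1 (lin (det3 w u (trot k p u)) p (det3 p w (trot k p u)) u) (det3 p u w) (trot k p u).
  by apply: eq_space; rewrite /det3 /=; ring.
move: cramer; rewrite d1 d2 d3 /lin /= => -[e1 e2 e3].
by apply: eq_space => /=; [move: e1|move: e2|move: e3]; lra.
Qed.

Lemma rot_tangent k p u : surface k p -> tangent k p u -> tangent k p (trot k p u).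
Proof.
move=> _ _; rewrite tangentE /bil /trot /=; ring.
Qed.

Lemma metric_rot k p u : surface k p -> tangent k p u -> metric k u (trot k p u) = 0.
Proof.
case: (pselect (k = Flat)) => [-> hp hu|k0 _ _].
  by rewrite /metric /trot /= (surface_flat hp) (tangent_flat hp hu); ring.
by case: k k0 => //= _; rewrite /metric /trot /=; ring.
Qed.

Lemma det3_rot k p u w : surface k p -> tangent k p u -> tangent k p w ->
  det3 p u w = metric k (trot k p u) w.
Proof.
case: (pselect (k = Flat)) => [-> hp hu hw|k0 _ _ _].
  rewrite /metric /trot /det3 /= (surface_flat hp) (tangent_flat hp hu).
  by rewrite (tangent_flat hp hw); ring.
by case: k k0 => //= _; rewrite /metric /trot /det3 /=; ring.
Qed.

Lemma unit_rot k p u : surface k p -> unit_tangent k p u -> unit_tangent k p (trot k p u).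
Proof.
move=> hp hu; have tr := rot_tangent hp hu.1; split => //.
by rewrite -det3_rot//; [exact: det3_rot_unit|case: hu].
Qed.

Lemma trot_trot k p u : surface k p -> unit_tangent k p u ->
  trot k p (trot k p u) = lin (-1) u 0 u.
Proof.
move=> hp hu; have tr := rot_tangent hp hu.1.
rewrite [LHS](frame_tangent hp hu (rot_tangent hp tr)).
rewrite metricC -det3_rot//; last by case: hu.
have -> : det3 p u (trot k p (trot k p u)) = 0.
  rewrite (det3_rot hp hu.1 (rot_tangent hp tr)).
  exact: metric_rot.
by rewrite det3_swap23 (det3_rot_unit hp hu); apply: eq_space => /=; ring.
Qed.

(** Half the distance is read off half the chord. The form [bil] would not do, since it is constant
    on the flat surface. *)
Definition dist k p q : R := 2 * gasin k (Num.sqrt (chord2 k p q) / 2).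

(** Reversed Cauchy-Schwarz inequality: the equation of the sheet turns it into the ordinary one for
    (1, x, y) and (1, a, b). *)
Lemma hyperbolic_bil_ge1 p q : surface Hyperbolic p -> surface Hyperbolic q ->
  1 <= bil Hyperbolic p q.
Proof.
rewrite /surface /bil /=; case: p q => [[x y] z] [[a b] c] /=.
move=> [h1 /(_ ltac:(by []))z0] [h2 /(_ ltac:(by [])) c0].
have zc := mulr_gt0 z0 c0.
have e : (1 + (x * a + y * b)) ^+ 2 <= (z * c) ^+ 2.
  have -> : (z * c) ^+ 2 = (1 + (x ^+ 2 + y ^+ 2)) * (1 + (a ^+ 2 + b ^+ 2)).
    have e1 : z ^+ 2 = 1 + (x ^+ 2 + y ^+ 2) by lra.
    have e2 : c ^+ 2 = 1 + (a ^+ 2 + b ^+ 2) by lra.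
    by rewrite exprMn e1 e2.
  have := sqr_ge0 (x - a); have := sqr_ge0 (y - b); have := sqr_ge0 (x * b - y * a).
  by move=> *; lra.
by rewrite leNgt; apply/negP => h; nra.
Qed.

Lemma hyperbolic_bil_eq1 p q : surface Hyperbolic p -> surface Hyperbolic q ->
  bil Hyperbolic p q = 1 -> p = q.
Proof.
rewrite /surface /bil /=; case: p q => [[x y] z] [[a b] c] /=.
move=> [h1 /(_ ltac:(by []))z0] [h2 /(_ ltac:(by [])) c0] e.
have {}e : z * c = 1 + (x * a + y * b) by lra.
have : (z * c) ^+ 2 = (1 + (x ^+ 2 + y ^+ 2)) * (1 + (a ^+ 2 + b ^+ 2)).
  have e1 : z ^+ 2 = 1 + (x ^+ 2 + y ^+ 2) by lra.
  have e2 : c ^+ 2 = 1 + (a ^+ 2 + b ^+ 2) by lra.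
  by rewrite exprMn e1 e2.
rewrite e => E.
have := sqr_ge0 (x - a); have := sqr_ge0 (y - b); have := sqr_ge0 (x * b - y * a).
move=> i1 i2 i3.
have /eqP : (x - a) ^+ 2 = 0 by nra.
have /eqP : (y - b) ^+ 2 = 0 by nra.
rewrite !sqrf_eq0 !subr_eq0 => /eqP yb /eqP xa.
have zc : z ^+ 2 = c ^+ 2 by subst x y; lra.
have {}zc : z = c by apply/eqP; rewrite -(@eqrXn2 _ 2)// ?ltW// zc.
by subst.
Qed.

Lemma spherical_bil_geN1 p q : surface Spherical p -> surface Spherical q ->
  -1 <= bil Spherical p q <= 1.
Proof.
rewrite /surface /bil /=; case: p q => [[x y] z] [[a b] c] /= [h1 _] [h2 _].
have := sqr_ge0 (x - a); have := sqr_ge0 (y - b); have := sqr_ge0 (z - c).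
have := sqr_ge0 (x + a); have := sqr_ge0 (y + b); have := sqr_ge0 (z + c).
by move=> *; apply/andP; split; nra.
Qed.

Lemma chord2_ge0 k p q : surface k p -> surface k q -> 0 <= chord2 k p q.
Proof.
move=> hp hq; case: k hp hq => hp hq.
- rewrite chord2_nonflat//=; have := hyperbolic_bil_ge1 hp hq; lra.
- by rewrite /chord2/= mul0r addr0 addr_ge0// sqr_ge0.
- rewrite chord2_nonflat//=; have := spherical_bil_geN1 hp hq; lra.
Qed.

Lemma chord2_eq0 k p q : surface k p -> surface k q -> chord2 k p q = 0 -> p = q.
Proof.
move=> hp hq; case: k hp hq => hp hq.
- rewrite chord2_nonflat//=; move=> ?; apply: hyperbolic_bil_eq1 => //; lra.
- rewrite /chord2/= mul0r addr0 => /eqP.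
  rewrite paddr_eq0 ?sqr_ge0// !sqrf_eq0 !subr_eq0 => /andP[/eqP ? /eqP ?].
  by apply: eq_space => //; rewrite (surface_flat hp) (surface_flat hq).
- rewrite /chord2 /= mul1r => /eqP.
  rewrite paddr_eq0 ?sqr_ge0// ?addr_ge0 ?sqr_ge0// paddr_eq0 ?sqr_ge0//.
  rewrite !sqrf_eq0 !subr_eq0 => /andP[/andP[/eqP ? /eqP ?] /eqP ?].
  exact: eq_space.
Qed.

Lemma spherical_antipode p q : surface Spherical p -> surface Spherical q ->
  bil Spherical p q = -1 -> q = - p.
Proof.
rewrite /surface /bil /=; case: p q => [[x y] z] [[a b] c] /= [h1 _] [h2 _] h.
have := sqr_ge0 (x + a); have := sqr_ge0 (y + b); have := sqr_ge0 (z + c).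
move=> i1 i2 i3.
have /eqP : (x + a) ^+ 2 = 0 by nra.
have /eqP : (y + b) ^+ 2 = 0 by nra.
have /eqP : (z + c) ^+ 2 = 0 by nra.
rewrite !sqrf_eq0 !addr_eq0 => /eqP-> /eqP-> /eqP->.
by apply: eq_space => /=; rewrite opprK.
Qed.

Lemma half_chord_le1 k p q : surface k p -> surface k q ->
  k = Spherical -> -1 <= Num.sqrt (chord2 k p q) / 2 <= 1.
Proof.
move=> + + ks; subst k => hp hq.
have s0 := sqrtr_ge0 (chord2 Spherical p q).
have : Num.sqrt (chord2 Spherical p q) <= 2.
  rewrite -(@ler_pXn2r _ 2) ?nnegrE// sqr_sqrtr ?chord2_ge0//.
  rewrite chord2_nonflat//=; have := spherical_bil_geN1 hp hq; lra.
by move=> h; lra.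
Qed.

Lemma gsin_half_dist k p q : surface k p -> surface k q ->
  gsin k (dist k p q / 2) = Num.sqrt (chord2 k p q) / 2.
Proof.
move=> hp hq; rewrite /dist mulrAC divff// mul1r gasinK//; exact: half_chord_le1.
Qed.

Lemma chord2_dist k p q : surface k p -> surface k q ->
  chord2 k p q = 4 * gsin k (dist k p q / 2) ^+ 2.
Proof.
move=> hp hq; rewrite gsin_half_dist// expr_div_n sqr_sqrtr ?chord2_ge0//.
by field.
Qed.

Lemma bil_dist k p q : surface k p -> surface k q -> bil k p q = gcos k (dist k p q).
Proof.
by move=> hp hq; rewrite bil_chord2// gcos_half chord2_dist//; field.
Qed.

Lemma distC k p q : dist k p q = dist k q p.
Proof. by rewrite /dist chord2C. Qed.

Lemma dist_ge0 k p q : surface k p -> surface k q -> 0 <= dist k p q.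
Proof.
move=> hp hq; rewrite mulr_ge0// gasin_ge0 ?divr_ge0 ?sqrtr_ge0//.
by move=> /(half_chord_le1 hp hq)/andP[].
Qed.

Lemma dist_pp k p : dist k p p = 0.
Proof.
rewrite /dist (_ : chord2 _ _ _ = 0); last by rewrite /chord2; ring.
by rewrite sqrtr0 mul0r gasin0 mulr0.
Qed.

Lemma dist_eq0 k p q : surface k p -> surface k q -> dist k p q = 0 -> p = q.
Proof.
move=> hp hq d0; apply: (@chord2_eq0 k) => //.
by rewrite chord2_dist// d0 mul0r gsin0 expr0n mulr0.
Qed.

Lemma dist_lepi k p q : surface k p -> surface k q -> k = Spherical -> dist k p q <= pi.
Proof.
move=> hp hq ks; have /andP[_ ] := gasin_quarter (half_chord_le1 hp hq) ks.
by rewrite /dist; lra.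
Qed.

Lemma dist_ltpi k p q : surface k p -> surface k q -> (k = Spherical -> q <> - p) ->
  k = Spherical -> dist k p q < pi.
Proof.
move=> hp hq h ks; rewrite lt_neqAle dist_lepi// andbT; apply/eqP => e.
apply: h => //; move: hp hq e; rewrite ks => hp hq e.
apply: spherical_antipode => //.
by rewrite bil_dist// e /= cospi.
Qed.

Lemma bil_tangents k p u w : surface k p -> tangent k p u -> tangent k p w ->
  bil k u w = K k * metric k u w.
Proof.
case: (pselect (k = Flat)) => [-> hp hu hw|k0 _ _ _]; last exact: bil_metric.
by rewrite /bil /= (tangent_flat hp hu); ring.
Qed.

Lemma bil_tangent k p u : tangent k p u -> bil k p u = 0.
Proof. by []. Qed.

(** Keeps geodesics on the upper sheet: since the square of [gsin] is below that of [gcos], the term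
    [gcos * p.2] dominates [gsin * u.2]. *)
Lemma tangent_sqr_hyperbolic p u : surface Hyperbolic p -> unit_tangent Hyperbolic p u ->
  u.2 ^+ 2 < p.2 ^+ 2.
Proof.
rewrite /surface /unit_tangent /tangent /metric /=.
case: p u => [[x y] z] [[a b] c] /= [h1 h] [h2 h3].
have z0 : 0 < z by apply: h.
have e : z * c = x * a + y * b by lra.
have e2 : (z * c) ^+ 2 <= (x ^+ 2 + y ^+ 2) * (a ^+ 2 + b ^+ 2).
  by rewrite e; have := sqr_ge0 (x * b - y * a); lra.
have e3 : x ^+ 2 + y ^+ 2 = z ^+ 2 - 1 by lra.
have e4 : a ^+ 2 + b ^+ 2 = 1 + c ^+ 2 by lra.
by move: e2; rewrite e3 e4 exprMn; lra.
Qed.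

Lemma geodesic_surface k p u t : surface k p -> unit_tangent k p u ->
  surface k (geodesic k p u t).
Proof.
move=> hp hu.
have hb : bil k (geodesic k p u t) (geodesic k p u t) = 1.
  rewrite geodesicE !bil_lin (bil_tangents hp hu.1 hu.1).
  rewrite (bilC k u p) (bil_tangent hu.1) hu.2 (surface_bil hp).
  by have := gcos2Dgsin2 k t; lra.
split; first by move: hb; rewrite /bil; lra.
move=> ks; case: k hp hu ks {hb} => hp hu ks //.
- have := tangent_sqr_hyperbolic hp hu; case: hp => _ /(_ ks).
  have c0 : 0 < gcos Hyperbolic t by apply: gcos_gt0.
  have := gcos2Dgsin2 Hyperbolic t.
  have -> : (geodesic Hyperbolic p u t).2 =
    gcos Hyperbolic t * p.2 + gsin Hyperbolic t * u.2 by [].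
  move: (gcos Hyperbolic t) c0 (gsin Hyperbolic t) (p.2) (u.2).
  move=> c c0 s z d /= h1 z0 dz.
  have [//|h] := ltrP 0 (c * z + s * d).
  have cz : 0 < c * z by rewrite mulr_gt0.
  have sd : 0 < - (s * d) by lra.
  have : (c * z) ^+ 2 <= (s * d) ^+ 2.
    have czsd : c * z <= - (s * d) by lra.
    by have := ler_pM (ltW cz) (ltW cz) czsd czsd; lra.
  have : s ^+ 2 * d ^+ 2 <= s ^+ 2 * z ^+ 2 by rewrite ler_wpM2l ?sqr_ge0// ltW.
  by rewrite !exprMn => *; clear ks; nra.
- by rewrite /= (surface_flat hp) (tangent_flat hp hu.1) /=; lra.
Qed.

Lemma bil_geodesic k p u t : surface k p -> unit_tangent k p u ->
  bil k p (geodesic k p u t) = gcos k t.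
Proof.
move=> hp hu; rewrite geodesicE bil_linr (surface_bil hp).
by rewrite (bil_tangent hu.1); ring.
Qed.

Lemma chord2_geodesic k p u t : surface k p -> unit_tangent k p u ->
  chord2 k p (geodesic k p u t) = 4 * gsin k (t / 2) ^+ 2.
Proof.
move=> hp hu; case: (pselect (k = Flat)) => [k0|k0].
  subst k; have [_ h] := hu; move: h; rewrite /metric /chord2 /= (tangent_flat hp hu.1).
  by move=> h; rewrite [RHS](_ : _ = t ^+ 2 * (u.1.1 * u.1.1 + u.1.2 * u.1.2 + 0 * (0 * 0)));
    [ring|rewrite h; field].
rewrite chord2_nonflat// ?bil_geodesic//; last exact: geodesic_surface.
by rewrite gcos_half; case: k k0 {hp hu} => // _ /=; ring.
Qed.

Lemma dist_geodesic k p u t : surface k p -> unit_tangent k p u -> 0 <= t ->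
  (k = Spherical -> t <= pi) -> dist k p (geodesic k p u t) = t.
Proof.
move=> hp hu t0 tpi; rewrite /dist chord2_geodesic//.
rewrite -[4]/(2 * 2)%:R natrM -expr2 -exprMn sqrtr_sqr ger0_norm; last first.
  rewrite mulr_ge0// gsin_ge0//; first by lra.
  by move=> /tpi; have := @pi_ge0 R; lra.
rewrite mulrAC divff// mul1r gsinK; first by field.
by move=> /tpi ?; apply/andP; have := @pi_ge0 R; split; lra.
Qed.

Lemma exists_unit_tangent k p : surface k p -> exists u, unit_tangent k p u.
Proof.
move=> hp; have [h|h] := ltrP 0 (p.2 ^+ 2 + K k * p.1.1 ^+ 2).
  pose m := Num.sqrt (p.2 ^+ 2 + K k * p.1.1 ^+ 2).
  have m0 : m != 0 by rewrite lt0r_neq0// sqrtr_gt0.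
  have m2 : m ^+ 2 = p.2 ^+ 2 + K k * p.1.1 ^+ 2 by rewrite sqr_sqrtr// ltW.
  exists (p.2 / m, 0, - K k * p.1.1 / m); split.
    by rewrite /tangent /=; field.
  rewrite /metric /=; have kk := curvK k.
  have -> : p.2 / m * (p.2 / m) + 0 * 0 + K k * (- K k * p.1.1 / m * (- K k * p.1.1 / m))
    = (p.2 ^+ 2 + (K k * K k * K k) * p.1.1 ^+ 2) / m ^+ 2 by field.
  by rewrite kk m2 divff// -m2 expf_neq0.
have [h1 h2] := hp; case: k hp h h1 h2 => /= hp h h1 h2.
- by have := h2 ltac:(by []); nra.
- by have := h2 ltac:(by []); nra.
(* What is left are the points of the sphere with x = z = 0, where the previous vector vanishes. *)
- exists (0, p.2, - p.1.2); split; rewrite /tangent /metric /=; first by ring.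
  by have := sqr_ge0 p.1.1; have := sqr_ge0 p.2; nra.
Qed.

Lemma exists_join k p q : surface k p -> surface k q -> (k = Spherical -> q <> - p) ->
  exists2 u, unit_tangent k p u & geodesic k p u (dist k p q) = q.
Proof.
move=> hp hq hpq; case: (pselect (p = q)) => [<-|pq].
  have [u hu] := exists_unit_tangent hp; exists u => //.
  by rewrite dist_pp geodesic0.
have d0 : 0 < dist k p q.
  rewrite lt_neqAle dist_ge0// andbT; apply/eqP => /esym/(dist_eq0 hp hq); exact: pq.
have s0 : 0 < gsin k (dist k p q) by apply: gsin_gt0 => //; exact: dist_ltpi.
pose c := gcos k (dist k p q); pose s := gsin k (dist k p q).
have sn : s != 0 by rewrite lt0r_neq0.
exists (lin s^-1 q (- c / s) p); last first.
  by apply: eq_space; rewrite /= -/c -/s; field.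
split; first by rewrite tangentE bil_linr (surface_bil hp) bil_dist// -/c; field.
case: (pselect (k = Flat)) => [k0|k0].
  have := chord2_dist hp hq; move: sn; rewrite /c /s; subst k; rewrite /= => sn e.
  rewrite !(metric_linl, metric_linr) /metric /= (surface_flat hp) (surface_flat hq).
  move: e; rewrite /chord2 /= mul0r addr0 => e.
  set d := dist _ _ _ in sn e *.
  have e2 : d ^+ 2 = (p.1.1 - q.1.1) ^+ 2 + (p.1.2 - q.1.2) ^+ 2.
    by rewrite e; field.
  transitivity (((p.1.1 - q.1.1) ^+ 2 + (p.1.2 - q.1.2) ^+ 2) / d ^+ 2); first by field.
  by rewrite -e2 divff// expf_neq0.
rewrite metric_bil// !bil_lin (surface_bil hp) (surface_bil hq).
rewrite (bilC k q p) bil_dist// -/c.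
have e : c ^+ 2 = 1 - K k * s ^+ 2 by have := gcos2Dgsin2 k (dist k p q); rewrite -/c -/s; lra.
have -> : K k * (s^-1 * (s^-1 * 1 + - c / s * c) + - c / s * (s^-1 * c + - c / s * 1)) =
  K k * (1 - c ^+ 2) / s ^+ 2 by field.
have kk : K k * K k = 1 by case: (k) k0 => //= _; ring.
rewrite e (_ : K k * (1 - (1 - K k * s ^+ 2)) = (K k * K k) * s ^+ 2); last by ring.
by rewrite kk mul1r divff// expf_neq0.
Qed.

Lemma spherical_dist_antipode p : surface Spherical p ->
  pi <= dist Spherical (- p) p.
Proof.
move=> hp; rewrite /dist; have -> : chord2 Spherical (- p) p = 2 ^+ 2.
  by have := surface_bil hp; rewrite /bil /chord2 /= => h; lra.
rewrite sqrtr_sqr ger0_norm// divff//=.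
have := @sinK R (pi / 2); rewrite sin_pihalf in_itv /= lexx andbT => ->; first by lra.
by have := @pi_ge0 R; lra.
Qed.

(** Law of cosines at the middle point [q]: for given [a] and [b] the third side is largest when the
    angle is straight, where it is [a + b]. On the sphere the case [pi <= a + b] is set apart, as no
    distance exceeds [pi]. *)
Lemma dist_triangle k p q r : surface k p -> surface k q -> surface k r ->
  dist k p r <= dist k p q + dist k q r.
Proof.
move=> hp hq hr.
set a := dist k p q; set b := dist k q r.
have a0 : 0 <= a by exact: dist_ge0.
have b0 : 0 <= b by exact: dist_ge0.
case: (pselect (k = Spherical /\ pi <= a + b)) => [[ks h]|h].
  by apply: le_trans h; exact: dist_lepi.
have abpi : k = Spherical -> a + b < pi.
  by move=> ks; rewrite ltNge; apply/negP => ?; apply: h.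
have api : k = Spherical -> a < pi by move=> ks; have := abpi ks; lra.
have bpi : k = Spherical -> b < pi by move=> ks; have := abpi ks; lra.
have [|u1 hu1 e1] := exists_join hq hp.
  move=> ks e; have := api ks; rewrite ltNge => /negP; apply.
  rewrite /a e ks; apply: spherical_dist_antipode; rewrite -ks//.
have [|u2 hu2 e2] := exists_join hq hr.
  move=> ks e; have := bpi ks; rewrite ltNge => /negP; apply.
  rewrite /b e ks distC; apply: spherical_dist_antipode; rewrite -ks//.
rewrite distC -/a in e1; rewrite -/b in e2.
have ab0 : 0 <= a + b by lra.
have -> : a + b = 2 * ((a + b) / 2) by field.
rewrite /dist ler_pM2l// -[leRHS](@gsinK k); last first.
  by move=> /abpi ?; have := @pi_ge0 R => ?; between.
have s0 : 0 <= gsin k ((a + b) / 2).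
  by apply: gsin_ge0; [lra|move=> /abpi; have := @pi_ge0 R; lra].
rewrite ler_gasin; first last.
- by move=> ->; rewrite sin_geN1 sin_le1.
- exact: half_chord_le1.
rewrite ler_pdivrMr// -(@ler_pXn2r _ 2) ?nnegrE ?sqrtr_ge0 ?mulr_ge0//.
rewrite sqr_sqrtr ?chord2_ge0// exprMn.
have /andP[m1 _] := metric_tangent_le1 hq hu1 hu2.
case: (pselect (k = Flat)) => [k0|k0].
  rewrite -e1 -e2; move: hq hu1 hu2 m1; rewrite k0 => hq' [t1 n1] [t2 n2] m1.
  move: n1 n2 m1; rewrite /metric /chord2 /= (tangent_flat hq' t1) (tangent_flat hq' t2) => n1 n2 m1.
  have -> : (1 * q.1.1 + a * u1.1.1 - (1 * q.1.1 + b * u2.1.1)) ^+ 2 +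
    (1 * q.1.2 + a * u1.1.2 - (1 * q.1.2 + b * u2.1.2)) ^+ 2 +
    0 * (1 * q.2 + a * 0 - (1 * q.2 + b * 0)) ^+ 2 =
    a ^+ 2 * (u1.1.1 * u1.1.1 + u1.1.2 * u1.1.2 + 0 * (0 * 0)) +
    b ^+ 2 * (u2.1.1 * u2.1.1 + u2.1.2 * u2.1.2 + 0 * (0 * 0)) -
    2 * (a * b) * (u1.1.1 * u2.1.1 + u1.1.2 * u2.1.2 + 0 * (0 * 0)) by ring.
  by rewrite n1 n2; have ab := mulr_ge0 a0 b0; nra.
have kk : K k * K k = 1 by case: (k) k0 => //= _; ring.
have -> : gsin k ((a + b) / 2) ^+ 2 * 2 ^+ 2 = 2 * K k * (1 - gcos k (a + b)).
  rewrite gcos_half; transitivity (4 * (K k * K k) * gsin k ((a + b) / 2) ^+ 2).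
    by rewrite kk; ring.
  by ring.
rewrite chord2_nonflat// -e1 -e2 !geodesicE !bil_lin gcosD.
rewrite (surface_bil hq) (bilC k u1 q) (bil_tangent hu1.1) (bil_tangent hu2.1).
rewrite (bil_tangents hq hu1.1 hu2.1).
have sa : 0 <= gsin k a by apply: gsin_ge0 => // /api; lra.
have sb : 0 <= gsin k b by apply: gsin_ge0 => // /bpi; lra.
have sab := mulr_ge0 sa sb.
have -> : 2 * K k * (1 - (gcos k a * (gcos k b * 1 + gsin k b * 0) +
    gsin k a * (gcos k b * 0 + gsin k b * (K k * metric k u1 u2)))) =
    2 * K k * (1 - gcos k a * gcos k b) - 2 * (K k * K k) * (gsin k a * gsin k b) * metric k u1 u2 by ring.
have -> : 2 * K k * (1 - (gcos k a * gcos k b - K k * (gsin k a * gsin k b))) =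
  2 * K k * (1 - gcos k a * gcos k b) + 2 * (K k * K k) * (gsin k a * gsin k b) by ring.
by rewrite kk; nra.
Qed.

(** * Relative topology of the surface and radial projection onto it *)

Definition near3 e p q : Prop :=
  [/\ `|p.1.1 - q.1.1| < e, `|p.1.2 - q.1.2| < e & `|p.2 - q.2| < e].

Lemma ball_near3 p e q : ball p e q <-> near3 e p q.
Proof. by split=> [[[? ?] ?]|[? ? ?]]; split. Qed.

Lemma near3_refl e p : 0 < e -> near3 e p p.
Proof. by move=> e0; rewrite /near3 !subrr normr0. Qed.

Lemma near3_le e e' p q : e <= e' -> near3 e p q -> near3 e' p q.
Proof. by move=> ee [? ? ?]; split; exact: lt_le_trans ee. Qed.

Lemma near3_trans d e p q r : near3 d p q -> near3 e q r -> near3 (d + e) p r.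
Proof.
by move=> [a1 a2 a3] [b1 b2 b3]; split;
  apply: le_lt_trans (ler_distD _ _ _) (ltrD _ _); eassumption.
Qed.

Lemma near3_convex e p q r t : near3 e p q -> near3 e p r -> 0 <= t <= 1 ->
  near3 e p (lin (1 - t) q t r).
Proof.
move=> [a1 a2 a3] [b1 b2 b3] /andP[t0 t1].
have H (x y z : R) : `|x - y| < e -> `|x - z| < e -> `|x - ((1 - t) * y + t * z)| < e.
  move=> xy xz; have -> : x - ((1 - t) * y + t * z) = (1 - t) * (x - y) + t * (x - z) by ring.
  move: xy xz; rewrite !ltr_norml; move: (x - y) (x - z) => c d.
  move=> /andP[? ?] /andP[? ?]; apply/andP; split.
    have [->|tn] := eqVneq t 0; first by lra.
    have tp : 0 < t by rewrite lt_neqAle eq_sym tn.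
    by have : t * - e < t * d by [rewrite ltr_pM2l]; nra.
  have [->|tn] := eqVneq t 0; first by lra.
  have tp : 0 < t by rewrite lt_neqAle eq_sym tn.
  by have : t * d < t * e by [rewrite ltr_pM2l]; nra.
by split; exact: H.
Qed.

Lemma nbhs_surfaceP k P p : surface k p ->
  nbhs (p : subspace (surface k)) (P : set (subspace (surface k))) <->
  exists2 e, 0 < e & forall q, surface k q -> near3 e p q -> P q.
Proof.
move=> sp; have -> : nbhs (p : subspace (surface k)) (P : set (subspace (surface k))) =
  within (surface k) (nbhs p) P by rewrite [RHS](congr1 (@^~ P) (nbhs_subspace_in sp)).
rewrite /within /=; split.
- by move=> /nbhs_ballP[e e0 h]; exists e => // q sq /ball_near3 pq; exact: h.
- move=> [e e0 h]; apply/nbhs_ballP; exists e => // q /ball_near3 pq sq; exact: h.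
Qed.

Lemma rel_interiorP k P p : surface k p ->
  rel_interior k P p <->
  exists2 e, 0 < e & forall q, surface k q -> near3 e p q -> P q.
Proof. exact: nbhs_surfaceP. Qed.

Lemma rel_closureP k P p : surface k p ->
  rel_closure k P p <->
  forall e, 0 < e -> exists q, [/\ surface k q, near3 e p q & P q].
Proof.
move=> sp; rewrite /rel_closure /closure /=; split.
- move=> h e e0; have [] := h [set q | surface k q /\ near3 e p q].
    by apply/nbhs_surfaceP => //; exists e.
  by move=> q [Pq [sq pq]]; exists q.
- move=> h B /(nbhs_surfaceP _ sp)[e e0 hB].
  by have [q [sq pq Pq]] := h e e0; exists q; split => //; exact: hB.
Qed.

(** Connectedness of the interval, in the form in which membership in a region is carried along
    paths in the rest of the proof. *)
Lemma segment_locally_constant (f : R -> Prop) a b : a <= b ->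
  (forall t, a <= t <= b -> exists2 d, 0 < d &
     forall s, a <= s <= b -> `|t - s| < d -> (f s <-> f t)) ->
  f a <-> f b.
Proof.
move=> ab h; have := @segment_connected R a b.
pose S := [set t | t \in `[a, b] -> (f t <-> f a)].
pose S' := [set t | t \in `[a, b] -> ~ (f t <-> f a)].
move=> /(_ (`[a, b]%classic `&` S)) c.
suff : `[a, b]%classic `&` S = `[a, b]%classic.
  move/seteqP => [_ /(_ b)]; rewrite /= in_itv /= ab lexx => /(_ isT)[_].
  by rewrite /S /= in_itv /= ab lexx => /(_ isT) [].
have ht t : t \in `[a, b] -> \forall s \near t, s \in `[a, b] -> (f s <-> f t).
  rewrite in_itv => /h[d d0 hd]; apply/nbhs_ballP; exists d => // s /= ts.
  by rewrite in_itv => ?; exact: hd.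
apply: c.
- by exists a; rewrite /S/= in_itv/= lexx ab.
- exists (interior S); first exact: open_interior.
  apply/seteqP; split=> t [tab tS]; split => //.
    by near=> s => sab; rewrite (near (ht t tab) s)//; exact: tS.
  by have := nbhs_singleton tS.
- exists (~` interior S'); first by apply: open_closedC; exact: open_interior.
  apply/seteqP; split=> t [tab tS]; split => //.
    by move=> /nbhs_singleton/(_ tab); apply; exact: tS.
  move=> _; apply: contrapT => ft; apply: tS.
  by near=> s => sab; rewrite (near (ht t tab) s).
Unshelve. all: by end_near. Qed.

(* The cone over the surface, with its radial projection: it turns geodesic
   segments into straight ones. *)
Definition cone k q : Prop := 0 < bil k q q /\ (k <> Spherical -> 0 < q.2).

Definition nrm k q : space := lin (Num.sqrt (bil k q q))^-1 q 0 q.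

Lemma surface_cone k p : surface k p -> cone k p.
Proof. by move=> hp; split; [rewrite surface_bil|case: hp]. Qed.

Lemma nrm_surface k q : cone k q -> surface k (nrm k q).
Proof.
move=> [q0 qk]; have s0 : 0 < Num.sqrt (bil k q q) by rewrite sqrtr_gt0.
have e : bil k (nrm k q) (nrm k q) = 1.
  rewrite /nrm !bil_lin.
  have -> : forall x, x * (x * bil k q q + 0 * bil k q q) + 0 * (x * bil k q q + 0 * bil k q q) =
     x ^+ 2 * bil k q q by move=> x; ring.
  by rewrite exprVn sqr_sqrtr ?ltW// mulVf// lt0r_neq0.
split; first by move: e; rewrite /bil; lra.
by move=> /qk q2; rewrite /= mul0r addr0 mulr_gt0// invr_gt0.
Qed.

Lemma nrm_id k p : surface k p -> nrm k p = p.
Proof.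
move=> hp; rewrite /nrm surface_bil// sqrtr1 invr1.
by coords.
Qed.

Lemma det3_nrm k p u q : det3 p u (nrm k q) = (Num.sqrt (bil k q q))^-1 * det3 p u q.
Proof. by rewrite /nrm det3_lin3 mul0r addr0. Qed.

Lemma continuous3 (f : space -> R) q : {for q, continuous f} -> forall e, 0 < e ->
  exists2 d, 0 < d & forall q', near3 d q q' -> `|f q - f q'| < e.
Proof.
move=> cf e e0; have /cvgrPdist_lt/(_ _ e0) := cf.
move=> /nbhs_ballP[d d0 hd]; exists d => // q' qq'; apply: hd.
exact/ball_near3.
Qed.

Lemma continuous_x q : {for q, continuous (fun q : space => q.1.1)}.
Proof. by apply: continuous_comp; exact: cvg_fst. Qed.

Lemma continuous_y q : {for q, continuous (fun q : space => q.1.2)}.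
Proof. by apply: continuous_comp; [exact: cvg_fst|exact: cvg_snd]. Qed.

Lemma continuous_z q : {for q, continuous (fun q : space => q.2)}.
Proof. exact: cvg_snd. Qed.

Lemma continuous_bil k q : {for q, continuous (fun q : space => bil k q q)}.
Proof.
have cx := @continuous_x q; have cy := @continuous_y q; have cz := @continuous_z q.
rewrite /continuous_at /bil; apply: cvgD; last exact: cvgM.
by apply: cvgM; [exact: cvg_cst|apply: cvgD; exact: cvgM].
Qed.

Lemma continuous_nrm k q : cone k q -> forall e, 0 < e -> exists2 d, 0 < d &
  forall q', near3 d q q' -> cone k q' /\ near3 e (nrm k q) (nrm k q').
Proof.
move=> [b0 z0] e e0.
have cs : {for q, continuous (fun q => (Num.sqrt (bil k q q))^-1)}.
  rewrite /continuous_at; apply: cvgV; first by rewrite lt0r_neq0// sqrtr_gt0.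
  apply: continuous_cvg; first exact: sqrt_continuous.
  exact: continuous_bil.
have cc (f : space -> R) : {for q, continuous f} ->
    {for q, continuous (fun q => (Num.sqrt (bil k q q))^-1 * f q + 0 * f q)}.
  move=> cf; rewrite /continuous_at; apply: cvgD; apply: cvgM => //.
  exact: cvg_cst.
have [d1 d10 h1] := continuous3 (cc _ (@continuous_x q)) e0.
have [d2 d20 h2] := continuous3 (cc _ (@continuous_y q)) e0.
have [d3 d30 h3] := continuous3 (cc _ (@continuous_z q)) e0.
have [d4 d40 h4] := continuous3 (@continuous_bil k q) b0.
have [d5 d50 h5] : exists2 d, 0 < d & forall q', near3 d q q' -> k <> Spherical -> 0 < q'.2.
  case: (pselect (k = Spherical)) => [->|/z0 q2]; first by exists 1.
  exists q.2 => // q' [_ _]; rewrite ltr_norml => /andP[_ h] _; lra.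
exists (Num.min (Num.min d1 d2) (Num.min d3 (Num.min d4 d5))).
  by rewrite !lt_min d10 d20 d30 d40.
move=> q' n; have n' i : (Num.min (Num.min d1 d2) (Num.min d3 (Num.min d4 d5))) <= i ->
  near3 i q q' by move=> hi; exact: near3_le n.
have k1 : near3 d1 q q' by apply: n'; rewrite !ge_min lexx.
have k2 : near3 d2 q q' by apply: n'; rewrite !ge_min lexx orbT.
have k3 : near3 d3 q q' by apply: n'; rewrite !ge_min lexx !orbT.
have k4 : near3 d4 q q' by apply: n'; rewrite !ge_min lexx !orbT.
have k5 : near3 d5 q q' by apply: n'; rewrite !ge_min lexx !orbT.
split; last by split; [exact: h1|exact: h2|exact: h3].
split; last exact: h5.
by have := h4 _ k4; rewrite ltr_norml => /andP[_ ?]; lra.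
Qed.

End Geometry.

(** * Velocity of a geodesic *)

Section Velocity.
Implicit Types (p u v : space).

Definition vel k p u t : space := lin (- K k * gsin k t) p (gcos k t) u.

Lemma vel_unit k p u t : surface k p -> unit_tangent k p u ->
  unit_tangent k (geodesic k p u t) (vel k p u t).
Proof.
move=> hp hu; have pu := bil_tangent hu.1; have up := pu; rewrite bilC in up.
have uu := bil_tangents hp hu.1 hu.1; rewrite hu.2 mulr1 in uu.
split.
  by rewrite tangentE geodesicE /vel !bil_lin (surface_bil hp) pu up uu; ring.
case: (pselect (k = Flat)) => [k0|k0].
  rewrite /vel; move: hu; rewrite k0 => -[_ <-]; rewrite !(metric_linl, metric_linr) /=; ring.
rewrite metric_bil// /vel !bil_lin (surface_bil hp) pu up uu.
have kk : K k * K k = 1 by case: (k) k0 => //= _; ring.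
transitivity (K k * K k * (gcos k t ^+ 2 + K k * gsin k t ^+ 2)).
  by ring.
by rewrite kk mul1r gcos2Dgsin2.
Qed.

Lemma geodesic_shift k p u t s :
  geodesic k (geodesic k p u t) (vel k p u t) s = geodesic k p u (t + s).
Proof. by rewrite !geodesicE gcosD gsinD; coords. Qed.

Lemma det3_vel k p u t q : det3 (geodesic k p u t) (vel k p u t) q = det3 p u q.
Proof.
rewrite geodesicE /vel !(det3_lin1, det3_lin2) !det3pp (det3_swap u p).
transitivity ((gcos k t ^+ 2 + K k * gsin k t ^+ 2) * det3 p u q); first by ring.
by rewrite gcos2Dgsin2 mul1r.
Qed.

Lemma unit_tangentN k p u : unit_tangent k p u -> unit_tangent k p (lin (-1) u 0 u).
Proof.
move=> [hu u1]; split; first by rewrite tangentE bil_linr (bil_tangent hu); ring.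
by rewrite !(metric_linl, metric_linr) u1; ring.
Qed.

Lemma unit_tangent_parallel k p u w : surface k p -> unit_tangent k p u ->
  unit_tangent k p w -> det3 p u w = 0 -> w = u \/ w = lin (-1) u 0 u.
Proof.
move=> hp hu hw d0; have := cauchy_tangent hp hu hw.
rewrite d0 expr0n addr0 => /eqP; rewrite sqrf_eq1.
have := frame_tangent hp hu hw.1; rewrite d0 => e.
move=> /orP[/eqP m|/eqP m]; rewrite m in e; [left|right]; rewrite e;
  by coords.
Qed.

End Velocity.

(** * The region lies on one side of its boundary, the same along all sides *)

Section PolygonSides.
Context (k : curvature) (n : nat) (P : polygon R k n).
Implicit Types (b : bool) (a e d : R) (p r u v w o : space) (i j : 'I_n).

Local Notation gam i := (geodesic k (vtx P i) (dir P i)).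
Local Notation side i := (det3 (vtx P i) (dir P i)).
Local Notation inside q := (region P (nrm k q)).
Local Notation RP := (region P).
Local Notation dP := (boundary k P).

Lemma nbhs_near3P p (A : set space) :
  nbhs p A <-> exists2 e, 0 < e & forall q, near3 e p q -> A q.
Proof.
split=> [/nbhs_ballP[e e0 h]|[e e0 h]].
  by exists e => // q /ball_near3; exact: h.
by apply/nbhs_ballP; exists e => // q /ball_near3; exact: h.
Qed.

Lemma gam_surface i t : surface k (gam i t).
Proof. apply: geodesic_surface; [exact: polygon_vtx|exact: polygon_dir]. Qed.

Lemma gam0 i : gam i 0 = vtx P i.
Proof. exact: geodesic0. Qed.

Lemma side_gam i t : side i (gam i t) = 0.
Proof. by rewrite geodesicE det3_lin3 det3_pqp det3_qpp; ring. Qed.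

Lemma region_surface q : RP q -> surface k q.
Proof. by have [h _ _] := polygon_region P; exact: h. Qed.

Lemma region_closed : closed (region P : set (subspace (surface k))).
Proof.
by have [_ _ ->] := polygon_region P; rewrite /rel_closure; exact: closed_closure.
Qed.

Lemma region_outside q : surface k q -> ~ RP q ->
  exists2 e, 0 < e & forall q', surface k q' -> near3 e q q' -> ~ RP q'.
Proof.
move=> sq nPq; apply: contrapT => h; apply: nPq; apply: region_closed.
apply/rel_closureP => // e e0; apply: contrapT => h'; apply: h.
by exists e => // q' sq' qq' Pq'; apply: h'; exists q'.
Qed.

Lemma region_dense q e : RP q -> 0 < e ->
  exists q', [/\ surface k q', near3 e q q' & rel_interior k RP q'].
Proof.
move=> Pq e0; have sq := region_surface Pq.
have [_ _ eqP_] := polygon_region P; rewrite eqP_ in Pq.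
by have /(_ e e0) := (rel_closureP _ sq).1 Pq.
Qed.

Lemma interior_region q : rel_interior k RP q -> RP q.
Proof. by move=> h; have := nbhs_singleton h. Qed.

Lemma boundary_region q : dP q -> RP q /\ ~ rel_interior k RP q.
Proof. by move=> [c ni]; split => //; exact: region_closed. Qed.

Lemma off_boundary q : surface k q -> ~ dP q ->
  exists2 e, 0 < e & forall q', surface k q' -> near3 e q q' -> (RP q' <-> RP q).
Proof.
move=> sq nb; case: (pselect (RP q)) => Pq; last first.
  have [e e0 h] := region_outside sq Pq; exists e => // q' s' n'.
  by split=> // Pq'; have := h q' s' n'.
have : rel_interior k RP q.
  by apply: contrapT => ni; apply: nb; split => //; exact: subset_closure.
move=> /(rel_interiorP _ sq)[e e0 h]; exists e => // q' s' n'.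
by split=> // _; exact: h.
Qed.

Lemma boundary_edge q : dP q <-> exists i, segment k (vtx P i) (dir P i) (len P i) q.
Proof.
rewrite (polygon_boundary P); split.
  by move=> [i _ h]; exists i.
by move=> [i h]; exists i.
Qed.

Lemma nrm_segment_locally q0 q1 t d : 0 < d -> exists2 e, 0 < e & forall s, `|t - s| < e ->
  near3 d (lin (1 - t) q0 t q1) (lin (1 - s) q0 s q1).
Proof.
move=> d0.
pose m := 1 + `|q0.1.1 - q1.1.1| + `|q0.1.2 - q1.1.2| + `|q0.2 - q1.2|.
have n1 := normr_ge0 (q0.1.1 - q1.1.1); have n2 := normr_ge0 (q0.1.2 - q1.1.2).
have n3 := normr_ge0 (q0.2 - q1.2).
have m0 : 0 < m by rewrite /m; lra.
exists (d / m); first exact: divr_gt0.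
move=> s; rewrite ltr_pdivlMr// => ts.
have H (x y : R) : `|x - y| <= m -> `|(1 - t) * x + t * y - ((1 - s) * x + s * y)| < d.
  move=> xy; have -> : (1 - t) * x + t * y - ((1 - s) * x + s * y) = - ((t - s) * (x - y)) by ring.
  by rewrite normrN normrM; apply: le_lt_trans ts; rewrite ler_wpM2l.
by split; apply: H; rewrite /m; lra.
Qed.

(** Membership is locally constant along straight segments of the cone that avoid the cone over the
    boundary, and a convex set [S] contains the segments between its points. *)
Lemma inside_convex p e (S : space -> Prop) q0 q1 :
  (forall q r t, S q -> S r -> 0 <= t <= 1 -> S (lin (1 - t) q t r)) ->
  (forall q, near3 e p q -> S q -> cone k q /\ ~ dP (nrm k q)) ->
  near3 e p q0 -> near3 e p q1 -> S q0 -> S q1 -> (inside q0 <-> inside q1).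
Proof.
move=> cS h n0 n1 S0 S1.
have := @segment_locally_constant (fun t => inside (lin (1 - t) q0 t q1)) 0 1.
have -> : lin (1 - 0) q0 0 q1 = q0 by coords.
have -> : lin (1 - 1) q0 1 q1 = q1 by coords.
apply; first exact: ler01.
move=> t t01.
have [ct bt] := h _ (near3_convex n0 n1 t01) (cS _ _ _ S0 S1 t01).
have [e1 e10 h1] := off_boundary (nrm_surface ct) bt.
have [d d0 h2] := continuous_nrm ct e10.
have [d' d'0 h3] := nrm_segment_locally q0 q1 t d0.
exists d' => // s _ /h3/h2[cs ns]; apply: h1 => //.
exact: nrm_surface.
Qed.

Lemma continuous_geodesic u v : continuous (geodesic k u v : R -> space).
Proof.
move=> t; have c1 := @continuous_gcos k t; have c2 := @continuous_gsin k t.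
have H (x y : R) : {for t, continuous (fun t => gcos k t * x + gsin k t * y)}.
  by rewrite /continuous_at; apply: cvgD; apply: cvgM => //; exact: cvg_cst.
exact: (cvg_pair (cvg_pair (H _ _) (H _ _)) (H _ _)).
Qed.

Lemma near_not_segment p i : ~ segment k (vtx P i) (dir P i) (len P i) p ->
  \forall q \near p, ~ segment k (vtx P i) (dir P i) (len P i) q.
Proof.
move=> ps; have : closed (segment k (vtx P i) (dir P i) (len P i)).
  apply: compact_closed; first exact: norm_hausdorff.
  apply: continuous_compact; last exact: segment_compact.
  by apply: continuous_subspaceT; exact: continuous_geodesic.
by move=> /closed_openC o; exact: open_nbhs_nbhs.
Qed.

Lemma edge_point_unique i j t : 0 < t < len P i ->
  segment k (vtx P j) (dir P j) (len P j) (gam i t) -> j = i.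
Proof.
move=> /andP[t0 t1] [s]; rewrite /= in_itv /= => /andP[s0 s1] e.
have [sl|sl] := ltrP s (len P j).
  by have [] := @polygon_simple _ _ _ P _ _ _ _ _ _ e; rewrite ?s0 ?sl// ltW.
have {}sl : s = len P j by lra.
(* The parameter [len P j] is excluded from [polygon_simple]: the end of side [j] has to be read as
   the start of side [ordS j]. *)
move: e; rewrite sl polygon_next -(gam0 (ordS j)) => e.
have [] := @polygon_simple _ _ _ P _ _ _ _ _ _ e; rewrite ?lexx ?polygon_len ?t1 ?ltW//.
by move=> _ e0; move: t0; rewrite -e0 ltxx.
Qed.

Lemma vertex_unique i j : segment k (vtx P j) (dir P j) (len P j) (vtx P i) ->
  j = i \/ ordS j = i.
Proof.
move=> [s]; rewrite /= in_itv /= => /andP[s0 s1] e.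
have [sl|sl] := ltrP s (len P j).
  by rewrite -(gam0 i) in e; have [] := @polygon_simple _ _ _ P _ _ _ _ _ _ e;
    rewrite ?s0 ?sl ?lexx ?polygon_len//; left.
have {}sl : s = len P j by lra.
move: e; rewrite sl polygon_next -(gam0 (ordS j)) -(gam0 i) => e.
by have [] := @polygon_simple _ _ _ P _ _ _ _ _ _ e; rewrite ?lexx ?polygon_len//; right.
Qed.

Lemma near_segments p (A : 'I_n -> Prop) :
  (forall j, segment k (vtx P j) (dir P j) (len P j) p -> A j) ->
  \forall q \near p, forall j, segment k (vtx P j) (dir P j) (len P j) q -> A j.
Proof.
move=> h; have := @filter_forall space _
  (fun j => [set q | segment k (vtx P j) (dir P j) (len P j) q -> A j]) (nbhs p) _.
apply => j.
case: (pselect (A j)) => Aj; first by apply: filterE => q _.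
by apply: filterS (near_not_segment (contra_not (h j) Aj)) => q ns /ns.
Qed.

Lemma near_nrm p (A : set space) : surface k p -> nbhs p A ->
  exists2 e, 0 < e & forall q, near3 e p q -> cone k q /\ A (nrm k q).
Proof.
move=> sp /nbhs_near3P[e e0 h].
have [d d0 hd] := continuous_nrm (surface_cone sp) e0.
rewrite nrm_id// in hd; exists d => // q /hd[cq nq]; split => //; exact: h.
Qed.

(** The other sides are compact and miss this point, so they miss a neighbourhood of it. *)
Lemma edge_nbhd i t : 0 < t < len P i -> exists2 e, 0 < e &
  forall q, near3 e (gam i t) q -> cone k q /\ (dP (nrm k q) -> side i q = 0).
Proof.
move=> ht.
have [|e e0 h] := @near_nrm (gam i t) [set q | forall j,
   segment k (vtx P j) (dir P j) (len P j) q -> j = i] (gam_surface i t).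
  by apply: near_segments => j; exact: edge_point_unique.
exists e => // q /h[cq hq]; split => // /boundary_edge[j sj].
have ji := hq _ sj; subst j; have [s _ es] := sj.
have := side_gam i s; rewrite es det3_nrm => /eqP; rewrite mulf_eq0 => /orP[|/eqP//].
by rewrite invr_eq0 sqrtr_eq0 leNgt (cq.1).
Qed.

Lemma vertex_nbhd i j : ordS j = i -> exists2 e, 0 < e &
  forall q, near3 e (vtx P i) q -> cone k q /\
    (dP (nrm k q) -> side i q = 0 \/ side j q = 0).
Proof.
move=> ji.
have [|e e0 h] := @near_nrm (vtx P i) [set q | forall l,
   segment k (vtx P l) (dir P l) (len P l) q -> l = i \/ l = j] (polygon_vtx P i).
  apply: near_segments => l /vertex_unique[|li]; [by left|right].
  by apply: (can_inj (@ordSK n)); rewrite ji.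
exists e => // q /h[cq hq]; split => // /boundary_edge[l sl].
have {hq} := hq _ sl; have [s _ es] := sl.
have := side_gam l s; rewrite es det3_nrm => /eqP; rewrite mulf_eq0 => /orP[|/eqP hl].
  by rewrite invr_eq0 sqrtr_eq0 leNgt (cq.1).
by move=> [<-|<-]; [left|right].
Qed.

(** The Euclidean cross product, whatever the metric of the surface: moving along it raises
    [det3 u v] at a constant positive rate. *)
Definition normal u v : space :=
  (u.1.2 * v.2 - u.2 * v.1.2, u.2 * v.1.1 - u.1.1 * v.2, u.1.1 * v.1.2 - u.1.2 * v.1.1).

Lemma det3_normal u v q s : det3 u v (lin 1 q s (normal u v)) =
  det3 u v q + s * ((normal u v).1.1 ^+ 2 + (normal u v).1.2 ^+ 2 + (normal u v).2 ^+ 2).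
Proof. by rewrite /det3 /=; ring. Qed.

Lemma side_push i : exists2 c, 0 < c & forall q s,
  side i (lin 1 q s (normal (vtx P i) (dir P i))) = side i q + s * c.
Proof.
exists ((normal (vtx P i) (dir P i)).1.1 ^+ 2 + (normal (vtx P i) (dir P i)).1.2 ^+ 2
   + (normal (vtx P i) (dir P i)).2 ^+ 2); last by move=> q s; exact: det3_normal.
rewrite lt_neqAle !addr_ge0 ?sqr_ge0// andbT; apply/eqP => /esym/eqP.
rewrite paddr_eq0 ?addr_ge0 ?sqr_ge0// paddr_eq0 ?sqr_ge0// !sqrf_eq0.
move=> /andP[/andP[/eqP n1 /eqP n2] /eqP n3].
have := det3_rot_unit (polygon_vtx P i) (polygon_dir P i).
have -> : side i (trot k (vtx P i) (dir P i)) =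
  (normal (vtx P i) (dir P i)).1.1 * (trot k (vtx P i) (dir P i)).1.1 +
  (normal (vtx P i) (dir P i)).1.2 * (trot k (vtx P i) (dir P i)).1.2 +
  (normal (vtx P i) (dir P i)).2 * (trot k (vtx P i) (dir P i)).2.
  by rewrite /det3 /=; ring.
by rewrite n1 n2 n3 !mul0r !addr0 => /esym/eqP; rewrite oner_eq0.
Qed.

Lemma push_near (m : space) e : 0 < e -> exists2 d, 0 < d &
  forall q s, `|s| <= d -> near3 e q (lin 1 q s m).
Proof.
move=> e0; pose c := 1 + `|m.1.1| + `|m.1.2| + `|m.2|.
have n1 := normr_ge0 m.1.1; have n2 := normr_ge0 m.1.2; have n3 := normr_ge0 m.2.
have c0 : 0 < c by rewrite /c; lra.
exists (e / c); first exact: divr_gt0.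
move=> q s; rewrite ler_pdivlMr// => sc.
have [->|s0] := eqVneq s 0.
  rewrite (_ : lin _ _ _ _ = q); first exact: near3_refl.
  by coords.
have {}s0 : 0 < `|s| by rewrite normr_gt0.
have H (x y : R) : `|y| < c -> `|x - (1 * x + s * y)| < e.
  move=> yc; have -> : x - (1 * x + s * y) = - (s * y) by ring.
  by rewrite normrN normrM; apply: lt_le_trans sc; rewrite ltr_pM2l.
by split; apply: H; rewrite /c; lra.
Qed.

Lemma det3_convex u v q r t : 0 < det3 u v q -> 0 < det3 u v r -> 0 <= t <= 1 ->
  0 < det3 u v (lin (1 - t) q t r).
Proof.
move=> a0 b0 /andP[t0 t1]; rewrite det3_lin3.
have [->|tn] := eqVneq t 0; first by lra.
have tp : 0 < t by rewrite lt_neqAle eq_sym tn.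
by have := mulr_gt0 tp b0; have : 0 <= (1 - t) * det3 u v q; [apply: mulr_ge0; lra|lra].
Qed.

Lemma det3_convexN u v q r t : det3 u v q < 0 -> det3 u v r < 0 -> 0 <= t <= 1 ->
  det3 u v (lin (1 - t) q t r) < 0.
Proof.
move=> a0 b0 t01; have := @det3_convex v u q r t; rewrite !(det3_swap v).
by rewrite !oppr_gt0; apply.
Qed.

(** Near this point of side [i] the region fills the left of the side if [b] holds and the right
    otherwise. Points of the side itself are left out. *)
Definition two_sided i t (b : bool) := exists2 e, 0 < e &
  forall q, near3 e (gam i t) q ->
    [/\ cone k q, 0 < side i q -> (inside q <-> b) & side i q < 0 -> (inside q <-> ~~ b)].

(** Each open half of a small neighbourhood is wholly inside or wholly outside. If the halves
    agreed, the point would be interior (both inside, the region being closed) or not a limit of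
    interior points (both outside); neither is possible on the boundary of a closed region. *)
Lemma exists_two_sided i t : 0 < t < len P i -> exists b : bool, two_sided i t b.
Proof.
move=> ht; have [e e0 he] := edge_nbhd ht.
have [c c0 hc] := side_push i.
have [d d0 hd] := push_near (normal (vtx P i) (dir P i)) e0.
pose pp := lin 1 (gam i t) d (normal (vtx P i) (dir P i)).
pose pm := lin 1 (gam i t) (- d) (normal (vtx P i) (dir P i)).
have npp : near3 e (gam i t) pp by apply: hd; rewrite ger0_norm// ltW.
have npm : near3 e (gam i t) pm by apply: hd; rewrite normrN ger0_norm// ltW.
have spp : 0 < side i pp by rewrite hc side_gam add0r mulr_gt0.
have spm : side i pm < 0 by rewrite hc side_gam add0r mulNr oppr_lt0 mulr_gt0.
have pos q : near3 e (gam i t) q -> 0 < side i q -> (inside q <-> inside pp).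
  move=> nq sq; apply: (@inside_convex (gam i t) e (fun q => 0 < side i q)) => //.
    by move=> *; exact: det3_convex.
  by move=> r /he[cr hr] sr; split => // /hr; lra.
have neg q : near3 e (gam i t) q -> side i q < 0 -> (inside q <-> inside pm).
  move=> nq sq; apply: (@inside_convex (gam i t) e (fun q => side i q < 0)) => //.
    by move=> *; exact: det3_convexN.
  by move=> r /he[cr hr] sr; split => // /hr; lra.
have bg : dP (gam i t).
  apply/boundary_edge; exists i; exists t => //.
  by rewrite /= in_itv /=; case/andP: ht => *; rewrite !ltW.
have [Pg nig] := boundary_region bg.
have sg := gam_surface i t.
have key : ~ (inside pp <-> inside pm).
  move=> same.
  have all q : near3 e (gam i t) q -> side i q != 0 -> (inside q <-> inside pp).
    move=> nq; rewrite neq_lt => /orP[sq|sq]; last exact: pos.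
    by rewrite neg// same.
  (* Points on the line of the side belong to neither half; they are approximated by points pushed
     off along [normal]. *)
  have push q e1 : surface k q -> near3 (e / 2) (gam i t) q -> side i q = 0 -> 0 < e1 ->
      exists r, [/\ cone k r, near3 e1 q (nrm k r) & inside r <-> inside pp].
    move=> sq nq s0 e10; have [e2 e20 h2] := continuous_nrm (surface_cone sq) e10.
    have em0 : 0 < Num.min e2 (e / 2) by rewrite lt_min e20 divr_gt0.
    have [d' d'0 hd'] := push_near (normal (vtx P i) (dir P i)) em0.
    have nr := hd' q d' ltac:(by rewrite ger0_norm// ltW).
    set r := lin _ _ _ _ in nr; exists r.
    have [|cr] := h2 r; first by apply: near3_le nr; rewrite ge_min lexx.
    rewrite nrm_id// => nr'; split=> //; apply: all; last by rewrite /r hc s0 add0r mulf_neq0 ?lt0r_neq0.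
    have -> : e = e / 2 + e / 2 by field.
    by apply: near3_trans nq _; apply: near3_le nr; rewrite ge_min lexx orbT.
  case: (pselect (inside pp)) => hp.
  - apply: nig; apply/rel_interiorP => //; exists (e / 2); first by rewrite divr_gt0.
    move=> q sq nq; have nq' : near3 e (gam i t) q by apply: near3_le nq; lra.
    have [s0|s0] := eqVneq (side i q) 0; last by rewrite -(nrm_id sq); apply/all.
    apply: contrapT => nPq; have [e1 e10 h1] := region_outside sq nPq.
    by have [r [cr nr /iffRL/(_ hp)]] := push q e1 sq nq s0 e10; exact: h1 (nrm_surface cr) nr.
  - have [q [sq nq iq]] := region_dense Pg (divr_gt0 e0 (ltr0Sn R 1)).
    have nq' : near3 e (gam i t) q by apply: near3_le nq; lra.
    have Pq := interior_region iq.
    have [s0|s0] := eqVneq (side i q) 0; last first.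
      by apply: hp; apply/(all q) => //; rewrite nrm_id.
    have [e1 e10 h1] := (rel_interiorP _ sq).1 iq.
    have [r [cr nr /iffLR]] := push q e1 sq nq s0 e10.
    by move/(_ (h1 _ (nrm_surface cr) nr)).
exists `[< inside pp >]; exists e => // q nq; split.
- by case: (he q nq).
- by move=> sq; rewrite (pos q)//; split=> /asboolP.
- move=> sq; rewrite (neg q)//; split=> [hm|/asboolP hp].
    by apply/asboolP => hp; apply: key.
  by apply: contrapT => hm; apply: key; split.
Qed.

Lemma near3_geodesic u v t e : 0 < e -> exists2 d, 0 < d & forall s, `|t - s| < d ->
  near3 e (geodesic k u v t) (geodesic k u v s).
Proof.
move=> e0; have : nbhs (geodesic k u v t) [set q | near3 e (geodesic k u v t) q].
  by apply/nbhs_near3P; exists e.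
move=> /continuous_geodesic/nbhs_ballP[d d0 h]; exists d => // s ts; exact: h.
Qed.

Lemma two_sided_uniq i t (b b' : bool) : two_sided i t b -> two_sided i t b' -> b = b'.
Proof.
move=> [e e0 h] [e' e'0 h'].
have em0 : 0 < Num.min e e' by rewrite lt_min e0.
have [c c0 hc] := side_push i.
have [d d0 hd] := push_near (normal (vtx P i) (dir P i)) em0.
have nr := hd (gam i t) d ltac:(by rewrite ger0_norm// ltW).
have em1 : Num.min e e' <= e by rewrite ge_min lexx.
have em2 : Num.min e e' <= e' by rewrite ge_min lexx orbT.
have [_ h1 _] := h _ (near3_le em1 nr).
have [_ h2 _] := h' _ (near3_le em2 nr).
have s0 : 0 < side i (lin 1 (gam i t) d (normal (vtx P i) (dir P i))).
  by rewrite hc side_gam add0r mulr_gt0.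
have {}h1 := h1 s0; have {}h2 := h2 s0.
by case: b b' h1 h2 {h h'} => -[] // h1 h2; [have := h2.1 (h1.2 isT)|have := h1.1 (h2.2 isT)].
Qed.

Lemma two_sided_const i s t b : 0 < s < len P i -> 0 < t < len P i ->
  two_sided i s b -> two_sided i t b.
Proof.
wlog st : s t b / s <= t => [H|] hs ht.
  have [|/ltW] := leP s t; first by move=> /H; apply.
  move=> ts hb; have [b' hb'] := exists_two_sided ht.
  by rewrite (two_sided_uniq hb (H _ _ _ ts ht hs hb')).
move=> hsb; move: (hsb).
suff : two_sided i s b <-> two_sided i t b by move=> [].
apply: (@segment_locally_constant (fun r : R => two_sided i r b) s t st) => r /andP[sr rt].
have hr : 0 < r < len P i by case/andP: hs ht => ? ? /andP[? ?]; between.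
have [b' [e e0 he]] := exists_two_sided hr.
have e20 : 0 < e / 2 by rewrite divr_gt0.
have [d d0 hd] := near3_geodesic (vtx P i) (dir P i) r e20.
have hb' : two_sided i r b' by exists e.
exists d => // r' _ /hd nr.
have hb'' : two_sided i r' b'.
  exists (e / 2) => // q nq; apply: he; have -> : e = e / 2 + e / 2 by field.
  exact: near3_trans nr nq.
by split=> hb; [rewrite -(two_sided_uniq hb'' hb)|rewrite -(two_sided_uniq hb' hb)].
Qed.

Variables (i j : 'I_n) (ij : ordS j = i).
Let v := vtx P i.
Let w := vel k (vtx P j) (dir P j) (len P j).

Lemma vtxE : v = gam j (len P j).
Proof. by rewrite polygon_next ij. Qed.

Lemma unit_w : unit_tangent k v w.
Proof. rewrite vtxE; apply: vel_unit; [exact: polygon_vtx|exact: polygon_dir]. Qed.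

Lemma side_w q : side j q = det3 v w q.
Proof. by rewrite vtxE det3_vel. Qed.

Lemma geodesic_back t : geodesic k v (lin (-1) w 0 w) t = gam j (len P j - t).
Proof.
rewrite -geodesic_shift -vtxE -/w !geodesicE gcosN gsinN.
by coords.
Qed.

(** A zero turn means that the next side doubles back or goes straight on. In the first case the two
    sides overlap, against simplicity. In the second the two boundary radii given by [is_vertex] lie
    on one line, so they are equal or opposite, which [is_vertex] excludes. *)
Lemma turn_neq0 : det3 v w (dir P i) != 0.
Proof.
apply/eqP => d0.
have sv : surface k v := polygon_vtx P i.
have [|] := unit_tangent_parallel sv unit_w (polygon_dir P i) d0; last first.
  move=> di.
  have li := polygon_len P i; have lj := polygon_len P j.
  have back t : gam i t = gam j (len P j - t) by rewrite di -geodesic_back.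
  pose m := Num.min (len P i) (len P j).
  have m0 : 0 < m by rewrite lt_min li.
  have mi : m <= len P i by rewrite ge_min lexx.
  have mj : m <= len P j by rewrite ge_min lexx orbT.
  have H t : 0 < t < m -> i = j /\ t = len P j - t.
    move=> /andP[t0 t1]; apply: (polygon_simple (p := P)); last exact: back.
      by between.
    by between.
  (* Two parameters are needed: [t = len P j - t] may hold for one of them. *)
  have [_ h1] := H (m / 3) ltac:(lra).
  by have [_ h2] := H (m / 2) ltac:(lra); lra.
move=> di.
have [bv [r [u [u' [r0 hu hu' [uu uu'] e]]]]] := polygon_vertex P i.
have [d d0' hd] := @vertex_nbhd i j ij.
have key x : unit_tangent k v x -> radial k v x r `<=` dP -> x = w \/ x = lin (-1) w 0 w.
  move=> hx sx; apply: (unit_tangent_parallel sv unit_w hx).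
  have [d1 d10 hd1] := near3_geodesic v x 0 d0'.
  pose t := Num.min (Num.min (r / 2) (d1 / 2)) 1.
  have t0 : 0 < t by rewrite !lt_min ltr01 andbT !divr_gt0.
  have tr : t <= r / 2 by rewrite !ge_min lexx.
  have td : t <= d1 / 2 by rewrite !ge_min lexx !orbT.
  have t1 : t <= 1 by rewrite ge_min lexx orbT.
  have nt : near3 d v (geodesic k v x t).
    have := hd1 t; rewrite geodesic0; apply; rewrite sub0r normrN ger0_norm ?ltW//; lra.
  have [ct bt] := hd _ nt.
  have st : surface k (geodesic k v x t) by exact: geodesic_surface.
  rewrite (nrm_id st) in bt.
  have dw : dP (geodesic k v x t).
    by apply: sx; exists t => //; rewrite /= in_itv /= ltW//=; lra.
  have : det3 v w (geodesic k v x t) = 0.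
    by case: (bt dw); rewrite ?side_w // di.
  rewrite geodesicE det3_lin3 det3_pqp mulr0 add0r => /eqP.
  rewrite mulf_eq0 => /orP[/eqP s0|/eqP//].
  suff : 0 < gsin k t by rewrite s0 ltxx.
  by apply: gsin_gt0 => // _; have := @pihalf_ge1 R; have := @pi_ge0 R; lra.
have sub1 : radial k v u r `<=` dP.
  by move=> q qr; have : (dP `&` disc k v r) q by [rewrite e; left]; case.
have sub2 : radial k v u' r `<=` dP.
  by move=> q qr; have : (dP `&` disc k v r) q by [rewrite e; right]; case.
have N2 x : lin (-1) x 0 x = - x.
  by coords.
have [e1|e1] := key _ hu sub1; have [e2|e2] := key _ hu' sub2; rewrite ?N2 in e1 e2.
- by apply: uu; rewrite e1 e2.
- by apply: uu'; rewrite e1 e2 opprK.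
- by apply: uu'; rewrite e1 e2.
- by apply: uu; rewrite e1 e2.
Qed.

(** The points near the vertex that lie on the inner side of the turn for both lines form a convex
    corner free of boundary points. The corner is adjacent to both sides, so both report the same
    membership. *)
Lemma two_sided_vertex s t b : 0 < s < len P j -> 0 < t < len P i ->
  two_sided j s b -> two_sided i t b.
Proof.
move=> hs ht hb.
have li := polygon_len P i; have lj := polygon_len P j.
have [e e0 he] := @vertex_nbhd i j ij.
have e20 : 0 < e / 2 by rewrite divr_gt0.
have [d1 d10 hd1] := near3_geodesic v (dir P i) 0 e20.
have [d2 d20 hd2] := near3_geodesic (vtx P j) (dir P j) (len P j) e20.
pose m := Num.min (Num.min (len P i) (len P j)) (Num.min (Num.min d1 d2) 1).
have m0 : 0 < m by rewrite !lt_min li lj d10 d20 ltr01.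
have mi : m <= len P i by rewrite !ge_min lexx.
have mj : m <= len P j by rewrite !ge_min lexx !orbT.
have md1 : m <= d1 by rewrite !ge_min lexx !orbT.
have md2 : m <= d2 by rewrite !ge_min lexx !orbT.
have m1 : m <= 1 by rewrite !ge_min lexx !orbT.
pose tau := m / 2.
have tau0 : 0 < tau by rewrite divr_gt0.
have tm : tau < m by rewrite /tau; lra.
have gt0 : 0 < gsin k tau.
  by apply: gsin_gt0 => // _; have := @pihalf_ge1 R; have := @pi_ge0 R; lra.
have hti : 0 < tau < len P i by between.
have htj : 0 < len P j - tau < len P j by between.
have [bi hbi] := exists_two_sided hti.
suff bb : b = bi by rewrite bb; exact: two_sided_const hbi.
have [e1 e10 h1] := hbi.
have [e2 e20' h2] := two_sided_const hs htj hb.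
(* The direction [dir P i - w] points into the inner corner: both side functions take the value [dl]
   on it. *)
pose pt := lin 1 (dir P i) (-1) w.
pose em := Num.min (e / 2) (Num.min e1 e2).
have em0 : 0 < em by rewrite !lt_min e20 e10.
have [d d0 hd] := push_near pt em0.
have emE : em <= e / 2 by rewrite ge_min lexx.
have em1 : em <= e1 by rewrite !ge_min lexx orbT.
have em2 : em <= e2 by rewrite !ge_min lexx !orbT.
pose qi := lin 1 (gam i tau) d pt; pose qj := lin 1 (gam j (len P j - tau)) d pt.
have ni : near3 em (gam i tau) qi by apply: hd; rewrite ger0_norm// ltW.
have nj : near3 em (gam j (len P j - tau)) qj by apply: hd; rewrite ger0_norm// ltW.
have ee : e = e / 2 + e / 2 by field.
have nvi : near3 e v qi.
  rewrite ee; apply: near3_trans (near3_le emE ni).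
  have := hd1 tau; rewrite geodesic0; apply; rewrite sub0r normrN ger0_norm ?ltW//; lra.
have nvj : near3 e v qj.
  rewrite ee; apply: near3_trans (near3_le emE nj).
  rewrite vtxE; apply: hd2; rewrite opprB addrC subrK ger0_norm ?ltW//; lra.
pose dl := det3 v w (dir P i).
have dwd : det3 v (dir P i) w = - dl by rewrite det3_swap23.
have sii : side i qi = d * dl.
  rewrite /qi det3_lin3 side_gam /pt det3_lin3 det3_qpp -/v dwd; ring.
have sji : side j qi = (gsin k tau + d) * dl.
  rewrite /qi det3_lin3 !side_w /pt det3_lin3 det3_qpp geodesicE det3_lin3 det3_pqp -/dl; ring.
have sjj : side j qj = d * dl.
  rewrite /qj det3_lin3 side_gam side_w /pt det3_lin3 det3_qpp -/dl; ring.
have sij : side i qj = (gsin k tau + d) * dl.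
  have -> : qj = lin 1 (geodesic k v (lin (-1) w 0 w) tau) d pt by rewrite /qj geodesic_back.
  have E (v1 u1 w1 : space) : det3 v1 u1 (lin 1 (lin (gcos k tau) v1 (gsin k tau)
      (lin (-1) w1 0 w1)) d (lin 1 u1 (-1) w1)) = - (gsin k tau + d) * det3 v1 u1 w1.
    by rewrite /det3 /=; ring.
  by rewrite geodesicE /pt E dwd; ring.
have [_ p1 p2] := h1 _ (near3_le em1 ni).
have [_ p3 p4] := h2 _ (near3_le em2 nj).
have gd0 : 0 < gsin k tau + d by lra.
have /orP[dl0|dl0] : (dl < 0) || (0 < dl) by rewrite -neq_lt turn_neq0.
- have same : inside qi <-> inside qj.
    apply: (@inside_convex v e (fun q => side i q < 0 /\ side j q < 0)) => //.
    + by move=> q r x [? ?] [? ?] hx; split; exact: det3_convexN.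
    + by move=> q nq [? ?]; have [cq hq] := he q nq; split => // /hq[]; lra.
    + by split; rewrite ?sii ?sji pmulr_rlt0.
    + by split; rewrite ?sij ?sjj pmulr_rlt0.
  have {}p2 : inside qi <-> ~~ bi by apply: p2; rewrite sii pmulr_rlt0.
  have {}p4 : inside qj <-> ~~ b by apply: p4; rewrite sjj pmulr_rlt0.
  case: b bi {hb hbi h1 h2 p1 p3} p2 p4 => -[] //= p2 p4.
    by have := p4.1 (same.1 (p2.2 isT)).
  by have := p2.1 (same.2 (p4.2 isT)).
- have same : inside qi <-> inside qj.
    apply: (@inside_convex v e (fun q => 0 < side i q /\ 0 < side j q)) => //.
    + by move=> q r x [? ?] [? ?] hx; split; exact: det3_convex.
    + by move=> q nq [? ?]; have [cq hq] := he q nq; split => // /hq[]; lra.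
    + by split; rewrite ?sii ?sji mulr_gt0.
    + by split; rewrite ?sij ?sjj mulr_gt0.
  have {}p1 : inside qi <-> bi by apply: p1; rewrite sii mulr_gt0.
  have {}p3 : inside qj <-> b by apply: p3; rewrite sjj mulr_gt0.
  case: b bi {hb hbi h1 h2 p2 p4} p1 p3 => -[] //= p1 p3.
    by have := p1.1 (same.2 (p3.2 isT)).
  by have := p3.1 (same.1 (p1.2 isT)).
Qed.

End PolygonSides.

Lemma ordS_ind n (A : 'I_n -> Prop) i0 : A i0 -> (forall j, A j -> A (ordS j)) -> forall i, A i.
Proof.
move=> A0 AS i.
have H m : A (iter m (@ordS n) i0) by elim: m => //= m IH; exact: AS.
have n0 : (0 < n)%N by exact: leq_ltn_trans (ltn_ord i0).
have V m : (iter m (@ordS n) i0 : nat) = ((i0 + m) %% n)%N.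
  elim: m => [|m IH] /=; first by rewrite addn0 modn_small.
  by rewrite IH -addn1 modnDml -addnA addn1.
suff -> : i = iter (i + (n - i0)) (@ordS n) i0 by [].
apply: val_inj; rewrite /= V addnCA subnKC; last exact: ltnW.
by rewrite modnDr modn_small.
Qed.

Lemma polygon_orientation k n (P : polygon R k n) :
  exists b : bool, forall i t, 0 < t < len P i -> two_sided P i t b.
Proof.
case: (pselect (exists i : 'I_n, True)) => [[i0 _]|hn]; last first.
  by exists true => i; exfalso; apply: hn; exists i.
have h i : 0 < len P i / 2 < len P i by have := polygon_len P i; lra.
have [b hb] := exists_two_sided (h i0); exists b => i t ht.
apply: two_sided_const (h i) ht _.
clear t; move: i; apply: (ordS_ind hb) => j hj.
exact: (two_sided_vertex (erefl (ordS j)) (h j) (h _) hj).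
Qed.

(** * Measures with a density *)

Section DensityMeasure.
Context (w : rT -> R).
Hypotheses (w0 : forall x, 0 <= w x) (mw : measurable_fun setT w).

Definition density (A : set rT) : \bar R := (\int[mu]_(x in A) (w x)%:E)%E.

Let density0 : density set0 = 0%E.
Proof. by rewrite /density integral_set0. Qed.

Let density_ge0 A : (0 <= density A)%E.
Proof. by apply: integral_ge0 => x _; rewrite lee_fin. Qed.

Let density_sigma_additive : semi_sigma_additive density.
Proof.
move=> /= F mF tF mUF; rewrite /density ge0_integral_bigcup//=.
- apply: is_cvg_ereal_nneg_natsum_cond => n _ _.
  by apply: integral_ge0 => x _; rewrite lee_fin.
- by apply/measurable_EFinP; exact: (measurable_funTS mw).
- by move=> x _; rewrite lee_fin.
Qed.

HB.instance Definition _ := isMeasure.Build _ _ _ density density0 density_ge0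
  density_sigma_additive.

Definition density_measure : {measure set rT -> \bar R} := density.

End DensityMeasure.

(** * Area in the coordinates x and longitude *)

Section Integration.
Implicit Types (x y a b c d e : R) (p u v : space) (w : R * R).

Lemma ocitv_cover : \bigcup_j `]- j%:R, j%:R]%classic = [set: R].
Proof.
apply/seteqP; split=> // x _; have [N hN] : exists N : nat, `|x| < N%:R.
  by exists (Num.Def.archi_bound `|x|); apply: archi_boundP.
exists N => //=; rewrite in_itv/=; move: hN; rewrite ltr_norml => /andP[-> /ltW ->//].
Qed.

Lemma integral_der (F f : R -> R) a b : a < b ->
  (forall y, a <= y <= b -> has_der F y (f y)) ->
  (forall y, a <= y <= b -> {for y, continuous f}) ->
  (\int[mu]_(y in `[a, b]) (f y)%:E)%E = (F b - F a)%:E.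
Proof.
move=> ab dF cf; rewrite (@continuous_FTC2 _ _ F)//.
- by apply: continuous_in_subspaceT => y; rewrite inE /= in_itv => /cf.
- split.
  + move=> y; rewrite in_itv/= => /andP[h1 h2].
    have /dF/has_derP[] : a <= y <= b by rewrite (ltW h1) (ltW h2).
    by [].
  + by apply: cvg_at_right_filter; apply: has_der_continuous (dF a _); rewrite lexx ltW.
  + by apply: cvg_at_left_filter; apply: has_der_continuous (dF b _); rewrite lexx ltW.
- move=> y; rewrite in_itv/= => /andP[h1 h2].
  have /dF/has_derP dy : a <= y <= b by rewrite (ltW h1) (ltW h2).
  by rewrite derive1E; exact: derive_val.
Qed.

(** Change of variables [y = ph s] over an arbitrary measurable set. Both sides are measures of [E]
    and agree on half-open intervals by the fundamental theorem of calculus for the inverse [ps].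
    The inverse is given through the equivalence of [ph s <= y] and [s <= ps y], which makes
    preimages of half-open intervals half-open. *)
Lemma integral_inverse_derivative (ph ps w : rT -> R) a0 b0 A0 B0 : A0 < B0 ->
  (forall s y, a0 <= s <= b0 -> A0 <= y <= B0 -> (ph s <= y) = (s <= ps y)) ->
  (forall s, a0 < s <= b0 -> A0 < ph s <= B0) ->
  (forall y, A0 <= y <= B0 -> a0 <= ps y <= b0) ->
  measurable_fun setT (ph : rT -> rT) -> measurable_fun setT w ->
  (forall y, A0 <= y <= B0 -> 0 <= w y) ->
  (forall y, A0 <= y <= B0 -> has_der ps y (w y)) ->
  (forall y, A0 <= y <= B0 -> {for y, continuous w}) ->
  forall E : set rT, measurable E ->
  (\int[mu]_(y in E `&` `]A0, B0]) (w y)%:E)%E = mu (ph @^-1` E `&` `]a0, b0]).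
Proof.
move=> AB phps phAB psab mph mw w0 der cw E mE.
have mI : measurable (`]A0, B0]%classic : set rT) by exact: measurable_itv.
pose w' (y : rT) : R := w y * \1_(`]A0, B0]%classic) y.
have w'0 y : 0 <= w' y.
  rewrite /w' indicE; case: (boolP (y \in _)) => [|_]; last by rewrite mulr0.
  by rewrite inE /= in_itv /= => /andP[h1 h2]; rewrite mulr1 w0// ltW.
have mw' : measurable_fun setT w' by apply: measurable_funM => //; exact: measurable_indic.
have dE G : measurable G -> (\int[mu]_(y in G `&` `]A0, B0]) (w y)%:E)%E = density w' G.
  move=> mF; rewrite integral_mkcondr /density; apply: eq_integral => y yF.
  rewrite /w' /patch indicE; case: ifP => h; rewrite ?h ?mulr1 ?mulr0//.
have mJ : measurable (`]a0, b0]%classic : set rT) by exact: measurable_itv.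
pose nu : {measure set rT -> \bar R} := mrestr mu mJ.
rewrite dE// -[RHS]/(nu (ph @^-1` E)).
have [m2 m2E] : exists m2 : {measure set rT -> \bar R}, forall G, m2 G = nu (ph @^-1` G).
  by unshelve eexists (pushforward nu (ph : rT -> rT) : {measure set rT -> \bar R}).
have [m1 m1E] : exists m1 : {measure set rT -> \bar R}, forall G, m1 G = density w' G.
  by exists (density_measure w'0 mw').
rewrite -m1E -m2E.
have itvE (a b : R) : m1 `]a, b]%classic = m2 `]a, b]%classic /\ (m1 `]a, b]%classic < +oo)%E.
  pose a' := Num.max a A0; pose b' := Num.min b B0.
  have I1 : `]a, b] `&` `]A0, B0] = `]a', b']%classic.
    apply/seteqP; split=> y /=; rewrite !in_itv/= /a' /b' gt_max le_min.
      by case=> /andP[-> ->] /andP[-> ->].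
    by case/andP=> /andP[-> ->] /andP[-> ->].
  rewrite m1E m2E -dE// I1.
  have [ba|ab] := leP b' a'.
    rewrite set_itv_ge ?bnd_simp -?leNgt// integral_set0; split => //.
    rewrite /nu /= /mrestr.
    rewrite (_ : _ `&` _ = set0) ?measure0//.
    apply/seteqP; split=> // s [] /=; rewrite in_itv/= => h1 h2.
    have : `]a', b']%classic (ph s).
      by rewrite -I1; split=> //=; rewrite in_itv/=; apply: phAB; move: h2; rewrite in_itv.
    by rewrite /= in_itv/= => /andP[h3 h4]; move: (lt_le_trans h3 h4); rewrite ltNge ba.
  have aA : A0 <= a' by rewrite /a' le_max lexx orbT.
  have bB : b' <= B0 by rewrite /b' ge_min lexx orbT.
  have inab y : a' <= y <= b' -> A0 <= y <= B0.
    by move=> /andP[h1 h2]; rewrite (le_trans aA h1) (le_trans h2 bB).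
  have ia : A0 <= a' <= B0 by apply: inab; rewrite lexx ltW.
  have ib : A0 <= b' <= B0 by apply: inab; rewrite lexx ltW.
  have psle : ps a' <= ps b'.
    rewrite -phps//; last exact: psab.
    by apply: le_trans (ltW ab); rewrite phps ?lexx//; exact: psab.
  have I2 : ph @^-1` `]a, b] `&` `]a0, b0] = `]ps a', ps b']%classic.
    apply/seteqP; split=> s /=.
      rewrite !in_itv/= => -[h1 /andP[h2 h3]].
      have : `]a', b']%classic (ph s).
        by rewrite -I1; split=> //=; rewrite in_itv/=; apply: phAB; rewrite h2.
      have hs' : a0 <= s <= b0 by rewrite h3 ltW.
      by rewrite /= in_itv/= ltNge !phps// -ltNge.
    rewrite !in_itv/= => /andP[h1 h2].
    have hs : a0 < s <= b0.
      have /andP[] := psab _ ia; have /andP[_ ] := psab _ ib.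
      by move=> u1 u2 _; rewrite (le_lt_trans u2)//= (le_trans h2).
    have hs' : a0 <= s <= b0 by case/andP: hs => /ltW -> ->.
    split=> //; move: h1 h2; rewrite ltNge -phps// -ltNge => h1; rewrite -phps// => h2.
    have : `]a', b']%classic (ph s) by rewrite /= in_itv/= h1.
    by rewrite -I1 => -[] /=; rewrite in_itv.
  have -> : nu (ph @^-1` `]a, b]%classic) = (ps b' - ps a')%:E.
    rewrite /nu /= /mrestr I2 /= lebesgue_measure_itv/= lte_fin.
    by move: psle; rewrite le_eqVlt => /orP[/eqP ->|->]; rewrite ?ltxx ?subrr.
  rewrite integral_itv_obnd_cbnd; last first.
    by apply/measurable_EFinP; exact: measurable_funTS.
  rewrite (@integral_der ps)//; first by rewrite ltry.
  - by move=> y /inab; exact: der.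
  - by move=> y /inab; exact: cw.
refine (@measure_unique _ _ rT (@ocitv R) (fun j => `]- j%:R, j%:R]%classic)
  _ _ _ _ m1 m2 _ _ E mE) => //.
- exact: ocitvI.
- by move=> j; exists (- j%:R, j%:R).
- exact: ocitv_cover.
- by move=> X [[a b] _ <-]; have [] := itvE a b.
- by move=> j; have [] := itvE (- j%:R) j%:R.
Qed.

(** On the sphere these longitudes describe the open upper half of a circle around the x-axis; the
    lower half is reached through [flip]. *)
Definition longitudes k : set rT := [set s | k = Spherical -> - (pi / 2) < s < pi / 2].

Lemma gasin_longitudes k x : (k = Spherical -> -1 < x < 1) -> longitudes k (gasin k x).
Proof.
move=> u; have u' : k = Spherical -> -1 <= x <= 1 by move=> /u /andP[/ltW -> /ltW ->].
move=> e; have := gasinK u'; have := gasin_quarter u' e; have := u e.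
rewrite e /= !le_eqVlt => h1 /andP[/predU1P[h|->] /predU1P[h'|->]]//.
- by rewrite -h sinN sin_pihalf => h2; lra.
- by rewrite -h sinN sin_pihalf => h2; lra.
- by rewrite h' sin_pihalf => h2; lra.
Qed.

(** Exhausts [longitudes k] by bounded intervals. On the sphere the density of the substitution
    below is singular at the ends, so it is made on these intervals before passing to the limit. *)
Definition half_bound k (j : nat) : R :=
  if k is Spherical then pi / 2 * (1 - j.+2%:R^-1) else j.+1%:R.

Lemma half_bound_gt0 k j : 0 < half_bound k j.
Proof.
rewrite /half_bound; case: k; rewrite ?ltr0n// mulr_gt0 ?divr_gt0 ?pi_gt0//.
by rewrite subr_gt0 invf_lt1 ?ltr1n// ltr0n.
Qed.

Lemma half_bound_lt k j : k = Spherical -> half_bound k j < pi / 2.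
Proof.
move=> ->; rewrite /half_bound gtr_pMr ?divr_gt0 ?pi_gt0//.
Qed.

Lemma half_bound_le k i j : (i <= j)%N -> half_bound k i <= half_bound k j.
Proof.
move=> ij; rewrite /half_bound; case: k; rewrite ?ler_nat//.
rewrite ler_pM2l ?divr_gt0 ?pi_gt0// lerB// lef_pV2 ?posrE ?ltr0n//.
by rewrite ler_nat.
Qed.

Lemma half_boundP k s : longitudes k s -> exists j, - half_bound k j < s <= half_bound k j.
Proof.
move=> hs; suff [j hj] : exists j, `|s| < half_bound k j.
  by exists j; move: hj; rewrite ltr_norml => /andP[-> /ltW ->].
move: hs; rewrite /longitudes /half_bound /=; case: k => hs.
- exists (Num.Def.archi_bound `|s|); apply: lt_le_trans (archi_boundP _) _ => //.
  by rewrite ler_nat.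
- exists (Num.Def.archi_bound `|s|); apply: lt_le_trans (archi_boundP _) _ => //.
  by rewrite ler_nat.
have pi0 := @pi_gt0 R.
have h : `|s| / (pi / 2) < 1.
  by rewrite ltr_pdivrMr ?divr_gt0// mul1r ltr_norml hs.
have [j hj] := ltr_add_invr h; exists j.
rewrite mulrC -ltr_pdivrMr ?divr_gt0// ltrBrDr; apply: le_lt_trans hj.
by rewrite lerD2l lef_pV2 ?posrE ?ltr0n// ler_nat.
Qed.

Lemma half_bigcup k : \bigcup_j `]- half_bound k j, half_bound k j]%classic = longitudes k.
Proof.
apply/seteqP; split=> [s [j _] /=|s /half_boundP[j hj]]; last by exists j => //=; rewrite in_itv.
rewrite in_itv/= => /andP[h1 h2] e; have := half_bound_lt j e.
by move=> h3; rewrite (le_lt_trans h2 h3) andbT (lt_trans _ h1)// ltrN2.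
Qed.

Lemma quarter_bound k j s : - half_bound k j <= s <= half_bound k j -> longitudes k s.
Proof.
move=> /andP[h1 h2] e; have h3 := half_bound_lt j e.
by rewrite (le_lt_trans h2 h3) andbT (lt_le_trans _ h1)// ltrN2.
Qed.

Lemma half_quarter k s : longitudes k s -> quarter k s.
Proof. by move=> h /h /andP[/ltW -> /ltW ->]. Qed.

Lemma measurable_gsin k c : measurable_fun setT ((fun s => c * gsin k s) : rT -> rT).
Proof.
apply: continuous_measurable_fun => s; apply: continuousM; first exact: cst_continuous.
exact: continuous_gsin.
Qed.

Lemma measurable_inverse : measurable_fun setT ((fun x => x^-1) : rT -> rT).
Proof.
have m0 : measurable [set (0 : rT)] by exact: measurable_set1.
rewrite -(setUv [set (0 : rT)]); apply/measurable_funU => //; first exact: measurableC.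
split; first exact: measurable_fun_set1.
apply: subspace_continuous_measurable_fun; first exact: measurableC.
by apply: continuous_in_subspaceT => x; rewrite inE => /eqP x0; exact: inv_continuous.
Qed.

(** The substitution [y = c * gsin k s], under which the density becomes 1. *)
Lemma slice_measure k c (E : set rT) : 0 < c -> measurable E ->
  (\int[mu]_(y in E) ((Num.sqrt (c ^+ 2 - K k * y ^+ 2))^-1)%:E)%E =
  mu ((fun s => c * gsin k s) @^-1` E `&` longitudes k).
Proof.
move=> c0 mE; pose w (y : rT) : R := (Num.sqrt (c ^+ 2 - K k * y ^+ 2))^-1.
have w0 y : 0 <= w y by rewrite invr_ge0 sqrtr_ge0.
have mw : measurable_fun setT w.
  apply: (measurableT_comp measurable_inverse).
  apply: continuous_measurable_fun => y; apply: continuous_comp; last exact: sqrt_continuous.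
  apply: continuousB; first exact: cst_continuous.
  apply: continuousM; first exact: cst_continuous.
  by move=> ?; apply: exprn_continuous.
pose B j := c * gsin k (half_bound k j).
have [m1 m1E] : exists m1 : {measure set rT -> \bar R}, forall G, m1 G = density w G.
  by exists (density_measure w0 mw).
pose E1 j := E `&` `]- B j, B j]%classic.
pose E2 j := (fun s => c * gsin k s) @^-1` E `&` `]- half_bound k j, half_bound k j]%classic.
have mE2 : measurable ((fun s => c * gsin k s) @^-1` E).
  by rewrite -[X in measurable X]setTI; exact: (measurable_gsin k c).
have b0 j := ltW (half_bound_gt0 k j).
have hb j : longitudes k (half_bound k j).
  by apply: (@quarter_bound _ j); rewrite lexx andbT; have := b0 j; lra.
have hNb j : longitudes k (- half_bound k j).
  by apply: (@quarter_bound _ j); rewrite lexx; have := b0 j; lra.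
have B0 j : 0 < B j.
  by rewrite mulr_gt0// gsin_gt0// ?half_bound_gt0// => e; have := half_bound_lt j e; have := @pi_gt0 R; lra.
have Ble i j : (i <= j)%N -> B i <= B j.
  move=> ij; rewrite ler_pM2l// ler_gsin ?half_bound_le//; exact: half_quarter.
have BE j y : - B j <= y <= B j ->
    - half_bound k j <= gasin k (y / c) <= half_bound k j /\ y = c * gsin k (gasin k (y / c)).
  move=> /andP[h1 h2].
  have u1 : - gsin k (half_bound k j) <= y / c by rewrite ler_pdivlMr// mulrC mulrN.
  have u2 : y / c <= gsin k (half_bound k j) by rewrite ler_pdivrMr// mulrC.
  have u : k = Spherical -> -1 <= y / c <= 1.
    move=> e; move: u1 u2; rewrite e /=; have := sin_le1 (half_bound Spherical j).
    have := sin_geN1 (half_bound Spherical j); lra.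
  split; last by rewrite gasinK//; field; rewrite gt_eqF.
  have hq := gasin_quarter u.
  rewrite -(ler_gsin (half_quarter (hNb j)) hq) -(ler_gsin hq (half_quarter (hb j))).
  by rewrite gasinK// gsinN u1 u2.
have posw y : longitudes k y -> c ^+ 2 - K k * (c * gsin k y) ^+ 2 = (c * gcos k y) ^+ 2 /\ 0 < c * gcos k y.
  move=> hy; split; last by rewrite mulr_gt0// gcos_gt0.
  have h : gcos k y ^+ 2 = 1 - K k * gsin k y ^+ 2 by have := gcos2Dgsin2 k y; lra.
  by rewrite !exprMn h; ring.
have caps (nu : {measure set rT -> \bar R}) (G : set rT) (b : nat -> R) : measurable G ->
    (forall i j, (i <= j)%N -> b i <= b j) ->
    let Gb j := G `&` `]- b j, b j]%classic in (fun j => nu (Gb j)) @ \oo --> nu (\bigcup_j Gb j).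
  move=> mG ble Gb; apply: nondecreasing_cvg_mu.
  - by move=> j; apply: measurableI => //; exact: measurable_itv.
  - by apply: bigcup_measurable => j _; apply: measurableI => //; exact: measurable_itv.
  - move=> i j /ble bij; apply/subsetPset; apply: setIS => x /=; rewrite !in_itv/= => /andP[h1 h2].
    by rewrite (le_trans h2 bij) andbT (le_lt_trans _ h1)// lerN2.
have c1 : (fun j => m1 (E1 j)) @ \oo --> m1 (\bigcup_j E1 j) by exact: caps.
have c2 : (fun j => mu (E2 j)) @ \oo --> mu (\bigcup_j E2 j) by apply: caps => //; exact: half_bound_le.
have E12 j : m1 (E1 j) = mu (E2 j).
  rewrite m1E /density; apply: (integral_inverse_derivative (ps := fun y => gasin k (y / c))) => //.
  - by have := B0 j; lra.
  - move=> s y hs /BE[h1 h2]; rewrite [in LHS]h2 ler_pM2l// ler_gsin//.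
      by apply: half_quarter; exact: quarter_bound hs.
    by apply: half_quarter; exact: quarter_bound h1.
  - move=> s /andP[h1 h2]; rewrite /B -mulrN -gsinN ltr_pM2l// ler_pM2l//.
    have hs : longitudes k s by apply: (@quarter_bound _ j); rewrite ltW.
    by rewrite ltr_gsin ?ler_gsin ?h1//; exact: half_quarter.
  - by move=> y /BE[].
  - exact: measurable_gsin.
  - move=> y /BE[/quarter_bound hy yE].
    have [p1 p2] := posw _ hy; rewrite -yE in p1.
    apply: der_eq.
      apply: (@der_comp (gasin k) (fun y => y / c)); last first.
        by apply: derM; [exact: der_id|exact: der_cst].
      apply: der_gasin => e; have := gcos_gt0 hy; have := gcos2Dgsin2 k (gasin k (y / c)).
      have -> : gsin k (gasin k (y / c)) = y / c by rewrite [in RHS]yE; field; rewrite gt_eqF.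
      by rewrite e /= mul1r; nra.
    rewrite /w p1 sqrtr_sqr gtr0_norm//.
    have -> : 1 - K k * (y / c) ^+ 2 = (gcos k (gasin k (y / c))) ^+ 2.
      move: p1; rewrite !exprMn exprVn => p1.
      have cn : c ^+ 2 != 0 by rewrite expf_neq0 ?gt_eqF.
      by apply: (mulfI cn); rewrite -p1; field; rewrite gt_eqF.
    rewrite sqrtr_sqr gtr0_norm ?gcos_gt0//; field.
    by rewrite !gt_eqF// gcos_gt0.
  - move=> y /BE[/quarter_bound hy yE].
    have [p1 p2] := posw _ hy; rewrite -yE in p1.
    apply: continuous_comp; last by apply: inv_continuous; rewrite p1 sqrtr_sqr gt_eqF// gtr0_norm.
    apply: continuous_comp; last exact: sqrt_continuous.
    apply: continuousB; first exact: cst_continuous.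
    apply: continuousM; first exact: cst_continuous.
    by move=> ?; apply: exprn_continuous.
have -> : (fun s => c * gsin k s) @^-1` E `&` longitudes k = \bigcup_j E2 j.
  by rewrite -half_bigcup setI_bigcupr.
transitivity (m1 (\bigcup_j E1 j)); last first.
  have e12 : (fun j => mu (E2 j)) = (fun j => m1 (E1 j)) by apply/funext => j; rewrite E12.
  by move: c2; rewrite e12 => c2; exact: cvg_unique c1 c2.
rewrite m1E /density -setI_bigcupr integral_mkcondr; apply: eq_integral => y _.
rewrite /patch; case: ifPn => //; rewrite notin_setE => hy.
(* Beyond the range of the substitution the radicand is not positive, so [Num.sqrt] gives 0 and the
   inverse of 0 is 0: these points do not contribute. *)
suff : c ^+ 2 - K k * y ^+ 2 <= 0 by move=> /ler0_sqrtr ->; rewrite invr0.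
rewrite leNgt; apply/negP => yp; apply: hy.
have u : k = Spherical -> -1 < y / c < 1.
  by move=> e; rewrite ltr_pdivlMr ?ltr_pdivrMr//; move: yp; rewrite e /=; nra.
have u' : k = Spherical -> -1 <= y / c <= 1 by move=> /u /andP[/ltW -> /ltW ->].
have hs := gasin_longitudes u.
have [j hj] := half_boundP hs; exists j => //=; rewrite in_itv/=.
have yE : y = c * gsin k (gasin k (y / c)) by rewrite gasinK//; field; rewrite gt_eqF.
rewrite yE /B -mulrN -gsinN ltr_pM2l// ler_pM2l// ltr_gsin ?ler_gsin//; exact: half_quarter.
Qed.

Arguments longitudes k _ : simpl never.

(** The measurable structure is the product one; an open set is a countable union of boxes with
    rational corners. *)
Lemma open_measurable_plane (U : set (R * R)) : open U ->
  measurable (U : set (rT * rT)).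
Proof.
move=> oU.
pose box (a b c d : rat) : set (rT * rT) := `]ratr a, ratr b[ `*` `]ratr c, ratr d[.
pose B (a b c d : rat) : set (rT * rT) := if `[< box a b c d `<=` U >] then box a b c d else set0.
rewrite (_ : U = \bigcup_a \bigcup_b \bigcup_c \bigcup_d B a b c d); last first.
  apply/seteqP; split=> [[x y] Uxy|[x y] [a _ [b _ [c _ [d _]]]]]; last first.
    by rewrite /B; case: asboolP => // /[apply].
  have /nbhs_ballP[e /= e0 he] := oU _ Uxy.
  have between (s t : R) : s < t -> exists r : rat, s < ratr r < t.
    by move=> /rat_in_itvoo[r]; rewrite inE /=; exists r.
  have [a /andP[a1 a2]] := between (x - e) x ltac:(lra).
  have [b /andP[b1 b2]] := between x (x + e) ltac:(lra).
  have [c /andP[c1 c2]] := between (y - e) y ltac:(lra).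
  have [d /andP[d1 d2]] := between y (y + e) ltac:(lra).
  exists a => //; exists b => //; exists c => //; exists d => //.
  rewrite /B asboolT; first by split; rewrite /= in_itv /= ?a2 ?b1 ?c2 ?d1.
  move=> [s t] [] /=; rewrite !in_itv /= => /andP[s1 s2] /andP[t1 t2].
  by apply: he; split; rewrite /ball /= ltr_norml; between.
apply: bigcupT_measurable_rat => a; apply: bigcupT_measurable_rat => b.
apply: bigcupT_measurable_rat => c; apply: bigcupT_measurable_rat => d.
rewrite /B; case: ifP => // _.
by apply: measurableX; exact: measurable_itv.
Qed.

Definition relclosed k F := forall q, surface k q -> ~ F q ->
  exists2 e, 0 < e & forall q', surface k q' -> near3 e q q' -> ~ F q'.

Lemma measurable_pullback k F (h : R * R -> space) (D : set (R * R)) :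
  relclosed k F -> open D -> continuous h -> (forall w, D w -> surface k (h w)) ->
  measurable (D `&` h @^-1` F : set (rT * rT)).
Proof.
move=> cF oD ch hD.
have -> : D `&` h @^-1` F = D `\` (D `&` h @^-1` (~` F)).
  apply/seteqP; split=> w [Dw Fw]; split => //; first by case.
  by apply: contrapT => nF; apply: Fw.
apply: measurableD; apply: open_measurable_plane => //.
rewrite openE => w [Dw nF]; have [e e0 he] := cF _ (hD _ Dw) nF.
have n1 : \forall w' \near w, D w' by apply: oD.
have n2 : \forall w' \near w, ball (h w) e (h w') by apply: (ch w); exact: nbhsx_ballx.
rewrite /interior /=; near=> w'; split; first by near: w'.
apply: he; first by apply: hD; near: w'.
by apply/ball_near3; near: w'.
Unshelve. all: by end_near. Qed.

Definition shadow k : set (R * R) := [set w | K k * (w.1 ^+ 2 + w.2 ^+ 2) < 1].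

Definition slab k : set (R * R) := [set w | K k * w.1 ^+ 2 < 1 /\ longitudes k w.2].

(** Size of the section of the surface by a plane of constant x. With y = [cradius k x * gsin k s]
    and height [cradius k x * gcos k s], the area element dx dy / height becomes dx ds, as in
    Archimedes' theorem on the sphere and the cylinder. *)
Definition cradius k x : R := Num.sqrt (1 - K k * x ^+ 2).

(* [s] is the longitude around the [x]-axis. *)
Definition pt k (w : R * R) : space :=
  (w.1, cradius k w.1 * gsin k w.2, cradius k w.1 * gcos k w.2).

Lemma continuous_pair3 (f g h : R * R -> R) : continuous f -> continuous g -> continuous h ->
  continuous (fun w => (f w, g w, h w)).
Proof.
by move=> cf cg ch w; exact: (cvg_pair (cvg_pair (cf w) (cg w)) (ch w)).
Qed.

Lemma continuous_fst2 : continuous (fun w : R * R => w.1). Proof. by move=> w; apply: cvg_fst. Qed.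
Lemma continuous_snd2 : continuous (fun w : R * R => w.2). Proof. by move=> w; apply: cvg_snd. Qed.

Lemma continuous_sqr (f : R * R -> R) : continuous f -> continuous (fun w => f w ^+ 2).
Proof. by move=> cf w; apply: cvgM; exact: cf. Qed.

Lemma continuous_mul (f g : R * R -> R) : continuous f -> continuous g ->
  continuous (fun w => f w * g w).
Proof. by move=> cf cg w; apply: cvgM; [exact: cf|exact: cg]. Qed.

Lemma continuous_post (f : R * R -> R) (g : R -> R) : continuous f -> continuous g ->
  continuous (fun w => g (f w)).
Proof. by move=> cf cg w; apply: continuous_comp; [exact: cf|exact: cg]. Qed.

Lemma continuous_height k : continuous (@height R k).
Proof.
move=> w; apply: continuous_comp; last exact: sqrt_continuous.
apply: continuousB; first exact: cst_continuous.
apply: continuousM; first exact: cst_continuous.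
by apply: continuousD; apply: continuous_sqr; [exact: continuous_fst2|exact: continuous_snd2].
Qed.

Lemma continuous_pt k : continuous (pt k).
Proof.
have cr : continuous (fun w : R * R => cradius k w.1).
  rewrite /cradius => w; apply: continuous_comp; last exact: sqrt_continuous.
  apply: continuousB; first exact: cst_continuous.
  apply: continuousM; first exact: cst_continuous.
  by apply: continuous_sqr; exact: continuous_fst2.
apply: continuous_pair3; first exact: continuous_fst2.
- by apply: continuous_mul => //; apply: continuous_post; [exact: continuous_snd2|exact: continuous_gsin].
- by apply: continuous_mul => //; apply: continuous_post; [exact: continuous_snd2|exact: continuous_gcos].
Qed.

Lemma open_below (f : R * R -> R) c : continuous f -> open [set w | f w < c].
Proof.
move=> cf; rewrite (_ : [set w | _] = f @^-1` `]-oo, c[); last first.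
  by apply/seteqP; split=> w /=; rewrite in_itv.
by apply: open_comp => // w _; exact: cf.
Qed.

Lemma open_shadow k : open (shadow k).
Proof.
apply: (@open_below (fun w => K k * (w.1 ^+ 2 + w.2 ^+ 2))).
apply: continuous_mul; first by move=> ?; exact: cst_continuous.
move=> w; apply: cvgD; apply: continuous_sqr; [exact: continuous_fst2|exact: continuous_snd2].
Qed.

Lemma open_slab k : open (slab k).
Proof.
have -> : slab k = [set w | K k * w.1 ^+ 2 < 1] `&` [set w | longitudes k w.2] by [].
apply: openI.
  apply: (@open_below (fun w => K k * w.1 ^+ 2)).
  apply: continuous_mul; first by move=> ?; exact: cst_continuous.
  by apply: continuous_sqr; exact: continuous_fst2.
rewrite /longitudes /=; case: k => /=; last first.
  rewrite (_ : [set w | _] = [set w | w.2 < pi / 2] `&` [set w | - w.2 < pi / 2]).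
    apply: openI; first by apply: open_below; exact: continuous_snd2.
    by apply: (@open_below (fun w => - w.2)) => w; apply: cvgN; exact: continuous_snd2.
  apply/seteqP; split=> w /=; first by move=> /(_ erefl)/andP[? ?]; split=> //; lra.
  by move=> [h1 h2] _; between.
all: by rewrite (_ : [set w | _] = setT); [exact: openT|apply/seteqP; split].
Qed.

Lemma cradius_sqr k x : K k * x ^+ 2 < 1 -> cradius k x ^+ 2 = 1 - K k * x ^+ 2.
Proof. by move=> h; rewrite sqr_sqrtr//; lra. Qed.

Lemma cradius_gt0 k x : K k * x ^+ 2 < 1 -> 0 < cradius k x.
Proof. by move=> h; rewrite sqrtr_gt0; lra. Qed.

Lemma pt_surface k w : K k * w.1 ^+ 2 < 1 -> (k <> Spherical -> longitudes k w.2) -> surface k (pt k w).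
Proof.
move=> h hh; split=> /= [|/hh hw].
  have r2 := cradius_sqr h; have gg := gcos2Dgsin2 k w.2.
  have g2 : gcos k w.2 ^+ 2 = 1 - K k * gsin k w.2 ^+ 2 by lra.
  by rewrite !exprMn r2 g2; ring.
by rewrite mulr_gt0 ?cradius_gt0 ?gcos_gt0.
Qed.

Definition flip q : space := (q.1, - q.2).

Lemma height_gcos k x s : K k * x ^+ 2 < 1 -> longitudes k s ->
  height k (x, cradius k x * gsin k s) = cradius k x * gcos k s.
Proof.
move=> hx hs; have c0 := cradius_gt0 hx; have g0 := gcos_gt0 hs.
have g2 : gcos k s ^+ 2 = 1 - K k * gsin k s ^+ 2 by have := gcos2Dgsin2 k s; lra.
rewrite /height /= (_ : 1 - _ = (cradius k x * gcos k s) ^+ 2).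
  by rewrite sqrtr_sqr gtr0_norm// mulr_gt0.
by rewrite !exprMn g2 cradius_sqr//; ring.
Qed.

Lemma shadow_gcos k x s : K k * x ^+ 2 < 1 -> longitudes k s -> shadow k (x, cradius k x * gsin k s).
Proof.
move=> hx hs; have c0 := cradius_gt0 hx; have g0 := gcos_gt0 hs.
rewrite /shadow /= -subr_gt0 (_ : 1 - _ = (cradius k x * gcos k s) ^+ 2) ?exprn_gt0 ?mulr_gt0//.
have g2 : gcos k s ^+ 2 = 1 - K k * gsin k s ^+ 2 by have := gcos2Dgsin2 k s; lra.
by rewrite !exprMn g2 cradius_sqr//; ring.
Qed.

Lemma measurable_height k : measurable_fun setT (fun w : rT * rT => height k w).
Proof.
move=> _ Y mY; rewrite setTI.
have mh : measurable_fun setT (fun w : rT * rT => 1 - K k * (w.1 ^+ 2 + w.2 ^+ 2)).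
  apply: measurable_funB => //; apply: measurable_funM => //.
  by apply: measurable_funD; apply: measurable_funX.
have ms : measurable_fun setT (@Num.sqrt R : rT -> rT).
  by apply: continuous_measurable_fun; exact: sqrt_continuous.
by have := measurableT_comp ms mh measurableT mY; rewrite setTI.
Qed.

Lemma shadow_slice k x (E : set (rT * rT)) : measurable E -> E `<=` shadow k ->
  (\int[mu]_y ((\1_E (x, y) / height k (x, y))%R)%:E)%E =
  mu [set s | slab k (x, s) /\ E (x, cradius k x * gsin k s)].
Proof.
move=> mE Eb; have [hx|hx] := ltP (K k * x ^+ 2) 1; last first.
  rewrite (_ : [set s | _] = set0) ?measure0; last first.
    by apply/seteqP; split=> // s [[/= h _] _]; lra.
  rewrite integral0_eq// => y _; rewrite indicE memNset ?mul0r// => /Eb; rewrite /shadow /=.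
  have : 0 <= K k * y ^+ 2.
    have x2 := sqr_ge0 x; rewrite mulr_ge0 ?sqr_ge0//; move: hx x2; clear; case: k => /=; nra.
  lra.
rewrite (_ : [set s | _] = (fun s => cradius k x * gsin k s) @^-1` (xsection E x) `&` longitudes k).
  rewrite -slice_measure ?cradius_gt0//; last exact: measurable_xsection.
  rewrite [RHS]integral_mkcond; apply: eq_integral => y _.
  rewrite /patch indicE mem_xsection; case: ifP => _; last by rewrite mul0r.
  rewrite mul1r /height /= cradius_sqr//; congr (_^-1)%:E; congr Num.sqrt; ring.
apply/seteqP; split=> s /=; first by move=> [[_ hs] h]; split=> //; rewrite /xsection /= inE.
by rewrite /slab/= /xsection /= inE => -[h hs].
Qed.

Definition sheet k (e : R) F : set (rT * rT) :=
  shadow k `&` (fun w => (w, e * height k w)) @^-1` F.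

Lemma measurable_sheet k e F : relclosed k F -> F `<=` surface k ->
  e = 1 \/ e = -1 -> measurable (sheet k e F).
Proof.
move=> cF Fs e1.
have surf w : shadow k w -> height k w ^+ 2 = 1 - K k * (w.1 ^+ 2 + w.2 ^+ 2) /\ 0 < height k w.
  by rewrite /shadow /= => h; rewrite sqr_sqrtr ?sqrtr_gt0//; lra.
have e2 : e ^+ 2 = 1 by case: e1 => ->; rewrite ?sqrrN expr1n.
have [ne|pe] : (k <> Spherical /\ e = -1) \/ (k <> Spherical -> e = 1).
- by case: (pselect (k = Spherical)) => [ek|nk]; [right|case: e1; [right|left]].
  rewrite (_ : sheet k e F = set0)//; apply/seteqP; split=> // w [/surf[_ h0]] /= /Fs[_ /(_ ne.1)] /=.
  by rewrite ne.2 mulN1r oppr_gt0; lra.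
apply: (measurable_pullback cF); first exact: open_shadow.
  have ce : continuous (fun w : R * R => e * height k w).
    by apply: continuous_mul; [move=> ?; exact: cst_continuous|exact: continuous_height].
  have := @continuous_pair3 _ _ _ (@continuous_fst2) (@continuous_snd2) ce.
  by rewrite (_ : (fun w => _) = fun w => (w, e * height k w)) //; apply: funext => -[].
move=> w /surf[h h0]; split=> /=; first by rewrite exprMn e2 h; ring.
by move=> /pe ->; rewrite mul1r.
Qed.

Definition sheet_density k e F (w : rT * rT) : R := \1_(sheet k e F) w / height k w.

Lemma sheet_density_ge0 k e F w : 0 <= sheet_density k e F w.
Proof. by rewrite mulr_ge0 ?invr_ge0 ?sqrtr_ge0// indicE; case: (_ \in _). Qed.

Lemma measurable_sheet_density k e F : relclosed k F -> F `<=` surface k ->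
  e = 1 \/ e = -1 -> measurable_fun setT (fun w => (sheet_density k e F w)%:E).
Proof.
move=> cF Fs e1; apply/measurable_EFinP; apply: measurable_funM.
  by apply: measurable_indic; exact: measurable_sheet.
by apply: (measurableT_comp measurable_inverse); exact: measurable_height.
Qed.

Definition sheets k F w : \bar R := ((sheet_density k 1 F w)%:E + (sheet_density k (-1) F w)%:E)%E.

Lemma measurable_sheets k F : relclosed k F -> F `<=` surface k ->
  measurable_fun setT (sheets k F) /\ forall w, (0 <= sheets k F w)%E.
Proof.
move=> cF Fs; split=> [|w]; last by rewrite adde_ge0// lee_fin sheet_density_ge0.
by apply: emeasurable_funD; apply: measurable_sheet_density => //; [left|right].
Qed.

Lemma area_sheets k F : area k F = (\int[mu \x mu]_w sheets k F w)%E.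
Proof.
rewrite /area integral_mkcond; apply: eq_integral => w _; rewrite /patch /sheets /sheet_density -EFinD -mulrDl.
rewrite !indicE; case: ifPn => [|/negP]; rewrite inE => hw; last first.
  by rewrite !memNset ?addr0 ?mul0r// => -[].
have -> : (w \in sheet k 1 F) = ((w, height k w) \in F).
  by apply/idP/idP; rewrite !inE /sheet /= mul1r // => -[].
by have -> : (w \in sheet k (-1) F) = ((w, - height k w) \in F)
  by apply/idP/idP; rewrite !inE /sheet /= mulN1r // => -[].
Qed.

Lemma fubini_sheets k F x : relclosed k F -> F `<=` surface k ->
  fubini_F mu (sheets k F) x =
  (mu [set s | slab k (x, s) /\ F (pt k (x, s))] +
   mu [set s | slab k (x, s) /\ F (flip (pt k (x, s)))])%E.
Proof.
move=> cF Fs; have m1 := measurable_sheet_density cF Fs (or_introl erefl).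
have m2 := measurable_sheet_density cF Fs (or_intror erefl).
rewrite /fubini_F ge0_integralD//; last 4 first.
- by move=> y _; rewrite lee_fin sheet_density_ge0.
- by apply: measurableT_comp m1 _.
- by move=> y _; rewrite lee_fin sheet_density_ge0.
- by apply: measurableT_comp m2 _.
rewrite !shadow_slice//; last 4 first.
- by apply: measurable_sheet => //; right.
- by move=> w [].
- by apply: measurable_sheet => //; left.
- by move=> w [].
rewrite /sheet; congr (mu _ + mu _)%E; apply/seteqP; split=> s [hs] /= => [[hb]|h].
- by rewrite /preimage /= mul1r height_gcos//; case: hs.
- by split=> //; split; [apply: shadow_gcos; case: hs|rewrite /preimage /= mul1r height_gcos//; case: hs].
- by rewrite /preimage /= mulN1r height_gcos//; case: hs.
- by split=> //; split; [apply: shadow_gcos; case: hs|rewrite /preimage /= mulN1r height_gcos//; case: hs].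
Qed.

Lemma area_slices k F : relclosed k F -> F `<=` surface k ->
  let slice x := (mu [set s | slab k (x, s) /\ F (pt k (x, s))] +
                  mu [set s | slab k (x, s) /\ F (flip (pt k (x, s)))])%E in
  measurable_fun setT slice /\ area k F = (\int[mu]_x slice x)%E.
Proof.
move=> cF Fs; have [mD D0] := measurable_sheets cF Fs.
move=> slice; have -> : slice = fubini_F mu (sheets k F).
  by apply/funext => x; rewrite fubini_sheets.
by split; [exact: measurable_fun_fubini_tonelli_F|rewrite area_sheets fubini_tonelli1].
Qed.

(** * Area under a reflection and under rotations of the sphere *)

Definition swap q : space := (q.1.2, q.1.1, q.2).

Lemma surface_swap k q : surface k (swap q) <-> surface k q.
Proof. by rewrite /surface /= [q.1.2 ^+ 2 + _]addrC. Qed.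

Lemma relclosed_swap k F : relclosed k F -> relclosed k (swap @^-1` F).
Proof.
move=> cF q sq nF; have [|e e0 h] := cF (swap q) _ nF; first exact/surface_swap.
by exists e => // q' sq' [h1 h2 h3]; apply: h; [exact/surface_swap|split].
Qed.

(** Fubini in the opposite order, the density being symmetric in x and y. *)
Lemma area_swap k F : relclosed k F -> F `<=` surface k ->
  area k (swap @^-1` F) = area k F.
Proof.
move=> cF Fs; have Fs' : swap @^-1` F `<=` surface k by move=> q /Fs/surface_swap.
have [m1 p1] := measurable_sheets (relclosed_swap cF) Fs'; have [m2 p2] := measurable_sheets cF Fs.
rewrite !area_sheets fubini_tonelli1; [|exact: m1|exact: p1].
rewrite fubini_tonelli2; [|exact: m2|exact: p2].
apply: eq_integral => x _; apply: eq_integral => y _.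
have E e : sheet_density k e (swap @^-1` F) (x, y) = sheet_density k e F (y, x).
  rewrite /sheet_density !indicE /height /= [x ^+ 2 + _]addrC; congr ((nat_of_bool _)%:R / _).
  by apply/idP/idP; rewrite !inE /sheet /shadow /preimage /swap /height /= [x ^+ 2 + _]addrC.
by rewrite /sheets !E.
Qed.

Lemma lebesgue_shift a (G : set rT) : measurable G -> mu ((fun s => s + a) @^-1` G) = mu G.
Proof.
move=> mG.
have mf : measurable_fun setT ((fun s => s + a) : rT -> rT) by apply: measurable_funD.
have [m mE] : exists m : {measure set rT -> \bar R}, forall G, m G = mu ((fun s => s + a) @^-1` G).
  by unshelve eexists (pushforward mu ((fun s => s + a) : rT -> rT) : {measure set rT -> \bar R}).
rewrite -mE; apply/esym; apply: lebesgue_measure_unique => //= _ [[c d] _ <-].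
rewrite mE (_ : _ @^-1` _ = `]c - a, d - a]%classic).
  rewrite !lebesgue_measure_itv /= !lte_fin ltrD2r; case: ifP => // _.
  by rewrite -!EFinD; congr (_%:E); ring.
by apply/seteqP; split=> s /=; rewrite !in_itv/= ltrBlDr lerBrDr.
Qed.

Lemma lebesgue_mirror a (G : set rT) : measurable G -> mu ((fun s => a - s) @^-1` G) = mu G.
Proof.
move=> mG; have mf : measurable_fun setT ((fun s => s + a) : rT -> rT) by apply: measurable_funD.
have mG' : measurable ((fun s => s + a) @^-1` G) by rewrite -[X in measurable X]setTI; exact: mf.
rewrite -(lebesgue_shift a mG) -[RHS]lebesgue_measureN// /pushforward.
by congr (mu _); apply/seteqP; split=> s /=; rewrite addrC.
Qed.

Section Arc.
Variable G : set rT.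
Hypothesis mG : measurable G.
Definition arc_measure a b := mu (G `&` `]a, b]).

Lemma arc_measureD a b c : a <= b -> b <= c -> arc_measure a c = (arc_measure a b + arc_measure b c)%E.
Proof.
move=> ab bc; rewrite /arc_measure -measureU.
- by rewrite -setIUr -itv_bndbnd_setU.
- by apply: measurableI => //; exact: measurable_itv.
- by apply: measurableI => //; exact: measurable_itv.
apply/seteqP; split=> // s [[_ /=] + [_ /=]]; rewrite !in_itv/= => /andP[_ h1] /andP[h2 _].
by move: (lt_le_trans h2 h1); rewrite ltxx.
Qed.

Lemma arc_measure_open a b : mu (G `&` `]a, b[) = arc_measure a b.
Proof.
rewrite /arc_measure; have [ab|ba] := ltP a b; last first.
  by congr (mu _); congr (_ `&` _); rewrite !set_itv_ge// bnd_simp -leNgt.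
rewrite -(@setUitv1 _ _ _ _ true)//= ?bnd_simp// setIUr measureU//; last 3 first.
- by apply: measurableI => //; exact: measurable_itv.
- by apply: measurableI => //; exact: measurable_set1.
- by apply/seteqP; split=> // s [[_ /=] + [_ /= e]]; rewrite e in_itv/= ltxx andbF.
rewrite [X in (_ + X)%E](_ : _ = 0%E) ?adde0//; apply/eqP; rewrite eq_le measure_ge0 andbT.
have : (mu (G `&` [set b]) <= mu [set b])%E.
  apply: le_measure; [rewrite inE|rewrite inE; exact: measurable_set1|exact: subIsetr].
  by apply: measurableI => //; exact: measurable_set1.
by rewrite lebesgue_measure_set1.
Qed.

End Arc.

Lemma arc_measure_shift (G : set rT) d a b : measurable G ->
  arc_measure ((fun s => s + d) @^-1` G) a b = arc_measure G (a + d) (b + d).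
Proof.
move=> mG; rewrite /arc_measure -[RHS](lebesgue_shift d); last first.
  by apply: measurableI => //; exact: measurable_itv.
congr (mu _); apply/seteqP; split=> s /=; by rewrite !in_itv/= ltrD2r lerD2r.
Qed.

Lemma circle_shift (G : set rT) a d : measurable G -> (forall s, G (s + 2 * pi) <-> G s) ->
  0 <= d <= 2 * pi ->
  arc_measure ((fun s => s + d) @^-1` G) a (a + 2 * pi) = arc_measure G a (a + 2 * pi).
Proof.
move=> mG per /andP[d0 d1]; rewrite arc_measure_shift//.
rewrite (@arc_measureD _ mG _ (a + 2 * pi)); [|lra|lra].
rewrite [RHS](@arc_measureD _ mG _ (a + d)); [|lra|lra].
rewrite addeC; congr (_ + _)%E.
have -> : a + 2 * pi + d = a + d + 2 * pi by ring.
rewrite -arc_measure_shift//; congr arc_measure.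
by apply/seteqP; split=> s /=; have := per s; tauto.
Qed.

(** Rotation around the x-axis that increases the longitude by [t]. *)
Definition roll t q : space :=
  (q.1.1, cos t * q.1.2 + sin t * q.2, cos t * q.2 - sin t * q.1.2).

Lemma roll_pt t x s : roll t (pt Spherical (x, s)) = pt Spherical (x, s + t).
Proof. by rewrite /roll /pt /= sinD cosD; coords. Qed.

Lemma surface_roll t q : surface Spherical (roll t q) <-> surface Spherical q.
Proof.
have e : cos t ^+ 2 = 1 - sin t ^+ 2 by have := cos2Dsin2 t; lra.
rewrite /surface /=; have -> : 1 * (q.1.1 ^+ 2 + (cos t * q.1.2 + sin t * q.2) ^+ 2) +
    (cos t * q.2 - sin t * q.1.2) ^+ 2 = 1 * (q.1.1 ^+ 2 + q.1.2 ^+ 2) + q.2 ^+ 2 by ring: e.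
by split=> -[-> _].
Qed.

Lemma near3_roll t e p q : near3 e p q -> near3 (2 * e) (roll t p) (roll t q).
Proof.
have H (a b u v : R) : `|a| <= 1 -> `|b| <= 1 -> `|u| < e -> `|v| < e -> `|a * u + b * v| < 2 * e.
  move=> a1 b1 ue ve; apply: le_lt_trans (ler_normD _ _) _; rewrite !normrM.
  by have := normr_ge0 u; have := normr_ge0 v; nra.
have c1 : `|cos t| <= 1 by rewrite ler_norml cos_geN1 cos_le1.
have s1 : `|sin t| <= 1 by rewrite ler_norml sin_geN1 sin_le1.
move=> [h1 h2 h3]; split=> /=.
- by have := normr_ge0 (p.1.1 - q.1.1); lra.
- have -> : cos t * p.1.2 + sin t * p.2 - (cos t * q.1.2 + sin t * q.2) =
    cos t * (p.1.2 - q.1.2) + sin t * (p.2 - q.2) by ring.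
  exact: H.
- have -> : cos t * p.2 - sin t * p.1.2 - (cos t * q.2 - sin t * q.1.2) =
    cos t * (p.2 - q.2) + (- sin t) * (p.1.2 - q.1.2) by ring.
  by apply: H; rewrite ?normrN.
Qed.

Lemma relclosed_roll t F : relclosed Spherical F ->
  relclosed Spherical (roll t @^-1` F).
Proof.
move=> cF q sq nF; have [|e e0 h] := cF (roll t q) _ nF; first exact/surface_roll.
exists (e / 2); first by rewrite divr_gt0.
move=> q' sq' /(near3_roll t); rewrite mulrC divfK ?pnatr_eq0// => nq'.
by apply: h => //; exact/surface_roll.
Qed.

Lemma measurable_circle F x : relclosed Spherical F -> x ^+ 2 < 1 ->
  measurable ([set s | F (pt Spherical (x, s))] : set rT).
Proof.
move=> cF hx; pose E : set (rT * rT) := setT `&` (fun w => pt Spherical (x, w.2)) @^-1` F.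
have mE : measurable E.
  apply: (measurable_pullback cF); first exact: openT.
    move=> w; apply: (@continuous_comp _ _ _ (fun w : R * R => (x, w.2)) (pt Spherical)).
      exact: (cvg_pair (cvg_cst x) (@continuous_snd2 w)).
    exact: continuous_pt.
  by move=> w _; apply: pt_surface => //=; rewrite mul1r.
rewrite (_ : [set s | _] = xsection E 0); first exact: measurable_xsection.
by apply/seteqP; split=> s /=; rewrite /xsection /= inE; [split|case].
Qed.

Lemma slice_circle F x : relclosed Spherical F -> x ^+ 2 < 1 ->
  (mu [set s | slab Spherical (x, s) /\ F (pt Spherical (x, s))] +
   mu [set s | slab Spherical (x, s) /\ F (flip (pt Spherical (x, s)))])%E =
  arc_measure [set s | F (pt Spherical (x, s))] (- (pi / 2)) (- (pi / 2) + 2 * pi).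
Proof.
move=> cF hx; set G : set rT := [set s | _ (pt _ (x, s))].
have mG : measurable G by exact: measurable_circle.
have pi0 := @pi_gt0 R.
have hs s : slab Spherical (x, s) <-> - (pi / 2) < s < pi / 2.
  by rewrite /slab /= mul1r; split=> [[_ h]|h]; [exact: h|split].
rewrite (_ : [set s | _ /\ F (pt _ _)] = G `&` `]- (pi / 2), pi / 2[); last first.
  by apply/seteqP; split=> s /=; rewrite in_itv/=; [move=> [/hs ? ?]|move=> [? /hs ?]]; split.
rewrite (_ : [set s | _ /\ F (flip _)] =
    (fun s => pi - s) @^-1` (G `&` `]pi / 2, - (pi / 2) + 2 * pi[)); last first.
  (* The lower graph covers the other half of the circle: [flip] mirrors the longitude [s] into
     [pi - s]. *)
  have fl s : flip (pt Spherical (x, s)) = pt Spherical (x, pi - s).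
    by rewrite /flip /pt /= sinB cosB sinpi cospi; coords.
  apply/seteqP; split=> s /=; rewrite in_itv/= fl; [move=> [/hs /andP[h1 h2] ?]|move=> [? /andP[h1 h2]]]; split=> //.
    by between.
  by apply/hs; between.
rewrite lebesgue_mirror; last by apply: measurableI => //; exact: measurable_itv.
by rewrite !arc_measure_open// -arc_measureD//; lra.
Qed.

(** The rotation shifts the longitude on every circle of constant x, and the measure of a periodic
    set over a full period does not change under a shift. *)
Lemma area_roll t F : relclosed Spherical F -> F `<=` surface Spherical ->
  0 <= t <= 2 * pi -> area Spherical (roll t @^-1` F) = area Spherical F.
Proof.
move=> cF Fs ht; have cF' := @relclosed_roll t _ cF.
have Fs' : roll t @^-1` F `<=` surface Spherical by move=> q /Fs/surface_roll.
rewrite (area_slices cF Fs).2 (area_slices cF' Fs').2; apply: eq_integral => x _.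
have [hx|hx] := ltP (x ^+ 2) 1; last first.
  have E (H : R -> Prop) : [set s | slab Spherical (x, s) /\ H s] = set0.
    by apply/seteqP; split=> // s [[/= h _] _]; lra.
  by rewrite !E !measure0.
rewrite !slice_circle// -[RHS](circle_shift _ (measurable_circle cF hx) _ ht).
  by congr arc_measure; apply/seteqP; split=> s /=; rewrite roll_pt.
move=> s; rewrite /= (_ : pt Spherical (x, s + 2 * pi) = pt Spherical (x, s))//.
have -> : s + 2 * pi = s + pi *+ 2 by rewrite mulr_natl.
by rewrite /pt /= sinD2pi cosD2pi.
Qed.

(** * Slices by meridians *)

Definition meridian_slice k F s : set rT :=
  [set x | slab k (x, s) /\ F (pt k (x, s))].

Lemma measurable_slab k F : relclosed k F ->
  measurable ([set w | slab k w /\ F (pt k w)] : set (rT * rT)).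
Proof.
move=> cF; apply: (measurable_pullback cF (@open_slab k) (@continuous_pt k)).
by move=> w [/= h1 h2]; exact: pt_surface.
Qed.

Lemma measurable_meridian_slice k F s : relclosed k F ->
  measurable (meridian_slice k F s).
Proof.
move=> cF; have mE := measurable_slab cF.
rewrite (_ : meridian_slice k F s = ysection [set w | slab k w /\ F (pt k w)] s).
  exact: measurable_ysection.
by apply/seteqP; split=> x /=; rewrite /ysection /= inE.
Qed.

Lemma area_meridians k F : relclosed k F -> F `<=` surface k ->
  (forall q, F q -> 0 < q.2) -> area k F = (\int[mu]_s mu (meridian_slice k F s))%E.
Proof.
move=> cF Fs F0; have mE := measurable_slab cF.
set E : set (rT * rT) := [set w | _] in mE.
rewrite (area_slices cF Fs).2.
transitivity (\int[mu]_x \int[mu]_s (\1_E (x, s))%:E)%E.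
  apply: eq_integral => x _.
  rewrite [X in (_ + mu X)%E](_ : _ = set0) ?measure0 ?adde0; last first.
    apply/seteqP; split=> // s [[/= h1 h2] /F0] /=.
    by have := mulr_gt0 (cradius_gt0 h1) (gcos_gt0 h2); lra.
  have -> : [set s | slab k (x, s) /\ F (pt k (x, s))] = xsection E x.
    by apply/seteqP; split=> s /=; rewrite /xsection /= inE.
  rewrite -[in LHS](setIT (xsection E x)) -integral_indic//; last exact: measurable_xsection.
  by apply: eq_integral => s _; rewrite !indicE mem_xsection.
have -> : (\int[mu]_x \int[mu]_s (\1_E (x, s))%:E = \int[mu]_s \int[mu]_x (\1_E (x, s))%:E)%E.
  apply: (@fubini_tonelli _ _ _ _ _ mu mu (fun w => (\1_E w)%:E)).
    by apply/measurable_EFinP; exact: measurable_indic.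
  by move=> w; rewrite lee_fin.
apply: eq_integral => s _.
have -> : meridian_slice k F s = ysection E s.
  by apply/seteqP; split=> x /=; rewrite /ysection /= inE.
rewrite -[in RHS](setIT (ysection E s)) -integral_indic//; last exact: measurable_ysection.
by apply: eq_integral => x _; rewrite !indicE mem_ysection.
Qed.

Lemma measurable_meridians k F : relclosed k F ->
  measurable_fun setT (fun s => mu (meridian_slice k F s)).
Proof.
move=> cF; have := measurable_fun_ysection mu (measurable_slab cF).
rewrite (_ : mu \o _ = fun s => mu (meridian_slice k F s))//.
apply/funext => s /=; congr (mu _).
by apply/seteqP; split=> x /=; rewrite /ysection /= inE.
Qed.

(** Serves to tell the small region bounded by a curve of the upper half-sphere from the large
    one. *)
Lemma area_lower_hemisphere F : relclosed Spherical F -> F `<=` surface Spherical ->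
  (forall q, surface Spherical q -> q.2 < 0 -> F q) -> ((2 * pi)%:E <= area Spherical F)%E.
Proof.
move=> cF Fs Flow; have [mS ->] := area_slices cF Fs.
have mI : measurable (`]-1, 1[%classic : set rT) by exact: measurable_itv.
have muI : mu `]-1, 1[ = 2%:E.
  by rewrite lebesgue_measure_itv /= lte_fin ifT; [rewrite -EFinD; congr (_%:E); lra|lra].
apply: (@le_trans _ _ (\int[mu]_(x in `](-1)%R, 1%R[) (pi : R)%:E)%E).
  by rewrite integral_cst//= muI -EFinM lee_fin mulrC.
rewrite integral_mkcond; apply: ge0_le_integral => //.
- by move=> x _; rewrite /patch; case: ifP => _; rewrite ?lee_fin ?pi_ge0.
- by apply/(measurable_restrictT _ mI).
move=> x _; rewrite /patch; case: ifPn => [|_]; last by rewrite adde_ge0.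
rewrite inE /= in_itv/= => /andP[x1 x2].
apply: lee_paddl; first exact: measure_ge0.
have x12 : 1 * x ^+ 2 < 1 by nra.
rewrite (_ : [set s | _] = `]- (pi / 2), pi / 2[%classic); last first.
  apply/seteqP; split=> s /=; rewrite in_itv/=; first by move=> [[_ /(_ erefl)]].
  move=> hs; have sl : slab Spherical (x, s) by split.
  split=> //; apply: Flow; first by have [h _] := @pt_surface Spherical (x, s) x12 (fun=> sl.2); split=> //; rewrite /= sqrrN.
  by rewrite /flip /pt /= oppr_lt0; apply: mulr_gt0; [apply: cradius_gt0|apply: (@gcos_gt0 Spherical); case: sl].
have pi0 := @pi_gt0 R.
rewrite lebesgue_measure_itv /= lte_fin ifT; last by lra.
by rewrite -EFinD lee_fin; lra.
Qed.

Lemma common_radius n (Q : 'I_n -> R -> Prop) x :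
  (forall i, exists2 d, 0 < d & forall y : R, `|y - x| < d -> Q i y) ->
  exists2 d, 0 < d & forall y : R, `|y - x| < d -> forall i, Q i y.
Proof.
elim: n Q => [|m IH] Q h; first by exists 1 => // y _ [].
have [d1 d10 h1] := IH (fun i => Q (lift ord0 i)) (fun i => h (lift ord0 i)).
have [d2 d20 h2] := h ord0.
exists (Num.min d1 d2); first by rewrite lt_min d10.
by move=> y; rewrite lt_min => /andP[/h1 y1 /h2 y2] i; case: (unliftP ord0 i) => [j|] ->.
Qed.

Lemma finite_null n (X : 'I_n -> R) : mu.-negligible [set X i | i in setT].
Proof.
have fin : finite_set [set X i | i in setT] by apply: finite_image; exact: finite_finset.
exists [set X i | i in setT]; split=> //.
  rewrite (_ : [set X i | i in setT] = \bigcup_(i in setT) [set X i]); last first.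
    by apply/seteqP; split=> x [i _ /= h]; exists i.
  by apply: fin_bigcup_measurable => //; exact: finite_finset.
exact: countable_lebesgue_measure0 (finite_set_countable fin).
Qed.

(** * Measure of a set of reals from its jumps *)

Section JumpMeasure.
Variables (n : nat) (act : pred 'I_n) (X sg : 'I_n -> R) (g : rT -> Prop) (M : R).
Hypothesis sgP : forall i, act i -> sg i = 1 \/ sg i = -1.
Hypothesis Xinj : forall i j, act i -> act j -> X i = X j -> i = j.
Hypothesis gfar : forall x, M < `|x| -> ~ g x.
Hypothesis gflat : forall x, (forall i, act i -> X i <> x) ->
  exists2 d, 0 < d & forall y : R, `|y - x| < d -> (g y <-> g x).
Hypothesis gjump : forall i, act i -> exists2 d, 0 < d & forall y : R, `|y - X i| < d ->
  (y < X i -> (g y <-> sg i = 1)) /\ (X i < y -> (g y <-> sg i = -1)).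

Let step i x : R := (X i < x)%R%:R.
Let f x : R := `[< g x >]%:R + \sum_(i | act i) sg i * step i x.

Let step_near i x : X i <> x -> exists2 d, 0 < d & forall y : R, `|y - x| < d -> step i y = step i x.
Proof.
move=> Xx; exists `|X i - x|; first by rewrite normr_gt0 subr_eq0; apply/eqP.
move=> y; rewrite /step ltr_norml => /andP[h1 h2]; congr (nat_of_bool _)%:R.
have [Xl|xl] := ltP (X i) x.
  by move: h1; rewrite ltr0_norm ?subr_lt0// => h1; apply/idP; lra.
have {}xl : x < X i by rewrite lt_neqAle xl andbT; apply/eqP => e; exact: Xx.
by move: h2; rewrite gtr0_norm ?subr_gt0// => h2; apply/negbTE; rewrite -leNgt; lra.
Qed.

Let fgood x : (forall i, act i -> X i <> x) ->
  exists2 d, 0 < d & forall y : R, `|y - x| < d -> f y = f x.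
Proof.
move=> nX; have [d1 d10 h1] := gflat nX.
have [d2 d20 h2] := @common_radius n (fun i y => act i -> step i y = step i x) x
  ltac:(move=> i /=; case: (boolP (act i)) => [/nX/step_near[d d0 h]|_]; [by exists d => // y /h|by exists 1; rewrite ?ltr01]).
exists (Num.min d1 d2); first by rewrite lt_min d10.
move=> y; rewrite lt_min => /andP[/h1 gy /h2 sy]; rewrite /f; congr (_ + _).
  by congr (nat_of_bool _)%:R; apply/asboolP/asboolP => /gy.
by apply: eq_bigr => i ai; rewrite sy.
Qed.

Let fpunct x : exists c, exists2 d, 0 < d & forall y : R, 0 < `|y - x| < d -> f y = c.
Proof.
case: (pselect (forall i, act i -> X i <> x)) => [/fgood[d d0 h]|].
  by exists (f x), d => // y /andP[_]; exact: h.
move=> /existsNP[j /not_implyP[aj /contrapT jx]]; subst x.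
have [d1 d10 h1] := gjump aj.
have [d2 d20 h2] := @common_radius n (fun i y => act i && (i != j) -> step i y = step i (X j)) (X j)
  ltac:(move=> i /=; case: (boolP (act i && (i != j))) => [/andP[ai ij]|_]; [|by exists 1; rewrite ?ltr01];
    have /step_near[d d0 h] : X i <> X j by [move=> /Xinj e; move: ij; rewrite e ?eqxx];
    by exists d => // y /h).
exists ((sg j == 1)%:R + \sum_(i | act i && (i != j)) sg i * step i (X j)).
exists (Num.min d1 d2); first by rewrite lt_min d10.
move=> y; rewrite lt_min => /and3P[yx /h1[hl hr] /h2 sy].
rewrite /f (bigD1 j)//= addrA; congr (_ + _); last by apply: eq_bigr => i /sy ->.
rewrite /step; have [yX|yX] := ltP y (X j).
  rewrite ltNge (ltW yX) mulr0 addr0; congr (nat_of_bool _)%:R.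
  by apply/asboolP/eqP => /(hl yX).
have {}yX : X j < y by rewrite lt_neqAle yX andbT eq_sym -subr_eq0 -normr_gt0.
rewrite yX mulr1; have := hr yX; have [-> gy|-> gy] := sgP aj.
  rewrite eqxx asboolF ?add0r// => /gy; lra.
rewrite asboolT; last exact/gy.
by rewrite (_ : -1 == 1 :> R = false) ?subrr//; apply/eqP; lra.
Qed.

Let fzero x : (forall i, act i -> X i <> x) -> f x = 0.
Proof.
(* Punctured neighbourhoods, because the value of [f] at a jump point itself is not controlled. *)
pose P y := exists2 d, 0 < d & forall z, 0 < `|z - y| < d -> f z = 0.
suff Pall : P x.
  move=> /fgood[d d0 hd]; have [d' d'0 hd'] := Pall.
  pose m := Num.min d d' / 2; have m0 : 0 < m by rewrite divr_gt0// lt_min d0.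
  have m1 : m < d by rewrite ltr_pdivrMr// gt_min; apply/orP; left; lra.
  have m2 : m < d' by rewrite ltr_pdivrMr// gt_min; apply/orP; right; lra.
  have e : `|x + m - x| = m by rewrite addrC addKr gtr0_norm.
  by rewrite -(hd (x + m)) ?e// hd' ?e// m0.
have [B hB] : exists B, forall i, B < X i.
  exists (- \sum_i `|X i| - 1) => i; have : `|X i| <= \sum_i `|X i|.
    by rewrite (bigD1 i)//= lerDl sumr_ge0.
  by have := ler_norm (- X i); rewrite normrN; lra.
(* A point to the left of all jumps and of [- M], where [f] is visibly zero. *)
pose a := Num.min (Num.min B (- M)) x - 1.
have mx : Num.min (Num.min B (- M)) x <= x by rewrite ge_min lexx orbT.
have ax : a <= x by rewrite /a; lra.
have aM z : `|z - a| < 1 -> f z = 0.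
  rewrite ltr_norml => /andP[_ h].
  have zm : z < Num.min (Num.min B (- M)) x by move: h; rewrite /a; lra.
  move: zm; rewrite !lt_min => /andP[/andP[zB zM] _].
  rewrite /f asboolF ?add0r; last by apply: gfar; have := ler_norm (- z); rewrite normrN; lra.
  by apply: big1 => i _; rewrite /step ltNge (ltW (lt_trans zB (hB i))) mulr0.
have Pa : P a by exists 1 => // z /andP[_]; exact: aM.
apply: (@segment_locally_constant P a x ax _).1 => // t _.
have [c [d d0 hd]] := fpunct t.
have key s : `|t - s| < d -> (P s <-> c = 0).
  move=> ts; split=> [[d' d'0 h']|c0].
    pose e := Num.min d' (d - `|t - s|) / 2.
    have e0 : 0 < e by rewrite divr_gt0// lt_min d'0 subr_gt0.
    have e1 : e < d' by rewrite ltr_pdivrMr// gt_min; apply/orP; left; lra.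
    have e2 : e < d - `|t - s| by rewrite ltr_pdivrMr// gt_min; apply/orP; right; lra.
    have [st|st] := leP t s.
      move: (ts) e2; rewrite ler0_norm ?subr_le0// => ts' e2.
      rewrite -(hd (s + e)); last by rewrite gtr0_norm; lra.
      by apply: h'; rewrite gtr0_norm; lra.
    move: (ts) e2; rewrite gtr0_norm ?subr_gt0// => ts' e2.
    rewrite -(hd (s - e)); last by rewrite ltr0_norm; lra.
    by apply: h'; rewrite ltr0_norm; lra.
  have [->|/eqP nst] := pselect (s = t).
    by exists d => // z /hd ->.
  have p : 0 < `|t - s| by rewrite normr_gt0 subr_eq0 eq_sym.
  exists (Num.min `|t - s| (d - `|t - s|)); first by rewrite lt_min p subr_gt0.
  move=> z; rewrite lt_min => /and3P[_ z1 z2]; rewrite hd//; apply/andP; split.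
    rewrite normr_gt0 subr_eq0; apply/eqP => zt; move: z1; rewrite zt; lra.
  by have := ler_distD s z t; rewrite (distrC s t); lra.
exists d => // s _ ts; rewrite key// key// subrr normr0//.
Qed.

Let step_integral a b c (i : 'I_n) : a < X i -> X i < b ->
  mu.-integrable `]a, b] (fun x => (c * step i x)%:E) /\
  (\int[mu]_(x in `]a, b]) (c * step i x)%:E = (c * (b - X i))%:E)%E.
Proof.
move=> aX Xb; have mI : measurable (`]a, b]%classic : set rT) by exact: measurable_itv.
have mJ : measurable (`]X i, b]%classic : set rT) by exact: measurable_itv.
have E x : x \in `]a, b]%classic -> (c * step i x)%:E = (c%:E * (\1_(`]X i, b]%classic : set rT) x)%:E)%E.
  rewrite inE /= in_itv/= => /andP[_ xb]; rewrite -EFinM indicE /step; congr (_ * (nat_of_bool _)%:R)%:E.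
  by apply/idP/idP; rewrite inE /= in_itv/= xb andbT.
have muJ : mu `]X i, b] = (b - X i)%:E by rewrite lebesgue_measure_itv /= lte_fin Xb -EFinD.
have IJ : `]X i, b] `&` `]a, b] = `]X i, b]%classic.
  apply/seteqP; split=> x /=; rewrite !in_itv/=; first by case.
  by move=> /andP[h1 h2]; rewrite h1 h2 (lt_trans aX h1).
have iJ : mu.-integrable `]a, b] (fun x => (\1_(`]X i, b]%classic : set rT) x)%:E).
  apply/integrableP; split; first by apply/measurable_EFinP; exact: measurable_indic.
  under eq_integral do rewrite gee0_abs ?lee_fin//.
  by rewrite integral_indic//= IJ muJ ltry.
split.
  apply: (eq_integrable mI (fun x => (c%:E * (\1_(`]X i, b]%classic : set rT) x)%:E)%E)).
    by move=> x /E.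
  exact: integrableZl.
transitivity (\int[mu]_(x in `]a, b]) (c%:E * (\1_(`]X i, b]%classic : set rT) x)%:E))%E.
  by apply: eq_integral => x /E.
rewrite integralZl// integral_indic//=.
by rewrite IJ muJ -EFinM.
Qed.

(** The indicator of [g] plus the signed steps has no jumps and vanishes on the far left, so it is
    zero off the jump points. Integration over a large interval gives the measure; the signs add up
    to zero because the set is empty on the far right as well, and the bound [B] drops out. *)
Lemma jump_measure : measurable [set x | g x] ->
  mu [set x | g x] = (\sum_(i | act i) sg i * X i)%:E.
Proof.
move=> mg; set G : set rT := [set x | g x] in mg *; pose B := \sum_i `|X i| + `|M| + 1.
have XB i : - B < X i < B.
  rewrite -ltr_norml /B (bigD1 i)//=.
  have : 0 <= \sum_(j | j != i) `|X j| by rewrite sumr_ge0.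
  by have := normr_ge0 M; lra.
have MB : M < B.
  have : 0 <= \sum_i `|X i| by rewrite sumr_ge0.
  by have := ler_norm M; rewrite /B; lra.
have s0 : \sum_(i | act i) sg i = 0.
  have : f B = 0 by apply: fzero => i _ e; have := XB i; rewrite e ltxx andbF.
  rewrite /f asboolF ?add0r; last by apply: gfar; apply: lt_le_trans MB (ler_norm _).
  under eq_bigr => i _ do [have /andP[_ XiB] := XB i; rewrite /step XiB mulr1]; by [].
have mI : measurable (`]- B, B]%classic : set rT) by exact: measurable_itv.
have gB : G `<=` `]- B, B].
  move=> x gx; rewrite /= in_itv/=; have : `|x| <= M by rewrite leNgt; apply/negP => /gfar.
  by rewrite ler_norml => /andP[h1 h2]; between.
have -> : mu G = (\int[mu]_(x in `](- B)%R, B]) (\1_G x)%:E)%E.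
  by rewrite integral_indic// setIidl.
have mf : measurable_fun (`]- B, B]%classic : set rT)
    (fun x => (\sum_(i | act i) (- sg i * step i x)%:E)%E).
  apply: (measurable_int mu); apply: integrable_sum => // i _; have /andP[h1 h2] := XB i.
  by have [] := step_integral (- sg i) h1 h2.
transitivity (\int[mu]_(x in `](- B)%R, B]) (\sum_(i | act i) (- sg i * step i x)%:E))%E.
  apply: ae_eq_integral => //.
    by apply/measurable_EFinP; exact: measurable_indic.
  have [N [mN N0 hN]] := finite_null X; exists N; split=> // x /= h; apply: hN => /=.
  apply: contrapT => nx; apply: h => _.
  have : f x = 0 by apply: fzero => i _ e; apply: nx; exists i.
  rewrite /f => e; rewrite sumEFin; congr (_%:E).
  under eq_bigr do rewrite mulNr; rewrite sumrN indicE.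
  move: e; have -> : `[< g x >] = (x \in G) by apply/asboolP/idP; rewrite inE.
  lra.
rewrite integral_sum//; last first.
  by move=> i; have /andP[h1 h2] := XB i; have [] := step_integral (- sg i) h1 h2.
rewrite (eq_bigr (fun i => (- sg i * (B - X i))%:E)); last first.
  by move=> i ai; have /andP[h1 h2] := XB i; have [] := step_integral (- sg i) h1 h2.
rewrite sumEFin; congr (_%:E).
under eq_bigr do rewrite mulrBr mulNr [- sg _ * _]mulNr opprK.
by rewrite big_split/= sumrN -mulr_suml s0 mul0r oppr0 add0r.
Qed.

End JumpMeasure.

(* Twice the angle whose tangent is the quotient: the signed area of the
   triangle with vertices (0, 0, 1), p and q. *)
Definition tri k p q : R :=
  2 * gatan k ((p.1.1 * q.1.2 - p.1.2 * q.1.1) / (1 + p.2 + q.2 + bil k p q)).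

(** * A primitive of the abscissa along a side *)

(** Signed area of the right triangle formed by the pole, [q] and the foot of the perpendicular from
    [q] to the line x = 0. Its differential is x times that of the longitude, minus the form of the
    area swept from the pole. *)
Definition wedge k q : R := 2 * gatan k
  (q.1.1 * q.1.2 / ((1 + cradius k q.1.1) * (cradius k q.1.1 + q.2))).

Lemma tri_den_gt0 k p q : surface k p -> surface k q -> 0 < p.2 -> 0 < q.2 ->
  0 < 1 + p.2 + q.2 + bil k p q.
Proof.
case: k => hp hq p0 q0.
- by have := hyperbolic_bil_ge1 hp hq; lra.
- by rewrite /bil /= mul0r add0r; have := mulr_gt0 p0 q0; lra.
- by have /andP[] := spherical_bil_geN1 hp hq; lra.
Qed.

(** The left side is the denominator in the derivative of [gatan] at the quotient of [tri]; the
    product form makes it simplify. *)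
Lemma tri_id k p q : surface k p -> surface k q ->
  (1 + p.2 + q.2 + bil k p q) ^+ 2 + (K k * (p.1.1 * q.1.2 - p.1.2 * q.1.1)) ^+ 2 =
  2 * (1 + p.2) * (1 + q.2) * (1 + bil k p q).
Proof.
move=> [hp hp'] [hq hq']; rewrite /bil; move: hp hq.
case: k hp' hq' => /= hp' hq' hp hq.
- have e1 : p.2 ^+ 2 = 1 + p.1.1 ^+ 2 + p.1.2 ^+ 2 by lra.
  have e2 : q.2 ^+ 2 = 1 + q.1.1 ^+ 2 + q.1.2 ^+ 2 by lra.
  by ring: e1 e2.
- have -> : p.2 = 1 by have := hp' ltac:(by []); nra.
  have -> : q.2 = 1 by have := hq' ltac:(by []); nra.
  ring.
- have e1 : p.2 ^+ 2 = 1 - p.1.1 ^+ 2 - p.1.2 ^+ 2 by lra.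
  have e2 : q.2 ^+ 2 = 1 - q.1.1 ^+ 2 - q.1.2 ^+ 2 by lra.
  by ring: e1 e2.
Qed.

Lemma der_gatan_div k (N D : R -> R) s dN dD : D s != 0 -> has_der N s dN -> has_der D s dD ->
  has_der (fun t => 2 * gatan k (N t / D t)) s
    (2 * (dN * D s - N s * dD) / (D s ^+ 2 + (K k * N s) ^+ 2)).
Proof.
move=> D0 hN hD; apply: der_eq.
  apply: derM; first exact: der_cst.
  apply: (@der_comp (gatan k) (fun t => N t / D t)); first exact: der_gatan.
  by apply: derM; [exact: hN|apply: derV; [exact: D0|exact: hD]].
rewrite /= mul0r add0r.
have D2 : 0 < D s ^+ 2 by rewrite exprn_even_gt0.
have p1 : D s ^+ 2 + (K k * N s) ^+ 2 != 0 by rewrite gt_eqF// ltr_wpDr// sqr_ge0.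
have -> : 1 + (K k * (N s / D s)) ^+ 2 = (D s ^+ 2 + (K k * N s) ^+ 2) / D s ^+ 2.
  by field.
by field; rewrite D0 p1.
Qed.

(* [a v + b v'] runs along the geodesic through v and v'. *)
Lemma der_tri k v v' (a b : R -> R) s da db :
  let ga t := lin (a t) v (b t) v' in let dga := lin da v db v' in
  surface k v -> 0 < v.2 -> surface k v' -> surface k (ga s) -> 0 < (ga s).2 ->
  has_der a s da -> has_der b s db ->
  a s * da + b s * db + bil k v v' * (a s * db + da * b s) = 0 ->
  has_der (fun t => tri k v (ga t)) s
    (((ga s).1.1 * dga.1.2 - (ga s).1.2 * dga.1.1) / (1 + (ga s).2)).
Proof.
move=> ga dga hv v0 hv' hg g0 ha hb r2.
have bvv := surface_bil hv; have bvv' := surface_bil hv'.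
have r1 : a s ^+ 2 + b s ^+ 2 + 2 * bil k v v' * (a s * b s) = 1.
  have e := surface_bil hg; rewrite /ga !bil_lin bvv bvv' (bilC k v' v) in e.
  by rewrite -[RHS]e; ring.
have D0 := tri_den_gt0 hv hg v0 g0.
have idD := tri_id hv hg.
rewrite /tri; apply: der_eq.
  apply: (@der_gatan_div k (fun t => v.1.1 * (ga t).1.2 - v.1.2 * (ga t).1.1)
    (fun t => 1 + v.2 + (ga t).2 + bil k v (ga t)) s
    (db * (v.1.1 * v'.1.2 - v.1.2 * v'.1.1)) (da * v.2 + db * v'.2 + (da + db * bil k v v'))).
  - by rewrite gt_eqF.
  - have := der_comb ha hb 0 (v.1.1 * v'.1.2 - v.1.2 * v'.1.1).
    rewrite mulr0 add0r (_ : (fun t => _) = fun t => v.1.1 * (ga t).1.2 - v.1.2 * (ga t).1.1)//.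
    by apply/funext => t; rewrite /ga /=; ring.
  - have := der_comb ha hb (v.2 + 1) (v'.2 + bil k v v') => h.
    apply: der_eq.
      rewrite (_ : (fun t => _) = fun t => (1 + v.2) + (a t * (v.2 + 1) + b t * (v'.2 + bil k v v'))).
        by apply: derD; [exact: der_cst|exact: h].
      by apply/funext => t; rewrite /ga bil_linr bvv /=; ring.
    by ring.
rewrite /= idD.
set be := bil k v v' in r1 r2 *; set w := v.1.1 * v'.1.2 - v.1.2 * v'.1.1.
have BE : bil k v (ga s) = a s + b s * be by rewrite /ga bil_linr bvv mulr1.
have B1 : 0 < 1 + bil k v (ga s).
  have : 0 < 2 * (1 + v.2) * (1 + (ga s).2) * (1 + bil k v (ga s)).
    by rewrite -idD ltr_pwDl ?sqr_ge0// exprn_gt0.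
  rewrite pmulr_rgt0// !mulr_gt0//; lra.
have e1 : db * w * (1 + v.2 + (ga s).2 + bil k v (ga s)) -
    (v.1.1 * (ga s).1.2 - v.1.2 * (ga s).1.1) * (da * v.2 + db * v'.2 + (da + db * be)) =
    w * (1 + v.2) * (db * (1 + a s) - b s * da).
  by rewrite BE /w /ga /=; ring.
have e2 : (a s * db - b s * da) * (1 + bil k v (ga s)) - (db * (1 + a s) - b s * da) =
    db * (a s ^+ 2 + b s ^+ 2 + 2 * be * (a s * b s) - 1) -
    b s * (a s * da + b s * db + be * (a s * db + da * b s)).
  by rewrite BE; ring.
rewrite r1 r2 subrr !mulr0 subr0 in e2.
have e3 : (ga s).1.1 * dga.1.2 - (ga s).1.2 * dga.1.1 = w * (a s * db - b s * da).
  by rewrite /w /ga /dga /=; ring.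
have F (V Z B c u : R) : 0 < V -> 0 < Z -> 0 < 1 + B ->
    2 * (u * (1 + V) * (c * (1 + B))) / (2 * (1 + V) * (1 + Z) * (1 + B)) = u * c / (1 + Z).
  by move=> V0 Z0 B0; field; rewrite !gt_eqF//; lra.
rewrite -[(_ * _ - _ * (da * v.1.1 + _))]/((ga s).1.1 * dga.1.2 - (ga s).1.2 * dga.1.1).
rewrite e3 -[X in 2 * X]/(db * w * (1 + v.2 + (ga s).2 + bil k v (ga s)) -
    (v.1.1 * (ga s).1.2 - v.1.2 * (ga s).1.1) * (da * v.2 + db * v'.2 + (da + db * be))).
by rewrite e1 -(subr0_eq e2); exact: F.
Qed.

Lemma der_wedge k (x y z : R -> R) s dx dy dz :
  has_der x s dx -> has_der y s dy -> has_der z s dz ->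
  surface k (x s, y s, z s) -> 0 < z s -> K k * x s ^+ 2 < 1 ->
  K k * (x s * dx + y s * dy) + z s * dz = 0 ->
  has_der (fun t => wedge k (x t, y t, z t)) s
    (x s * (z s * dy - y s * dz) / cradius k (x s) ^+ 2 -
     (x s * dy - y s * dx) / (1 + z s)).
Proof.
move=> hx hy hz [/= hs _] z0 x1 ht.
have c0 := cradius_gt0 x1; have c2 := cradius_sqr x1.
set c := cradius k (x s) in c0 c2 *.
have hc : has_der (fun t => cradius k (x t)) s (- K k * x s * dx / c).
  apply: der_eq.
    apply: (@der_sqrt (fun t => 1 - K k * x t ^+ 2)); first by lra.
    by apply: derB; [exact: der_cst|apply: derM; [exact: der_cst|exact: derX2 hx]].
  by rewrite /= -/(cradius k (x s)) -/c; field; rewrite gt_eqF.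
set dc := _ / c in hc.
rewrite /wedge /=; apply: der_eq.
  apply: (@der_gatan_div k (fun t => x t * y t)
    (fun t => (1 + cradius k (x t)) * (cradius k (x t) + z t)) s).
  - by rewrite /= -/c gt_eqF// mulr_gt0//; lra.
  - exact: derM hx hy.
  - by apply: derM; apply: derD; [exact: der_cst|exact: hc|exact: hc|exact: hz].
rewrite /= -/c add0r.
have dcE : c * dc = - K k * x s * dx by rewrite /dc; field; rewrite gt_eqF.
move: (x s) (y s) (z s) hs z0 x1 ht c0 c2 dc dcE {hc hx hy hz} => X Y Z hs z0 x1 ht c0 c2 dc dcE.
have ky : K k * Y ^+ 2 = c ^+ 2 - Z ^+ 2 by rewrite c2; lra.
have kx : K k * X ^+ 2 = 1 - c ^+ 2 by rewrite c2; ring.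
have DE : ((1 + c) * (c + Z)) ^+ 2 + (K k * (X * Y)) ^+ 2 = 2 * c * (1 + Z) * (1 + c) * (c + Z).
  have -> : (K k * (X * Y)) ^+ 2 = (K k * X ^+ 2) * (K k * Y ^+ 2) by ring.
  by rewrite kx ky; ring.
rewrite DE.
have key : c * ((dx * Y + X * dy) * ((1 + c) * (c + Z)) - X * Y * (dc * (c + Z) + (1 + c) * (dc + dz))) =
    (X * (Z * dy - Y * dz) * (1 + Z) - c ^+ 2 * (X * dy - Y * dx)) * ((1 + c) * (c + Z)).
  apply: (mulfI (lt0r_neq0 z0)); apply/eqP; rewrite -subr_eq0; apply/eqP.
  (* [A], [B], [C] are cofactors: they write the difference, multiplied by [Z], as a combination of
     the relations between [X], [Y], [Z], [c] and their differentials. *)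
  pose A := dx * Y * (Z * (1 + 2 * c + Z) + (1 + c) * c - (1 + Z) * (1 + c) * (c + Z)).
  pose B := dy * X * ((1 + c) * c - (1 + Z) * (1 + c) * (c + Z)).
  pose C := X * Y * ((1 + Z) * (1 + c) * (c + Z) - (1 + c) * c).
  transitivity (A * (K k * X ^+ 2 - (1 - c ^+ 2)) + B * (K k * Y ^+ 2 - (c ^+ 2 - Z ^+ 2)) +
    C * (K k * (X * dx + Y * dy) + Z * dz) - X * Y * Z * (c + Z + (1 + c)) * (c * dc - (- K k * X * dx))).
    by rewrite /A /B /C; ring.
  by rewrite kx ky ht dcE !subrr !mulr0 !addr0 subr0.
have -> : forall u : R, 2 * u / (2 * c * (1 + Z) * (1 + c) * (c + Z)) =
    c * u / (c ^+ 2 * (1 + Z) * ((1 + c) * (c + Z))).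
  by move=> u; field; rewrite !gt_eqF//; lra.
rewrite key; field.
by rewrite !gt_eqF//; lra.
Qed.

Definition upper k q := surface k q /\ 0 < q.2.

Lemma upper_cradius k q : upper k q -> K k * q.1.1 ^+ 2 < 1 /\
  cradius k q.1.1 ^+ 2 = K k * q.1.2 ^+ 2 + q.2 ^+ 2.
Proof.
move=> [[hq hq'] q0].
have h : K k * q.1.1 ^+ 2 < 1.
  have z2 : 0 < q.2 ^+ 2 by rewrite exprn_gt0.
  by have := sqr_ge0 q.1.1; have := sqr_ge0 q.1.2; move: hq; clear hq'; case: k => /=; lra.
by split=> //; rewrite cradius_sqr//; lra.
Qed.

Lemma upper_bilN1 k p q : upper k p -> upper k q -> -1 < bil k p q.
Proof.
move=> [hp p0] [hq q0]; case: k hp hq => hp hq.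
- by have := hyperbolic_bil_ge1 hp hq; lra.
- by rewrite /bil /= mul0r add0r; have := mulr_gt0 p0 q0; lra.
- have /andP[h _] := spherical_bil_geN1 hp hq; rewrite lt_neqAle h andbT; apply/eqP => e.
  by have := spherical_antipode hp hq (esym e) => qp; move: q0; rewrite qp /= oppr_gt0; lra.
Qed.

Lemma upper_nrm k v v' a b : upper k v -> upper k v' -> 0 <= a -> 0 <= b -> 0 < a + b ->
  let q := lin a v b v' in
  [/\ 0 < bil k q q, bil k q q = a ^+ 2 + b ^+ 2 + 2 * bil k v v' * (a * b),
      0 < q.2 & upper k (nrm k q)].
Proof.
move=> hv hv' a0 b0 ab q; have B1 := upper_bilN1 hv hv'.
have E : bil k q q = a ^+ 2 + b ^+ 2 + 2 * bil k v v' * (a * b).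
  by rewrite /q !bil_lin (surface_bil hv.1) (surface_bil hv'.1) (bilC k v' v); ring.
have q0 : 0 < bil k q q.
  rewrite E; have -> : a ^+ 2 + b ^+ 2 + 2 * bil k v v' * (a * b) =
    (a - b) ^+ 2 + 2 * (1 + bil k v v') * (a * b) by ring.
  have h : 0 <= 2 * (1 + bil k v v') * (a * b) by rewrite !mulr_ge0//; lra.
  have [e|ne] := eqVneq a b.
    by rewrite ltr_wpDl ?sqr_ge0// !mulr_gt0//; lra.
  by rewrite ltr_pwDl// exprn_even_gt0//= subr_eq0.
have z0 : 0 < q.2.
  rewrite /q /=; have [v0 v'0] := (hv.2, hv'.2); move: a0; rewrite le_eqVlt => /predU1P[e|a0].
    by rewrite -e mul0r add0r mulr_gt0//; lra.
  by rewrite ltr_pwDl ?mulr_gt0// mulr_ge0// ltW.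
split=> //; split; first by apply: nrm_surface.
by rewrite /nrm /= mul0r addr0 mulr_gt0// invr_gt0 sqrtr_gt0.
Qed.

(** The area swept from the pole occurs with opposite signs in [tri] and [wedge]. What is left is
    the abscissa times the differential of the longitude, whose quotient form does not depend on the
    scale of [q], so it is stated before normalization. *)
Lemma der_edge k v v' (p r : R -> R) s dp dr :
  upper k v -> upper k v' -> has_der p s dp -> has_der r s dr ->
  0 <= p s -> 0 <= r s -> 0 < p s + r s ->
  let ga t := nrm k (lin (p t) v (r t) v') in
  let q := lin (p s) v (r s) v' in let dq := lin dp v dr v' in
  has_der (fun t => tri k v (ga t) + wedge k (ga t)) s
    ((ga s).1.1 * ((q.2 * dq.1.2 - q.1.2 * dq.2) / (K k * q.1.2 ^+ 2 + q.2 ^+ 2))) /\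
  {for s, continuous (fun t => (ga t).1.1)}.
Proof.
move=> hv hv' hp hr p0 r0 pr ga q dq.
have [Q0 QE q0 [gs g0]] := upper_nrm hv hv' p0 r0 pr; rewrite -/q in Q0 QE q0.
pose Q t := p t ^+ 2 + r t ^+ 2 + 2 * bil k v v' * (p t * r t).
pose dQ := 2 * p s * dp + 2 * r s * dr + 2 * bil k v v' * (dp * r s + p s * dr).
have bE t : bil k (lin (p t) v (r t) v') (lin (p t) v (r t) v') = Q t.
  by rewrite !bil_lin (surface_bil hv.1) (surface_bil hv'.1) (bilC k v' v) /Q; ring.
have hQ : has_der Q s dQ.
  apply: derD; first by apply: derD; exact: derX2.
  apply: der_eq; first by apply: derM; [exact: der_cst|apply: derM; [exact: hp|exact: hr]].
  by rewrite /= mul0r add0r.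
have Qs : 0 < Q s by rewrite -bE.
pose w := Num.sqrt (Q s); have w0 : 0 < w by rewrite sqrtr_gt0.
have w2 : w ^+ 2 = Q s by rewrite sqr_sqrtr// ltW.
have hw (f : R -> R) df : has_der f s df ->
    has_der (fun t => (Num.sqrt (Q t))^-1 * f t) s (df / w - f s * dQ / (2 * w ^+ 3)).
  move=> hf; apply: der_eq.
    by apply: derM; [apply: derV; [|apply: der_sqrt; [exact: Qs|exact: hQ]]; rewrite gt_eqF|exact: hf].
  by rewrite /= -/w; field; rewrite gt_eqF.
set da := dp / w - p s * dQ / (2 * w ^+ 3); set db := dr / w - r s * dQ / (2 * w ^+ 3).
have ha := hw _ _ hp; have hb := hw _ _ hr; rewrite -/da -/db in ha hb.
have gaE t : ga t = lin ((Num.sqrt (Q t))^-1 * p t) v ((Num.sqrt (Q t))^-1 * r t) v'.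
  by rewrite /ga /nrm bE; coords.
have gaF : ga = fun t => lin ((Num.sqrt (Q t))^-1 * p t) v ((Num.sqrt (Q t))^-1 * r t) v'.
  by apply/funext.
have rel : (w^-1 * p s) * da + (w^-1 * r s) * db + bil k v v' * ((w^-1 * p s) * db + da * (w^-1 * r s)) = 0.
  transitivity (dQ / (2 * w ^+ 2) * (1 - Q s / w ^+ 2)).
    by rewrite /da /db /dQ /Q; field; rewrite gt_eqF.
  by rewrite w2 divff ?gt_eqF// subrr mulr0.
pose dga := lin da v db v'.
have hx : has_der (fun t => (ga t).1.1) s dga.1.1 by rewrite gaF; exact: (der_comb ha hb).
have hy : has_der (fun t => (ga t).1.2) s dga.1.2 by rewrite gaF; exact: (der_comb ha hb).
have hz : has_der (fun t => (ga t).2) s dga.2 by rewrite gaF; exact: (der_comb ha hb).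
split; last exact: has_der_continuous hx.
have [x1 c2] := upper_cradius (conj gs g0).
have tang : K k * ((ga s).1.1 * dga.1.1 + (ga s).1.2 * dga.1.2) + (ga s).2 * dga.2 = 0.
  rewrite -[LHS]/(bil k (ga s) dga) gaE /dga -/w !bil_lin.
  by rewrite (surface_bil hv.1) (surface_bil hv'.1) (bilC k v' v) -[RHS]rel; ring.
have ht : has_der (fun t => tri k v (ga t)) s
    (((ga s).1.1 * dga.1.2 - (ga s).1.2 * dga.1.1) / (1 + (ga s).2)).
  have gs' := gs; have g0' := g0; rewrite -/(ga s) gaE in gs' g0'.
  have h := @der_tri k v v' (fun t => (Num.sqrt (Q t))^-1 * p t)
    (fun t => (Num.sqrt (Q t))^-1 * r t) s da db hv.1 hv.2 hv'.1 gs' g0' ha hb rel.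
  by rewrite gaF; exact: h.
have hW : has_der (fun t => wedge k (ga t)) s
    ((ga s).1.1 * ((ga s).2 * dga.1.2 - (ga s).1.2 * dga.2) / cradius k (ga s).1.1 ^+ 2 -
     ((ga s).1.1 * dga.1.2 - (ga s).1.2 * dga.1.1) / (1 + (ga s).2)).
  have hs : surface k ((ga s).1.1, (ga s).1.2, (ga s).2) by move: gs; rewrite -/(ga s); case: (ga s) => -[].
  have := der_wedge hx hy hz hs g0 x1 tang.
  by rewrite (_ : (fun t => wedge k ((ga t).1.1, (ga t).1.2, (ga t).2)) = fun t => wedge k (ga t)).
apply: der_eq; first by apply: derD; [exact: ht|exact: hW].
rewrite addrC subrK c2 -mulrA; congr (_ * _).
have e1 : (ga s).2 * dga.1.2 - (ga s).1.2 * dga.2 = (q.2 * dq.1.2 - q.1.2 * dq.2) / w ^+ 2.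
  by rewrite gaE /dga /q /dq -/w /= /da /db; field; rewrite gt_eqF.
have e2 : K k * (ga s).1.2 ^+ 2 + (ga s).2 ^+ 2 = (K k * q.1.2 ^+ 2 + q.2 ^+ 2) / w ^+ 2.
  by rewrite gaE /q -/w /=; field; rewrite gt_eqF.
have e3 : K k * q.1.2 ^+ 2 + q.2 ^+ 2 != 0.
  have : 0 < cradius k (ga s).1.1 ^+ 2 by rewrite exprn_gt0// cradius_gt0.
  by rewrite c2 e2 pmulr_lgt0 ?invr_gt0 ?exprn_gt0// => /gt_eqF ->.
by rewrite e1 e2; field; rewrite e3 gt_eqF.
Qed.

(** Linear in [q], zero on the meridian of longitude [s]; on upper points its sign compares their
    longitude with [s]. *)
Definition tilt k s q : R := q.1.2 * gcos k s - q.2 * gsin k s.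

Definition longitude k q : R := gasin k (q.1.2 / cradius k q.1.1).

Lemma pt_longitude k q : upper k q ->
  pt k (q.1.1, longitude k q) = q /\ longitudes k (longitude k q).
Proof.
move=> hq; have [x1 c2] := upper_cradius hq; have c0 := cradius_gt0 x1.
have q0 := hq.2; set c := cradius k q.1.1 in c0 c2.
have u : k = Spherical -> -1 < q.1.2 / c < 1.
  move=> e; rewrite ltr_pdivlMr// ltr_pdivrMr//; move: c2; rewrite e /=.
  by have : 0 < q.2 ^+ 2 by [rewrite exprn_gt0]; nra.
have u' : k = Spherical -> -1 <= q.1.2 / c <= 1 by move=> /u /andP[/ltW -> /ltW ->].
have hl : longitudes k (longitude k q) by exact: gasin_longitudes.
split=> //; have e1 : c * gsin k (longitude k q) = q.1.2.
  by rewrite /longitude -/c gasinK//; field; rewrite gt_eqF.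
apply: eq_space => //=; rewrite -/c ?e1//.
have g0 := mulr_gt0 c0 (gcos_gt0 hl).
apply/eqP; rewrite -(eqrXn2 (_ : 0 < 2)%N)//; [|exact: ltW|exact: ltW]; apply/eqP.
have g2 : gcos k (longitude k q) ^+ 2 = 1 - K k * gsin k (longitude k q) ^+ 2.
  by have := gcos2Dgsin2 k (longitude k q); lra.
by rewrite exprMn g2 mulrBr mulr1 mulrCA -exprMn e1 c2; ring.
Qed.

Lemma tilt_longitude k s q : upper k q ->
  tilt k s q = cradius k q.1.1 * gsin k (longitude k q - s).
Proof.
by move=> hq; rewrite /tilt -{1 2}(pt_longitude hq).1 /= gsinB; ring.
Qed.

Lemma gsin_diff k s t : longitudes k s -> longitudes k t ->
  ((0 < gsin k (s - t)) = (t < s)) * ((gsin k (s - t) < 0) = (s < t)).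
Proof.
have pos a b : longitudes k a -> longitudes k b -> a < b -> 0 < gsin k (b - a).
  move=> ha hb ab; rewrite gsin_gt0 ?subr_gt0// => e.
  by have := ha e; have := hb e; lra.
move=> hs ht; have [st|st|->] := ltgtP s t.
- have h := pos _ _ hs ht st; have e : gsin k (s - t) = - gsin k (t - s) by rewrite -gsinN opprB.
  by rewrite e oppr_gt0 oppr_lt0 h; split=> //; apply/negbTE; rewrite -leNgt ltW.
- have h := pos _ _ ht hs st; rewrite h; split=> //.
  by apply/negbTE; rewrite -leNgt ltW.
- by rewrite subrr gsin0 ltxx.
Qed.

Lemma tilt_sign k s q : upper k q -> longitudes k s ->
  ((0 < tilt k s q) = (s < longitude k q)) * ((tilt k s q < 0) = (longitude k q < s)).
Proof.
move=> hq hs; have c0 := cradius_gt0 (upper_cradius hq).1.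
rewrite tilt_longitude// pmulr_rgt0// pmulr_rlt0//.
by have := gsin_diff (pt_longitude hq).2 hs; case=> -> ->.
Qed.

Lemma tilt_longitude0 k q : upper k q -> tilt k (longitude k q) q = 0.
Proof. by move=> hq; rewrite tilt_longitude// subrr gsin0 mulr0. Qed.

(* The point where a rising side crosses the meridian of longitude [s]. *)
Definition crossing k v v' s : space := nrm k (lin (tilt k s v') v (- tilt k s v) v').

Lemma der_tilt k q s : has_der (fun t => tilt k t q) s (- K k * q.1.2 * gsin k s - q.2 * gcos k s).
Proof.
apply: der_eq.
  by apply: derB; apply: derM; [exact: der_cst|exact: der_gcos|exact: der_cst|exact: der_gsin].
by rewrite !mul0r !add0r; ring.
Qed.

Lemma nrm_scale k q c : surface k q -> 0 < c -> nrm k (lin c q 0 q) = q.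
Proof.
move=> hq c0; rewrite /nrm !bil_lin (surface_bil hq).
rewrite (_ : _ + _ = c ^+ 2); last by ring.
by rewrite sqrtr_sqr gtr0_norm//; apply: eq_space => /=; field; rewrite gt_eqF.
Qed.

Lemma tri_pp k p : tri k p p = 0.
Proof. by rewrite /tri [p.1.1 * _]mulrC subrr mul0r gatan0 mulr0. Qed.

Lemma triC k p q : tri k p q = - tri k q p.
Proof.
rewrite /tri -[RHS]mulrN -(gatanN k) (bilC k q); congr (2 * gatan k _).
by rewrite -[RHS]mulNr; congr (_ / _); ring.
Qed.

(** The side is parametrized by longitude, so [der_edge] makes [tri + wedge] a primitive of the
    abscissa of the crossing point. *)
Lemma edge_rise k v v' : upper k v -> upper k v' -> longitude k v < longitude k v' ->
  (forall s, longitude k v <= s <= longitude k v' ->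
    {for s, continuous (fun t => (crossing k v v' t).1.1)}) /\
  (\int[mu]_(s in `[longitude k v, longitude k v']) ((crossing k v v' s).1.1)%:E)%E =
  (tri k v v' + wedge k v' - wedge k v)%:E.
Proof.
move=> hv hv' ll; set l := longitude k v in ll *; set l' := longitude k v' in ll *.
have hl s : l <= s <= l' -> longitudes k s.
  move=> /andP[h1 h2] e; have [_ /(_ e)/andP[a1 _]] := pt_longitude hv.
  have [_ /(_ e)/andP[_ a2]] := pt_longitude hv'.
  by rewrite (lt_le_trans a1 h1) (le_lt_trans h2 a2).
have sg s : l <= s <= l' -> [/\ 0 <= tilt k s v', 0 <= - tilt k s v & 0 < tilt k s v' + - tilt k s v].
  move=> hs; have [e1 _] := tilt_sign hv' (hl _ hs); have [_ e2] := tilt_sign hv (hl _ hs).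
  have [e3 _] := tilt_sign hv (hl _ hs); have [_ e4] := tilt_sign hv' (hl _ hs).
  have a1 : 0 <= tilt k s v' by rewrite leNgt e4 -leNgt; case/andP: hs.
  have a2 : tilt k s v <= 0 by rewrite leNgt e3 -leNgt; case/andP: hs.
  split=> //; first by lra.
  have [h|h] := ltP s l'; first by move: h; rewrite -/l' -e1; lra.
  by have := lt_le_trans ll h; rewrite -e2; lra.
pose f s := (crossing k v v' s).1.1.
have main s : l <= s <= l' ->
    has_der (fun t => tri k v (crossing k v v' t) + wedge k (crossing k v v' t)) s (f s) /\
    {for s, continuous f}.
  move=> hs; have [a1 a2 a3] := sg _ hs.
  have [h1 h2] := der_edge hv hv' (der_tilt k v' s) (derN (der_tilt k v s)) a1 a2 a3.
  split; last exact: h2.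
  apply: der_eq; first exact: h1.
  rewrite -[RHS]mulr1; congr (_ * _).
  set q := lin (tilt k s v') v (- tilt k s v) v'.
  set dq := lin (_ - _) v _ v'.
  have [_ _ q0 _] := upper_nrm hv hv' a1 a2 a3; rewrite -/q in q0.
  have g0 := gcos_gt0 (hl _ hs).
  have qeta : q.1.2 * gcos k s = q.2 * gsin k s by rewrite /q /tilt /=; ring.
  have dqeta : dq.1.2 * gcos k s - dq.2 * gsin k s = K k * q.1.2 * gsin k s + q.2 * gcos k s.
    by rewrite /dq /q /tilt /=; ring.
  pose m := q.2 / gcos k s.
  have qz : q.2 = m * gcos k s by rewrite /m; field; rewrite gt_eqF.
  have qy : q.1.2 = m * gsin k s.
    by apply: (mulIf (lt0r_neq0 g0)); rewrite qeta qz; ring.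
  have gg := gcos2Dgsin2 k s.
  have e1 : q.2 * dq.1.2 - q.1.2 * dq.2 = m * (dq.1.2 * gcos k s - dq.2 * gsin k s).
    by rewrite qz qy; ring.
  have e2 : K k * q.1.2 ^+ 2 + q.2 ^+ 2 = m * (K k * q.1.2 * gsin k s + q.2 * gcos k s).
    by rewrite qz qy; ring.
  rewrite e1 e2 dqeta divff// qz qy.
  rewrite (_ : m * _ = m ^+ 2 * (gcos k s ^+ 2 + K k * gsin k s ^+ 2)); last by ring.
  by rewrite gg mulr1 expf_neq0// mulf_neq0 ?gt_eqF ?invr_gt0.
split; first by move=> s /main[].
have := @integral_der (fun t => tri k v (crossing k v v' t) + wedge k (crossing k v v' t)) f l l'
  ll (fun s hs => (main s hs).1) (fun s hs => (main s hs).2).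
rewrite /f => ->.
have cl : crossing k v v' l = v.
  have [|_ _] := sg l; first by rewrite lexx ltW.
  rewrite /crossing tilt_longitude0// oppr0 addr0 => h.
  rewrite (_ : lin _ v 0 v' = lin (tilt k l v') v 0 v); first exact: nrm_scale hv.1 h.
  by coords.
have cl' : crossing k v v' l' = v'.
  have [|_ _] := sg l'; first by rewrite lexx ltW.
  rewrite /crossing tilt_longitude0// add0r => h.
  rewrite (_ : lin 0 v _ v' = lin (- tilt k l' v) v' 0 v'); first exact: nrm_scale hv'.1 h.
  by coords.
by rewrite cl cl' tri_pp add0r.
Qed.

(** Along a side contained in a meridian the longitude does not vary, so the primitive is
    constant. *)
Lemma edge_level k v v' : upper k v -> upper k v' -> longitude k v = longitude k v' ->
  tri k v v' + wedge k v' - wedge k v = 0.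
Proof.
move=> hv hv' ll.
pose p (t : R) := 1 - t; pose r (t : R) := t.
have hp t : has_der p t (-1) by apply: der_eq; [apply: derB; [exact: der_cst|exact: der_id]|rewrite sub0r].
have hr t : has_der r t 1 by exact: der_id.
pose ga t := nrm k (lin (p t) v (r t) v').
have main t : 0 <= t <= 1 ->
    has_der (fun t => tri k v (ga t) + wedge k (ga t)) t 0.
  move=> /andP[t0 t1]; have a1 : 0 <= p t by rewrite /p; lra.
  have a3 : 0 < p t + r t by rewrite /p /r; lra.
  have [h _] := der_edge hv hv' (hp t) (hr t) a1 t0 a3.
  apply: der_eq; first exact: h.
  rewrite (_ : _ - _ = 0) ?mul0r ?mulr0//.
  have [e1 _] := pt_longitude hv; have [e2 _] := pt_longitude hv'.
  have : v.1.2 * v'.2 = v.2 * v'.1.2.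
    have -> : v.1.2 = cradius k v.1.1 * gsin k (longitude k v) by rewrite -[in LHS]e1.
    have -> : v.2 = cradius k v.1.1 * gcos k (longitude k v) by rewrite -[in LHS]e1.
    have -> : v'.1.2 = cradius k v'.1.1 * gsin k (longitude k v') by rewrite -[in LHS]e2.
    have -> : v'.2 = cradius k v'.1.1 * gcos k (longitude k v') by rewrite -[in LHS]e2.
    by rewrite ll; ring.
  by rewrite /= /p /r => e; ring: e.
have := @integral_der (fun t => tri k v (ga t) + wedge k (ga t)) (fun=> 0) 0 1 ltr01 main
  (fun y _ => @cst_continuous _ _ _ y).
rewrite integral0 => -[/esym].
have -> : ga 1 = v'.
  rewrite /ga (_ : lin _ v _ v' = lin 1 v' 0 v'); first exact: nrm_scale hv'.1 ltr01.
  by apply: eq_space; rewrite /p /r /=; ring.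
have -> : ga 0 = v.
  rewrite /ga (_ : lin _ v _ v' = lin 1 v 0 v); first exact: nrm_scale hv.1 ltr01.
  by apply: eq_space; rewrite /p /r /=; ring.
by rewrite tri_pp add0r.
Qed.

Definition contribution k v v' s : R :=
  if ~~ `[< longitudes k s >] then 0
  else if (tilt k s v < 0) && (0 < tilt k s v') then (crossing k v v' s).1.1
  else if (0 < tilt k s v) && (tilt k s v' < 0) then - (crossing k v' v s).1.1
  else 0.

(** [h] is a continuous function cut off to a closed interval, or zero, so its integrability is
    immediate; the exceptional longitudes are negligible. *)
Lemma edge_contribution k v v' : upper k v -> upper k v' -> exists h : rT -> R,
  [/\ mu.-integrable setT (fun s => (h s)%:E),
      (\int[mu]_s (h s)%:E)%E = (tri k v v' + wedge k v' - wedge k v)%:E &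
      forall s, s <> longitude k v -> s <> longitude k v' -> h s = contribution k v v' s].
Proof.
move=> hv hv'.
have outside (w w' : space) s : upper k w -> upper k w' -> ~ longitudes k s ->
    (longitude k w <= s <= longitude k w') = false.
  move=> hw hw' nl; apply/negP => /andP[h1 h2]; apply: nl => e.
  have [_ /(_ e)/andP[a1 _]] := pt_longitude hw; have [_ /(_ e)/andP[_ a2]] := pt_longitude hw'.
  by rewrite (lt_le_trans a1 h1) (le_lt_trans h2 a2).
have rise (w w' : space) : upper k w -> upper k w' -> longitude k w < longitude k w' ->
  let h := (fun s : rT => (crossing k w w' s).1.1) \_ `[longitude k w, longitude k w'] in
  [/\ mu.-integrable setT (fun s => (h s)%:E) &
      (\int[mu]_s (h s)%:E)%E = (tri k w w' + wedge k w' - wedge k w)%:E].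
  move=> hw hw' ll h; have [c1 i1] := edge_rise hw hw' ll.
  have hE : (fun s => (h s)%:E) = (fun s => ((crossing k w w' s).1.1)%:E) \_ `[longitude k w, longitude k w'].
    by apply/funext => s; rewrite /h /patch; case: ifP.
  split; last by rewrite hE -integral_mkcond.
  have mI : measurable (`[longitude k w, longitude k w']%classic : set rT) by exact: measurable_itv.
  rewrite hE; apply: (integrable_mkcond _ mI).1.
  apply: continuous_compact_integrable; first exact: segment_compact.
  by apply: continuous_in_subspaceT => s; rewrite inE /= in_itv/= => /c1.
have [ll|ll|ll] := ltgtP (longitude k v) (longitude k v').
- have [i1 i2] := rise _ _ hv hv' ll; eexists; split; [exact: i1|exact: i2|].
  move=> s n1 n2; rewrite /contribution; case: asboolP => [hs|nl] /=; last first.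
    by rewrite patchE memNset//= in_itv/= outside.
  rewrite !tilt_sign//; rewrite patchE.
  have [h1|h1] := ltP (longitude k v) s.
    rewrite (lt_gtF h1)/=; have [h2|h2] := ltP s (longitude k v').
      by rewrite mem_set//= in_itv/= !ltW.
    rewrite memNset//= in_itv/= => /andP[_ h3]; apply: n2; apply/eqP.
    by rewrite eq_le h2 h3.
  rewrite /= memNset; last first.
    by rewrite /= in_itv/= => /andP[h3 _]; apply: n1; apply/eqP; rewrite eq_le h1 h3.
  rewrite [X in _ && X]ltNge (le_trans h1 (ltW ll)) andbF//.
- have [i1 i2] := rise _ _ hv' hv ll.
  set h := (X in mu.-integrable _ (fun s => (X s)%:E)) in i1.
  exists (fun s => - h s); split.
  + exact: (integrableN i1).
  + under eq_integral do rewrite EFinN.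
    by rewrite integralN ?i2; [rewrite -EFinN (triC k v'); congr (_%:E); ring|exact: integrable_add_def].
  move=> s n1 n2; rewrite /contribution; case: asboolP => [hs|nl] /=; last first.
    by rewrite /h patchE memNset ?oppr0//= in_itv/= outside.
  rewrite !tilt_sign// /h patchE.
  have [h1|h1] := ltP (longitude k v') s.
    rewrite [X in _ && X]ltNge (ltW h1) andbF; have [h2|h2] := ltP s (longitude k v).
      by rewrite mem_set//= in_itv/= !ltW.
    rewrite memNset ?oppr0//= in_itv/= => /andP[_ h3]; apply: n1; apply/eqP.
    by rewrite eq_le h2 h3.
  rewrite /= memNset; last first.
    by rewrite /= in_itv/= => /andP[h3 _]; apply: n2; apply/eqP; rewrite eq_le h1 h3.
  by rewrite andbF [X in X && _]ltNge (le_trans h1 (ltW ll)) oppr0.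
exists (fun=> 0); split.
- exact: integrable0.
- by rewrite integral0 edge_level.
move=> s n1 n2; rewrite /contribution; case: asboolP => [hs|nl] //=.
rewrite !tilt_sign// ll; have [h1|h1|h1] := ltgtP (longitude k v') s => //.
Qed.

End Integration.

Lemma curv_sqr_ge1 k (x : R) : 1 <= curv R k * x ^+ 2 -> k = Spherical.
Proof. by have := sqr_ge0 x; case: k => //= x0; rewrite ?mul0r => h; exfalso; lra. Qed.

Lemma orient_sign (b : bool) : let o : R := if b then 1 else -1 in
  [/\ o = 1 <-> b, o = -1 <-> ~~ b, - o = 1 <-> ~~ b & - o = -1 <-> b].
Proof. by case: b; split; split=> // h; rewrite ?opprK//; exfalso; lra. Qed.

(** * Area of a region bounded by a closed polygonal curve *)

Section Green.
Implicit Types (x y a c e : R) (p : space).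
Variables (k : curvature) (n : nat) (F : set space) (v : 'I_n -> space) (b : bool).

(** Nonnegative combinations describe the side between two points of an open half-surface without
    mention of direction or length, and linear motions respect them. *)
Definition on_edge (v : 'I_n -> space) (i : 'I_n) q :=
  exists a c, [/\ 0 <= a, 0 <= c & q = lin a (v i) c (v (ordS i))].

Definition within_edge (v : 'I_n -> space) (i : 'I_n) q :=
  exists a c, [/\ 0 < a, 0 < c & q = lin a (v i) c (v (ordS i))].

(* [F] is bounded by the closed polygonal curve [v], lying on its left if [b]
   holds and on its right otherwise. *)
Record bounded_by : Prop := BoundedBy {
  bounded_closed : relclosed k F;
  bounded_surface : F `<=` surface k;
  bounded_flat : forall q, surface k q -> (forall i, ~ on_edge v i q) ->
    exists2 e, 0 < e & forall q', surface k q' -> near3 e q q' -> (F q' <-> F q);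
  bounded_jump : forall i q, surface k q -> within_edge v i q ->
    exists2 e, 0 < e & forall q', surface k q' -> near3 e q q' ->
      (0 < det3 (v i) (v (ordS i)) q' -> (F q' <-> b)) /\
      (det3 (v i) (v (ordS i)) q' < 0 -> (F q' <-> ~~ b));
  bounded_simple : forall i j q, surface k q -> within_edge v i q -> on_edge v j q -> i = j }.

Hypothesis vup : forall i, upper k (v i).
Hypothesis Fv : bounded_by.

Let cF := bounded_closed Fv.
Let sF := bounded_surface Fv.

Lemma on_edge_upper i q : surface k q -> on_edge v i q -> 0 < q.2.
Proof.
move=> sq [a [c [a0 c0 e]]]; have [_ v0] := vup i; have [_ v1] := vup (ordS i).
have := surface_bil sq; move: a0 c0; rewrite !le_eqVlt => /predU1P[a0|a0] /predU1P[c0|c0].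
- by rewrite e -a0 -c0 /bil /= !mul0r !addr0 !mulr0 => h; lra.
- by move=> _; rewrite e /= -a0 mul0r add0r mulr_gt0.
- by move=> _; rewrite e /= -c0 mul0r addr0 mulr_gt0.
- by move=> _; rewrite e /= addr_gt0 ?mulr_gt0.
Qed.

(** No edge meets the closed lower half-sphere, so [F] contains all or nothing of it; containing it
    would cost an area of at least [2 * pi]. *)
Lemma bounded_upper q : (k = Spherical -> (area k F < (2 * pi)%:E)%E) -> F q -> 0 < q.2.
Proof.
move=> Fsph Fq; have sq := sF Fq; case: (pselect (k = Spherical)) => [ek|nk]; last by apply: sq.2.
rewrite ltNge; apply/negP => q0.
(* The south pole, to which every point of the closed lower half-sphere is joined inside it. *)
pose S : space := (0, 0, -1).
have sS : surface k S by split; rewrite /= ?sqrrN; [ring|move/(_ ek)].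
have con p : surface k p -> p.2 <= 0 -> (F p <-> F S).
  move=> sp p0; pose g (t : R) : space := lin (1 - t) p t S.
  have cg t : 0 <= t <= 1 -> cone k (g t).
    move=> /andP[t0 t1]; split; last by move/(_ ek).
    rewrite /g !bil_lin (surface_bil sp) (surface_bil sS) (bilC k S p).
    have h : 0 <= bil k p S by rewrite /bil /=; lra.
    have h2 : 0 <= t * (1 - t) * bil k p S by rewrite !mulr_ge0//; lra.
    have h3 : 0 < (1 - t) ^+ 2 + t ^+ 2 by have := sqr_ge0 (1 - 2 * t); nra.
    by lra.
  have z0 t : 0 <= t <= 1 -> (nrm k (g t)).2 <= 0.
    move=> /andP[t0 t1]; rewrite /nrm /= mul0r addr0 pmulr_rle0; last first.
      by rewrite invr_gt0 sqrtr_gt0; case: (cg t); rewrite ?t0.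
    by clear ek Fsph; have h : 0 <= (1 - t) * - p.2; [rewrite mulr_ge0; lra|lra].
  have := @segment_locally_constant (fun t => F (nrm k (g t))) 0 1 ler01 _.
  have -> : nrm k (g 0) = p.
    rewrite (_ : g 0 = p); first exact: nrm_id.
    by rewrite /g; coords.
  have -> : nrm k (g 1) = S.
    rewrite (_ : g 1 = S); first exact: nrm_id.
    by rewrite /g; coords.
  apply => t ht; have [|e e0 he] := bounded_flat Fv (nrm_surface (cg _ ht)).
    move=> i /(on_edge_upper (nrm_surface (cg _ ht))); have := z0 _ ht; lra.
  have [d d0 hd] := continuous_nrm (cg _ ht) e0.
  pose M := `|p.1.1| + `|p.1.2| + `|p.2| + 2.
  have M0 : 0 < M by rewrite /M; have := normr_ge0 p.1.1; have := normr_ge0 p.1.2; have := normr_ge0 p.2; lra.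
  exists (d / M); first by rewrite divr_gt0.
  move=> s hs ts; have [_ nr] : cone k (g s) /\ near3 e (nrm k (g t)) (nrm k (g s)).
    apply: hd; have tsM : `|t - s| * M < d by rewrite -ltr_pdivlMr.
    have H (u w : R) : `|u| + `|w| <= M -> `|((1 - t) * u + t * w) - ((1 - s) * u + s * w)| < d.
      move=> uw; rewrite (_ : _ - _ = (t - s) * (w - u)); last by ring.
      rewrite normrM; apply: le_lt_trans tsM; rewrite ler_wpM2l//.
      by apply: le_trans (ler_normB _ _) _; lra.
    have := normr_ge0 p.1.1; have := normr_ge0 p.1.2; have := normr_ge0 p.2 => n1 n2 n3.
    by split; apply: H; rewrite /S /= ?normr0 ?normrN ?normr1 /M; lra.
  by apply: he => //; apply: nrm_surface; exact: cg.
have FS : F S by apply/(con _ sq q0).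
have := Fsph ek; apply/negP; rewrite -leNgt; move: cF sF Fq con FS; rewrite ek => cF' sF' Fq con FS.
by apply: area_lower_hemisphere => // p sp p0; apply/con => //; exact: ltW.
Qed.

Hypothesis Fup : forall q, F q -> 0 < q.2.

(** The quotient of x by [cradius k x] is increasing, so a point moving along a meridian crosses the
    line of an edge only once. *)
Lemma cradius_mono x y : K k * y ^+ 2 < 1 -> K k * x ^+ 2 < 1 -> y < x ->
  y * cradius k x < x * cradius k y.
Proof.
move=> hy hx yx; have cx := cradius_gt0 hx; have cy := cradius_gt0 hy.
have sq : (y * cradius k x) ^+ 2 - (x * cradius k y) ^+ 2 = y ^+ 2 - x ^+ 2.
  by rewrite !exprMn !cradius_sqr//; ring.
have [y0|y0] := ltP y 0.
  have [x0|x0] := ltP x 0; last first.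
    by apply: (@lt_le_trans _ _ 0); [rewrite nmulr_rlt0|rewrite mulr_ge0// ltW].
  have a1 : y * cradius k x < 0 by rewrite nmulr_rlt0.
  have a2 : x * cradius k y < 0 by rewrite nmulr_rlt0.
  have : 0 < (y * cradius k x) ^+ 2 - (x * cradius k y) ^+ 2 by rewrite sq; clear sq; nra.
  by move: a1 a2; move: (y * _) (x * _) => u w u0 w0; rewrite subr_sqr; nra.
have a1 : 0 <= y * cradius k x by rewrite mulr_ge0// ltW.
have a2 : 0 < x * cradius k y by rewrite mulr_gt0//; lra.
have : (y * cradius k x) ^+ 2 - (x * cradius k y) ^+ 2 < 0 by rewrite sq; clear sq; nra.
by move: a1 a2; move: (y * _) (x * _) => u w u0 w0; rewrite subr_sqr; nra.
Qed.

Section Slice.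
Variable s : R.
Hypothesis hs : longitudes k s.
Hypothesis generic : forall i, s <> longitude k (v i).

Let et i := tilt k s (v i).
Let up i := (et i < 0) && (0 < et (ordS i)).
Let down i := (0 < et i) && (et (ordS i) < 0).
Let act i := up i || down i.
Let Xp i := nrm k (lin `|et (ordS i)| (v i) `|et i| (v (ordS i))).
Let X i := (Xp i).1.1.
Let o : R := if b then 1 else -1.
(** For a region on the left, a side that crosses towards larger longitudes bounds the slice at its
    larger abscissas. *)
Let sg i := o * (if up i then 1 else -1).
Let g x := slab k (x, s) /\ F (pt k (x, s)).

Lemma et_neq0 i : et i != 0.
Proof.
have [e1 e2] := tilt_sign (vup i) hs.
rewrite neq_lt /et e1 e2 -neq_lt; apply/eqP => h; exact: (@generic i (esym h)).
Qed.

Lemma tilt0_pt q : upper k q -> tilt k s q = 0 -> q = pt k (q.1.1, s).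
Proof.
move=> uq t0; have [e1 e2] := tilt_sign uq hs; rewrite -[LHS](pt_longitude uq).1; congr (pt _ (_, _)).
by apply/eqP; rewrite eq_le leNgt -e1 t0 ltxx leNgt -e2 t0 ltxx.
Qed.

Lemma act_pt i : act i -> [/\ upper k (Xp i), Xp i = pt k (X i, s) & within_edge v i (Xp i)].
Proof.
move=> ai; have n0 : 0 < `|et i| by rewrite normr_gt0 et_neq0.
have n1 : 0 < `|et (ordS i)| by rewrite normr_gt0 et_neq0.
have [q0 _ _ uq] := upper_nrm (vup i) (vup (ordS i)) (ltW n1) (ltW n0) (addr_gt0 n1 n0).
split=> //.
  apply: tilt0_pt => //.
  have E (c : R) q : tilt k s (lin c q 0 q) = c * tilt k s q by rewrite /tilt /=; ring.
  rewrite /Xp /nrm E (_ : tilt k s _ = 0) ?mulr0//.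
  have -> : tilt k s (lin `|et (ordS i)| (v i) `|et i| (v (ordS i))) =
      `|et (ordS i)| * et i + `|et i| * et (ordS i) by rewrite /et /tilt /=; ring.
  by case/orP: ai => /andP[h1 h2];
    [rewrite (ltr0_norm h1) (gtr0_norm h2)|rewrite (gtr0_norm h1) (ltr0_norm h2)]; ring.
set c := (Num.sqrt (bil k (lin `|et (ordS i)| (v i) `|et i| (v (ordS i)))
  (lin `|et (ordS i)| (v i) `|et i| (v (ordS i)))))^-1.
have c0 : 0 < c by rewrite invr_gt0 sqrtr_gt0.
exists (c * `|et (ordS i)|), (c * `|et i|); split; rewrite ?mulr_gt0//.
by rewrite /Xp /nrm -/c; coords.
Qed.

Lemma on_edge_act i q : surface k q -> on_edge v i q -> tilt k s q = 0 -> act i /\ q = Xp i.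
Proof.
move=> sq [a [c [a0 c0 e]]] t0.
have lc : a * et i + c * et (ordS i) = 0 by rewrite -t0 e /et /tilt /=; ring.
have e0 := et_neq0 i; have e1 := et_neq0 (ordS i).
have ac : 0 < a /\ 0 < c.
  move: a0 c0; rewrite !le_eqVlt => /predU1P[a0|a0] /predU1P[c0|c0]//.
  - have := surface_bil sq; rewrite e -a0 -c0 /bil /= !mul0r !addr0 !mulr0 => h; lra.
  - by move: lc; rewrite -a0 mul0r add0r => /eqP; rewrite mulf_eq0 (negbTE e1) orbF (gt_eqF c0).
  - by move: lc; rewrite -c0 mul0r addr0 => /eqP; rewrite mulf_eq0 (negbTE e0) orbF (gt_eqF a0).
have {a0 c0} [a0 c0] := ac.
have ai : act i.
  rewrite /act /up /down; move: e0 e1; rewrite !neq_lt => /orP[h1|h1] /orP[h2|h2]; rewrite h1 h2 ?orbT//.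
  - have := lc; have p1 : a * et i < 0 by rewrite pmulr_rlt0.
    have p2 : c * et (ordS i) < 0 by rewrite pmulr_rlt0.
    lra.
  - have := lc; have p1 : 0 < a * et i by rewrite pmulr_rgt0.
    have p2 : 0 < c * et (ordS i) by rewrite pmulr_rgt0.
    lra.
split=> //; pose d := a / `|et (ordS i)|.
have n1 : 0 < `|et (ordS i)| by rewrite normr_gt0.
have d0 : 0 < d by rewrite divr_gt0.
have dn : d * `|et (ordS i)| = a by rewrite /d; field; rewrite gt_eqF.
have dn' : d * `|et i| = c.
  apply: (mulIf (lt0r_neq0 n1)); rewrite mulrAC dn.
  by case/orP: ai => /andP[h1 h2];
    [rewrite (ltr0_norm h1) (gtr0_norm h2)|rewrite (gtr0_norm h1) (ltr0_norm h2)]; lra.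
set w := lin `|et (ordS i)| (v i) `|et i| (v (ordS i)).
have qw : q = lin d w 0 w by rewrite e -dn -dn' /w; coords.
have bw : 1 = d ^+ 2 * bil k w w.
  by rewrite -(surface_bil sq) qw !bil_lin; ring.
rewrite /Xp -/w /nrm.
have -> : bil k w w = d^-1 ^+ 2.
  by apply: (mulfI (expf_neq0 2 (lt0r_neq0 d0))); rewrite -bw; field; rewrite gt_eqF.
by rewrite sqrtr_sqr gtr0_norm ?invr_gt0// invrK.
Qed.

Lemma near_pt x e : 0 < e -> exists2 d, 0 < d &
  forall y, `|y - x| < d -> near3 e (pt k (x, s)) (pt k (y, s)) /\ (K k * x ^+ 2 < 1 -> K k * y ^+ 2 < 1).
Proof.
move=> e0.
have c1 : {for x, continuous (fun y => pt k (y, s))}.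
  apply: (@continuous_comp _ _ _ (fun y : R => (y, s)) (pt k)).
    exact: (cvg_pair (@cvg_id _ (nbhs x)) (cvg_cst s)).
  exact: continuous_pt.
have c2 : {for x, continuous (fun y => K k * y ^+ 2)}.
  by apply: cvgM; [exact: cvg_cst|exact: exprn_continuous].
have [d1 d10 h1] : exists2 d, 0 < d & forall y, `|y - x| < d -> near3 e (pt k (x, s)) (pt k (y, s)).
  have : \forall y \near x, ball (pt k (x, s)) e (pt k (y, s)) by apply: c1; exact: nbhsx_ballx.
  move=> /nbhs_ballP[d d0 hd]; exists d => // y yx; apply/ball_near3; apply: hd.
  by rewrite /ball /= distrC.
have [d2 d20 h2] : exists2 d, 0 < d & forall y, `|y - x| < d -> K k * x ^+ 2 < 1 -> K k * y ^+ 2 < 1.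
  have [hx|hx] := ltP (K k * x ^+ 2) 1; last first.
    by exists 1 => // y _ h; move: (lt_le_trans h hx); rewrite ltxx.
  have e'0 : 0 < 1 - K k * x ^+ 2 by rewrite subr_gt0.
  have /cvgrPdist_lt/(_ _ e'0) := c2.
  move=> /nbhs_ballP[d d0 hd]; exists d => // y yx _.
  have : `|K k * x ^+ 2 - K k * y ^+ 2| < 1 - K k * x ^+ 2 by apply: hd; rewrite /ball /= distrC.
  by rewrite ltr_norml => /andP[h _]; lra.
exists (Num.min d1 d2); first by rewrite lt_min d10.
by move=> y; rewrite lt_min => /andP[/h1 ? /h2 ?].
Qed.

Lemma slice_flat x : (forall i, act i -> X i <> x) ->
  exists2 d, 0 < d & forall y, `|y - x| < d -> (g y <-> g x).
Proof.
move=> nX; have [hx|hx] := ltP (K k * x ^+ 2) 1.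
  have sq : surface k (pt k (x, s)) by exact: pt_surface.
  have t0 : tilt k s (pt k (x, s)) = 0 by rewrite /tilt /=; ring.
  have [|e e0 he] := bounded_flat Fv sq.
    by move=> i oe; have [ai /esym eX] := on_edge_act sq oe t0; apply: (nX i ai); rewrite /X eX.
  have [d d0 hd] := near_pt x e0; exists d => // y /hd[ny /(_ hx) hy].
  have /he fy := pt_surface (w := (y, s)) hy (fun=> hs).
  by split=> -[_ Fy]; split=> //; apply/(fy ny).
have ng y : 1 <= K k * y ^+ 2 -> ~ g y by move=> h [[/= h' _] _]; move: (lt_le_trans h' h); rewrite ltxx.
suff [d d0 hd] : exists2 d, 0 < d & forall y, `|y - x| < d -> ~ g y.
  by exists d => // y /hd ngy; split=> // /(ng _ hx).
have kS := curv_sqr_ge1 hx; have ek : K k = 1 by rewrite kS.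
have [x1|x1] := eqVneq (x ^+ 2) 1; last first.
  have nx : 1 < `|x|.
    rewrite ltNge; apply/negP => h; move: hx x1; rewrite ek mul1r => hx /negP; apply.
    by rewrite eq_le hx andbT -real_normK ?num_real// expr_le1.
  exists (`|x| - 1); first by rewrite subr_gt0.
  move=> y yx; apply: ng; rewrite ek mul1r -real_normK ?num_real//.
  by have := lerB_dist x y; rewrite distrC => h; rewrite expr_ge1//; lra.
(* At [x ^+ 2 = 1] the point lies on the equator of the sphere, which [Fup] keeps out of [F];
   closedness of [F] then excludes nearby points. *)
have c0 : cradius k x = 0 by rewrite /cradius ek mul1r x1 subrr sqrtr0.
have sq : surface k (pt k (x, s)).
  split=> /=; first by rewrite c0 !mul0r ek x1; ring.
  by move/(_ kS).
have nF : ~ F (pt k (x, s)) by move=> /Fup /=; rewrite c0 mul0r ltxx.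
have [e e0 he] := cF sq nF; have [d d0 hd] := near_pt x e0.
exists d => // y /hd[ny _] [[/= hy _] Fy]; apply: (he _ _ ny) => //.
exact: (pt_surface (w := (y, s)) hy (fun=> hs)).
Qed.

Lemma slice_jump i : act i -> exists2 d, 0 < d & forall y, `|y - X i| < d ->
  (y < X i -> (g y <-> sg i = 1)) /\ (X i < y -> (g y <-> sg i = -1)).
Proof.
move=> ai; have [uq qE wq] := act_pt ai; have [hX _] := upper_cradius uq.
have [e e0 he] := bounded_jump Fv uq.1 wq; rewrite qE in he.
have [d d0 hd] := near_pt (X i) e0; exists d => // y /hd[ny /(_ hX) hy].
have sy := pt_surface (w := (y, s)) hy (fun=> hs).
have [hp hm] := he _ sy ny.
have gF : g y <-> F (pt k (y, s)) by split=> [[]//|Fy]; split.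
set V := v i in hp hm; set W := v (ordS i) in hp hm.
pose n1 := V.1.2 * W.2 - V.2 * W.1.2.
have n1E : n1 * gcos k s = W.2 * et i - V.2 * et (ordS i) by rewrite /n1 /et /tilt -/V -/W; ring.
have g0 := gcos_gt0 hs; have cX := cradius_gt0 hX; have cy := cradius_gt0 hy.
have D0 : det3 V W (pt k (X i, s)) = 0.
  by rewrite -qE; have [a [c [_ _ ->]]] := wq; rewrite /det3 /= -/V -/W; ring.
(* Up to positive factors, the side function along the meridian is [n1] times the difference whose
   sign [cradius_mono] decides; [n1] carries the direction of the crossing. *)
have DE : cradius k (X i) * det3 V W (pt k (y, s)) =
    n1 * (y * cradius k (X i) - X i * cradius k y).
  transitivity (cradius k (X i) * det3 V W (pt k (y, s)) - cradius k y * det3 V W (pt k (X i, s))).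
    by rewrite D0 mulr0 subr0.
  by rewrite /det3 /pt /n1 /=; ring.
have V0 : 0 < V.2 := (vup i).2; have W0 : 0 < W.2 := (vup (ordS i)).2.
have [s1 s2 s3 s4] := @orient_sign b; rewrite -/o in s1 s2 s3 s4.
rewrite /sg; case: ifP => ui.
  have n10 : n1 < 0.
    have /andP[u1 u2] := ui; rewrite -(pmulr_llt0 _ g0) n1E.
    have : W.2 * et i < 0 by rewrite pmulr_rlt0.
    by have : 0 < V.2 * et (ordS i) by [rewrite mulr_gt0]; lra.
  rewrite mulr1; split=> yX.
  - have l : 0 < det3 V W (pt k (y, s)).
      by rewrite -(pmulr_rgt0 _ cX) DE nmulr_rgt0// subr_lt0 cradius_mono.
    by have := hp l; tauto.
  - have l : det3 V W (pt k (y, s)) < 0.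
      by rewrite -(pmulr_rlt0 _ cX) DE nmulr_rlt0// subr_gt0 cradius_mono.
    by have := hm l; tauto.
have n10 : 0 < n1.
  move: ai; rewrite /act ui /= => /andP[u1 u2]; rewrite -(pmulr_lgt0 _ g0) n1E.
  have : V.2 * et (ordS i) < 0 by rewrite pmulr_rlt0.
  by have : 0 < W.2 * et i by [rewrite mulr_gt0]; lra.
rewrite mulrN1; split=> yX.
- have l : det3 V W (pt k (y, s)) < 0.
    by rewrite -(pmulr_rlt0 _ cX) DE pmulr_rlt0// subr_lt0 cradius_mono.
  by have := hm l; tauto.
- have l : 0 < det3 V W (pt k (y, s)).
    by rewrite -(pmulr_rgt0 _ cX) DE pmulr_rgt0// subr_gt0 cradius_mono.
  by have := hp l; tauto.
Qed.

(** Beyond all crossings membership is constant, and a slice that contained a half-line would have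
    infinite length. *)
Lemma slice_far : (mu (meridian_slice k F s) < +oo)%E -> exists M, forall x, M < `|x| -> ~ g x.
Proof.
move=> fin; case: (pselect (k = Spherical)) => [ek|nk].
  exists 1 => x x1 [[/= h _] _]; move: h; rewrite ek /= mul1r -real_normK ?num_real//; nra.
pose M := \sum_i `|X i|; exists M => x xM gx.
have XM i : `|X i| <= M by rewrite /M (bigD1 i)//= lerDl sumr_ge0.
have far t : M < `|t| -> exists2 d, 0 < d & forall y, `|y - t| < d -> (g y <-> g t).
  by move=> tM; apply: slice_flat => i _ e; have := XM i; rewrite e leNgt tM.
have mS : measurable (meridian_slice k F s) by exact: measurable_meridian_slice.
have inf (I : interval R) : (mu [set` I] = +oo)%E -> [set` I] `<=` meridian_slice k F s -> False.
  move=> e IF; have : (mu [set` I] <= mu (meridian_slice k F s))%E.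
    by apply: le_measure => //; rewrite inE //; exact: measurable_itv.
  by rewrite e => h; move: (le_lt_trans h fin); rewrite ltxx.
have M0 : 0 <= M by rewrite sumr_ge0.
have [x0|x0] := leP 0 x.
  rewrite ger0_norm// in xM.
  apply: (inf `[x, +oo[); first by rewrite lebesgue_measure_itv /= ltry.
  move=> y /=; rewrite in_itv/= andbT => xy.
  apply: (@segment_locally_constant g x y xy _).1 => // t /andP[xt _].
  have [|d d0 hd] := far t; first by rewrite ger0_norm; lra.
  by exists d => // z _ zt; apply: hd; rewrite distrC.
rewrite ltr0_norm// in xM.
apply: (inf `]-oo, x]); first by rewrite lebesgue_measure_itv /= ltNyr.
move=> y /=; rewrite in_itv/= => xy.
apply: (@segment_locally_constant g y x xy _).2 => // t /andP[_ xt].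
have [|d d0 hd] := far t; first by rewrite ltr0_norm; lra.
by exists d => // z _ zt; apply: hd; rewrite distrC.
Qed.

Lemma slice_contribution : (mu (meridian_slice k F s) < +oo)%E ->
  mu (meridian_slice k F s) = (o * \sum_i contribution k (v i) (v (ordS i)) s)%:E.
Proof.
move=> /slice_far[M hM].
have sgP i : act i -> sg i = 1 \/ sg i = -1.
  by rewrite /sg /o => _; case: b; case: ifP; rewrite ?mulr1 ?mulrN1 ?opprK; [left|right|right|left].
have Xinj i j : act i -> act j -> X i = X j -> i = j.
  move=> ai aj e; have [uq qE wq] := act_pt ai; have [_ qE' [a [c [a0 c0 e']]]] := act_pt aj.
  apply: (bounded_simple Fv uq.1 wq); exists a, c; split; [exact: ltW|exact: ltW|].
  by rewrite -e' qE qE' e.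
have mS : measurable [set x | g x] by exact: measurable_meridian_slice.
have := jump_measure sgP Xinj hM slice_flat slice_jump mS.
rewrite -[[set x | g x]]/(meridian_slice k F s) => ->; congr (_%:E).
rewrite mulr_sumr [LHS]big_mkcond/=; apply: eq_bigr => i _.
rewrite /contribution asboolT//= -!/(et _) -/(up i) -/(down i) /sg.
case: ifP => ai; last by move: ai; rewrite /act; case: (up i); case: (down i) => //=; rewrite mulr0.
have [ui|nui] := boolP (up i).
  rewrite mulr1; congr (_ * _); have /andP[u1 u2] := ui.
  by rewrite /X /Xp (gtr0_norm u2) (ltr0_norm u1).
move: ai; rewrite /act (negbTE nui) /= => di; rewrite di mulrN1 mulrN mulNr; congr (- (_ * _)).
have /andP[u1 u2] := di; rewrite /X /Xp (gtr0_norm u1) (ltr0_norm u2) /crossing.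
by congr (nrm _ _).1.1; coords.
Qed.

End Slice.

Lemma finite_slices : (area k F < +oo)%E -> {ae mu, forall s, mu (meridian_slice k F s) \is a fin_num}.
Proof.
rewrite (area_meridians cF sF Fup) => Ffin.
have : mu.-integrable setT (fun s => mu (meridian_slice k F s)).
  by apply/integrableP; split; [exact: measurable_meridians|under eq_integral do rewrite gee0_abs//].
by move=> /(integrable_ae measurableT); apply: filterS => s; apply.
Qed.

(** Around the closed curve the [wedge] terms cancel in pairs. The finiteness of almost all slices
    is a hypothesis, so that it may come from a bound on the region when the area is still
    unknown. *)
Lemma green_area : {ae mu, forall s, mu (meridian_slice k F s) \is a fin_num} ->
  area k F = ((if b then 1 else -1) * \sum_i tri k (v i) (v (ordS i)))%:E.
Proof.
move=> fin; set o := if b then _ else _.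
have /choice[h hP] : forall i, exists h : rT -> R, [/\ mu.-integrable setT (fun s => (h s)%:E),
      (\int[mu]_s (h s)%:E)%E = (tri k (v i) (v (ordS i)) + wedge k (v (ordS i)) - wedge k (v i))%:E &
      forall s, s <> longitude k (v i) -> s <> longitude k (v (ordS i)) ->
        h s = contribution k (v i) (v (ordS i)) s].
  by move=> i; exact: edge_contribution.
have iS : mu.-integrable setT (fun s => (\sum_i (h i s)%:E)%E).
  by apply: integrable_sum => // i _; have [] := hP i.
have aE : area k F = (\int[mu]_s mu (meridian_slice k F s))%E by exact: area_meridians cF sF Fup.
have mS : measurable_fun setT (fun s => mu (meridian_slice k F s)) by exact: measurable_meridians.
rewrite aE; transitivity (\int[mu]_s (o%:E * \sum_i (h i s)%:E))%E.
  apply: ae_eq_integral => //; first by apply: measurable_funeM; exact: (measurable_int mu).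
  have [N [mN N0 hN]] := finite_null (fun i => longitude k (v i)).
  have aeN : {ae mu, forall s, forall i, s <> longitude k (v i)}.
    exists N; split=> // s /= hs; apply: hN => /=.
    by apply: contrapT => h'; apply: hs => i e; apply: h'; exists i.
  apply: (negligibleS _ (negligibleU fin aeN)) => s /= hs; apply: contrapT => hs'; apply: hs => _.
  have fs : mu (meridian_slice k F s) \is a fin_num by apply: contrapT => h'; apply: hs'; left.
  have ns : forall i, s <> longitude k (v i) by apply: contrapT => h'; apply: hs'; right.
  have hE : (o%:E * \sum_i (h i s)%:E = (o * \sum_i contribution k (v i) (v (ordS i)) s)%:E)%E.
    by rewrite sumEFin -EFinM; congr (_ * _)%:E; apply: eq_bigr => i _; have [_ _ ->] := hP i.
  rewrite hE; case: (pselect (longitudes k s)) => [hs|nl]; last first.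
    rewrite (_ : meridian_slice k F s = set0) ?measure0; last first.
      by apply/seteqP; split=> // x [[_ /= /nl]].
    by rewrite big1 ?mulr0// => i _; rewrite /contribution asboolF.
  by rewrite slice_contribution// -ge0_fin_numE.
rewrite integralZl// integral_sum//; last by move=> i; have [] := hP i.
rewrite (eq_bigr (fun i => (tri k (v i) (v (ordS i)) + wedge k (v (ordS i)) - wedge k (v i))%:E)); last first.
  by move=> i _; have [] := hP i.
rewrite sumEFin -EFinM; congr (_ * _)%:E.
rewrite sumrB big_split/= -[RHS]addr0 -addrA; congr (_ + _).
by rewrite [X in _ - X](reindex_inj (@ordS_inj n)) /= subrr.
Qed.

End Green.

(** * Sides as nonnegative combinations of their ends *)

Section Edges.
Context (k : curvature) (n : nat).
Variables (vt dr : 'I_n -> space) (ln : 'I_n -> R).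
Implicit Types (a c e : R) (p : space) (i j : 'I_n).
Local Notation gam i := (geodesic k (vt i) (dr i)).
Hypothesis vtS : forall i, surface k (vt i).
Hypothesis drU : forall i, unit_tangent k (vt i) (dr i).
Hypothesis ln0 : forall i, 0 < ln i.
Hypothesis lnE : forall i, gam i (ln i) = vt (ordS i).
Hypothesis len_pi : k = Spherical -> forall i, ln i < pi.

Lemma exists_angle (A D : R) : 0 <= D -> A ^+ 2 + K k * D ^+ 2 = 1 -> (k <> Spherical -> 0 <= A) ->
  exists t, [/\ 0 <= t, k = Spherical -> t <= pi, gcos k t = A & gsin k t = D].
Proof.
move=> D0 AD A0; case: (pselect (k = Spherical)) => [e|nk].
  move: AD; rewrite e /= mul1r => AD; have A1 : -1 <= A <= 1 by have := sqr_ge0 D; nra.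
  have h1 : 0 <= acos A by rewrite acos_ge0.
  exists (acos A); split=> //; first by rewrite acos_lepi.
    by rewrite acosK// in_itv.
  by rewrite sin_acos// (_ : 1 - A ^+ 2 = D ^+ 2) ?sqrtr_sqr ?ger0_norm//; lra.
have u : k = Spherical -> -1 <= D <= 1 by move/nk.
exists (gasin k D); split=> //; [by apply: gasin_ge0 => // /nk| |exact: gasinK].
have g0 : 0 < gcos k (gasin k D) by apply: gcos_gt0 => /nk.
have := gcos2Dgsin2 k (gasin k D); rewrite gasinK// => h.
have e : gcos k (gasin k D) ^+ 2 = A ^+ 2 by lra.
by apply/eqP; rewrite -(eqrXn2 (_ : 0 < 2)%N)//; [apply/eqP|exact: ltW|exact: A0].
Qed.

Lemma gsin_len_gt0 i : 0 < gsin k (ln i).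
Proof. by apply: gsin_gt0; [exact: ln0|move=> e; exact: len_pi]. Qed.

Lemma gam_lin i t : gam i t =
  lin (gsin k (ln i - t) / gsin k (ln i)) (vt i) (gsin k t / gsin k (ln i)) (vt (ordS i)).
Proof.
have s0 := gsin_len_gt0 i; rewrite -(lnE i) !geodesicE gsinB.
by apply: eq_space => /=; field; rewrite gt_eqF.
Qed.

Lemma det3_edge i q :
  det3 (vt i) (vt (ordS i)) q = gsin k (ln i) * det3 (vt i) (dr i) q.
Proof. by rewrite -(lnE i) geodesicE det3_lin2 det3pp; ring. Qed.

Lemma segment_edge i q : segment k (vt i) (dr i) (ln i) q -> on_edge vt i q.
Proof.
move=> [t]; rewrite /= in_itv /= => /andP[t0 t1] <-; rewrite gam_lin.
have s0 := gsin_len_gt0 i; have l0 := ln0 i.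
exists (gsin k (ln i - t) / gsin k (ln i)), (gsin k t / gsin k (ln i)).
split=> //; apply: divr_ge0 (ltW s0); (apply: gsin_ge0; first by lra); move=> e;
  by have := len_pi e i; lra.
Qed.

Lemma edge_segment i a c : let q := lin a (vt i) c (vt (ordS i)) in
  0 <= a -> 0 <= c -> surface k q -> exists t,
  [/\ 0 <= t <= ln i, gam i t = q & 0 < a -> 0 < c -> 0 < t < ln i].
Proof.
move=> q a0 c0 sq; have s0 := gsin_len_gt0 i; have l0 := ln0 i.
pose A := a + c * gcos k (ln i); pose D := c * gsin k (ln i).
have qE : q = lin A (vt i) D (dr i).
  by rewrite /q -(lnE i) geodesicE; apply: eq_space; rewrite /A /D /=; ring.
have D0 : 0 <= D by rewrite mulr_ge0// ltW.
have hd := drU i; have hv := vtS i.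
have AD : A ^+ 2 + K k * D ^+ 2 = 1.
  have := surface_bil sq; rewrite qE !bil_lin (surface_bil hv) (bil_tangent hd.1).
  by rewrite (bilC k (dr i)) (bil_tangent hd.1) (bil_tangents hv hd.1 hd.1) hd.2 => <-; ring.
have A0 : k <> Spherical -> 0 <= A.
  by move=> nk; rewrite addr_ge0// mulr_ge0// ltW// gcos_gt0// => /nk.
have [t [t0 tpi cE sE]] := exists_angle D0 AD A0.
have qg : gam i t = q by rewrite qE geodesicE cE sE.
have sB : gsin k (ln i - t) = a * gsin k (ln i) by rewrite gsinB cE sE /A /D; ring.
have tl : t <= ln i.
  rewrite leNgt; apply/negP => lt; have : 0 < gsin k (t - ln i).
    by apply: gsin_gt0 => [|e]; [lra|have := tpi e; lra].
  by rewrite -opprB gsinN sB oppr_gt0 pmulr_llt0// ltNge a0.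
exists t; split=> //; first by rewrite t0.
move=> a1 c1; rewrite !lt_neqAle t0 tl !andbT; apply/andP; split; apply/eqP => e.
  by have := mulr_gt0 c1 s0; rewrite -/D -sE -e gsin0 ltxx.
by have := mulr_gt0 a1 s0; rewrite -sB e subrr gsin0 ltxx.
Qed.

End Edges.

Section PolygonBounded.
Context (k : curvature) (n : nat) (P : polygon R k n).
Implicit Types (a c e : R) (i j : 'I_n).
Hypothesis len_pi : k = Spherical -> forall i, len P i < pi.

Lemma polygon_bounded (b : bool) : (forall i t, 0 < t < len P i -> two_sided P i t b) ->
  bounded_by k (region P) (vtx P) b.
Proof.
move=> ts; split.
- by move=> q sq nq; have [e e0 h] := region_outside sq nq; exists e.
- by move=> q; exact: region_surface.
- move=> q sq nq; have [|e e0 h] := @off_boundary _ _ P q sq; last by exists e.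
  by rewrite (polygon_boundary P) => -[i _ /(segment_edge (polygon_len P) (polygon_next P) len_pi)]; exact: nq.
- move=> i q sq [a [c [a0 c0 qE]]]; rewrite qE in sq *.
  have [t [_ tq /(_ a0 c0)/ts[e e0 h]]] := edge_segment (polygon_vtx P) (polygon_dir P) (polygon_len P) (polygon_next P) len_pi (ltW a0) (ltW c0) sq.
  exists e => // q' sq' nq'; have s0 := gsin_len_gt0 (polygon_len P) len_pi i; rewrite -tq in nq'.
  have [_ h1 h2] := h q' nq'; rewrite nrm_id// in h1 h2.
  by rewrite (det3_edge (polygon_next P)) pmulr_rgt0// pmulr_rlt0.
- move=> i j q sq [a [c [a0 c0 qE]]] [a' [c' [a'0 c'0 qE']]].
  have sq2 := sq; rewrite qE in sq; rewrite qE' in sq2.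
  have [t [_ tq /(_ a0 c0) ht]] := edge_segment (polygon_vtx P) (polygon_dir P) (polygon_len P) (polygon_next P) len_pi (ltW a0) (ltW c0) sq.
  have [s [hs sE _]] := edge_segment (polygon_vtx P) (polygon_dir P) (polygon_len P) (polygon_next P) len_pi a'0 c'0 sq2.
  apply/esym/(edge_point_unique ht); exists s; rewrite /= ?in_itv//=.
  by rewrite sE tq -qE -qE'.
Qed.

End PolygonBounded.

(** * Motions that preserve the area *)

Section Transport.
Implicit Types (a c e : R) (p : space).

(** Orientation preserving linear motions. Invariance of the area is a field, because it is
    established for generating rotations and passes to compositions. *)
Record rigid k (f g : space -> space) : Prop := Rigid {
  rigid_fg : forall q, g (f q) = q;
  rigid_gf : forall q, f (g q) = q;
  rigid_lin : forall a p c q, f (lin a p c q) = lin a (f p) c (f q);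
  rigid_surface : forall q, surface k (f q) <-> surface k q;
  rigid_bil : forall p q, bil k (f p) (f q) = bil k p q;
  rigid_metric : forall p q, metric k (f p) (f q) = metric k p q;
  rigid_det : forall p q u, det3 (f p) (f q) (f u) = det3 p q u;
  rigid_near : exists2 C, 0 < C & forall e p q, near3 e p q -> near3 (C * e) (g p) (g q);
  rigid_closed : forall F, relclosed k F -> relclosed k (g @^-1` F);
  rigid_area : forall F, relclosed k F -> F `<=` surface k ->
    area k (g @^-1` F) = area k F }.

Lemma rigid_id k : rigid k id id.
Proof.
by split=> //; exists 1 => // e p q; rewrite mul1r.
Qed.

Lemma bounded_image k n (f g : space -> space) F (v : 'I_n -> space) (o b : bool) C :
  (forall q, g (f q) = q) -> (forall q, f (g q) = q) ->
  (forall a p c q, f (lin a p c q) = lin a (f p) c (f q)) ->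
  (forall q, surface k (f q) <-> surface k q) ->
  (forall p q u, det3 (f p) (f q) (f u) = (if o then 1 else -1) * det3 p q u) ->
  0 < C -> (forall e p q, near3 e p q -> near3 (C * e) (g p) (g q)) -> relclosed k (g @^-1` F) ->
  bounded_by k F v b -> bounded_by k (g @^-1` F) (f \o v) (if o then b else ~~ b).
Proof.
move=> fg gf fl fs fd C0 hC cl [b1 b2 b3 b4 b5].
have sg q : surface k q -> surface k (g q) by move=> sq; apply/fs; rewrite gf.
have oe i q : on_edge (f \o v) i q -> on_edge v i (g q).
  by move=> [a [c [a0 c0 ->]]]; exists a, c; split=> //; rewrite /= -fl fg.
have we i q : within_edge (f \o v) i q -> within_edge v i (g q).
  by move=> [a [c [a0 c0 ->]]]; exists a, c; split=> //; rewrite /= -fl fg.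
have oe' i q : on_edge v i (g q) -> on_edge (f \o v) i q.
  by move=> [a [c [a0 c0 h]]]; exists a, c; split=> //; rewrite /= -fl -h gf.
have nr e q q' : near3 (e / C) q q' -> near3 e (g q) (g q').
  by move=> /hC; rewrite mulrC divfK ?gt_eqF.
split=> //.
- by move=> q /b2 h; rewrite -(gf q); apply/fs.
- move=> q sq ne; have [|e e0 h] := b3 _ (sg _ sq); first by move=> i /oe'; exact: ne.
  by exists (e / C); [rewrite divr_gt0|move=> q' /sg sq' /nr; exact: h].
- move=> i q sq /we wq; have [e e0 h] := b4 i _ (sg _ sq) wq.
  exists (e / C); [by rewrite divr_gt0|move=> q' /sg sq' /nr /(h _ sq')].
  have -> : det3 ((f \o v) i) ((f \o v) (ordS i)) q' =
      (if o then 1 else -1) * det3 (v i) (v (ordS i)) (g q') by rewrite -fd gf.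
  case: (o) => -[h1 h2]; first by rewrite !mul1r.
  by rewrite !mulN1r oppr_gt0 oppr_lt0 negbK.
- by move=> i j q sq /we wq /oe oq; exact: b5 (sg _ sq) wq oq.
Qed.

Lemma bounded_transport k n f g F (v : 'I_n -> space) b : rigid k f g ->
  bounded_by k F v b -> bounded_by k (g @^-1` F) (f \o v) b.
Proof.
move=> [fg gf fl fs _ _ fd [C C0 hC] cl _] Fv.
apply: (bounded_image (o := true) fg gf fl fs _ C0 hC (cl _ (bounded_closed Fv)) Fv).
by move=> p q u; rewrite fd mul1r.
Qed.

Lemma bounded_swap k n F (v : 'I_n -> space) b :
  bounded_by k F v b -> bounded_by k (swap @^-1` F) (swap \o v) (~~ b).
Proof.
move=> Fv; have sK (q : space) : swap (swap q) = q by case: q => -[].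
apply: (bounded_image (o := false) (C := 1) sK sK _ (surface_swap k) _ ltr01 _ (relclosed_swap (bounded_closed Fv)) Fv).
- by move=> *; apply: eq_space.
- by move=> p q u; rewrite /det3 /=; ring.
- by move=> e p q [h1 h2 h3]; rewrite mul1r; split.
Qed.

Lemma cos_sin_exists (x y : R) : x ^+ 2 + y ^+ 2 = 1 -> exists t, [/\ 0 <= t <= 2 * pi, cos t = x & sin t = y].
Proof.
move=> h; have x1 : -1 <= x <= 1 by have := sqr_ge0 y; nra.
have := @pi_gt0 R; have a0 := acos_ge0 x1; have a1 := acos_lepi x1 => p0.
have ac : cos (acos x) = x by rewrite acosK// in_itv.
have as_ : sin (acos x) = `|y| by rewrite sin_acos// (_ : 1 - x ^+ 2 = y ^+ 2) ?sqrtr_sqr//; lra.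
have [y0|y0] := leP 0 y.
  by exists (acos x); split=> //; [lra|rewrite as_ ger0_norm].
exists (2 * pi - acos x); split; first by lra.
- by rewrite mulr_natl cosB cos2pi sin2pi ac; ring.
- by rewrite mulr_natl sinB cos2pi sin2pi as_ ltr0_norm//; ring.
Qed.

Lemma rigid_comp k f1 g1 f2 g2 : rigid k f1 g1 -> rigid k f2 g2 ->
  rigid k (f2 \o f1) (g1 \o g2).
Proof.
move=> [a1 a2 a3 a4 a5 a6 a7 [C1 C10 a8] a9 a10] [b1 b2 b3 b4 b5 b6 b7 [C2 C20 b8] b9 b10]; split.
- by move=> q /=; rewrite b1 a1.
- by move=> q /=; rewrite a2 b2.
- by move=> a p c q /=; rewrite a3 b3.
- by move=> q /=; rewrite b4 a4.
- by move=> p q /=; rewrite b5 a5.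
- by move=> p q /=; rewrite b6 a6.
- by move=> p q u /=; rewrite b7 a7.
- exists (C1 * C2); first exact: mulr_gt0.
  by move=> e p q /b8/a8; rewrite mulrA.
- by move=> F /a9/b9.
- move=> F cF sF; rewrite comp_preimage b10; [exact: a10|exact: a9|].
  by move=> q /sF h; rewrite -(a2 q); apply/a4.
Qed.

Lemma rollK t q : roll (- t) (roll t q) = q.
Proof.
have e : cos t ^+ 2 = 1 - sin t ^+ 2 by have := cos2Dsin2 t; lra.
by apply: eq_space; rewrite /roll /= ?cosN ?sinN; ring: e.
Qed.

Lemma rigid_roll t : 0 <= t <= 2 * pi -> rigid Spherical (roll (- t)) (roll t).
Proof.
have e : cos t ^+ 2 = 1 - sin t ^+ 2 by have := cos2Dsin2 t; lra.
move=> ht; split.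
- by move=> q; rewrite -{1}(opprK t) rollK.
- by move=> q; rewrite rollK.
- by move=> a p c q; apply: eq_space; rewrite /roll /=; ring.
- by move=> q; exact: surface_roll.
- by move=> p q; rewrite /bil /roll /= cosN sinN; ring: e.
- by move=> p q; rewrite /metric /roll /= cosN sinN; ring: e.
- by move=> p q u; rewrite /det3 /roll /= cosN sinN; ring: e.
- by exists 2 => // e' p q; exact: near3_roll.
- by move=> F; exact: relclosed_roll.
- by move=> F cF sF; exact: area_roll.
Qed.

Lemma det3_swapped p q u : det3 (swap p) (swap q) (swap u) = - det3 p q u.
Proof. by rewrite /det3 /swap /=; ring. Qed.

(** Turns rotations around the x-axis into rotations around the y-axis. *)
Lemma rigid_swap_conj f g : rigid Spherical f g ->
  rigid Spherical (swap \o f \o swap) (swap \o g \o swap).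
Proof.
have sK (q : space) : swap (swap q) = q by case: q => -[].
have sl a (p : space) c q : swap (lin a p c q) = lin a (swap p) c (swap q) by [].
have sn e (p q : space) : near3 e p q -> near3 e (swap p) (swap q) by move=> [h1 h2 h3]; split.
have ss (F : set space) : F `<=` surface Spherical -> swap @^-1` F `<=` surface Spherical.
  by move=> sF q /sF/surface_swap.
move=> [a1 a2 a3 a4 a5 a6 a7 [C1 C10 a8] a9 a10]; split.
- by move=> q /=; rewrite sK a1 sK.
- by move=> q /=; rewrite sK a2 sK.
- by move=> a p c q /=; rewrite sl a3 sl.
- by move=> q /=; rewrite surface_swap a4 surface_swap.
- move=> p q /=; have sb u w : bil Spherical (swap u) (swap w) = bil Spherical u w by rewrite /bil /=; ring.
  by rewrite sb a5 sb.
- move=> p q /=; have sb u w : metric Spherical (swap u) (swap w) = metric Spherical u w by rewrite /metric /=; ring.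
  by rewrite sb a6 sb.
- by move=> p q u /=; rewrite det3_swapped a7 det3_swapped opprK.
- by exists C1 => // e p q /sn/a8/sn.
- by move=> F cF; apply: (relclosed_swap (F := g @^-1` (swap @^-1` F))); apply: a9; exact: relclosed_swap.
- move=> F cF sF; have cF' := relclosed_swap cF; have sF' := ss _ sF.
  rewrite -[LHS]/(area Spherical (swap @^-1` (g @^-1` (swap @^-1` F)))) area_swap.
  + by rewrite a10// area_swap.
  + exact: a9.
  + by move=> q /sF' h; rewrite -(a2 q); apply/a4.
Qed.

(** A rotation around the x-axis brings [m] into the plane y = 0, and one around the y-axis then
    brings it to the pole. *)
Lemma rigid_to_pole m : surface Spherical m -> exists f g, rigid Spherical f g /\ f m = (0, 0, 1).
Proof.
move=> sm; have [hm _] := sm; rewrite /= mul1r in hm.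
pose r := Num.sqrt (m.1.2 ^+ 2 + m.2 ^+ 2).
have h0 : 0 <= m.1.2 ^+ 2 + m.2 ^+ 2 by have := sqr_ge0 m.1.2; have := sqr_ge0 m.2; lra.
have r2 : r ^+ 2 = m.1.2 ^+ 2 + m.2 ^+ 2 by rewrite sqr_sqrtr.
have [t [ht ct st]] : exists t, [/\ 0 <= t <= 2 * pi, r * cos t = m.2 & r * sin t = m.1.2].
  have [r0|r0] := eqVneq r 0.
    exists 0; split; [by rewrite lexx mulr_ge0 ?pi_ge0| |];
      rewrite r0 mul0r; apply/esym/eqP; rewrite -sqrf_eq0; apply/eqP; move: r2; rewrite r0; nra.
  have [|t [ht ct st]] := @cos_sin_exists (m.2 / r) (m.1.2 / r).
    by rewrite !exprMn !exprVn -mulrDl addrC -r2 divff// expf_neq0.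
  by exists t; split=> //; rewrite ?ct ?st mulrC divfK.
have [t' [ht' ct' st']] : exists t, [/\ 0 <= t <= 2 * pi, cos t = r & sin t = m.1.1].
  by apply: cos_sin_exists; rewrite r2; lra.
have rg := rigid_comp (rigid_roll ht) (rigid_swap_conj (rigid_roll ht')).
eexists; eexists; split; first exact: rg.
have e : cos t ^+ 2 + sin t ^+ 2 = 1 by exact: cos2Dsin2.
rewrite /= /roll /swap /= !cosN !sinN ct' st' -ct -st.
have rr : r ^+ 2 = 1 - m.1.1 ^+ 2 by rewrite r2; lra.
have e' : r * (cos t ^+ 2 + sin t ^+ 2) = r by rewrite e mulr1.
apply: eq_space => /=.
- have -> : cos t * (r * cos t) - - sin t * (r * sin t) = r * (cos t ^+ 2 + sin t ^+ 2) by ring.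
  by rewrite e'; ring.
- by ring.
- rewrite (_ : cos t * _ - _ = r * (cos t ^+ 2 + sin t ^+ 2)); last by ring.
  by rewrite e' -expr2 rr; ring.
Qed.

End Transport.

(** * Closed chains shorter than a great circle *)

Section CyclicLength.
Context (n : nat).
Hypothesis n0 : (0 < n)%N.
Implicit Types (f : 'I_n -> R).

Definition windex (m : nat) : 'I_n := Ordinal (ltn_pmod m n0).

Lemma windexS m : windex m.+1 = ordS (windex m).
Proof. by apply/val_inj; rewrite /= -addn1 -modnDml addn1. Qed.

Lemma windex_ord (i : 'I_n) : windex i = i.
Proof. by apply/val_inj; rewrite /= modn_small. Qed.

Lemma windexDn m : windex (m + n) = windex m.
Proof. by apply/val_inj; rewrite /= modnDr. Qed.

Lemma sum_windex f : \sum_(0 <= m < n) f (windex m) = \sum_i f i.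
Proof. by rewrite big_mkord; apply: eq_bigr => i _; rewrite windex_ord. Qed.

Lemma sum_windex_shift f a : \sum_(a <= m < a + n) f (windex m) = \sum_i f i.
Proof.
elim: a => [|a IH]; first by rewrite add0n sum_windex.
rewrite -IH addSn (@big_ltn _ _ _ a)/=; last by rewrite -[ltnLHS]addn0 ltn_add2l.
by rewrite big_nat_recr/= ?windexDn 1?addrC// -[leqLHS]addn0 ltn_add2l.
Qed.

End CyclicLength.

Lemma ler_cos_norm (x y : R) : - y <= x <= y -> y <= pi -> cos y <= cos x.
Proof.
move=> /andP[h1 h2] yp.
have main z : 0 <= z -> z <= y -> cos y <= cos z.
  rewrite le_eqVlt => z0; rewrite le_eqVlt => /predU1P[->//|zy]; rewrite ltW// ltr_cos// in_itv/=.
    by move: z0 zy => /predU1P[<-|]; move=> *; between.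
  by move: z0 zy => /predU1P[<-|]; move=> *; between.
have [x0|x0] := leP 0 x; first exact: main.
by rewrite -(cosN x); apply: main; lra.
Qed.

Section ChainPaths.
Context (k : curvature) (n : nat) (c : 'I_n -> R * R * R).
Hypothesis n0 : (0 < n)%N.
Hypothesis sc : forall i, surface k (c i).
Local Notation dist := (dist k).
Local Notation L := (\sum_i dist (c i) (c (ordS i))).
Local Notation V m := (c (windex n0 m)).
Local Notation l m := (dist (V m) (V m.+1)).

Lemma dist_path a b : (a <= b)%N -> dist (V a) (V b) <= \sum_(a <= m < b) l m.
Proof.
elim: b => [|b IH]; first by rewrite leqn0 => /eqP ->; rewrite big_geq// dist_pp.
rewrite leq_eqVlt => /predU1P[->|]; first by rewrite big_geq// dist_pp.
rewrite ltnS => ab; rewrite big_nat_recr//=.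
by apply: le_trans (dist_triangle (sc _) (sc (windex n0 b)) (sc _)) _; rewrite lerD2r; exact: IH.
Qed.

Lemma sum_sides a : \sum_(a <= m < a + n) l m = L.
Proof.
rewrite -(sum_windex_shift n0 (fun i => dist (c i) (c (ordS i))) a).
by apply: eq_bigr => m _; rewrite windexS.
Qed.

Lemma dist_le_length i j : dist (c i) (c j) <= L.
Proof.
wlog ij : i j / (i <= j)%N => [th|].
  by have [/th//|/ltnW/th] := leqP i j; rewrite distC.
have := dist_path ij; rewrite !windex_ord => /le_trans; apply.
have jn : (j <= i + n)%N by apply: leq_trans (ltnW (ltn_ord j)) _; rewrite leq_addl.
rewrite -(sum_sides i) [leRHS](@big_cat_nat _ _ _ j)//=.
by rewrite lerDl sumr_ge0// => m _; apply: dist_ge0; exact: sc.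
Qed.

(** The remaining sides join the same two points. *)
Lemma side_le_half i : dist (c i) (c (ordS i)) <= L / 2.
Proof.
have i0 : (i < i + n)%N by rewrite -[ltnLHS]addn0 ltn_add2l.
have := sum_sides i; rewrite big_ltn//; have := @dist_path i.+1 (i + n) i0.
by rewrite windexDn distC !windexS windex_ord; lra.
Qed.

End ChainPaths.

Section Hemisphere.
Context (n : nat) (c : 'I_n -> R * R * R).
Hypothesis n0 : (0 < n)%N.
Hypothesis sc : forall i, surface Spherical (c i).
Local Notation dist := (dist Spherical).
Local Notation bil := (bil Spherical).
Local Notation L := (\sum_i dist (c i) (c (ordS i))).
Let V m := c (windex n0 m).
Let l m := dist (V m) (V m.+1).

Let sV m : surface Spherical (V m).
Proof. exact: sc. Qed.

Let path_le a b : (a <= b)%N -> dist (V a) (V b) <= \sum_(a <= m < b) l m.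
Proof. exact: dist_path. Qed.

(* The centre is the midpoint of two points that halve the closed chain. *)
Lemma in_hemisphere : L < 2 * pi -> exists m, [/\ surface Spherical m,
  forall i, cos (L / 4) <= bil m (c i) &
  forall o, (forall i, 0 < bil o (c i)) -> 0 < bil o m].
Proof.
move=> short; have pi0 := @pi_gt0 R.
have L0 : 0 <= L by apply: sumr_ge0 => j _; exact: dist_ge0.
have Ssum : \sum_(0 <= m < n) l m = L by rewrite -(sum_sides Spherical c n0 0) add0n.
have exn : L / 2 <= \sum_(0 <= m < n.-1.+1) l m by rewrite prednK// Ssum; lra.
have ex : exists j : nat, L / 2 <= \sum_(0 <= m < j.+1) l m by exists n.-1.
(* Side [j] contains the point [q] at half the total length from [V 0], at distance [t] from the
   start of the side. *)
case: (ex_minnP ex) => j hj jmin.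
have jn : (j < n)%N by have := jmin _ exn; rewrite -ltnS prednK.
pose S := \sum_(0 <= m < j) l m.
have Sj : S <= L / 2.
  rewrite leNgt; apply/negP => h; have [j0|j0] := posnP j.
    by move: h; rewrite /S j0 big_geq//; lra.
  by have := jmin j.-1; rewrite prednK// => /(_ (ltW h)); rewrite -ltnS prednK// ltnn.
pose t := L / 2 - S; have t0 : 0 <= t by rewrite /t; lra.
have tl : t <= l j by move: hj; rewrite big_nat_recr//= -/S /t; lra.
have ljL : l j <= L / 2 by rewrite /l /V windexS; exact: side_le_half.
have ljp : l j < pi by lra.
have [u tu ju] : exists2 u, unit_tangent Spherical (V j) u & geodesic Spherical (V j) u (l j) = V j.+1.
  apply: exists_join => // _ e; have := spherical_dist_antipode (sV j).
  by rewrite -e distC -/(l j); lra.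
pose q := geodesic Spherical (V j) u t.
have sq : surface Spherical q by exact: geodesic_surface.
have d1 : dist (V j) q = t by apply: dist_geodesic => // _; lra.
have d2 : dist q (V j.+1) = l j - t.
  rewrite -ju; have -> : geodesic Spherical (V j) u (l j) = geodesic Spherical q (vel Spherical (V j) u t) (l j - t).
    by rewrite /q geodesic_shift; congr geodesic; ring.
  apply: (dist_geodesic sq (vel_unit t (sV j) tu)); first by rewrite subr_ge0.
  by move=> _; lra.
(* [V 0] and [q] cut the chain into two paths of length [L / 2], and every vertex lies on one of
   them. *)
have key m : (m < n)%N -> dist (V 0) (V m) + dist (V m) q <= L / 2.
  move=> mn; have [mj|jm] := leqP m j.
    have h1 := path_le (leq0n m); have h2 := path_le mj.
    have := dist_triangle (sV m) (sV j) sq; rewrite d1.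
    have : S = \sum_(0 <= m' < m) l m' + \sum_(m <= m' < j) l m' by rewrite -big_cat_nat.
    by rewrite /t in d1 *; lra.
  have h1 := path_le jm; have h2 := path_le (ltnW mn).
  have e : V n = V 0 by rewrite /V -[n in windex _ n]add0n windexDn.
  rewrite e in h2; have h3 := dist_triangle (sV m) (sV j.+1) sq.
  rewrite (distC _ (V j.+1) q) d2 (distC _ (V m) (V j.+1)) in h3.
  have : L = S + l j + \sum_(j.+1 <= m' < m) l m' + \sum_(m <= m' < n) l m'.
    rewrite -Ssum (@big_cat_nat _ _ _ m)//= 1?ltnW// (@big_cat_nat _ _ _ j.+1)//= big_nat_recr//=.
  by rewrite (distC _ (V 0)); move: h1 h2 h3; rewrite /t; lra.
have D0 := dist_ge0 (sV 0) sq; set D := dist (V 0) q in D0.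
have DL : D <= L / 2 by have := key 0 n0; rewrite dist_pp add0r.
have gD : 0 < cos (D / 2) by apply: cos_gt0_pihalf; between.
pose w := lin 1 (V 0) 1 q.
have bw : bil w w = (2 * cos (D / 2)) ^+ 2.
  have gen (x z : R * R * R) : surface Spherical x -> surface Spherical z ->
      bil (lin 1 x 1 z) (lin 1 x 1 z) = 2 + 2 * bil x z.
    by move=> sx sz; rewrite !bil_lin (surface_bil sx) (surface_bil sz) (bilC _ z); ring.
  rewrite /w gen// (bil_dist (sV 0) sq) -/D.
  by rewrite (_ : gcos _ (dist (V 0) q) = cos (D / 2 + D / 2)) /=; [rewrite cosD -!expr2 sin2cos2; ring|congr cos; rewrite -/D; field].
have bw0 : 0 < bil w w by rewrite bw exprn_gt0// mulr_gt0.
exists (nrm Spherical w); split; first by apply: nrm_surface; split.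
- move=> i; rewrite /nrm bil_linl mul0r addr0 bw sqrtr_sqr gtr0_norm ?mulr_gt0//.
  have := key i (ltn_ord i); rewrite /V windex_ord => hk.
  set p0 := c (windex n0 0) in hk; rewrite /w bil_linl !mul1r -/(V 0) -/p0.
  have sp0 : surface Spherical p0 by exact: sc.
  rewrite (bil_dist sp0 (sc i)) (bilC _ q) (bil_dist (sc i) sq) /=.
  have h1 := dist_triangle sp0 (sc i) sq; have h2 := dist_triangle (sc i) sp0 sq; have h3 := dist_triangle sp0 sq (sc i).
  rewrite (distC _ (c i) p0) in h2; rewrite (distC _ q (c i)) in h3.
  change (dist p0 q) with D in h1, h2, h3.
  set a := dist p0 (c i) in hk h1 h2 h3 *; set b := dist (c i) q in hk h1 h2 h3 *.
  (* Sum to product: the half-sum [(a + b) / 2] is at most [L / 4], and the half-difference is at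
     most [D / 2], which compensates the normalization of the midpoint. *)
  have -> : cos a + cos b = 2 * cos ((a + b) / 2) * cos ((a - b) / 2).
    have -> : cos a = cos ((a + b) / 2 + (a - b) / 2) by congr cos; field.
    have -> : cos b = cos ((a + b) / 2 - (a - b) / 2) by congr cos; field.
    by rewrite cosD cosB; ring.
  have ab : cos (L / 4) <= cos ((a + b) / 2).
    by apply: ler_cos_norm; [apply/andP; split|]; lra.
  have dd : cos (D / 2) <= cos ((a - b) / 2).
    by apply: ler_cos_norm; [apply/andP; split|]; lra.
  have L4 : 0 < cos (L / 4) by apply: cos_gt0_pihalf; between.
  have -> : (2 * cos (D / 2))^-1 * (2 * cos ((a + b) / 2) * cos ((a - b) / 2)) =
    cos ((a + b) / 2) * cos ((a - b) / 2) / cos (D / 2) by field; rewrite gt_eqF.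
  rewrite ler_pdivlMr// ler_pM//; exact: ltW.
- move=> o ho; rewrite /nrm bil_linr mul0r addr0 mulr_gt0 ?invr_gt0 ?sqrtr_gt0//.
  rewrite /w bil_linr !mul1r addr_gt0//; first exact: ho.
  have [e|tpos] := eqVneq t 0.
    by rewrite /q e geodesicE /= cos0 sin0 bil_linr mul1r mul0r addr0; exact: ho.
  have sl : 0 < sin (l j) by apply: sin_gt0_pi; apply/andP; split=> //; lra.
  have st : 0 < sin t by apply: sin_gt0_pi; between.
  have sd : 0 <= sin (l j - t) by apply: sin_ge0_pi; between.
  rewrite -(pmulr_rgt0 _ sl).
  have -> : sin (l j) * bil o q = sin (l j - t) * bil o (V j) + sin t * bil o (V j.+1).
    by rewrite -ju /q !geodesicE /= !bil_linr sinB; ring.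
  by rewrite ltr_wpDl ?mulr_ge0 ?mulr_gt0// ?ltW//; exact: ho.
Qed.

End Hemisphere.

(** * From polygons to chains of vertices *)

Section ShortPolygon.
Context (n : nat) (P : polygon R Spherical n).
Hypothesis n0 : (0 < n)%N.
Local Notation dist := (dist Spherical).
Local Notation L := (\sum_i dist (vtx P i) (vtx P (ordS i))).

Let dist_side i : dist (vtx P i) (vtx P (ordS i)) <= len P i.
Proof.
rewrite -polygon_next; have [lp|/ltW lp] := leP (len P i) pi.
  by rewrite dist_geodesic//; [exact: polygon_vtx|exact: polygon_dir|exact/ltW/polygon_len].
by apply: le_trans (dist_lepi _ _ _) lp => //; [exact: polygon_vtx|exact: gam_surface].
Qed.

Lemma chain_le_perimeter : L <= perimeter P.
Proof. by apply: ler_sum => i _; exact: dist_side. Qed.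

(** The ends of a side of length at least [pi] are at distance [2 * pi - len P i]. The other sides
    have to cover this distance, so the perimeter would be at least [2 * pi]. *)
Lemma len_lt_pi i : perimeter P < 2 * pi -> len P i < pi.
Proof.
move=> short; rewrite ltNge; apply/negP => lp.
have l2 : L - dist (vtx P i) (vtx P (ordS i)) <= perimeter P - len P i.
  rewrite /perimeter (bigD1 i)//= [X in _ <= X - _](bigD1 i)//= !(addrC _ (\sum_(_ | _) _)) !addrK.
  by apply: ler_sum => j _; exact: dist_side.
have l3 : len P i <= perimeter P.
  by rewrite /perimeter (bigD1 i)//= lerDl sumr_ge0// => j _; exact/ltW/polygon_len.
have := side_le_half n0 (polygon_vtx P) i.
have e : dist (vtx P i) (vtx P (ordS i)) = 2 * pi - len P i.
  rewrite -polygon_next.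
  have -> : geodesic Spherical (vtx P i) (dir P i) (len P i) =
      geodesic Spherical (vtx P i) (lin (-1) (dir P i) 0 (dir P i)) (2 * pi - len P i).
    rewrite !geodesicE /= mulr_natl cosB sinB cos2pi sin2pi.
    by coords.
  by rewrite dist_geodesic//; [exact: polygon_vtx|exact/unit_tangentN/polygon_dir|lra|lra].
by rewrite e in l2 *; lra.
Qed.

End ShortPolygon.

Lemma rigid_chord2 k f g p q : rigid k f g -> chord2 k (f p) (f q) = chord2 k p q.
Proof. by move=> rg; rewrite !chord2_metric !(rigid_metric rg). Qed.

(** On the sphere the bound on the perimeter provides a half-sphere that holds the boundary, and the
    bound on the area places the region in it. The sign records on which side of its boundary the
    region lies. *)
Lemma polygon_chain k n (P : polygon R k n) (A : R) : (0 < n)%N -> area k (region P) = A%:E ->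
  (k = Spherical -> A < 2 * pi) -> (k = Spherical -> perimeter P < 2 * pi) ->
  exists f g b, [/\ rigid k f g, forall i, upper k (f (vtx P i)),
    bounded_by k (g @^-1` region P) (f \o vtx P) b,
    forall i, dist k (f (vtx P i)) (f (vtx P (ordS i))) = len P i &
    A = (if b then 1 else -1) * \sum_i tri k (f (vtx P i)) (f (vtx P (ordS i)))].
Proof.
move=> n0 aP A2 short.
have lenpi : k = Spherical -> forall i, len P i < pi.
  by move=> e; subst k => i; apply: (len_lt_pi n0); exact: short.
have [b ts] := polygon_orientation P.
have bd := polygon_bounded lenpi ts.
have [f [g [rg up]]] : exists f g, rigid k f g /\ forall i, upper k (f (vtx P i)).
  case: (pselect (k = Spherical)) => [e|nk]; last first.
    exists id, id; split; first exact: rigid_id.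
    by move=> i; have s := polygon_vtx P i; split=> //; exact: s.2.
  subst k; have short' := le_lt_trans (chain_le_perimeter P) (short erefl).
  have [m [sm hm _]] := in_hemisphere n0 (polygon_vtx P) short'.
  have [f [g [rg fm]]] := rigid_to_pole sm; exists f, g; split=> // i.
  split; first by apply/(rigid_surface rg); exact: polygon_vtx.
  have L0 : 0 <= \sum_i dist Spherical (vtx P i) (vtx P (ordS i)).
    by apply: sumr_ge0 => j _; apply: dist_ge0; exact: polygon_vtx.
  have c0 : 0 < cos ((\sum_i dist Spherical (vtx P i) (vtx P (ordS i))) / 4).
    by apply: cos_gt0_pihalf; have := @pi_gt0 R; move=> h; between.
  by have := hm i; rewrite -(rigid_bil rg) fm /bil /=; lra.
exists f, g, b; have bd' := bounded_transport rg bd; split=> //.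
- move=> i; rewrite /dist (rigid_chord2 _ _ rg) -/(dist k _ _) -(polygon_next P i).
  apply: dist_geodesic; [exact: polygon_vtx|exact: polygon_dir|exact/ltW/polygon_len|].
  by move=> e; have := lenpi e i; lra.
- have aE : area k (g @^-1` region P) = A%:E.
    by rewrite (rigid_area rg)//; [exact: bounded_closed bd|exact: bounded_surface bd].
  have fin : (area k (g @^-1` region P) < +oo)%E by rewrite aE ltry.
  have sph : k = Spherical -> (area k (g @^-1` region P) < (2 * pi)%:E)%E.
    by move=> e; rewrite aE lte_fin; exact: A2.
  have Fup q : (g @^-1` region P) q -> 0 < q.2 by apply: bounded_upper bd' _ sph.
  by have := green_area up bd' Fup (finite_slices bd' Fup fin); rewrite aE => -[].
Qed.

(** * First variation of the area of a triangle *)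

Section CurveDerivatives.
Implicit Types (a b : R) (p u v m : space) (c d : R -> space).

Definition has_der3 c s xi : Prop :=
  [/\ has_der (fun t => (c t).1.1) s xi.1.1, has_der (fun t => (c t).1.2) s xi.1.2 &
      has_der (fun t => (c t).2) s xi.2].

Lemma der3_eq c s xi xi' : has_der3 c s xi -> xi = xi' -> has_der3 c s xi'.
Proof. by move=> ? <-. Qed.

Lemma der3_cst v s : has_der3 (fun=> v) s 0.
Proof. by split; exact: der_cst. Qed.

Lemma der_bil k c d s xi et : has_der3 c s xi -> has_der3 d s et ->
  has_der (fun t => bil k (c t) (d t)) s (bil k xi (d s) + bil k (c s) et).
Proof.
move=> [c1 c2 c3] [d1 d2 d3]; apply: der_eq.
  apply: derD; last exact: derM c3 d3.
  by apply: derM; [exact: der_cst|apply: derD; [exact: derM c1 d1|exact: derM c2 d2]].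
by rewrite /bil /=; ring.
Qed.

Lemma der_det3 c d (e : R -> space) s xi et ze : has_der3 c s xi -> has_der3 d s et -> has_der3 e s ze ->
  has_der (fun t => det3 (c t) (d t) (e t)) s
    (det3 xi (d s) (e s) + det3 (c s) et (e s) + det3 (c s) (d s) ze).
Proof.
move=> [c1 c2 c3] [d1 d2 d3] [e1 e2 e3]; apply: der_eq.
  apply: derD; first apply: derB.
  - by apply: derM; [exact: c1|apply: derB; [exact: derM d2 e3|exact: derM d3 e2]].
  - by apply: derM; [exact: c2|apply: derB; [exact: derM d1 e3|exact: derM d3 e1]].
  - by apply: derM; [exact: c3|apply: derB; [exact: derM d1 e2|exact: derM d2 e1]].
by rewrite /det3 /=; ring.
Qed.

Lemma der3_lin (a b : R -> R) c d s da db xi et : has_der a s da -> has_der b s db ->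
  has_der3 c s xi -> has_der3 d s et ->
  has_der3 (fun t => lin (a t) (c t) (b t) (d t)) s
    (lin 1 (lin da (c s) (a s) xi) 1 (lin db (d s) (b s) et)).
Proof.
move=> ha hb [c1 c2 c3] [d1 d2 d3]; split=> /=;
  (apply: der_eq; [by apply: derD; apply: derM; eassumption|ring]).
Qed.

Lemma der3_nrm k c s xi : has_der3 c s xi -> 0 < bil k (c s) (c s) ->
  let N := Num.sqrt (bil k (c s) (c s)) in
  has_der3 (fun t => nrm k (c t)) s (lin N^-1 xi (- bil k (c s) xi / N ^+ 3) (c s)).
Proof.
move=> hc B0 N; have N0 : 0 < N by rewrite sqrtr_gt0.
have hb := der_bil k hc hc.
have hn : has_der (fun t => (Num.sqrt (bil k (c t) (c t)))^-1) s (- bil k (c s) xi / N ^+ 3).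
  apply: der_eq; first by apply: derV; [|apply: der_sqrt; [exact: B0|exact: hb]]; rewrite gt_eqF.
  by rewrite /= -/N (bilC k xi); field; rewrite gt_eqF.
by apply: der3_eq (der3_lin hn (der_cst 0 s) hc hc) _; coords.
Qed.

Lemma der0_const (f : R -> R) a b : a < b -> (forall y, a <= y <= b -> has_der f y 0) -> f b = f a.
Proof.
move=> ab hf; have := @integral_der f (fun=> 0) a b ab hf (fun y _ => @cst_continuous _ _ _ y).
by rewrite integral0 => -[] e; apply/eqP; rewrite -subr_eq0 -e.
Qed.

Definition origin : space := (0, 0, 1).

(** [tri] with a free point in place of the pole. *)
Definition tri3 k m p q : R :=
  2 * gatan k (det3 m p q / (1 + bil k m p + bil k p q + bil k q m)).

Lemma tri3_origin k p q : tri k p q = tri3 k origin p q.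
Proof.
rewrite /tri /tri3; congr (_ * gatan k (_ / _)); first by rewrite /det3 /=; ring.
by rewrite [bil k origin p]/bil [bil k q origin]/bil /=; ring.
Qed.

Lemma tri3_cycle k m p q : tri3 k m p q = tri3 k p q m.
Proof. by rewrite /tri3 det3_cycle; congr (_ * gatan k (_ / _)); ring. Qed.

Lemma tri3_id k m p q : surface k m -> surface k p -> surface k q ->
  (1 + bil k m p + bil k p q + bil k q m) ^+ 2 + (K k * det3 m p q) ^+ 2 =
  2 * (1 + bil k m p) * (1 + bil k p q) * (1 + bil k q m).
Proof.
move=> hm hp hq; have [bm bp bq] := And3 (surface_bil hm) (surface_bil hp) (surface_bil hq).
have gram : (K k * det3 m p q) ^+ 2 = 1 + 2 * bil k m p * bil k p q * bil k q m -
    bil k m p ^+ 2 - bil k p q ^+ 2 - bil k q m ^+ 2.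
  transitivity (bil k m m * bil k p p * bil k q q + 2 * bil k m p * bil k p q * bil k q m -
    bil k q q * bil k m p ^+ 2 - bil k m m * bil k p q ^+ 2 - bil k p p * bil k q m ^+ 2).
    by rewrite /bil /det3; ring.
  by rewrite bm bp bq; ring.
by rewrite gram; ring.
Qed.

(** Signed rate at which the segment from [p] to [m] sweeps area when [m] moves with velocity [xi]:
    the area form of polar coordinates around [p]. *)
Definition edge_form k m p xi : R := det3 m p xi / (1 + bil k m p).

Lemma der_tri3 k (m p q : R -> space) s xm xp xq :
  has_der3 m s xm -> has_der3 p s xp -> has_der3 q s xq ->
  surface k (m s) -> surface k (p s) -> surface k (q s) ->
  bil k (m s) xm = 0 -> bil k (p s) xp = 0 -> bil k (q s) xq = 0 ->
  -1 < bil k (m s) (p s) -> -1 < bil k (p s) (q s) -> -1 < bil k (q s) (m s) ->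
  0 < 1 + bil k (m s) (p s) + bil k (p s) (q s) + bil k (q s) (m s) ->
  has_der (fun t => tri3 k (m t) (p t) (q t)) s
    (edge_form k (m s) (q s) xm - edge_form k (m s) (p s) xm +
     (edge_form k (p s) (m s) xp - edge_form k (p s) (q s) xp) +
     (edge_form k (q s) (p s) xq - edge_form k (q s) (m s) xq)).
Proof.
move=> hm hp hq sm sp sq tm tp tq mp pq qm D0; apply: der_eq.
  apply: (@der_gatan_div k (fun t => det3 (m t) (p t) (q t))
    (fun t => 1 + bil k (m t) (p t) + bil k (p t) (q t) + bil k (q t) (m t))).
  - by rewrite gt_eqF.
  - exact: (der_det3 hm hp hq).
  - apply: (derD _ (der_bil k hq hm)); apply: (derD _ (der_bil k hp hq)).
    exact: (derD (der_cst 1 s) (der_bil k hm hp)).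
rewrite /= (tri3_id sm sp sq) /edge_form add0r.
have [bm bp bq] := And3 (surface_bil sm) (surface_bil sp) (surface_bil sq).
move: (m s) (p s) (q s) sm sp sq tm tp tq mp pq qm D0 bm bp bq => M P Q _ _ _ tm tp tq mp pq qm D0 bm bp bq.
(* Motion of one vertex only. The identity comes from the linear relation between the four vectors
   [a], [b], [c], [xi] in space, paired with [a], [b] and [c] through [e0]. *)
have key (a b c xi : space) : bil k a a = 1 -> bil k b b = 1 -> bil k c c = 1 -> bil k a xi = 0 ->
    det3 xi b c * (1 + bil k a b + bil k b c + bil k c a) - det3 a b c * (bil k xi b + bil k c xi) =
    (1 + bil k b c) * (det3 a c xi * (1 + bil k a b) - det3 a b xi * (1 + bil k a c)).
  move=> ha hb hc hx.
  have e0 (z : space) : det3 a b c * bil k xi z =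
      det3 xi b c * bil k a z + det3 a xi c * bil k b z + det3 a b xi * bil k c z.
    by rewrite /det3 /bil; ring.
  have eb := e0 b; have ec := e0 c; have ea := e0 a.
  rewrite hb in eb; rewrite hc in ec; rewrite (bilC k xi a) hx ha mulr0 mulr1 in ea.
  have s1 : det3 xi b c = - det3 a xi c * bil k a b - det3 a b xi * bil k a c.
    by rewrite (bilC k a b) (bilC k a c); lra.
  have e1 : det3 a b c * (bil k xi b + bil k c xi) = det3 xi b c * (bil k a b + bil k c a) +
      (1 + bil k b c) * (det3 a xi c + det3 a b xi).
    by rewrite mulrDr (bilC k c xi) eb ec (bilC k c a) (bilC k c b); ring.
  rewrite e1 (det3_swap23 a c xi) [X in X = _](_ : _ = (1 + bil k b c) * (det3 xi b c - (det3 a xi c + det3 a b xi))); last by ring.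
  by rewrite s1; ring.
have n1 : 1 + bil k M P != 0 by rewrite gt_eqF//; lra.
have n2 : 1 + bil k P Q != 0 by rewrite gt_eqF//; lra.
have n3 : 1 + bil k Q M != 0 by rewrite gt_eqF//; lra.
have k1 := key M P Q xm bm bp bq tm; have k2 := key P Q M xp bp bq bm tp; have k3 := key Q M P xq bq bm bp tq.
have c1 : det3 P Q M = det3 M P Q by rewrite [RHS]det3_cycle.
have c2 : det3 Q M P = det3 M P Q by rewrite [LHS]det3_cycle.
have c3 : det3 xp Q M = det3 M xp Q by rewrite [RHS]det3_cycle.
have c4 : det3 xq M P = det3 M P xq by rewrite [LHS]det3_cycle.
rewrite c1 c3 in k2; rewrite c2 c4 in k3.
rewrite (bilC k Q P) (bilC k M Q) (bilC k P M).
rewrite (bilC k M Q) in k1; rewrite (bilC k P M) in k2; rewrite (bilC k Q P) in k3.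
have num : (det3 xm P Q + det3 M xp Q + det3 M P xq) *
      (1 + bil k M P + bil k P Q + bil k Q M) -
    det3 M P Q * (bil k xm P + bil k M xp + (bil k xp Q + bil k P xq) + (bil k xq M + bil k Q xm)) =
    (1 + bil k P Q) * (det3 M Q xm * (1 + bil k M P) - det3 M P xm * (1 + bil k Q M)) +
    (1 + bil k Q M) * (det3 P M xp * (1 + bil k P Q) - det3 P Q xp * (1 + bil k M P)) +
    (1 + bil k M P) * (det3 Q P xq * (1 + bil k Q M) - det3 Q M xq * (1 + bil k P Q)).
  by rewrite -k1 -k2 -k3; ring.
rewrite ?add0r num; field; exact/and3P.
Qed.

Lemma upper_origin k : upper k origin.
Proof. by split=> //; split=> //=; ring. Qed.

Lemma bil_origin k p : bil k origin p = p.2.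
Proof. by rewrite /bil /=; ring. Qed.

(** The apex moves from the pole to [m]. By [der_tri3] the rates of the triangles are differences of
    [edge_form] terms that cancel, so the defect is constant, and it is zero at the pole. The two
    positivity hypotheses keep the moving apex on the good side of [p] and [q]. *)
Lemma tri3_cocycle k m p q : upper k m -> upper k p -> upper k q ->
  0 < bil k m p -> 0 < bil k m q -> tri3 k m p q = tri k m p + tri k p q + tri k q m.
Proof.
move=> um up uq mp mq.
pose ga t := nrm k (lin (1 - t) origin t m).
have main t : 0 <= t <= 1 -> [/\ upper k (ga t), 0 < bil k (ga t) p, 0 < bil k (ga t) q &
    exists2 xi, has_der3 ga t xi & bil k (ga t) xi = 0].
  move=> /andP[t0 t1]; have a0 : 0 <= 1 - t by lra.
  have [B0 _ _ ug] := upper_nrm (upper_origin k) um a0 t0 ltac:(lra).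
  have pos z : upper k z -> 0 < bil k m z -> 0 < bil k (ga t) z.
    move=> uz mz; rewrite /ga /nrm bil_linl mul0r addr0 mulr_gt0 ?invr_gt0 ?sqrtr_gt0//.
    rewrite bil_linl bil_origin; have z0 := uz.2.
    move: a0 t0; rewrite !le_eqVlt => /predU1P[a0|a0] /predU1P[t0|t0]; first by lra.
    - by rewrite -a0 mul0r add0r mulr_gt0.
    - by rewrite -t0 mul0r addr0 mulr_gt0.
    - by rewrite addr_gt0// mulr_gt0.
  split=> //; [exact: pos|exact: pos|].
  have hl : has_der3 (fun t => lin (1 - t) origin t m) t (lin (-1) origin 1 m).
    have ha : has_der (fun t : R => 1 - t) t (-1).
      by apply: der_eq; [apply: derB; [exact: der_cst|exact: der_id]|rewrite sub0r].
    by apply: der3_eq (der3_lin ha (der_id t) (der3_cst origin t) (der3_cst m t)) _; coords.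
  have := der3_nrm hl B0; set w := lin (1 - t) origin t m in B0 *; set N := Num.sqrt _ => hN.
  eexists; first exact: hN.
  have N0 : 0 < N by rewrite sqrtr_gt0.
  have N2 : N ^+ 2 = bil k w w by rewrite sqr_sqrtr// ltW.
  have -> : ga t = lin N^-1 w 0 w by [].
  move: (lin (-1) origin 1 m) {hN} => z; move: w N N0 N2 B0 => w N N0 N2 B0.
  rewrite !bil_lin -N2; field; by rewrite gt_eqF.
have D (t : R) : 0 <= t <= 1 ->
    has_der (fun t => tri3 k (ga t) p q - tri3 k (ga t) p origin - tri3 k (ga t) origin q) t 0.
  move=> /main[ug gp gq [xi hx tx]].
  have pq := upper_bilN1 up uq; have o1 := up.2; have o2 := uq.2; have o3 := ug.2.
  have b1 : bil k p origin = p.2 by rewrite bilC bil_origin.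
  have b2 : bil k q origin = q.2 by rewrite bilC bil_origin.
  have b3 : bil k (ga t) origin = (ga t).2 by rewrite bilC bil_origin.
  have z0 (z : space) : bil k z 0 = 0 by rewrite /bil /=; ring.
  have e0 (a b : space) : edge_form k a b 0 = 0 by rewrite /edge_form /det3 /=; ring.
  have h1 := der_tri3 hx (der3_cst p t) (der3_cst q t) ug.1 up.1 uq.1 tx (z0 p) (z0 q).
  have h2 := der_tri3 hx (der3_cst p t) (der3_cst origin t) ug.1 up.1 (upper_origin k).1 tx (z0 p) (z0 origin).
  have h3 := der_tri3 hx (der3_cst origin t) (der3_cst q t) ug.1 (upper_origin k).1 uq.1 tx (z0 origin) (z0 q).
  rewrite !e0 ?(bil_origin, b1, b2, b3, bilC k q (ga t)) in h1 h2 h3.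
  apply: der_eq; first by apply: derB; [apply: derB; [apply: h1; lra|apply: h2; lra]|apply: h3; lra].
  by ring.
have := der0_const ltr01 D.
have -> : ga 1 = m.
  by rewrite /ga (_ : lin _ _ _ _ = m) ?nrm_id//; [exact: um.1|coords].
have -> : ga 0 = origin.
  by rewrite /ga (_ : lin _ _ _ _ = origin) ?nrm_id//; [exact: (upper_origin k).1|coords].
have d0 (a b : space) : tri3 k a b origin = tri k a b by rewrite -tri3_cycle tri3_origin.
have e1 : tri3 k m origin q = tri k q m by rewrite tri3_origin tri3_cycle.
have e2 : tri3 k origin p origin = 0.
  by rewrite /tri3 (_ : det3 _ _ _ = 0) ?mul0r ?gatan0 ?mulr0//; rewrite /det3 /=; ring.
have e3 : tri3 k origin origin q = 0.
  by rewrite /tri3 (_ : det3 _ _ _ = 0) ?mul0r ?gatan0 ?mulr0//; rewrite /det3 /=; ring.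
rewrite d0 e1 e2 e3 -tri3_origin; lra.
Qed.

(** The half-turn about the midpoint of [m] and the pole, which exchanges them: twice the projection
    onto [m + origin] for [bil], minus the identity. In the flat case it is a point reflection. *)
Definition half_turn k m q : space :=
  let c := lin 1 m 1 origin in lin (2 * bil k q c / bil k c c) c (-1) q.

Section HalfTurn.
Variables (k : curvature) (m : space).
Hypothesis um : upper k m.
Local Notation h := (half_turn k m).
Local Notation c := (lin 1 m 1 origin).

Let cc : bil k c c = 2 * (1 + m.2).
Proof. by rewrite !bil_lin (surface_bil um.1) bilC bil_origin /bil /=; ring. Qed.

Let cc0 : bil k c c != 0.
Proof. by rewrite cc gt_eqF//; have := um.2; lra. Qed.

Lemma half_turn_bil p q : bil k (h p) (h q) = bil k p q.
Proof.
rewrite /half_turn; move: cc0; generalize c => d d0.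
by rewrite !bil_lin (bilC k d q); field.
Qed.

Lemma half_turn_center : h m = origin.
Proof.
have e : bil k m c = 1 + m.2 by rewrite bil_linr (surface_bil um.1) bilC bil_origin; ring.
have mm : 1 + m.2 != 0 by rewrite gt_eqF//; have := um.2; lra.
rewrite /half_turn e cc (_ : _ / _ = 1); last by field.
by coords.
Qed.

Lemma half_turn_snd p : (h p).2 = bil k m p.
Proof.
have e : bil k origin c = 1 + m.2 by rewrite bil_linr bil_origin /bil /=; ring.
have mm : 1 + m.2 != 0 by rewrite gt_eqF//; have := um.2; lra.
rewrite /half_turn cc (bilC k p c) bil_linl bil_origin /=; field; exact: mm.
Qed.

Lemma half_turn_upper p : surface k p -> 0 < bil k m p -> upper k (h p).
Proof.
move=> sp mp; have z : 0 < (h p).2 by rewrite half_turn_snd.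
by split=> //; split=> //; have := half_turn_bil p p; rewrite (surface_bil sp) /bil => <-; ring.
Qed.

Lemma half_turn_chord2 p q : surface k p -> surface k q -> 0 < bil k m p -> 0 < bil k m q ->
  chord2 k (h p) (h q) = chord2 k p q.
Proof.
move=> sp sq mp mq.
case: (pselect (k = Flat)) => [e|k0]; last first.
  by rewrite !chord2_nonflat ?half_turn_bil//; apply: (half_turn_upper _ _).1.
have one (z : space) : surface k z -> z.2 = 1.
  by rewrite e => -[/= h1 /(_ ltac:(by []))]; nra.
have mm := one _ um.1; have pp := one _ sp; have qq := one _ sq.
rewrite /half_turn cc mm (bilC k p) (bilC k q) !bil_linl !bil_origin.
by rewrite e /bil /chord2 /= mm pp qq; field.
Qed.

Lemma half_turn_det p q w : det3 (h p) (h q) (h w) = det3 p q w.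
Proof.
rewrite /half_turn; move: cc0; generalize c => d d0.
have key : bil k p d * det3 d q w + bil k q d * det3 p d w + bil k w d * det3 p q d = bil k d d * det3 p q w.
  by rewrite /bil /det3; ring.
have e : det3 p q w = (bil k p d * det3 d q w + bil k q d * det3 p d w + bil k w d * det3 p q d) / bil k d d.
  by rewrite key; field.
have exp a b g : det3 (lin a d (-1) p) (lin b d (-1) q) (lin g d (-1) w) =
   a * det3 d q w + b * det3 p d w + g * det3 p q d - det3 p q w by rewrite /det3 /=; ring.
by rewrite exp e; field.
Qed.

End HalfTurn.

End CurveDerivatives.

(** * Existence of shortest chains *)

Section Minimization.
Implicit Types (p m u xi : space).

Lemma compact_minimizer (T : topologicalType) (B E : set T) (F G : T -> R) (A0 : R) :
  compact B -> closed E -> E `<=` B -> (forall v, E v -> {for v, continuous F}) ->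
  (forall v, E v -> {for v, continuous G}) -> (exists2 v, E v & A0 <= F v) ->
  exists v, [/\ E v, A0 <= F v & forall w, E w -> A0 <= F w -> G v <= G w].
Proof.
move=> cB cE EB cF cG [v0 Ev0 Fv0].
pose E' := [set v | E v /\ A0 <= F v].
have clE : closed E'.
  move=> v cv; have Ev : E v by apply: cE => U /cv [w [[Ew _] Uw]]; exists w.
  split=> //; rewrite leNgt; apply/negP => Fv.
  have := cF v Ev _ (lt_nbhsl Fv); rewrite nbhs_simpl => /cv [w [[_ h] /=]].
  by rewrite ltNge h.
have cpt : compact E' by apply: subclosed_compact clE cB _ => v [/EB].
have wc : {within E', continuous G}.
  apply: continuous_in_subspaceT => v; rewrite inE => -[Ev _]; exact: cG.
have [v /set_mem [Ev Fv] hv] := compact_EVT_min (ex_intro _ v0 (conj Ev0 Fv0)) cpt wc.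
by exists v; split=> // w Ew Fw; apply: hv; rewrite inE.
Qed.

Definition chain_area k n (c : 'I_n -> space) : R := \sum_i tri k (c i) (c (ordS i)).
Definition chain_length k n (c : 'I_n -> space) : R := \sum_i dist k (c i) (c (ordS i)).

(** A disc around the pole, measured by the squared chord. On the sphere [rho < 2] keeps it away
    from the equator, which makes it compact. *)
Definition cap k rho p : Prop := upper k p /\ chord2 k origin p <= rho.

Lemma cap_bounds k rho : 0 <= rho -> (k = Spherical -> rho < 2) -> exists2 d, 0 < d &
  forall p, cap k rho p <-> [/\ surface k p, d <= p.2, chord2 k origin p <= rho,
    - (2 + rho) <= p.1.1 <= 2 + rho & (- (2 + rho) <= p.1.2 <= 2 + rho) && (p.2 <= 2 + rho)].
Proof.
move=> r0 r2; exists (if k is Spherical then 1 - rho / 2 else 1).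
  by case: k r2 => // /(_ erefl); lra.
move=> [[x y] z]; rewrite /cap /upper /surface /chord2 /=; split; last first.
  move=> [sp dz ch _ _]; do 2!split=> //; case: k r2 dz {sp ch} => r2; try lra.
  by have := r2 erefl; lra.
case: k r2 => /= r2 [[[e _] z0] ch]; split=> //; rewrite ?z0//; try (apply/andP; split); try (apply/andP; split); try nra.
Qed.

Section Coordinates.
Variable n : nat.
Notation T := ('rV[R]_n * 'rV[R]_n * 'rV[R]_n)%type.
Implicit Types (w : T).

(** A chain is stored as three coordinate rows, so that boxes of row vectors provide compactness. *)
Definition point w (i : 'I_n) : space := (w.1.1 ord0 i, w.1.2 ord0 i, w.2 ord0 i).

Definition encode (c : 'I_n -> space) : T :=
  (\row_i (c i).1.1, \row_i (c i).1.2, \row_i (c i).2).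

Lemma encodeK c : point (encode c) = c.
Proof. by apply/funext => i; rewrite /point /= !mxE; case: (c i) => [[]]. Qed.

Lemma continuous_point_x i w : {for w, continuous (fun w => (point w i).1.1)}.
Proof.
apply: (@continuous_comp _ _ _ (fun w : T => w.1) (fun z => z.1 ord0 i)); first exact: cvg_fst.
apply: (@continuous_comp _ _ _ fst (fun z : 'rV[R]_n => z ord0 i)); first exact: cvg_fst.
exact: coord_continuous.
Qed.

Lemma continuous_point_y i w : {for w, continuous (fun w => (point w i).1.2)}.
Proof.
apply: (@continuous_comp _ _ _ (fun w : T => w.1) (fun z => z.2 ord0 i)); first exact: cvg_fst.
apply: (@continuous_comp _ _ _ snd (fun z : 'rV[R]_n => z ord0 i)); first exact: cvg_snd.
exact: coord_continuous.
Qed.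

Lemma continuous_point_z i w : {for w, continuous (fun w => (point w i).2)}.
Proof.
apply: (@continuous_comp _ _ _ (fun w : T => w.2) (fun z : 'rV[R]_n => z ord0 i)); first exact: cvg_snd.
exact: coord_continuous.
Qed.

Lemma continuous_for_comp (f : T -> R) (g : R -> R) w : {for w, continuous f} ->
  {for f w, continuous g} -> {for w, continuous (fun v => g (f v))}.
Proof. exact: continuous_comp. Qed.

Lemma continuous_sum_for (N : nat) (F : 'I_N -> T -> R) w : (forall i, {for w, continuous (F i)}) ->
  {for w, continuous (fun v => \sum_i F i v)}.
Proof.
move=> h; elim: (index_enum _) => [|i s IH].
  by rewrite (_ : (fun=> _) = fun=> 0); [exact: cvg_cst|apply/funext => v; rewrite big_nil].
rewrite (_ : (fun=> _) = fun v => F i v + \sum_(j <- s) F j v); first exact: (cvgD (h i) IH).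
by apply/funext => v; rewrite big_cons.
Qed.

Ltac continuous_coordinate := first [exact: continuous_point_x|exact: continuous_point_y
  |exact: continuous_point_z|exact: cvg_cst].

Lemma continuous_point_tri k i j w : upper k (point w i) -> upper k (point w j) ->
  {for w, continuous (fun w => tri k (point w i) (point w j))}.
Proof.
move=> ui uj; apply: cvgM; first exact: cvg_cst.
apply: (@continuous_for_comp (fun w => ((point w i).1.1 * (point w j).1.2 - (point w i).1.2 * (point w j).1.1) /
     (1 + (point w i).2 + (point w j).2 + bil k (point w i) (point w j))) (gatan k)); last exact: has_der_continuous (der_gatan k _).
apply: cvgM.
  by apply: cvgB; apply: cvgM; continuous_coordinate.
apply: cvgV; first by rewrite gt_eqF//; have := upper_bilN1 ui uj; have := ui.2; have := uj.2; lra.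
apply: cvgD; last first.
  apply: cvgD; last by apply: cvgM; continuous_coordinate.
  apply: cvgM; first exact: cvg_cst.
  by apply: cvgD; apply: cvgM; continuous_coordinate.
by apply: cvgD; [apply: cvgD; continuous_coordinate|continuous_coordinate].
Qed.

Lemma continuous_point_chord2 k p i w :
  {for w, continuous (fun w => chord2 k p (point w i))}.
Proof.
apply: cvgD; last first.
  apply: cvgM; first exact: cvg_cst.
  by apply: cvgM; apply: cvgB; continuous_coordinate.
apply: cvgD; apply: cvgM; apply: cvgB; continuous_coordinate.
Qed.

Lemma continuous_point_dist k i j w : upper k (point w i) -> upper k (point w j) ->
  {for w, continuous (fun w => dist k (point w i) (point w j))}.
Proof.
move=> ui uj; apply: cvgM; first exact: cvg_cst.
apply: (@continuous_for_comp (fun w => Num.sqrt (chord2 k (point w i) (point w j)) / 2) (gasin k)); last first.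
  apply: has_der_continuous; apply: der_gasin => e.
  have s0 := sqrtr_ge0 (chord2 k (point w i) (point w j)).
  have : Num.sqrt (chord2 k (point w i) (point w j)) < 2.
    have -> : 2 = Num.sqrt (2 ^+ 2) :> R by rewrite sqrtr_sqr ger0_norm.
    rewrite ltr_sqrt ?exprn_gt0//; have := upper_bilN1 ui uj.
    by rewrite chord2_nonflat ?e//=; [lra|rewrite -e; exact: ui.1|rewrite -e; exact: uj.1].
  by move=> s2; clear e; between.
apply: cvgM; last exact: cvg_cst.
apply: (@continuous_for_comp (fun w => chord2 k (point w i) (point w j)) Num.sqrt); last exact: sqrt_continuous.
apply: cvgD; last first.
  by apply: cvgM; [exact: cvg_cst|apply: cvgM; apply: cvgB; continuous_coordinate].
by apply: cvgD; apply: cvgM; apply: cvgB; continuous_coordinate.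
Qed.

(** The constraint is a lower bound for the area: a motion that gains area to first order is
    admissible without any correction. *)
Lemma chain_minimizer k rho A0 (c0 : 'I_n -> space) : 0 <= rho -> (k = Spherical -> rho < 2) ->
  (forall i, cap k rho (c0 i)) -> A0 <= chain_area k c0 ->
  exists c : 'I_n -> space, [/\ forall i, cap k rho (c i), A0 <= chain_area k c &
    forall c' : 'I_n -> space, (forall i, cap k rho (c' i)) -> A0 <= chain_area k c' -> chain_length k c <= chain_length k c'].
Proof.
move=> r0 r2 hc0 A0c0; have [d d0 hd] := cap_bounds r0 r2.
pose I : set R := `[- (2 + rho), 2 + rho]%classic.
pose row : set 'rV[R]_n := [set v | forall i, I (v ord0 i)].
have crow : compact row by apply: (@rV_compact R n (fun=> I)) => _; exact: segment_compact.
pose E : set T := [set w | forall i, cap k rho (point w i)].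
have EB : E `<=` (row `*` row `*` row).
  move=> w hw; split; first split; move=> i; have /hd[_ h1 _ h2 /andP[h3 h4]] := hw i; rewrite /I /= in_itv//=.
  by apply/andP; split=> //; rewrite /point /= in h1; lra.
have cE : closed E.
  pose F i w := K k * ((point w i).1.1 ^+ 2 + (point w i).1.2 ^+ 2) + (point w i).2 ^+ 2.
  have -> : E = \bigcap_(i in [set: 'I_n]) ((F i @^-1` [set 1]) `&` ((fun w => (point w i).2) @^-1` [set t | d <= t]) `&`
      ((fun w => chord2 k origin (point w i)) @^-1` [set t | t <= rho])).
    apply/seteqP; split=> w hw.
      by move=> i _; have /hd[[h1 h2] h3 h4 _ _] := hw i.
    move=> i; have [[h1 h2] h3] := hw i Logic.I; split=> //; split; last exact: lt_le_trans d0 h2.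
    by split=> // _; exact: lt_le_trans d0 h2.
  apply: closed_bigI => i _; apply: closedI; first apply: closedI.
  - apply: closed_comp => [w _|]; last exact: closed_eq.
    apply: cvgD; last by apply: cvgM; continuous_coordinate.
    apply: cvgM; first exact: cvg_cst.
    by apply: cvgD; apply: cvgM; continuous_coordinate.
  - by apply: closed_comp => [w _|]; [continuous_coordinate|exact: closed_ge].
  - by apply: closed_comp => [w _|]; [exact: continuous_point_chord2|exact: closed_le].
have exc0 : exists2 w, E w & A0 <= chain_area k (point w).
  by exists (encode c0); rewrite ?encodeK// => i; rewrite encodeK.
have [w [Ew Fw hw]] := @compact_minimizer T _ E (fun w => chain_area k (point w)) (fun w => chain_length k (point w)) A0
   (compact_setX (compact_setX crow crow) crow) cE EB
   (fun w Ew => continuous_sum_for (fun i => continuous_point_tri (Ew i).1 (Ew (ordS i)).1))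
   (fun w Ew => continuous_sum_for (fun i => continuous_point_dist (Ew i).1 (Ew (ordS i)).1))
   exc0.
exists (point w); split=> // c' hc' Ac'; have := hw (encode c'); rewrite encodeK; apply=> //.
by move=> i; rewrite encodeK.
Qed.
End Coordinates.

Lemma tri3_half_turn k m p q u : upper k m ->
  tri3 k (half_turn k m p) (half_turn k m q) (half_turn k m u) = tri3 k p q u.
Proof. by move=> um; rewrite /tri3 !half_turn_bil// half_turn_det. Qed.

(** Around the cycle the terms of [tri3_cocycle] that involve only the new apex cancel. *)
Lemma chain_area_from k n (c : 'I_n -> space) m : upper k m -> (forall i, upper k (c i)) ->
  (forall i, 0 < bil k m (c i)) -> chain_area k c = \sum_i tri3 k m (c i) (c (ordS i)).
Proof.
move=> um uc mc.
rewrite (eq_bigr (fun i => tri k m (c i) + tri k (c i) (c (ordS i)) - tri k m (c (ordS i)))); last first.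
  by move=> i _; rewrite tri3_cocycle// (triC k (c (ordS i))).
have e : \sum_i tri k m (c i) = \sum_i tri k m (c (ordS i)) by rewrite (reindex_inj (@ordS_inj n)).
by rewrite big_split big_split/= sumrN e /chain_area; lra.
Qed.

Lemma recenter_chain k n (c : 'I_n -> space) m : upper k m -> (forall i, upper k (c i)) ->
  (forall i, 0 < bil k m (c i)) -> exists c' : 'I_n -> space,
  [/\ forall i, upper k (c' i), chain_area k c' = chain_area k c, chain_length k c' = chain_length k c,
    forall i j, bil k (c' i) (c' j) = bil k (c i) (c j) &
    forall i j l, det3 (c' i) (c' j) (c' l) = det3 (c i) (c j) (c l)] /\
  (forall i j, chord2 k (c' i) (c' j) = chord2 k (c i) (c j)) /\
  (forall i, chord2 k origin (c' i) = chord2 k m (c i)).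
Proof.
move=> um uc mc; pose c' i := half_turn k m (c i); exists c'.
have mm : 0 < bil k m m by rewrite (surface_bil um.1).
have ch i j : chord2 k (c' i) (c' j) = chord2 k (c i) (c j).
  by rewrite half_turn_chord2//; [exact: (uc i).1|exact: (uc j).1].
split; last first.
  by split=> // i; rewrite -(half_turn_center um) half_turn_chord2//; [exact: um.1|exact: (uc i).1].
split.
- by move=> i; apply: half_turn_upper => //; exact: (uc i).1.
- rewrite (chain_area_from um uc mc); apply: eq_bigr => i _.
  by rewrite tri3_origin -(half_turn_center um) tri3_half_turn.
- by apply: eq_bigr => i _; rewrite /dist ch.
- by move=> i j; rewrite half_turn_bil.
- by move=> i j l; rewrite half_turn_det.
Qed.

(** Squared chord of a radius within which a suitable centre sees every closed chain of length [L]: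
    radius [L / 4] on the sphere, by [in_hemisphere], and radius [L] around any vertex elsewhere.
    For [L] below [2 * pi] the spherical value is below 2. *)
Definition cap_bound k (L : R) : R :=
  if k is Spherical then 2 - 2 * cos (L / 4) else 4 * gsin k (L / 2) ^+ 2.

Lemma cap_bound_ge0 k L : 0 <= cap_bound k L.
Proof.
have g : 0 <= 4 * gsin k (L / 2) ^+ 2 by rewrite mulr_ge0 ?sqr_ge0.
by case: k g => //= _; have := cos_le1 (L / 4); lra.
Qed.

Lemma cap_bound_homo k L L' : 0 <= L -> L <= L' -> (k = Spherical -> L' < 2 * pi) ->
  cap_bound k L <= cap_bound k L'.
Proof.
move=> L0 LL s.
have gen : k <> Spherical -> 4 * gsin k (L / 2) ^+ 2 <= 4 * gsin k (L' / 2) ^+ 2.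
  move=> ks; have g0 : 0 <= gsin k (L / 2) by apply: gsin_ge0 => //; lra.
  have : gsin k (L / 2) <= gsin k (L' / 2) by rewrite ler_gsin => //; lra.
  by nra.
case: k s gen => s gen; rewrite /cap_bound; [exact: gen|exact: gen|].
have p0 := @pi_gt0 R; have := s erefl => s'.
have : cos (L' / 4) <= cos (L / 4) by apply: ler_cos_norm; [apply/andP; split|]; lra.
by lra.
Qed.

Lemma chain_center k n (c : 'I_n -> space) : (0 < n)%N -> (forall i, upper k (c i)) ->
  (k = Spherical -> chain_length k c < 2 * pi) ->
  exists m, [/\ upper k m, forall i, 0 < bil k m (c i) &
    forall i, chord2 k m (c i) <= cap_bound k (chain_length k c)].
Proof.
move=> n0 uc short.
have L0 : 0 <= chain_length k c by apply: sumr_ge0 => i _; apply: dist_ge0; [exact: (uc _).1|exact: (uc _).1].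
case: (pselect (k = Spherical)) => [e|ks]; last first.
  exists (c (Ordinal n0)); split=> //.
    move=> i; rewrite (bil_dist (uc _).1 (uc _).1); apply: gcos_gt0 => //.
  move=> i; rewrite (chord2_dist (uc _).1 (uc _).1).
  have h := dist_le_length n0 (fun i => (uc i).1) (Ordinal n0) i.
  have d0 := dist_ge0 (uc (Ordinal n0)).1 (uc i).1.
  have g0 : 0 <= gsin k (dist k (c (Ordinal n0)) (c i) / 2) by apply: gsin_ge0 => //; lra.
  have gl : gsin k (dist k (c (Ordinal n0)) (c i) / 2) <= gsin k (chain_length k c / 2).
    by rewrite ler_gsin => //; rewrite /chain_length; lra.
  by case: k ks gl g0 {uc short L0 h d0} => //= _ gl g0; nra.
subst k; have sh := short erefl.
have [m [sm hm om]] := in_hemisphere n0 (fun i => (uc i).1) sh.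
have p0 := @pi_gt0 R.
have c0 : 0 < cos (chain_length Spherical c / 4) by apply: cos_gt0_pihalf; between.
have mc i : 0 < bil Spherical m (c i) by apply: lt_le_trans c0 (hm i).
exists m; split=> //.
  by split=> //; rewrite -(bil_origin Spherical); apply: om => i; rewrite bil_origin; exact: (uc i).2.
move=> i; rewrite (chord2_nonflat _ sm (uc i).1)//= /cap_bound.
by have := hm i; rewrite -/(chain_length Spherical c); lra.
Qed.

(** * First variation of a chain *)

Lemma der_gt0_near (f : R -> R) d : has_der f 0 d -> 0 < d -> \forall t \near (0 : R), 0 < t -> f 0 < f t.
Proof.
move=> /has_derP[dv e] d0; have c : (fun h => h^-1 *: ((f \o shift 0) (h *: 1) - f 0)) @ 0^' --> d.
  by rewrite -e; exact: dv.
have := c _ (lt_nbhsr d0); rewrite nbhs_simpl /= => /nbhs_ballP[r r0 hr].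
apply/nbhs_ballP; exists r => // t tb t0; have /= := hr t tb; rewrite gt_eqF// => /(_ isT).
by rewrite addr0 scaler1 /GRing.scale/= pmulr_rgt0 ?invr_gt0// subr_gt0.
Qed.

Lemma upper_join k p q : upper k p -> upper k q -> p <> q -> exists e g S,
  [/\ unit_tangent k p e, q = lin g p S e, 0 < S, g = bil k p q & S = gsin k (dist k p q)] /\
  (-1 < g /\ g ^+ 2 + K k * S ^+ 2 = 1).
Proof.
move=> up uq pq; have B := upper_bilN1 up uq.
have na : k = Spherical -> q <> - p.
  by move=> e eq; have := uq.2; rewrite eq /=; have := up.2; lra.
have [e he je] := exists_join up.1 uq.1 na.
exists e, (gcos k (dist k p q)), (gsin k (dist k p q)); split; last by split; [rewrite -(bil_dist up.1 uq.1)|exact: gcos2Dgsin2].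
have g : gcos k (dist k p q) = bil k p q by rewrite (bil_dist up.1 uq.1).
split=> //; rewrite ?g//.
apply: gsin_gt0; last exact: (dist_ltpi up.1 uq.1).
by rewrite lt_neqAle dist_ge0 ?andbT ?up.1 ?uq.1//; [apply/eqP => /esym/(dist_eq0 up.1 uq.1)|exact: up.1|exact: uq.1].
Qed.

(** First variation of the distance, computed through the squared chord. It is 0 for a degenerate
    side, which is the true rate when both ends move alike. *)
Definition edge_rate k p q xp xq : R :=
  metric k (lin 1 p (-1) q) (lin 1 xp (-1) xq) / gsin k (dist k p q).

Lemma edge_rate_pp k p xp xq : edge_rate k p p xp xq = 0.
Proof. by rewrite /edge_rate (_ : metric _ _ _ = 0) ?mul0r// /metric /=; ring. Qed.

Lemma der_dist k (p q : R -> space) s xp xq : has_der3 p s xp -> has_der3 q s xq ->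
  upper k (p s) -> upper k (q s) -> p s <> q s ->
  has_der (fun t => dist k (p t) (q t)) s (edge_rate k (p s) (q s) xp xq).
Proof.
move=> [p1 p2 p3] [q1 q2 q3] up uq pq.
have d0 := dist_ge0 up.1 uq.1; have sp := up.1; have sq := uq.1.
have dpi : k = Spherical -> dist k (p s) (q s) < pi.
  by apply: dist_ltpi => // e eq; have := uq.2; rewrite eq /=; have := up.2; lra.
have dn0 : 0 < dist k (p s) (q s).
  by rewrite lt_neqAle d0 andbT; apply/eqP => /esym/(dist_eq0 sp sq).
have pi0 := @pi_gt0 R.
have s0 : 0 < gsin k (dist k (p s) (q s) / 2).
  by apply: gsin_gt0; [lra|move=> e; have := dpi e; clear e; lra].
have c0 : 0 < gcos k (dist k (p s) (q s) / 2).
  by apply: gcos_gt0 => e; have := dpi e; clear e => h; between.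
have hs := gsin_half_dist sp sq.
have ch0 : 0 < chord2 k (p s) (q s) by rewrite chord2_dist// mulr_gt0// exprn_gt0.
have hch : has_der (fun t => chord2 k (p t) (q t)) s
    (2 * metric k (lin 1 (p s) (-1) (q s)) (lin 1 xp (-1) xq)).
  apply: der_eq.
    apply: derD; first by apply: derD; apply: derX2; [exact: derB p1 q1|exact: derB p2 q2].
    by apply: derM; [exact: der_cst|apply: derX2; exact: derB p3 q3].
  by rewrite /metric /=; ring.
apply: der_eq.
  apply: derM; first exact: der_cst.
  apply: (@der_comp (gasin k) (fun t => Num.sqrt (chord2 k (p t) (q t)) / 2)).
    apply: der_gasin => e; rewrite -hs; have := c0; have := gcos2Dgsin2 k (dist k (p s) (q s) / 2).
    move: s0; rewrite e /=; move: (cos _) (sin _) => c ss; clear; nra.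
  by apply: derM; [exact: (@der_sqrt (fun t => chord2 k (p t) (q t)) s _ ch0 hch)|exact: der_cst].
rewrite /= -hs mul0r add0r; have sc : Num.sqrt (chord2 k (p s) (q s)) = 2 * gsin k (dist k (p s) (q s) / 2).
  by rewrite hs; field.
have -> : 1 - K k * gsin k (dist k (p s) (q s) / 2) ^+ 2 = gcos k (dist k (p s) (q s) / 2) ^+ 2.
  by have := gcos2Dgsin2 k (dist k (p s) (q s) / 2); lra.
rewrite sqrtr_sqr gtr0_norm// sc /edge_rate (gsin_half k (dist k (p s) (q s))).
by field; rewrite !gt_eqF.
Qed.

Definition move_point k p xi t : space := nrm k (lin 1 p t xi).

Lemma move_point0 k p xi : surface k p -> move_point k p xi 0 = p.
Proof.
by move=> sp; rewrite /move_point (_ : lin _ _ _ _ = p) ?nrm_id//; coords.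
Qed.

Lemma der3_tangent p xi : has_der3 (fun t => lin 1 p t xi) 0 xi.
Proof. by apply: der3_eq (der3_lin (der_cst 1 0) (der_id 0) (der3_cst p 0) (der3_cst xi 0)) _; coords. Qed.

Lemma der_move_point k p xi : surface k p -> bil k p xi = 0 -> has_der3 (move_point k p xi) 0 xi.
Proof.
move=> sp tx; have e0 : lin 1 p 0 xi = p by coords.
have hl := der3_tangent p xi; have B0 : 0 < bil k (lin 1 p 0 xi) (lin 1 p 0 xi) by rewrite e0 (surface_bil sp).
apply: der3_eq (der3_nrm hl B0) _; rewrite e0 (surface_bil sp) sqrtr1 tx.
by apply: eq_space => /=; field.
Qed.

Lemma upper_move_point k p xi : upper k p -> \forall t \near (0 : R), upper k (move_point k p xi t).
Proof.
move=> [sp p0].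
have cB : {for 0, continuous (fun t : R => bil k (lin 1 p t xi) (lin 1 p t xi))}.
  apply: (@has_der_continuous _ _ (2 * bil k p xi)).
  have hl := der3_tangent p xi.
  by apply: der_eq (der_bil k hl hl) _; rewrite /bil /=; ring.
have cz : {for 0, continuous (fun t : R => (lin 1 p t xi).2)}.
  apply: (@has_der_continuous _ _ xi.2); apply: der_eq.
    by apply: derD; [exact: der_cst|apply: derM; [exact: der_id|exact: der_cst]].
  by rewrite mul1r mulr0 addr0 add0r.
have e0 : lin 1 p 0 xi = p by coords.
have B1 : 0 < bil k (lin 1 p 0 xi) (lin 1 p 0 xi) by rewrite e0 (surface_bil sp).
have z1 : 0 < (lin 1 p 0 xi).2 by rewrite e0.
have := cB _ (lt_nbhsr B1); have := cz _ (lt_nbhsr z1); rewrite !nbhs_simpl /=.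
apply: filterS2 => t zt Bt; split; first by apply: nrm_surface; split.
by rewrite /move_point /nrm /= mul0r addr0 mulr_gt0 ?invr_gt0 ?sqrtr_gt0.
Qed.

Section Chain.
Variables (k : curvature) (n : nat) (c : 'I_n -> space).
Hypothesis uc : forall i, upper k (c i).
Implicit Types (w : 'I_n -> space).

Definition area_rate w : R := \sum_i (edge_form k (c (ordS i)) (c i) (w (ordS i)) - edge_form k (c i) (c (ordS i)) (w i)).
Definition length_rate w : R := \sum_i edge_rate k (c i) (c (ordS i)) (w i) (w (ordS i)).

Lemma der_sum (f : 'I_n -> R -> R) d s : (forall i, has_der (f i) s (d i)) ->
  has_der (fun t => \sum_i f i t) s (\sum_i d i).
Proof.
move=> h; elim: (index_enum _) => [|i l IH].
  have -> : (fun t => \sum_(i <- [::]) f i t) = fun=> 0 by apply/funext => t; rewrite big_nil.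
  by rewrite big_nil; exact: der_cst.
have -> : (fun t => \sum_(j <- i :: l) f j t) = fun t => f i t + \sum_(j <- l) f j t.
  by apply/funext => t; rewrite big_cons.
by rewrite big_cons; exact: derD (h i) IH.
Qed.

Lemma der_chain_area w : (forall i, bil k (c i) (w i) = 0) ->
  has_der (fun t => chain_area k (fun i => move_point k (c i) (w i) t)) 0 (area_rate w).
Proof.
move=> tw; have dc i := der_move_point (uc i).1 (tw i).
have z0 : bil k origin (0 : space) = 0 by rewrite /bil /=; ring.
apply: der_eq.
  apply: der_sum => i; rewrite (_ : (fun t => _) = fun t => tri3 k origin (move_point k (c i) (w i) t)
     (move_point k (c (ordS i)) (w (ordS i)) t)); last by apply/funext => t; rewrite tri3_origin.
  have B := upper_bilN1 (uc i) (uc (ordS i)); have z1 := (uc i).2; have z2 := (uc (ordS i)).2.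
  apply: (der_tri3 (der3_cst origin 0) (dc i) (dc (ordS i))); rewrite ?move_point0 ?bil_origin//;
    try exact: (uc _).1; try exact: (upper_origin k).1; rewrite ?(bilC k _ origin) ?bil_origin//; lra.
have e0 (a b : space) : edge_form k a b 0 = 0 by rewrite /edge_form /det3 /=; ring.
(* The terms that involve the fixed apex cancel around the cycle. *)
have eq1 : \sum_i edge_form k (c i) origin (w i) = \sum_i edge_form k (c (ordS i)) origin (w (ordS i)).
  by rewrite (reindex_inj (@ordS_inj n)).
transitivity (\sum_i (edge_form k (c (ordS i)) (c i) (w (ordS i)) - edge_form k (c i) (c (ordS i)) (w i) +
    (edge_form k (c i) origin (w i) - edge_form k (c (ordS i)) origin (w (ordS i))))).
  by apply: eq_bigr => i _; rewrite !e0 !move_point0; [ring|exact: (uc _).1|exact: (uc _).1].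
by rewrite big_split/= [X in _ + X]sumrB eq1 subrr addr0.
Qed.

Lemma der_chain_length w : (forall i, bil k (c i) (w i) = 0) ->
  (forall i, c i = c (ordS i) -> w i = w (ordS i)) ->
  has_der (fun t => chain_length k (fun i => move_point k (c i) (w i) t)) 0 (length_rate w).
Proof.
move=> tw ww; have dc i := der_move_point (uc i).1 (tw i).
apply: der_sum => i; case: (pselect (c i = c (ordS i))) => [e|ne].
  rewrite -(ww i e) -e edge_rate_pp (_ : (fun t => _) = fun=> 0); first exact: der_cst.
  by apply/funext => t; rewrite dist_pp.
have := der_dist (dc i) (dc (ordS i)); rewrite !move_point0; [|exact: (uc _).1|exact: (uc _).1].
by apply=> //; exact: uc.
Qed.

Variables (rho A0 : R).
Hypothesis inside_cap : forall i, chord2 k origin (c i) < rho.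
Hypothesis area_ge : A0 <= chain_area k c.
Hypothesis minimal : forall c' : 'I_n -> space, (forall i, cap k rho (c' i)) ->
  A0 <= chain_area k c' -> chain_length k c <= chain_length k c'.

(** The vertices are strictly inside the cap, so a small motion that gains area is an admissible
    competitor. Ends of a degenerate side must move alike, as the distance is not differentiable
    there. *)
Lemma first_order w : (forall i, bil k (c i) (w i) = 0) ->
  (forall i, c i = c (ordS i) -> w i = w (ordS i)) -> 0 < area_rate w -> 0 <= length_rate w.
Proof.
move=> tw ww Aw; rewrite leNgt; apply/negP => Lw.
have hL := derN (der_chain_length tw ww).
have e0 : (fun i => move_point k (c i) (w i) 0) = c by apply/funext => i; rewrite move_point0//; exact: (uc i).1.
have nL := der_gt0_near hL ltac:(by rewrite oppr_gt0); rewrite e0 in nL.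
have nA := der_gt0_near (der_chain_area tw) Aw; rewrite e0 in nA.
have nC : \forall t \near (0 : R), forall i, cap k rho (move_point k (c i) (w i) t).
  suff each i : \forall t \near (0 : R), cap k rho (move_point k (c i) (w i) t) by exact: filter_forall each.
  have cc : {for 0, continuous (fun t => chord2 k origin (move_point k (c i) (w i) t))}.
    have [h1 h2 h3] := der_move_point (uc i).1 (tw i).
    apply: has_der_continuous; apply: derD.
      by apply: derD; apply: derX2; apply: derB; [exact: der_cst|exact: h1|exact: der_cst|exact: h2].
    by apply: derM; [exact: der_cst|apply: derX2; apply: derB; [exact: der_cst|exact: h3]].
  have c1 : chord2 k origin (move_point k (c i) (w i) 0) < rho by rewrite move_point0//; exact: (uc i).1.
  have := cc _ (lt_nbhsl c1); rewrite nbhs_simpl /=.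
  by apply: filterS2 (upper_move_point (w i) (uc i)) => t ut ct; split=> //; exact/ltW.
have [r /= r0 hr] := (iffLR (nbhs_ballP _ _) (filterI nL (filterI nA nC))).
have rb : ball (0 : R) r (r / 2) by rewrite -ball_normE /= sub0r normrN ger0_norm; lra.
have [hl [ha hc]] := hr _ rb; have r2 : 0 < r / 2 by lra.
have := minimal hc (le_trans area_ge (ltW (ha r2))); have := hl r2.
by rewrite ltrN2 => h; rewrite leNgt h.
Qed.

End Chain.

(** * Multiplier rule and exclusion of degenerate sides *)

Section Update.
Variable n : nat.
Hypothesis n1 : (1 < n)%N.

Lemma ordS_neq (i : 'I_n) : ordS i != i.
Proof.
apply/eqP => /(congr1 val) /= e; have := ltn_ord i; rewrite leq_eqVlt => /predU1P[h|h].
  by move: e; rewrite h modnn => e; move: n1; rewrite -h -e.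
by move: e; rewrite modn_small// => /eqP; rewrite eqn_leq ltnn.
Qed.

Lemma sum_update (T : Type) (G : 'I_n -> T -> T -> R) (c : 'I_n -> T) i x :
  let c' := fun j => if j == ordS i then x else c j in
  \sum_j G j (c' j) (c' (ordS j)) = \sum_j G j (c j) (c (ordS j)) +
  (G i (c i) x + G (ordS i) x (c (ordS (ordS i))) -
   G i (c i) (c (ordS i)) - G (ordS i) (c (ordS i)) (c (ordS (ordS i)))).
Proof.
move=> c'; apply/eqP; rewrite addrC -subr_eq -sumrB (bigD1 i)//= (bigD1 (ordS i)) ?ordS_neq//= big1.
  rewrite /c' eqxx !ifF; [apply/eqP; ring|exact/negbTE/ordS_neq|].
  by apply/negbTE; rewrite eq_sym ordS_neq.
move=> j /andP[ji jS]; rewrite /c' (negbTE jS) ifF ?subrr//.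
by apply/negbTE; rewrite (inj_eq (@ordS_inj n)).
Qed.

End Update.

(** Lagrange's rule for an inequality constraint. [A] and [L] are the rates of area and length along
    one shortening motion, [a] and [l] those along an additional motion [xi]; a multiple of the
    first compensates the area that [xi] loses. *)
Lemma multiplier (a l : space -> R) (T : space -> Prop) A L : L < 0 ->
  (forall t xi, T xi -> T (lin t xi 0 xi)) ->
  (forall t xi, a (lin t xi 0 xi) = t * a xi) -> (forall t xi, l (lin t xi 0 xi) = t * l xi) ->
  (forall mu xi, T xi -> 0 < mu * A + a xi -> 0 <= mu * L + l xi) ->
  (exists2 xi, T xi & a xi != 0) -> A < 0 /\ forall xi, T xi -> l xi * A = L * a xi.
Proof.
move=> L0 hT ha hl H [x0 T0 a0].
have A0 : A < 0.
  (* Otherwise a large multiple of the shortening motion would cost no area, while [x1] gains area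
     at rate 1. *)
  rewrite ltNge; apply/negP => A0; set x1 := lin (a x0)^-1 x0 0 x0.
  have a1 : a x1 = 1 by rewrite ha mulVf.
  have m0 : 0 <= (`|l x1| + 1) / - L by apply: divr_ge0; [rewrite addr_ge0|lra].
  have := H _ _ (hT (a x0)^-1 _ T0) (_ : 0 < (`|l x1| + 1) / - L * A + a x1).
  rewrite a1 => /(_ ltac:(by rewrite ltr_wpDl// mulr_ge0)).
  have -> : (`|l x1| + 1) / - L * L = - (`|l x1| + 1) by field; rewrite lt_eqF.
  by have := ler_norm (l x1); rewrite -/x1; lra.
have le xi : T xi -> l xi * A <= L * a xi.
  move=> Tx; rewrite leNgt; apply/negP => h.
  (* The compensated motion gains area at rate [ep]; this value of [ep] is small enough for the
     length still to decrease. *)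
  pose ep := (l xi * A - L * a xi) / (- L) / 2.
  have e0 : 0 < ep by rewrite !divr_gt0//; lra.
  have := H ((ep - a xi) / A) xi Tx.
  have -> : (ep - a xi) / A * A + a xi = ep by field; rewrite lt_eqF.
  move=> /(_ e0); rewrite -(ler_nM2r A0) mul0r.
  have -> : ((ep - a xi) / A * L + l xi) * A = ep * L - a xi * L + l xi * A by field; rewrite lt_eqF.
  have -> : ep * L = - (l xi * A - L * a xi) / 2 by rewrite /ep; field; rewrite lt_eqF.
  by lra.
split=> // xi Tx; apply/eqP; rewrite eq_le le//=.
by have := le _ (hT (-1) _ Tx); rewrite ha hl; lra.
Qed.

(** If no motion of [v] changed the area, [p / (1 + bil k v p)] and the same quotient for [q] would
    have equal tangential parts at [v]. These are stereographic projections, which determine the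
    point. *)
Lemma exists_area_change k v p q : upper k v -> upper k p -> upper k q -> p <> q ->
  exists2 xi, bil k v xi = 0 & edge_form k v p xi - edge_form k v q xi != 0.
Proof.
move=> uv up uq pq; apply: contrapT => hn; apply: pq.
have Bp := upper_bilN1 uv up; have Bq := upper_bilN1 uv uq.
pose g := 1 + bil k v p; pose h := 1 + bil k v q.
have g0 : g != 0 by rewrite gt_eqF// /g; lra.
have h0 : h != 0 by rewrite gt_eqF// /h; lra.
pose w := lin g^-1 p (- h^-1) q; pose y := lin 1 w (- bil k v w) v.
have z xi : bil k v xi = 0 -> det3 v y xi = 0.
  move=> tx; have -> : det3 v y xi = edge_form k v p xi - edge_form k v q xi.
    by rewrite /y /w /edge_form -/g -/h !(det3_lin1, det3_lin2) det3pp; field; apply/andP.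
  by apply/eqP; apply: contrapT => /negP e; apply: hn; exists xi.
have ty : bil k v y = 0 by rewrite /y bil_linr (surface_bil uv.1); ring.
have [u hu] := exists_unit_tangent uv.1.
have fy := frame_tangent uv.1 hu ty.
have d1 : det3 v u y = 0 by rewrite det3_swap23 z ?oppr0//; exact: hu.1.
have m1 : metric k u y = 0.
  have hr := unit_rot uv.1 hu.
  have := z _ hr.1; rewrite det3_swap23 (det3_rot uv.1 hr.1 ty) (trot_trot uv.1 hu) metric_linl; lra.
have y0 : y = lin 0 v 0 v by rewrite fy m1 d1; coords.
have al : bil k v w = h^-1 - g^-1.
  by rewrite /w bil_linr (_ : bil k v p = g - 1) 1?(_ : bil k v q = h - 1); [field; apply/andP|rewrite /h; ring|rewrite /g; ring].
have e : p = lin (g / h) q (g / h - 1) v.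
  move: (congr1 (fun z => z.1.1) y0) (congr1 (fun z => z.1.2) y0) (congr1 (fun z => z.2) y0).
  rewrite /y al /w /= => e1 e2 e3.
  have ex (P Q V : R) : 1 * (g^-1 * P + - h^-1 * Q) + - (h^-1 - g^-1) * V = 0 * V + 0 * V -> P = g / h * Q + (g / h - 1) * V.
    move=> E; have : g * (1 * (g^-1 * P + - h^-1 * Q) + - (h^-1 - g^-1) * V) = 0 by rewrite E; ring.
    have -> : g * (1 * (g^-1 * P + - h^-1 * Q) + - (h^-1 - g^-1) * V) = P - (g / h * Q + (g / h - 1) * V).
      by field; apply/andP.
    by lra.
  by apply: eq_space; apply: ex.
have gh : g = h.
  have : bil k (lin 1 p 1 v) (lin 1 p 1 v) = (g / h) ^+ 2 * bil k (lin 1 q 1 v) (lin 1 q 1 v).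
    by rewrite e /bil /=; ring.
  rewrite !bil_lin (surface_bil up.1) (surface_bil uq.1) (surface_bil uv.1) (bilC k p v) (bilC k q v).
  rewrite (_ : bil k v p = g - 1) 1?(_ : bil k v q = h - 1); [|rewrite /h; ring|rewrite /g; ring].
  have -> : (g / h) ^+ 2 * (1 * (1 * 1 + 1 * (h - 1)) + 1 * (1 * (h - 1) + 1 * 1)) = 2 * g / h * g by field.
  move=> E; have : 2 * g * (1 - g / h) = 0 by lra.
  move=> /eqP; rewrite !mulf_eq0 (negbTE g0) pnatr_eq0/= subr_eq0 => /eqP E2.
  by rewrite -[h]mulr1 E2; field.
by rewrite e gh divff// subrr; coords.
Qed.

Lemma mid_height k (c s a b z rho : R) : k <> Flat -> c ^+ 2 + K k * s ^+ 2 = 1 -> 0 < c ->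
  0 < a -> 0 < b -> 0 < z -> a + b = 2 * c * z ->
  2 * K k * (1 - a) < rho -> 2 * K k * (1 - b) < rho -> 2 * K k * (1 - z) < rho.
Proof.
case: k => //= _ cs c0 a0 b0 z0 e ha hb.
  have c1 : 1 <= c by have := sqr_ge0 s; nra.
  have h : z <= z * c by rewrite ler_peMr// ltW.
  by nra.
have c1 : c <= 1 by have := sqr_ge0 s; nra.
have h : z * c <= z by rewrite ler_piMr// ltW.
by nra.
Qed.

(** The midpoint can be inserted into a side at no cost in length or area and without leaving the
    cap; moreover, moving it does not change the length to first order. *)
Lemma midpoint k p q : upper k p -> upper k q -> p <> q -> exists m,
  [/\ upper k m, dist k p m + dist k m q = dist k p q, tri k p m + tri k m q = tri k p q,
      p <> m /\ m <> q &
      forall rho, chord2 k origin p < rho -> chord2 k origin q < rho -> chord2 k origin m < rho] /\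
  forall xi, bil k m xi = 0 -> edge_rate k p m 0 xi + edge_rate k m q xi 0 = 0.
Proof.
move=> up uq pq; have B := upper_bilN1 up uq; have sp := up.1; have sq := uq.1; have pi0 := @pi_gt0 R.
have na : k = Spherical -> q <> - p.
  by move=> e eq; have := uq.2; rewrite eq /=; have := up.2; lra.
have [e he je] := exists_join sp sq na; have dpi := dist_ltpi sp sq na.
have d0 : 0 < dist k p q.
  by rewrite lt_neqAle dist_ge0// andbT; apply/eqP => /esym/(dist_eq0 sp sq).
set d := dist k p q in je dpi d0 *.
have c0 : 0 < gcos k (d / 2) by apply: gcos_gt0 => E; have := dpi E; clear E => h; between.
have s0 : 0 < gsin k (d / 2) by apply: gsin_gt0; [lra|move=> E; have := dpi E; clear E; lra].
pose m := geodesic k p e (d / 2); have sm : surface k m by exact: geodesic_surface.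
have pm : dist k p m = d / 2.
  by apply: (dist_geodesic sp he); [lra|move=> E; have := dpi E; clear E; lra].
have mq : dist k m q = d / 2.
  rewrite -je; have -> : geodesic k p e d = geodesic k m (vel k p e (d / 2)) (d / 2).
    by rewrite /m geodesic_shift; congr geodesic; field.
  by apply: (dist_geodesic sm (vel_unit _ sp he)); [lra|move=> E; have := dpi E; clear E; lra].
have sum : lin 1 p 1 q = lin (2 * gcos k (d / 2)) m 0 m.
  rewrite -{1}je /m !geodesicE gsin_half gcos_half'.
  by coords.
have mE (f : space -> R) : (forall a x b y, f (lin a x b y) = a * f x + b * f y) ->
    f p + f q = 2 * gcos k (d / 2) * f m.
  by move=> hf; have := congr1 f sum; rewrite !hf; lra.
have z2 : p.2 + q.2 = 2 * gcos k (d / 2) * m.2 by apply: (mE (fun x => x.2)).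
have um : upper k m.
  have : 0 < 2 * gcos k (d / 2) * m.2 by rewrite -z2 addr_gt0//; [exact: up.2|exact: uq.2].
  by rewrite pmulr_rgt0 ?mulr_gt0// => m0; split.
clearbody m; exists m; split; first split=> //.
- by rewrite pm mq; field.
- have bmp : bil k m p = gcos k (d / 2) by rewrite bilC (bil_dist sp sm) pm.
  have bmq : bil k m q = gcos k (d / 2) by rewrite (bil_dist sm sq) mq.
  have := tri3_cocycle um up uq; rewrite bmp bmq => /(_ c0 c0).
  have -> : tri3 k m p q = 0.
    have : 2 * gcos k (d / 2) * det3 m p q = 0.
      have := mE (fun x => det3 x p q) (fun a x b y => det3_lin1 a x b y p q).
      by rewrite det3pp det3_pqp; lra.
    by move/eqP; rewrite mulf_eq0 gt_eqF ?mulr_gt0//= => /eqP D; rewrite /tri3 D mul0r gatan0 mulr0.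
  by rewrite (triC k m p) (triC k q m); lra.
- by split=> E; [move: pm; rewrite -E dist_pp; lra|move: mq; rewrite E dist_pp; lra].
- move=> rho hp hq.
  case: (pselect (k = Flat)) => [E|nf].
    have g1 : gcos k (d / 2) = 1 by rewrite E.
    rewrite g1 in mE z2; have mx := mE (fun x => x.1.1) (fun _ _ _ _ => erefl); have my := mE (fun x => x.1.2) (fun _ _ _ _ => erefl).
    move: hp hq; rewrite E /chord2 /=; move: mx my => /= mx my.
    rewrite (_ : m.1.1 = (p.1.1 + q.1.1) / 2) 1?(_ : m.1.2 = (p.1.2 + q.1.2) / 2); [|lra|lra].
    have := sqr_ge0 (p.1.1 - q.1.1); have := sqr_ge0 (p.1.2 - q.1.2); nra.
  rewrite !(chord2_nonflat nf (upper_origin k).1)// !bil_origin in hp hq *.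
  exact: (mid_height nf (gcos2Dgsin2 k (d / 2)) c0 up.2 uq.2 um.2 z2).
- move=> xi tx; rewrite /edge_rate pm mq -mulrDl.
  rewrite (_ : _ + _ = 0) ?mul0r//.
  have mm := mE (fun x => metric k x xi) (fun a x b y => metric_linl k a x b y xi).
  have l0 : (1 - gcos k (d / 2)) * metric k m xi = 0.
    case: (pselect (k = Flat)) => [E|nf]; first by rewrite E /= subrr mul0r.
    by rewrite metric_bil// tx !mulr0.
  by rewrite !(metric_linl, metric_linr) (_ : metric k p 0 = 0) 1?(_ : metric k m 0 = 0) 1?(_ : metric k q 0 = 0);
    [lra|rewrite /metric /=; ring|rewrite /metric /=; ring|rewrite /metric /=; ring].
Qed.

(** Sides and turns are expressed by the chords to the next vertex and to the one after it. Together
    with left turns they determine each vertex from the three preceding ones. *)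
Definition regular_chain k n (c : 'I_n -> space) : Prop := exists x y : R, forall i,
  [/\ chord2 k (c i) (c (ordS i)) = x, chord2 k (c i) (c (ordS (ordS i))) = y &
      0 < det3 (c i) (c (ordS i)) (c (ordS (ordS i)))].

(** The bound is strict for [c] and weak for its competitors, which makes the cap inactive in the
    first variation. *)
Definition cap_minimizer k rho A0 n (c : 'I_n -> space) : Prop :=
  [/\ forall i, upper k (c i), forall i, chord2 k origin (c i) < rho, A0 <= chain_area k c &
  forall c' : 'I_n -> space, (forall i, cap k rho (c' i)) ->
    A0 <= chain_area k c' -> chain_length k c <= chain_length k c'].

Lemma edge_form_lin k v p a x b y :
  edge_form k v p (lin a x b y) = a * edge_form k v p x + b * edge_form k v p y.
Proof. by rewrite /edge_form det3_lin3; ring. Qed.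

Lemma edge_rate_lin k p q a x b y x' y' :
  edge_rate k p q (lin a x b y) (lin a x' b y') = a * edge_rate k p q x x' + b * edge_rate k p q y y'.
Proof. by rewrite /edge_rate /metric /=; ring. Qed.

(** The vectors are the tangential parts of the pole: motion straight towards it. Since heights are
    positive, no side grows and every nondegenerate side shrinks. *)
Lemma contraction_rate k p q : upper k p -> upper k q ->
  edge_rate k p q (lin 1 origin (- p.2) p) (lin 1 origin (- q.2) q) =
  - ((p.2 + q.2) / 2 * chord2 k p q) / gsin k (dist k p q).
Proof.
move=> up uq; rewrite /edge_rate; congr (_ / _).
have key : (p.2 - q.2) * metric k (lin 1 p (-1) q) (lin 1 p 1 q) = 0.
  case: (pselect (k = Flat)) => [E|nf].
    move: up uq; rewrite E => up uq; have [p1 q1] := (surface_flat up.1, surface_flat uq.1).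
    by rewrite p1 q1 subrr mul0r.
  rewrite metric_bil// !bil_lin (surface_bil up.1) (surface_bil uq.1) (bilC k q p).
  ring.
transitivity (- ((p.2 + q.2) / 2 * chord2 k p q) - (p.2 - q.2) * metric k (lin 1 p (-1) q) (lin 1 p 1 q) / 2).
  by rewrite /metric /chord2 /=; field.
by rewrite key; ring.
Qed.

Section Minimizer.
Variables (k : curvature) (rho A0 : R) (n : nat) (c : 'I_n -> space).
Hypothesis n1 : (1 < n)%N.
Hypothesis cm : cap_minimizer k rho A0 c.

Let uc i : upper k (c i). Proof. by case: cm. Qed.

Let w0 i : space := lin 1 origin (- (c i).2) (c i).

Let tw0 i : bil k (c i) (w0 i) = 0.
Proof. by rewrite bil_linr bilC bil_origin (surface_bil (uc i).1); ring. Qed.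

Lemma length_rate_contraction i : c i <> c (ordS i) -> length_rate k c w0 < 0.
Proof.
move=> ne; have le0 j : edge_rate k (c j) (c (ordS j)) (w0 j) (w0 (ordS j)) <= 0.
  rewrite contraction_rate// mulNr oppr_le0 !mulr_ge0 ?invr_ge0//.
  - by rewrite addr_ge0// ltW//; exact: (uc _).2.
  - by apply: chord2_ge0; exact: (uc _).1.
  - case: (pselect (c j = c (ordS j))) => [<-|nj]; first by rewrite dist_pp gsin0.
    by have [e [g [S [[_ _ S0 _ <-] _]]]] := upper_join (uc j) (uc (ordS j)) nj; exact: ltW.
rewrite /length_rate (bigD1 i)//= ltr_wnDr ?sumr_le0//.
rewrite contraction_rate// mulNr oppr_lt0 !mulr_gt0 ?invr_gt0//.
- by rewrite addr_gt0//; exact: (uc _).2.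
- rewrite lt_neqAle chord2_ge0 ?andbT//; [|exact: (uc _).1|exact: (uc _).1].
  by apply/eqP => /esym/(chord2_eq0 (uc i).1 (uc (ordS i)).1).
- by have [e [g [S [[_ _ S0 _ <-] _]]]] := upper_join (uc i) (uc (ordS i)) ne.
Qed.

(** [multiplier] with the contraction towards the pole as the shortening motion and a motion of the
    middle vertex as the additional one. *)
Lemma vertex_condition i : let p := c i in let v := c (ordS i) in let q := c (ordS (ordS i)) in
  p <> v -> v <> q -> p <> q -> area_rate k c w0 < 0 /\
  forall xi, bil k v xi = 0 ->
  (edge_rate k p v 0 xi + edge_rate k v q xi 0) * area_rate k c w0 =
  length_rate k c w0 * (edge_form k v p xi - edge_form k v q xi).
Proof.
move=> p v q pv vq pq.
apply: (@multiplier (fun xi => edge_form k v p xi - edge_form k v q xi)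
  (fun xi => edge_rate k p v 0 xi + edge_rate k v q xi 0) (fun xi => bil k v xi = 0)).
- exact: length_rate_contraction pv.
- by move=> t xi h; rewrite bil_linr h; ring.
- by move=> t xi; rewrite !edge_form_lin; ring.
- move=> t xi; have e : (0 : space) = lin t 0 0 0 by coords.
  by rewrite {1 2}e !edge_rate_lin; ring.
- move=> mu xi tx h; have [_ hin har hmin] := cm.
  pose mw j := lin mu (w0 j) 0 (w0 j).
  pose w j := if j == ordS i then lin mu (w0 (ordS i)) 1 xi else mw j.
  have wx : w (ordS i) = lin mu (w0 (ordS i)) 1 xi by rewrite /w eqxx.
  have dA : area_rate k c w = mu * area_rate k c w0 + (edge_form k v p xi - edge_form k v q xi).
    have := sum_update n1 (fun j x y => edge_form k (c (ordS j)) (c j) y - edge_form k (c j) (c (ordS j)) x)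
      mw i (lin mu (w0 (ordS i)) 1 xi).
    rewrite /= -/(area_rate k c w) -/(area_rate k c mw) => ->.
    have -> : area_rate k c mw = mu * area_rate k c w0.
      by rewrite /area_rate mulr_sumr; apply: eq_bigr => j _; rewrite /mw !edge_form_lin; ring.
    by rewrite /mw !edge_form_lin /p /v /q; ring.
  have dL : length_rate k c w = mu * length_rate k c w0 + (edge_rate k p v 0 xi + edge_rate k v q xi 0).
    have := sum_update n1 (fun j x y => edge_rate k (c j) (c (ordS j)) x y) mw i (lin mu (w0 (ordS i)) 1 xi).
    rewrite /= -/(length_rate k c w) -/(length_rate k c mw) => ->.
    have -> : length_rate k c mw = mu * length_rate k c w0.
      by rewrite /length_rate mulr_sumr; apply: eq_bigr => j _; rewrite /mw !edge_rate_lin; ring.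
    by rewrite /edge_rate /metric /mw /p /v /q /=; ring.
  rewrite -dL; apply: (@first_order k n c uc rho A0 hin har hmin); last by rewrite dA.
    move=> j; rewrite /w; case: eqP => [->|_].
      by rewrite bil_linr tw0 tx; ring.
    by rewrite /mw bil_linr tw0; ring.
  move=> j ej; have nj1 : j <> i by move=> E; apply: pv; rewrite /p /v -E.
  have nj2 : j <> ordS i by move=> E; apply: vq; rewrite /v /q -E.
  rewrite /w (_ : (j == ordS i) = false) 1?(_ : (ordS j == ordS i) = false).
  - by rewrite /mw /w0 -ej.
  - by apply/negbTE; rewrite (inj_eq (@ordS_inj n)); apply/eqP.
  - by apply/negbTE/eqP.
- exact: (exists_area_change (uc _) (uc _) (uc _) pq).
Qed.

(** Retracting a spike to its base keeps the area and saves twice its length. *)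
Lemma no_spike i : c i <> c (ordS i) -> c i <> c (ordS (ordS i)).
Proof.
move=> ne e; have [_ hin har hmin] := cm.
pose c' j := if j == ordS i then c i else c j.
have uA := sum_update n1 (fun _ => tri k) c i (c i).
have uL := sum_update n1 (fun _ => dist k) c i (c i).
rewrite /= -/c' -e !tri_pp (triC k (c (ordS i))) in uA.
rewrite /= -/c' -e !dist_pp (distC k (c (ordS i))) in uL.
have d0 : 0 < dist k (c i) (c (ordS i)).
  rewrite lt_neqAle dist_ge0 ?andbT; [|exact: (uc _).1|exact: (uc _).1].
  by apply/eqP => /esym/(dist_eq0 (uc i).1 (uc (ordS i)).1).
have := hmin c' ; rewrite /chain_length uL -/(chain_length k c) /chain_area uA -/(chain_area k c).
move=> /(_ _ ltac:(lra)) h; suff : forall i, cap k rho (c' i) by move=> /h; lra.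
by move=> j; rewrite /c'; case: ifP => _; split; rewrite ?ltW.
Qed.

End Minimizer.

(** A repeated vertex could be slid back to the midpoint of the preceding side, giving another
    minimizer. Moving this midpoint changes the area but, to first order, not the length, against
    the multiplier rule. *)
Lemma no_zero_edge k rho A0 n (c : 'I_n -> space) i : (2 < n)%N -> cap_minimizer k rho A0 c ->
  c i <> c (ordS i) -> c (ordS i) <> c (ordS (ordS i)).
Proof.
move=> n2 cm ne e; have n1 := ltnW n2; have [uc hin har hmin] := cm.
set v := c (ordS i) in ne e; have [m [[um dm tm [pm mq] cpm] rm]] := midpoint (uc i) (uc (ordS i)) ne.
pose c' j := if j == ordS i then m else c j.
have uA := sum_update n1 (fun _ => tri k) c i m.
have uL := sum_update n1 (fun _ => dist k) c i m.
rewrite /= -/c' -/v -e tri_pp in uA; rewrite /= -/c' -/v -e dist_pp in uL.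
have ci : c' i = c i by rewrite /c' ifF//; apply/negbTE; rewrite eq_sym ordS_neq.
have cv : c' (ordS i) = m by rewrite /c' eqxx.
have cq : c' (ordS (ordS i)) = v by rewrite /c' ifF//; apply/negbTE; rewrite ordS_neq.
have cm' : cap_minimizer k rho A0 c'.
  split.
  - by move=> j; rewrite /c'; case: ifP.
  - by move=> j; rewrite /c'; case: ifP => _ //; apply: cpm.
  - by rewrite /chain_area uA -/(chain_area k c) -/v; lra.
  - move=> d hd Ad; have := hmin d hd Ad.
    by rewrite [chain_length k c']/chain_length uL -/(chain_length k c) -/v; lra.
have := vertex_condition n1 cm' (i := i); rewrite /= ci cv cq.
move=> /(_ pm mq ne)[A1 hA].
have [xi tx ax] := exists_area_change um (uc i) (uc (ordS i)) ne.
have L1 : length_rate k c' (fun j => lin 1 origin (- (c' j).2) (c' j)) < 0.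
  by apply: (length_rate_contraction cm' (i := i)); rewrite ci cv.
have := hA xi tx; rewrite rm// mul0r => /esym/eqP; rewrite mulf_eq0 (negbTE ax) orbF => /eqP h.
by move: L1; rewrite h ltxx.
Qed.

(** With unit vectors [e1], [e2] from a vertex to its neighbours, the multiplier rule reads
    [- (e1 + e2) = la * (t1 * ... - t2 * ...)], the right side being made of the quarter-turned
    vectors and the tangents [t1], [t2] of half the sides. The multiplier [la] is common to all
    vertices, so sides and turns are too. *)
Lemma minimizer_regular k rho A0 n (c : 'I_n -> space) : (2 < n)%N -> 0 < A0 ->
  cap_minimizer k rho A0 c -> regular_chain k c.
Proof.
move=> n2 A00 cm; have n1 := ltnW n2; have [uc hin har hmin] := cm.
have [i0 ne0] : exists i, c i <> c (ordS i).
  apply: contrapT => h; have : chain_area k c = 0.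
    apply: big1 => i _; have -> : c i = c (ordS i) by apply: contrapT => hi; apply: h; exists i.
    exact: tri_pp.
  by move: har => + e; rewrite e; lra.
have ne : forall i, c i <> c (ordS i) by apply: (ordS_ind ne0) => j; exact: no_zero_edge n2 cm.
have ns i : c i <> c (ordS (ordS i)) by apply: (no_spike n1 cm).
set w0 := fun j => lin 1 origin (- (c j).2) (c j).
pose A := area_rate k c w0; pose L := length_rate k c w0.
have L0 : L < 0 by apply: (length_rate_contraction cm (ne i0)).
have A1 : A < 0 by have [] := vertex_condition n1 cm (ne i0) (ne (ordS i0)) (ns i0).
pose la := L / A; have la0 : 0 < la by rewrite /la -mulrNN -invrN divr_gt0// oppr_gt0.
(* [S] recovers the [gsin] of a side from its squared chord. [Y] is the squared chord to the vertex
   after next, obtained from [1 + m = la * t1 * D] and [m ^+ 2 + D ^+ 2 = 1]. *)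
pose S (x : R) := gsin k (2 * gasin k (Num.sqrt x / 2)).
pose Y (x : R) := 4 * S x ^+ 2 / (1 + (la * (S x / (2 - K k * x / 2))) ^+ 2).
suff step i : [/\ chord2 k (c i) (c (ordS i)) = chord2 k (c (ordS i)) (c (ordS (ordS i))),
    chord2 k (c i) (c (ordS (ordS i))) = Y (chord2 k (c i) (c (ordS i))) &
    0 < det3 (c i) (c (ordS i)) (c (ordS (ordS i)))].
  have cst : forall i, chord2 k (c i) (c (ordS i)) = chord2 k (c i0) (c (ordS i0)).
    by apply: (ordS_ind (erefl (chord2 k (c i0) (c (ordS i0))))) => j; have [-> _ _] := step j.
  exists (chord2 k (c i0) (c (ordS i0))), (Y (chord2 k (c i0) (c (ordS i0)))) => i.
  by have [_ e d] := step i; rewrite e cst.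
have [_ hA] := vertex_condition n1 cm (ne i) (ne (ordS i)) (ns i).
rewrite -/w0 -/A -/L in hA.
have := (uc (ordS i), uc i, uc (ordS (ordS i)), ns i, ne i, ne (ordS i)).
move: (c i) (c (ordS i)) (c (ordS (ordS i))) hA => p v q hA [[[[[uv up] uq] pq] pv] vq].
have [xi0 tx0 ax0] := exists_area_change uv up uq pq.
have [e1 [g1 [S1 [[h1 E1 s1 gp S1E] [b1 q1]]]]] := upper_join uv up (fun E => pv (esym E)).
have [e2 [g2 [S2 [[h2 E2 s2 gq S2E] [b2 q2]]]]] := upper_join uv uq vq.
have n1' : 1 + g1 != 0 by rewrite gt_eqF//; lra.
have n2' : 1 + g2 != 0 by rewrite gt_eqF//; lra.
have mv g s xi : -1 < g -> g ^+ 2 + K k * s ^+ 2 = 1 -> bil k v xi = 0 -> (g - 1) * metric k v xi = 0.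
  move=> g1' gs tx; case: (pselect (k = Flat)) => [E|nf]; last by rewrite metric_bil// tx !mulr0.
  move: gs; rewrite E /= mul0r addr0 => /eqP; rewrite sqrf_eq1 => /orP[]/eqP gE; last by move: g1'; rewrite gE ltxx.
  by rewrite gE subrr mul0r.
have rate xi : bil k v xi = 0 -> edge_rate k p v 0 xi + edge_rate k v q xi 0 = - metric k e1 xi - metric k e2 xi.
  move=> tx; rewrite /edge_rate (distC k p) -S1E -S2E.
  have -> : metric k (lin 1 p (-1) v) (lin 1 0 (-1) xi) = - S1 * metric k e1 xi - (g1 - 1) * metric k v xi.
    by rewrite E1 /metric /=; ring.
  have -> : metric k (lin 1 v (-1) q) (lin 1 xi (-1) 0) = - S2 * metric k e2 xi - (g2 - 1) * metric k v xi.
    by rewrite E2 /metric /=; ring.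
  rewrite (mv g1 S1)// (mv g2 S2)//; field; by rewrite !gt_eqF.
have form xi : edge_form k v p xi - edge_form k v q xi =
    S1 / (1 + g1) * det3 v e1 xi - S2 / (1 + g2) * det3 v e2 xi.
  by rewrite /edge_form -gp -gq {1}E1 {1}E2 !det3_lin2 !det3pp; field; apply/andP.
have eqn xi : bil k v xi = 0 -> - metric k e1 xi - metric k e2 xi =
    la * (S1 / (1 + g1) * det3 v e1 xi - S2 / (1 + g2) * det3 v e2 xi).
  move=> tx; have := hA xi tx; rewrite rate// form => h.
  by rewrite /la mulrAC -h; field; rewrite lt_eqF.
set t1 := S1 / (1 + g1) in form eqn *; set t2 := S2 / (1 + g2) in form eqn *.
have t10 : 0 < t1 by rewrite divr_gt0//; lra.
have t20 : 0 < t2 by rewrite divr_gt0//; lra.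
pose m := metric k e1 e2; pose D := det3 v e2 e1.
have mD : m ^+ 2 + D ^+ 2 = 1 by rewrite /m metricC; exact: (cauchy_tangent uv.1 h2 h1).
(* Tested on [e1] and on [e2], the rule gives two expressions for [1 + m], namely [la * t2 * D] and
   [la * t1 * D]. *)
have x1 := eqn e1 h1.1; have x2 := eqn e2 h2.1.
rewrite h1.2 (metricC k e2 e1) -/m det3_qpp -/D in x1.
rewrite h2.2 -/m det3_qpp det3_swap23 -/D in x2.
(* Without a turn the two directions are opposite, so the length would be stationary under every
   motion of the vertex, while the area is not. *)
have D0 : D != 0.
  apply/eqP => D0; have m1 : m = -1 by rewrite D0 in x1; lra.
  have e2E : e2 = lin (-1) e1 0 e1.
    rewrite {1}(frame_tangent uv.1 h1 h2.1) -/m m1 det3_swap23 -/D D0.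
    by coords.
  have := eqn xi0 tx0; rewrite -form e2E metric_linl => /eqP.
  have -> : - metric k e1 xi0 - (-1 * metric k e1 xi0 + 0 * metric k e1 xi0) = 0 by ring.
  by rewrite eq_sym mulf_eq0 (negbTE ax0) gt_eqF.
have t12 : t1 = t2.
  have : la * D * (t1 - t2) = 0 by lra.
  have lan : la != 0 by rewrite gt_eqF.
  by move/eqP; rewrite mulf_eq0 (negbTE (mulf_neq0 lan D0)) subr_eq0 => /eqP.
have laD : 1 + m = la * t1 * D by rewrite t12; lra.
have lt0 : 0 < la * t1 by rewrite mulr_gt0.
have Dpos : 0 < D.
  rewrite lt_neqAle eq_sym D0 leNgt; apply/negP => Dn.
  have : (1 + m) < 0 by rewrite laD pmulr_rlt0.
  by have := sqr_ge0 D; nra.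
have gS1 : (1 + g1) * (1 + K k * t1 ^+ 2) = 2.
  have -> : (1 + g1) * (1 + K k * t1 ^+ 2) = 1 + g1 + K k * S1 ^+ 2 / (1 + g1) by rewrite /t1; field.
  by rewrite (_ : K k * S1 ^+ 2 = (1 - g1) * (1 + g1)); [field|lra].
have gS2 : (1 + g2) * (1 + K k * t2 ^+ 2) = 2.
  have -> : (1 + g2) * (1 + K k * t2 ^+ 2) = 1 + g2 + K k * S2 ^+ 2 / (1 + g2) by rewrite /t2; field.
  by rewrite (_ : K k * S2 ^+ 2 = (1 - g2) * (1 + g2)); [field|lra].
have g12 : g1 = g2.
  rewrite -t12 in gS2; have : (g1 - g2) * (1 + K k * t1 ^+ 2) = 0 by lra.
  move/eqP; rewrite mulf_eq0 subr_eq0 => /orP[/eqP//|/eqP h].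
  by move: gS1; rewrite h mulr0; lra.
have S12 : S1 = S2.
  have -> : S1 = t1 * (1 + g1) by rewrite /t1; field.
  by rewrite t12 g12 /t2; field.
have chE : chord2 k p v = chord2 k v q.
  have c1 : chord2 k p v = (g1 - 1) ^+ 2 * metric k v v + 2 * S1 * ((g1 - 1) * metric k v e1) + S1 ^+ 2 * metric k e1 e1.
    by rewrite E1 /chord2 /metric /=; ring.
  have c2 : chord2 k v q = (g2 - 1) ^+ 2 * metric k v v + 2 * S2 * ((g2 - 1) * metric k v e2) + S2 ^+ 2 * metric k e2 e2.
    by rewrite E2 /chord2 /metric /=; ring.
  by rewrite c1 c2 (mv g1 S1)//; [rewrite (mv g2 S2)//; [rewrite h1.2 h2.2 g12 S12|exact: h2.1]|exact: h1.1].
have Sx : S (chord2 k p v) = S1 by rewrite /S S1E chord2C.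
have gx : 2 - K k * chord2 k p v / 2 = 1 + g1.
  by rewrite gp bilC (bil_chord2 up.1 uv.1); ring.
split=> //.
- rewrite /Y Sx gx -/t1.
  have -> : chord2 k p q = S1 ^+ 2 * (2 - 2 * m).
    transitivity (S1 ^+ 2 * (metric k e1 e1 + metric k e2 e2 - 2 * metric k e1 e2)); last by rewrite h1.2 h2.2 -/m; ring.
    by rewrite E1 E2 -g12 -S12 /chord2 /metric /=; ring.
  have q0 : 1 + (la * t1) ^+ 2 != 0 by rewrite gt_eqF// ltr_wpDr ?sqr_ge0.
  have Dm : D = la * t1 * (1 - m).
    have : D * (D - la * t1 * (1 - m)) = 0 by rewrite mulrBr mulrCA mulrA -laD; lra.
    by move/eqP; rewrite mulf_eq0 (negbTE D0) subr_eq0 => /eqP.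
  have : (1 - m) * (1 + (la * t1) ^+ 2) = 2 by move: laD; rewrite Dm; lra.
  move=> h; have -> : 4 * S1 ^+ 2 / (1 + (la * t1) ^+ 2) = S1 ^+ 2 * (2 * ((1 - m) * (1 + (la * t1) ^+ 2))) / (1 + (la * t1) ^+ 2).
    by rewrite h; field.
  by field.
- rewrite E1 E2 -g12 -S12 !(det3_lin1, det3_lin3) det3_pqp !det3_qpp ?det3pp.
  have -> : det3 e1 v e2 = D by rewrite det3_cycle.
  by have := mulr_gt0 (mulr_gt0 s1 s1) Dpos; lra.
Qed.

(** * Regular chains lie on a circle *)

Lemma metric_pole k v (g s : R) xi : -1 < g -> g ^+ 2 + K k * s ^+ 2 = 1 -> bil k v xi = 0 ->
  (g - 1) * metric k v xi = 0.
Proof.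
move=> g1 gs tx; case: (pselect (k = Flat)) => [E|nf]; last by rewrite metric_bil// tx !mulr0.
move: gs; rewrite E /= mul0r addr0 => /eqP; rewrite sqrf_eq1 => /orP[]/eqP gE; last by move: g1; rewrite gE ltxx.
by rewrite gE subrr mul0r.
Qed.

(* [d] is the mirror image of [a] in the perpendicular bisector of [b] and [c]. *)
Lemma chain_recurrence k a b c d (x y : R) : surface k a -> surface k b -> surface k c -> surface k d ->
  -1 < bil k b c -> chord2 k a b = x -> chord2 k b c = x -> chord2 k c d = x ->
  chord2 k a c = y -> chord2 k b d = y -> 0 < det3 a b c -> 0 < det3 b c d ->
  d = lin 1 a (y / x - 1) (lin 1 c (-1) b).
Proof.
move=> sa sb sc sd b1 ab bc cd ac bd abc bcd.
have bnc : b <> c by move=> E; move: bcd; rewrite E det3pp ltxx.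
have x0 : 0 < x.
  rewrite -bc lt_neqAle chord2_ge0// andbT; apply/eqP => /esym/(chord2_eq0 sb sc); exact: bnc.
have na : k = Spherical -> c <> - b.
  move=> E cb; have bb := surface_bil sb; move: b1; rewrite cb.
  have -> : bil k b (- b) = - bil k b b by rewrite /bil /=; ring.
  by rewrite bb ltxx.
have [e he je] := exists_join sb sc na.
set g := gcos k (dist k b c); set S := gsin k (dist k b c).
have gE : g = bil k b c by rewrite /g -bil_dist.
have cE : c = lin g b S e by rewrite -je.
have gS : g ^+ 2 + K k * S ^+ 2 = 1 by exact: gcos2Dgsin2.
have S0 : 0 < S.
  apply: gsin_gt0; last exact: dist_ltpi.
  by rewrite lt_neqAle dist_ge0// andbT; apply/eqP => /esym/(dist_eq0 sb sc).
set ka := y / x - 1; set a' := lin 1 a ka (lin 1 c (-1) b).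
have kx : ka * x = y - x by rewrite /ka; field; rewrite gt_eqF.
(* [z] is the deviation from the expected point. It is tangent at [b] and orthogonal to the side,
   hence a multiple [be] of the normal; [key] leaves two values, and the second one would be a right
   turn. *)
pose z := lin 1 d (-1) a'.
have ch (p q : space) : chord2 k p q = metric k (lin 1 p (-1) q) (lin 1 p (-1) q) by rewrite /chord2 /metric /=; ring.
have i1 : metric k (lin 1 a (-1) b) (lin 1 c (-1) b) = x - y / 2.
  have -> : metric k (lin 1 a (-1) b) (lin 1 c (-1) b) = (chord2 k a b + chord2 k b c - chord2 k a c) / 2.
    by rewrite /metric /chord2 /=; field.
  by rewrite ab bc ac; field.
have i2 : metric k (lin 1 d (-1) b) (lin 1 c (-1) b) = y / 2.
  have -> : metric k (lin 1 d (-1) b) (lin 1 c (-1) b) = (chord2 k b d + chord2 k b c - chord2 k c d) / 2.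
    by rewrite /metric /chord2 /=; field.
  by rewrite bd bc cd; field.
have i3 : metric k (lin 1 c (-1) b) (lin 1 c (-1) b) = x by rewrite -ch chord2C.
have zc : metric k z (lin 1 c (-1) b) = 0.
  transitivity (metric k (lin 1 d (-1) b) (lin 1 c (-1) b) - metric k (lin 1 a (-1) b) (lin 1 c (-1) b) -
     ka * metric k (lin 1 c (-1) b) (lin 1 c (-1) b)); first by rewrite /z /a' /metric /=; ring.
  by rewrite i1 i2 i3 kx; lra.
have tz : bil k b z = 0.
  rewrite /z /a' !bil_linr (bil_chord2 sb sd) (bilC k b a) (bil_chord2 sa sb) (bil_chord2 sb sc) (surface_bil sb).
  by rewrite ab bd bc; have := kx; nra.
have ez : metric k e z = 0.
  have : S * metric k e z = 0.
    have -> : S * metric k e z = metric k z (lin 1 c (-1) b) - (g - 1) * metric k b z.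
      by rewrite cE /metric /=; ring.
    by rewrite zc (metric_pole _ gS tz) ?gE// subrr.
  by move/eqP; rewrite mulf_eq0 gt_eqF//= => /eqP.
set be := det3 b e z.
have zE : z = lin be (trot k b e) 0 e.
  by rewrite (frame_tangent sb he tz) ez -/be; coords.
have rt (w : space) : (k = Flat -> w.2 = 0) -> metric k (trot k b e) w = det3 b e w.
  by case: k {ab bc cd ac bd sa sb sc sd b1 na he je g S gE cE gS S0 a' z ch i1 i2 i3 zc tz ez be zE} => h;
    rewrite /metric /det3 /trot /=; [ring|rewrite h//; ring|ring].
have fl : k = Flat -> (lin 1 a' (-1) b).2 = 0.
  move=> E; move: sa sb sc; rewrite E => sa sb sc.
  by rewrite /a' /= (surface_flat sa) (surface_flat sb) (surface_flat sc); ring.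
have dpos q : 0 < det3 b c q -> 0 < det3 b e q.
  by rewrite cE det3_lin2 det3pp mulr0 add0r pmulr_rgt0.
have da : 0 < det3 b e a'.
  by apply: dpos; rewrite /a' !det3_lin3 det3_qpp det3_pqp -det3_cycle; lra.
have dd : det3 b e d = det3 b e a' + be by rewrite /be /z det3_lin3; ring.
have key : be * (2 * det3 b e a' + be) = 0.
  have na' : metric k (lin 1 a' (-1) b) (lin 1 a' (-1) b) = y.
    transitivity (chord2 k a b + 2 * ka * metric k (lin 1 a (-1) b) (lin 1 c (-1) b) + ka ^+ 2 *
      metric k (lin 1 c (-1) b) (lin 1 c (-1) b)); first by rewrite ch /a' /metric /=; ring.
    rewrite ab i1 i3; have : ka ^+ 2 * x = ka * (y - x) by rewrite expr2 -mulrA kx.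
    by have := kx; lra.
  have ur := (unit_rot sb he).2; have uf := rt _ fl.
  rewrite det3_lin3 det3_pqp mulr0 addr0 mul1r in uf.
  have : chord2 k b d = y + 2 * be * metric k (trot k b e) (lin 1 a' (-1) b) + be ^+ 2 * metric k (trot k b e) (trot k b e).
    rewrite -na' chord2C ch; have -> : lin 1 d (-1) b = lin 1 (lin 1 a' (-1) b) be (trot k b e).
      have : d = lin 1 a' 1 z by rewrite /z; coords.
      by rewrite zE => {1}->; coords.
    by rewrite /metric /=; ring.
  by rewrite bd uf ur; lra.
have be0 : be = 0.
  move/eqP: key; rewrite mulf_eq0 => /orP[/eqP//|/eqP h].
  by have := dpos _ bcd; rewrite dd; lra.
have : d = lin 1 a' 1 z by rewrite /z; coords.
by rewrite zE be0 => {1}->; coords.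
Qed.

Section Center.
Variables (n : nat) (c : 'I_n -> space).
Hypothesis n0 : (0 < n)%N.

Definition mean : space :=
  (n%:R^-1 * \sum_i (c i).1.1, n%:R^-1 * \sum_i (c i).1.2, n%:R^-1 * \sum_i (c i).2).

Lemma mean_lin (f : space -> R) : (forall a p b q, f (lin a p b q) = a * f p + b * f q) ->
  f mean = n%:R^-1 * \sum_i f (c i).
Proof.
move=> hf; have E (p : space) : f p = p.1.1 * f (1, 0, 0) + p.1.2 * f (0, 1, 0) + p.2 * f (0, 0, 1).
  have -> : f p = f (lin 1 (lin p.1.1 (1, 0, 0) p.1.2 (0, 1, 0)) p.2 (0, 0, 1)).
    by congr f; coords.
  by rewrite !hf; ring.
rewrite E (eq_bigr _ (fun i _ => E (c i))) !big_split /= -!mulr_suml; ring.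
Qed.

Lemma sum_ordS (f : 'I_n -> R) : \sum_i f (ordS i) = \sum_i f i.
Proof. by rewrite [RHS](reindex_inj (@ordS_inj n)). Qed.

(** The third-order recurrence has a first integral, constant around the cycle; summation over the
    cycle expresses it through the mean. *)
Lemma scalar_center (f : 'I_n -> R) ka : (forall i, f (ordS (ordS (ordS i))) = f i + ka * (f (ordS (ordS i)) - f (ordS i))) ->
  forall i, f (ordS (ordS i)) - (ka - 1) * f (ordS i) + f i = (3 - ka) * (n%:R^-1 * \sum_j f j).
Proof.
move=> h; pose W i := f (ordS (ordS i)) - (ka - 1) * f (ordS i) + f i.
pose i0 := Ordinal n0.
have cst : forall i, W i = W i0 by apply: (ordS_ind (erefl (W i0))) => j <-; rewrite /W h; ring.
have nz : n%:R != 0 :> R by rewrite pnatr_eq0 -lt0n.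
have : \sum_i W i = n%:R * W i0.
  by rewrite (eq_bigr _ (fun i _ => cst i)) sumr_const card_ord mulr_natl.
rewrite /W big_split big_split/= sumrN -mulr_sumr !(sum_ordS (fun i => f (ordS i))) !sum_ordS -/(W i0).
move=> e i; rewrite -/(W i) cst; apply: (mulfI nz); rewrite -e; field; exact: nz.
Qed.

End Center.

(** The deviations [X] from the mean satisfy [X (i + 2) = 2 * chi * X (i + 1) - X i] with constant
    norm, and are tangent at the normalized mean: they turn there by the constant angle [acos chi].
    The chain may go around several times, so [phi] is not yet known. The last clause says that the
    centre stays in every half-surface that holds the chain. *)
Lemma regular_chain_circle k n (c : 'I_n -> space) (n0 : (0 < n)%N) : (forall i, surface k (c i)) ->
  (forall i, -1 < bil k (c i) (c (ordS i))) -> regular_chain k c ->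
  exists m w N r phi, [/\ surface k m, unit_tangent k m w, 0 < N /\ 0 < r, 0 < phi < pi & N ^+ 2 + K k * r ^+ 2 = 1] /\
   (forall j : nat, c (windex n0 j) =
      lin N m r (lin (cos (j%:R * phi)) w (sin (j%:R * phi)) (trot k m w))) /\
   (forall o, (forall i, 0 < bil k o (c i)) -> 0 < bil k o m).
Proof.
move=> sc b1 [x [y h]]; have nz : n%:R != 0 :> R by rewrite pnatr_eq0 -lt0n.
pose i0 := Ordinal n0; pose ka := y / x - 1; have [m' m'E] : exists m', m' = mean c by exists (mean c).
have rec i : c (ordS (ordS (ordS i))) = lin 1 (c i) ka (lin 1 (c (ordS (ordS i))) (-1) (c (ordS i))).
  have [a1 a2 a3] := h i; have [a4 a5 a6] := h (ordS i); have [a7 _ _] := h (ordS (ordS i)).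
  exact: (chain_recurrence (sc _) (sc _) (sc _) (sc _) (b1 _) a1 a4 a7 a2 a5 a3 a6).
have [X hX] : exists X : 'I_n -> space, forall i, X i = lin 1 (c i) (-1) m' by exists (fun i => lin 1 (c i) (-1) m').
have W i : lin 1 (c (ordS (ordS i))) 1 (lin (- (ka - 1)) (c (ordS i)) 1 (c i)) = lin (3 - ka) m' 0 m'.
  have cx := scalar_center n0 (f := fun i => (c i).1.1) (ka := ka) _ i.
  have cy := scalar_center n0 (f := fun i => (c i).1.2) (ka := ka) _ i.
  have cz := scalar_center n0 (f := fun i => (c i).2) (ka := ka) _ i.
  have := (cx (fun i => ltac:(by rewrite rec /=; ring)), cy (fun i => ltac:(by rewrite rec /=; ring)), cz (fun i => ltac:(by rewrite rec /=; ring))).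
  move=> [[ex ey] ez].
  by apply: eq_space; [move: ex|move: ey|move: ez]; rewrite m'E /mean /= => E; lra.
have X2 i : X (ordS (ordS i)) = lin (ka - 1) (X (ordS i)) (-1) (X i).
  have E := W i; apply: eq_space.
  - by have := congr1 (fun z => z.1.1) E; rewrite !hX /=; lra.
  - by have := congr1 (fun z => z.1.2) E; rewrite !hX /=; lra.
  - by have := congr1 (fun z => z.2) E; rewrite !hX /=; lra.
have d0 i : 0 < (3 - ka) * det3 (c i) (c (ordS i)) m'.
  have [_ _] := h i; have -> : c (ordS (ordS i)) = lin 1 (lin (3 - ka) m' 0 m') 1 (lin (ka - 1) (c (ordS i)) (-1) (c i)).
    by rewrite -(W i); coords.
  by rewrite !det3_lin3 det3_qpp det3_pqp; lra.
have ka3 : 3 - ka != 0 by apply/eqP => E; have := d0 i0; rewrite E mul0r ltxx.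
pose a i := metric k (X i) (X i).
have chx i : metric k (lin 1 (X i) (-1) (X (ordS i))) (lin 1 (X i) (-1) (X (ordS i))) = x.
  by have [<- _ _] := h i; rewrite !hX /chord2 /metric /=; ring.
have chy i : metric k (lin 1 (X i) (-1) (X (ordS (ordS i)))) (lin 1 (X i) (-1) (X (ordS (ordS i)))) = y.
  by have [_ <- _] := h i; rewrite !hX /chord2 /metric /=; ring.
have aS i : (3 - ka) ^+ 2 * a (ordS i) = 4 * x - y.
  have e1 := chx i; have e2 := chx (ordS i); have e3 := chy i.
  rewrite X2 in e2 e3.
  have -> : 4 * x - y = 2 * x + 2 * x - y by ring.
  rewrite -{1}e1 -e2 -e3 /a; move: (X i) (X (ordS i)) => p q.
  by rewrite /metric /=; ring.
have [r2 ar] : exists r2, forall i, a i = r2.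
  exists (a i0); apply: (ordS_ind (erefl (a i0))) => j <-; rewrite /i0.
  apply: (mulfI (expf_neq0 2 ka3)); rewrite aS.
  by have := (aS (ord_pred j)); rewrite ord_predK.
have arM i : metric k (X i) (X i) = r2 := ar i.
have sumX (f : space -> R) : (forall b p d q, f (lin b p d q) = b * f p + d * f q) -> \sum_i f (X i) = 0.
  move=> hf; rewrite (eq_bigr (fun i => f (c i) - f m')); last by move=> i _; rewrite hX hf; ring.
  by rewrite sumrB sumr_const card_ord -mulr_natl m'E (mean_lin c hf) mulrA divff// mul1r subrr.
have BX i : bil k (X i) (X i) = K k * r2.
  rewrite -(ar i) /a; case: (pselect (k = Flat)) => [E|nf]; last by rewrite bil_metric.
  have one j : (c j).2 = 1 by apply: surface_flat; rewrite -E; exact: sc.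
  have m2 : m'.2 = 1.
    by rewrite m'E /mean /= (eq_bigr (fun=> 1) (fun j _ => one j)) sumr_const card_ord -mulr_natl mulr1 mulVf.
  have : (X i).2 = 0 by rewrite hX /= one m2; ring.
  by rewrite E /bil /= => ->; ring.
have cX i : c i = lin 1 m' 1 (X i) by rewrite hX; coords.
have mX i : bil k m' (X i) = 0.
  pose t := (1 - bil k m' m' - K k * r2) / 2.
  have e j : bil k m' (X j) = t.
    have := surface_bil (sc j); rewrite {1 2}cX !bil_lin BX (bilC k (X j)) /t; lra.
  have := sumX (bil k m') (fun b p d q => bil_linr k b p d q m').
  rewrite (eq_bigr _ (fun j _ => e j)) sumr_const card_ord -mulr_natl => /eqP.
  by rewrite mulf_eq0 (negbTE nz)/= e => /eqP.
have mm : bil k m' m' + K k * r2 = 1.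
  have := surface_bil (sc i0); rewrite {1 2}cX !bil_lin BX (bilC k (X i0)) !mX; lra.
have ninv : 0 < n%:R^-1 :> R by rewrite invr_gt0 ltr0n.
have possum (f : 'I_n -> R) : (forall i, 0 < f i) -> 0 < n%:R^-1 * \sum_i f i.
  move=> f0; rewrite mulr_gt0// (bigD1 i0)//= ltr_pwDl// sumr_ge0// => j _; exact: ltW.
have omean o : (forall i, 0 < bil k o (c i)) -> 0 < bil k o m'.
  by move=> ho; rewrite m'E (mean_lin c (fun b p d q => bil_linr k b p d q o)); exact: possum.
(* On the sphere [bil] is positive definite and [d0] excludes a zero mean; elsewhere [bil] is
   positive between any two vertices, hence also on their mean. *)
have cm : cone k m'.
  split.
    case: (pselect (k = Spherical)) => [E|ns].
      have : 0 <= bil k m' m' by rewrite E /bil /= mul1r addr_ge0 ?addr_ge0// -expr2 sqr_ge0.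
      rewrite le_eqVlt => /predU1P[E0|//]; exfalso.
      have z0 : m' = lin 0 m' 0 m'.
        move: E0; rewrite E /bil /= => E0; have h1 := sqr_ge0 m'.1.1; have h2 := sqr_ge0 m'.1.2; have h3 := sqr_ge0 m'.2.
        by apply: eq_space => /=; rewrite !mul0r addr0; apply/eqP; rewrite -sqrf_eq0; apply/eqP; lra.
      by have := d0 i0; rewrite z0 det3_lin3; lra.
    apply: (omean) => i; rewrite bilC; apply: (omean) => j.
    by rewrite (bil_dist (sc i) (sc j)); apply: gcos_gt0.
  by move=> ns; rewrite m'E /mean /=; apply: possum => i; exact: (sc i).2 ns.
pose N := Num.sqrt (bil k m' m'); have N0 : 0 < N by rewrite sqrtr_gt0; exact: cm.1.
have N2 : N ^+ 2 = bil k m' m' by rewrite sqr_sqrtr// ltW//; exact: cm.1.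
pose m := nrm k m'; have sm : surface k m by exact: nrm_surface.
have mE : m' = lin N m 0 m by rewrite /m /nrm -/N; apply: eq_space => /=; field; rewrite gt_eqF.
have tX i : bil k m (X i) = 0 by rewrite /m /nrm bil_linl mX; ring.
have XX i : X i <> lin 0 m 0 m.
  move=> E; have r20 : r2 = 0 by rewrite -(ar i) /a E /metric /=; ring.
  have Xj j : X j = lin 0 m 0 m.
    have [u hu] := exists_unit_tangent sm.
    have := gram_tangent sm hu.1 (tX j); rewrite hu.2 arM r20 mulr0 => /esym/eqP.
    rewrite paddr_eq0 ?sqr_ge0// !sqrf_eq0 => /andP[/eqP x1 /eqP x2].
    by rewrite (frame_tangent sm hu (tX j)) x1 x2; coords.
  by have := d0 i0; rewrite !cX !Xj (_ : det3 _ _ _ = 0) ?mulr0 ?ltxx// /det3 /=; ring.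
have r20 : 0 < r2.
  have [u hu] := exists_unit_tangent sm; have := gram_tangent sm hu.1 (tX i0); rewrite hu.2 arM mul1r => E.
  rewrite lt_neqAle E addr_ge0 ?sqr_ge0// andbT; apply/eqP => /esym/eqP.
  rewrite paddr_eq0 ?sqr_ge0// !sqrf_eq0 => /andP[/eqP x1 /eqP x2]; apply: (XX i0).
  by rewrite (frame_tangent sm hu (tX i0)) x1 x2; coords.
pose r := Num.sqrt r2; have r0 : 0 < r by rewrite sqrtr_gt0.
have rr : r ^+ 2 = r2 by rewrite sqr_sqrtr// ltW.
pose chi := (ka - 1) / 2.
have X12 i : metric k (X i) (X (ordS i)) = chi * r2.
  have q1 j : metric k (X j) (X (ordS j)) = (2 * r2 - x) / 2.
    have e1 := ar j; have e2 := ar (ordS j); rewrite /a in e1 e2.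
    by rewrite -(chx j) -{1}e1 {1}(_ : 2 * _ = metric k (X j) (X j) + metric k (X (ordS j)) (X (ordS j)));
      [rewrite /metric /=; field|rewrite e1 e2; ring].
  have : metric k (X (ordS i)) (X (ordS (ordS i))) + metric k (X i) (X (ordS i)) = 2 * chi * r2.
    by rewrite X2 -(ar (ordS i)) /a /chi /metric /=; field.
  by rewrite !q1; lra.
pose D i := det3 m (X i) (X (ordS i)).
have Dd i : det3 (c i) (c (ordS i)) m' = N * D i.
  rewrite !cX det3_lin1 det3_lin2 (det3_lin2 1 m' 1 _ (X i)) det3pp det3_pqp.
  have : det3 (X i) (X (ordS i)) m' = N * D i by rewrite /D -det3_cycle mE det3_lin1; ring.
  have : det3 (X i) m' m' = 0 by rewrite /det3; ring.
  by lra.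
have gramD i : r2 ^+ 2 = (chi * r2) ^+ 2 + D i ^+ 2.
  by have := gram_tangent sm (tX i) (tX (ordS i)); rewrite !arM X12 -expr2.
have Dn i : D i != 0 by apply/eqP => E; have := d0 i; rewrite Dd E !mulr0 ltxx.
have chi1 : chi ^+ 2 < 1.
  have := gramD i0; have : 0 < D i0 ^+ 2 by rewrite lt_neqAle sqr_ge0 andbT eq_sym sqrf_eq0.
  move=> h1 h2; rewrite -(ltr_pM2r (_ : 0 < r2 ^+ 2)) ?exprn_gt0//; lra.
have chi_itv : -1 < chi < 1 by apply/andP; split; nra.
have ka0 : 0 < 3 - ka by move: chi_itv; rewrite /chi; lra.
have Dpos i : 0 < D i by have := d0 i; rewrite Dd pmulr_rgt0// pmulr_rgt0.
pose phi := acos chi.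
have cphi : cos phi = chi by rewrite /phi acosK// in_itv/=; between.
have phi_itv : 0 < phi < pi by rewrite /phi acos_gt0 ?acos_ltpi//; lra.
have sphi : 0 < sin phi by exact: sin_gt0_pi.
have DE i : D i = sin phi * r2.
  have := gramD i; have := sin2cos2 phi; rewrite cphi => s2 g2.
  have : (D i - sin phi * r2) * (D i + sin phi * r2) = 0.
    have -> : (D i - sin phi * r2) * (D i + sin phi * r2) = D i ^+ 2 - sin phi ^+ 2 * r2 ^+ 2 by ring.
    by rewrite s2; lra.
  have dn : D i + sin phi * r2 != 0 by rewrite gt_eqF// addr_gt0// mulr_gt0.
  by move/eqP; rewrite mulf_eq0 (negbTE dn) orbF => /eqP; lra.
have [w wE] : exists w, w = lin r^-1 (X i0) 0 (X i0) by exists (lin r^-1 (X i0) 0 (X i0)).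
have rn : r != 0 by rewrite gt_eqF.
have wi : windex n0 0 = i0 by apply/val_inj; rewrite /= mod0n.
have hw : unit_tangent k m w.
  split; first by rewrite tangentE wE bil_linr tX; ring.
  by rewrite wE !(metric_linl, metric_linr) arM -rr; field; rewrite gt_eqF.
have XE (j : nat) : X (windex n0 j) = lin (r * cos (j%:R * phi)) w (r * sin (j%:R * phi)) (trot k m w).
  elim: j => [|j IH].
    rewrite wi mul0r cos0 sin0 wE; move: (X i0) (trot _ _ _) => p q.
    by apply: eq_space => /=; field.
  rewrite windexS; set i := windex n0 j in IH *.
  have u1 : unit_tangent k m (lin r^-1 (X i) 0 (X i)).
    split; first by rewrite tangentE bil_linr tX; ring.
    by rewrite !(metric_linl, metric_linr) arM -rr; field; rewrite gt_eqF.
  rewrite (frame_tangent sm u1 (tX (ordS i))) metric_linl det3_lin2 X12 -/(D i) DE IH.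
  have tl b (p : space) d q : trot k m (lin b p d q) = lin b (trot k m p) d (trot k m q).
    by apply: eq_space; rewrite /trot /=; ring.
  rewrite !tl (trot_trot sm hw) -cphi -rr.
  have -> : j.+1%:R * phi = phi + j%:R * phi by rewrite -natr1; ring.
  rewrite cosD sinD; move: (trot k m w) (cos phi) (sin phi) (cos _) (sin _) => t cp sp cj sj.
  by apply: eq_space; rewrite /=; field.
exists m, w, N, r, phi; split; first by split=> //; rewrite N2 rr.
split=> [j|o ho].
  by rewrite cX XE mE; coords.
by rewrite /m /nrm bil_linr mul0r addr0 mulr_gt0 ?invr_gt0//; exact: omean.
Qed.

End Minimization.

(** * Comparison of circles and the isoperimetric inequality for chains *)

Section RegularComparison.
Implicit Types (p m u w : space) (a b phi N r : R).

(** Monotonicity of the tangent, [u / p] for [gsin] over [gcos], without division. *)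
Lemma ratio_lt k (u v p q : R) : 0 <= u -> u < v -> 0 < p -> 0 < q ->
  p ^+ 2 + K k * u ^+ 2 = 1 -> q ^+ 2 + K k * v ^+ 2 = 1 -> u * q < v * p.
Proof.
move=> u0 uv p0 q0 hp hq; have v0 : 0 < v by lra.
rewrite -(@ltr_pXn2r _ 2)// ?nnegrE ?mulr_ge0//; try exact: ltW.
rewrite !exprMn (_ : q ^+ 2 = 1 - K k * v ^+ 2); last by lra.
rewrite (_ : p ^+ 2 = 1 - K k * u ^+ 2); last by lra.
have : u ^+ 2 < v ^+ 2 by rewrite ltr_pXn2r// nnegrE ltW.
by lra.
Qed.

Lemma half_ratio_lt k (u v p q : R) : 0 <= u -> u < v -> 0 < p -> 0 < q ->
  p ^+ 2 + K k * u ^+ 2 = 1 -> q ^+ 2 + K k * v ^+ 2 = 1 -> u / (1 + p) < v / (1 + q).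
Proof.
move=> u0 uv p0 q0 hp hq; have := ratio_lt u0 uv p0 q0 hp hq.
by rewrite ltr_pdivrMr ?addr_gt0// mulrAC ltr_pdivlMr ?addr_gt0//; lra.
Qed.

Lemma half_ratio_le k (u v p q : R) : 0 <= u -> u <= v -> 0 < p -> 0 < q ->
  p ^+ 2 + K k * u ^+ 2 = 1 -> q ^+ 2 + K k * v ^+ 2 = 1 -> u / (1 + p) <= v / (1 + q).
Proof.
move=> u0; rewrite le_eqVlt => /predU1P[<-|uv] p0 q0 hp hq; last exact/ltW/(half_ratio_lt u0 uv p0 q0 hp hq).
have pq : p ^+ 2 = q ^+ 2 by lra.
have -> : p = q by apply/eqP; rewrite -(@eqrXn2 _ 2)// ?pq//; exact: ltW.
by [].
Qed.

(* [U] is the tangent of a quarter of the area of the triangle, a product of the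
   tangents of half the legs of a right triangle. *)
Lemma corner_lt k (S g N h S0 g0 N0 h0 : R) : 0 < S -> 0 < g -> 0 < N -> 0 < h ->
  0 < S0 -> 0 < g0 -> 0 < N0 -> 0 < h0 ->
  g ^+ 2 + K k * S ^+ 2 = 1 -> N ^+ 2 + K k * (S * h) ^+ 2 = g ^+ 2 ->
  g0 ^+ 2 + K k * S0 ^+ 2 = 1 -> N0 ^+ 2 + K k * (S0 * h0) ^+ 2 = g0 ^+ 2 ->
  S <= S0 -> h <= h0 -> (S < S0 \/ h < h0) ->
  S ^+ 2 * h / (N + g ^+ 2) < S0 ^+ 2 * h0 / (N0 + g0 ^+ 2).
Proof.
move=> S1 g1 N1 h1 S2 g2 N2 h2 e1 e2 e3 e4 SS hh lt.
pose U (s p q x : R) : R := s / (1 + p) * (s * x / p / (1 + q / p)).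
(* Double-angle formula of the tangent: it reduces the comparison to [U], a product of two factors
   that are each monotone. *)
have dbl (s p q x : R) : 0 < s -> 0 < p -> 0 < q -> 0 < x -> p ^+ 2 + K k * s ^+ 2 = 1 -> q ^+ 2 + K k * (s * x) ^+ 2 = p ^+ 2 ->
    s ^+ 2 * x / (q + p ^+ 2) * (1 - (K k * U s p q x) ^+ 2) = 2 * U s p q x /\ 0 < U s p q x /\ 0 < s ^+ 2 * x / (q + p ^+ 2).
  move=> s0 p0 q0 x0 hp hq.
  have pp : 0 < p ^+ 2 by rewrite exprn_gt0.
  have q2 : 0 < q + p ^+ 2 by lra.
  have q1 : 0 < 1 + q / p by rewrite addr_gt0// divr_gt0.
  split; last first.
    by split; rewrite ?divr_gt0 ?mulr_gt0 ?exprn_gt0 ?invr_gt0//; lra.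
  have UE : U s p q x = s ^+ 2 * x / ((1 + p) * (p + q)).
    by rewrite /U; field; rewrite !gt_eqF//; lra.
  have KU : (K k * U s p q x) ^+ 2 = (1 - p) * (p - q) / ((1 + p) * (p + q)).
    have -> : (K k * U s p q x) ^+ 2 = (K k * s ^+ 2) * (K k * (s * x) ^+ 2) / ((1 + p) * (p + q)) ^+ 2.
      by rewrite UE; field; rewrite !gt_eqF//; lra.
    rewrite (_ : K k * s ^+ 2 = (1 - p) * (1 + p)); last by lra.
    rewrite (_ : K k * (s * x) ^+ 2 = (p - q) * (p + q)); last by lra.
    by field; rewrite !gt_eqF//; lra.
  by rewrite KU UE; field; rewrite !gt_eqF//; lra.
have [d1 [u1 v1]] := dbl _ _ _ _ S1 g1 N1 h1 e1 e2.
have [d2 [u2 v2]] := dbl _ _ _ _ S2 g2 N2 h2 e3 e4.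
have yN (s p q x : R) : 0 < p -> q ^+ 2 + K k * (s * x) ^+ 2 = p ^+ 2 -> (q / p) ^+ 2 + K k * (s * x / p) ^+ 2 = 1.
  move=> p0 hq; transitivity ((q ^+ 2 + K k * (s * x) ^+ 2) / p ^+ 2); first by field; rewrite gt_eqF.
  by rewrite hq divff// expf_neq0// gt_eqF.
have y1 := yN _ _ _ _ g1 e2; have y2 := yN _ _ _ _ g2 e4.
have sg : S / g <= S0 / g0 /\ (S < S0 -> S / g < S0 / g0).
  have : S < S0 -> S / g < S0 / g0.
    move=> lSS; have := ratio_lt (ltW S1) lSS g1 g2 e1 e3.
    by rewrite ltr_pdivrMr// mulrAC ltr_pdivlMr//; lra.
  move=> hs; split=> //; move: SS; rewrite le_eqVlt => /predU1P[E|/hs/ltW//].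
  rewrite E in e1; have gg : g ^+ 2 = g0 ^+ 2 by lra.
  by rewrite E (_ : g = g0)//; apply/eqP; rewrite -(@eqrXn2 _ 2)// ?gg//; exact: ltW.
have y0 : 0 < S * h / g by rewrite !mulr_gt0// invr_gt0.
have yy : S * h / g < S0 * h0 / g0.
  rewrite mulrAC [ltRHS]mulrAC; have sg0 : 0 < S / g by rewrite divr_gt0.
  case: lt => [/(sg.2) l|l].
    by apply: lt_le_trans (_ : S0 / g0 * h <= _); rewrite ?ltr_pM2r ?ler_pM2l// divr_gt0.
  by apply: lt_le_trans (_ : S / g * h0 <= _); rewrite ?ltr_pM2l ?ler_pM2r//; exact: sg.1.
have UU : U S g N h < U S0 g0 N0 h0.
  have x1 := half_ratio_le (ltW S1) SS g1 g2 e1 e3.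
  have x2 := half_ratio_lt (ltW y0) yy (divr_gt0 N1 g1) (divr_gt0 N2 g2) y1 y2.
  have p1 : 0 < S0 / (1 + g0) by rewrite divr_gt0// addr_gt0.
  have p2 : 0 < S * h / g / (1 + N / g) by rewrite divr_gt0// addr_gt0// divr_gt0.
  apply: le_lt_trans (_ : S0 / (1 + g0) * (S * h / g / (1 + N / g)) < _).
    by rewrite /U ler_pM2r.
  by rewrite /U ltr_pM2l.
move: d1 d2 u1 u2 v1 v2 UU; move: (U S g N h) (U S0 g0 N0 h0) (_ / _) (_ / _) => u v b a d1 d2 u0 v0 a0 b0 uv.
have Ku : (K k * u) ^+ 2 <= (K k * v) ^+ 2.
  by rewrite !exprMn ler_wpM2l ?sqr_ge0// ler_pXn2r ?nnegrE// ltW.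
have kv : 0 < 1 - (K k * v) ^+ 2 by rewrite -(pmulr_rgt0 _ b0) d2; lra.
rewrite -(ltr_pM2r kv) d2; apply: le_lt_trans (_ : a * (1 - (K k * u) ^+ 2) < _).
  by rewrite ler_pM2l//; lra.
by rewrite d1; lra.
Qed.

(** Circle around [m], by the angle at the centre; [N] and [r] are [gcos] and [gsin] of the
    radius. *)
Definition circ k m w N r t : space := lin N m r (lin (cos t) w (sin t) (trot k m w)).

Section Circ.
Variables (k : curvature) (m w : space) (N r : R).
Hypothesis sm : surface k m.
Hypothesis hw : unit_tangent k m w.
Local Notation c := (circ k m w N r).
Let u t := lin (cos t) w (sin t) (trot k m w).

Let tu t : tangent k m (u t).
Proof.
have := (unit_rot sm hw).1; have := hw.1; rewrite !tangentE /u bil_linr => -> ->; ring.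
Qed.

Let muu s t : metric k (u s) (u t) = cos (s - t).
Proof.
rewrite /u !(metric_linl, metric_linr) (metricC k (trot k m w) w) (metric_rot sm hw.1) hw.2 (unit_rot sm hw).2 cosB.
ring.
Qed.

Let duu s t : det3 m (u s) (u t) = sin (t - s).
Proof.
rewrite /u !(det3_lin2, det3_lin3) !det3_qpp (det3_rot_unit sm hw) (det3_swap23 m _ w) (det3_rot_unit sm hw) sinB.
ring.
Qed.

Lemma circ_pole t : bil k m (c t) = N.
Proof. by rewrite bil_linr (surface_bil sm) [bil k m _](tu t); ring. Qed.

Lemma circ_bil s t : bil k (c s) (c t) = N ^+ 2 + K k * r ^+ 2 * cos (s - t).
Proof.
rewrite /circ -!/(u _) -muu; move: (tu s) (tu t); move: (u s) (u t) => x y tx ty.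
rewrite !bil_lin (surface_bil sm) (bilC k x m) [bil k m x]tx [bil k m y]ty (bil_tangents sm tx ty).
ring.
Qed.

Lemma circ_chord2 s t : chord2 k (c s) (c t) = 2 * r ^+ 2 * (1 - cos (s - t)).
Proof.
transitivity (r ^+ 2 * (metric k (u s) (u s) + metric k (u t) (u t) - 2 * metric k (u s) (u t))).
  by rewrite /circ -!/(u _) /chord2 /metric /=; ring.
by rewrite !muu !subrr cos0; ring.
Qed.

Lemma circ_det_pole s t : det3 m (c s) (c t) = r ^+ 2 * sin (t - s).
Proof.
rewrite /circ -!/(u _) -duu; move: (u s) (u t) => x y.
by rewrite !(det3_lin2, det3_lin3) !(det3pp, det3_pqp); ring.
Qed.

Lemma circ_det a s t : det3 (c a) (c s) (c t) = N * r ^+ 2 * (sin (s - a) + sin (t - s) + sin (a - t)).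
Proof.
have flat0 : det3 (u a) (u s) (u t) = 0.
  by rewrite /u; move: (trot k m w) => v; rewrite /det3 /=; ring.
rewrite -!duu /circ -!/(u _); move: flat0; move: (u a) (u s) (u t) => x y z.
move=> flat0; transitivity (N * r ^+ 2 * (det3 m x y + det3 m y z + det3 m z x) + r ^+ 3 * det3 x y z).
  by rewrite /det3 /=; ring.
by rewrite flat0; ring.
Qed.

Lemma circ_period s t : 0 < r -> c s = c t -> cos (s - t) = 1.
Proof.
move=> r0 e; have := circ_chord2 s t; rewrite e (_ : chord2 k (c t) (c t) = 0); last by rewrite /chord2; ring.
have rn : 2 * r ^+ 2 != 0 by rewrite mulf_neq0// expf_neq0// gt_eqF.
by move/esym/eqP; rewrite mulf_eq0 (negbTE rn) => /eqP; lra.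
Qed.

End Circ.

Lemma cos_eq1 t : 0 < t -> t < 2 * pi -> cos t = 1 -> False.
Proof.
move=> t0 t2 c1; have s0 : 0 < sin (t / 2) by apply: sin_gt0_pi; between.
have : cos t = cos (t / 2 + t / 2) by congr cos; field.
by rewrite cosD c1 -!expr2 => e; have := cos2Dsin2 (t / 2); have := exprn_gt0 2 s0; lra.
Qed.

(** The quotient in [tri3] for the centre of the circle and two of its points at angle [phi]: the
    tangent of half the area of this isosceles triangle. *)
Definition corner k N r phi : R := r ^+ 2 * sin phi / (1 + 2 * N + (N ^+ 2 + K k * r ^+ 2 * cos phi)).

(** The isosceles triangle is described by its right half: [S] is the [gsin] of half the side and
    [h] the cotangent of half the central angle. *)
Lemma corner_half k N r phi : N ^+ 2 + K k * r ^+ 2 = 1 -> 0 < sin (phi / 2) ->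
  let S := r * sin (phi / 2) in let h := cos (phi / 2) / sin (phi / 2) in
  corner k N r phi = S ^+ 2 * h / (N + (1 - K k * S ^+ 2)).
Proof.
move=> e s0 S h.
have sp : sin phi = 2 * sin (phi / 2) * cos (phi / 2).
  by rewrite {1}(_ : phi = phi / 2 + phi / 2) ?sinD; [ring|field].
have cp : cos phi = 1 - 2 * sin (phi / 2) ^+ 2.
  by rewrite {1}(_ : phi = phi / 2 + phi / 2) ?cosD -?expr2 ?cos2sin2; [ring|field].
rewrite /corner sp cp (_ : N ^+ 2 = 1 - K k * r ^+ 2); last by lra.
rewrite /S /h; rewrite [X in _ / X](_ : _ = 2 * (N + (1 - K k * (r * sin (phi / 2)) ^+ 2))); last by ring.
move: (N + _) => T; rewrite invfM [LHS]mulrA; congr (_ * _).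
by field; rewrite gt_eqF.
Qed.

(* Both comparisons at once: the side grows with the area and with the angle. *)
Lemma corner_compare k N r phi N0 r0 phi0 : 0 < N -> 0 < r -> 0 < N0 -> 0 < r0 ->
  N ^+ 2 + K k * r ^+ 2 = 1 -> N0 ^+ 2 + K k * r0 ^+ 2 = 1 ->
  0 < phi0 -> phi0 <= phi -> phi < pi -> corner k N0 r0 phi0 <= corner k N r phi ->
  r0 * sin (phi0 / 2) <= r * sin (phi / 2) /\
  (r0 * sin (phi0 / 2) = r * sin (phi / 2) -> phi = phi0).
Proof.
move=> N1 r1 N2 r2 e1 e2 p0 pp ppi le.
have sg t : 0 < t -> t < pi -> 0 < sin (t / 2) by move=> t0 t1; apply: sin_gt0_pi; between.
have cg t : 0 < t -> t < pi -> 0 < cos (t / 2) by move=> t0 t1; apply: cos_gt0_pihalf; between.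
have s1 := sg phi ltac:(lra) ppi; have c1 := cg phi ltac:(lra) ppi.
have s2 := sg phi0 p0 ltac:(lra); have c2 := cg phi0 p0 ltac:(lra).
set S := r * sin (phi / 2); set S0 := r0 * sin (phi0 / 2).
have S1 : 0 < S by rewrite mulr_gt0. have S2 : 0 < S0 by rewrite mulr_gt0.
have pos (n' q t : R) : 0 < n' -> 0 < q -> n' ^+ 2 + K k * q ^+ 2 = 1 -> 0 < sin (t / 2) ->
   0 < 1 - K k * (q * sin (t / 2)) ^+ 2 /\ n' ^+ 2 + K k * (q * sin (t / 2) * (cos (t / 2) / sin (t / 2))) ^+ 2 = 1 - K k * (q * sin (t / 2)) ^+ 2.
  move=> n0 q0 e st; have sc := cos2Dsin2 (t / 2); split; last first.
    have -> : q * sin (t / 2) * (cos (t / 2) / sin (t / 2)) = q * cos (t / 2) by field; rewrite gt_eqF.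
    by rewrite !exprMn (_ : cos (t / 2) ^+ 2 = 1 - sin (t / 2) ^+ 2); lra.
  have : K k * q ^+ 2 < 1 by have := exprn_gt0 2 n0; lra.
  have ss : sin (t / 2) ^+ 2 <= 1 by have := sqr_ge0 (cos (t / 2)); lra.
  rewrite exprMn => kq; have := sqr_ge0 (sin (t / 2)); have := exprn_gt0 2 st; nra.
have [G1 E1] := pos _ _ _ N1 r1 e1 s1; have [G2 E2] := pos _ _ _ N2 r2 e2 s2.
rewrite -/S in G1 E1; rewrite -/S0 in G2 E2.
have hlt : phi0 < phi -> cos (phi / 2) / sin (phi / 2) < cos (phi0 / 2) / sin (phi0 / 2).
  move=> l; rewrite ltr_pdivrMr// mulrAC ltr_pdivlMr//.
  have : 0 < sin (phi / 2 - phi0 / 2) by apply: sin_gt0_pi; between.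
  by rewrite sinB; lra.
have hle : cos (phi / 2) / sin (phi / 2) <= cos (phi0 / 2) / sin (phi0 / 2).
  by move: pp; rewrite le_eqVlt => /predU1P[->//|/hlt/ltW].
have contra : S <= S0 -> (S < S0 \/ phi0 < phi) -> False.
  move=> SS o; have o' : S < S0 \/ cos (phi / 2) / sin (phi / 2) < cos (phi0 / 2) / sin (phi0 / 2).
    by case: o => [|/hlt]; [left|right].
  have q1 : Num.sqrt (1 - K k * S ^+ 2) ^+ 2 = 1 - K k * S ^+ 2 by rewrite sqr_sqrtr// ltW.
  have q2 : Num.sqrt (1 - K k * S0 ^+ 2) ^+ 2 = 1 - K k * S0 ^+ 2 by rewrite sqr_sqrtr// ltW.
  have := @corner_lt k S (Num.sqrt (1 - K k * S ^+ 2)) N (cos (phi / 2) / sin (phi / 2))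
    S0 (Num.sqrt (1 - K k * S0 ^+ 2)) N0 (cos (phi0 / 2) / sin (phi0 / 2)).
  rewrite q1 q2 !sqrtr_gt0 -(corner_half e1 s1) -(corner_half e2 s2).
  move=> /(_ S1 G1 N1 (divr_gt0 c1 s1) S2 G2 N2 (divr_gt0 c2 s2) ltac:(lra) E1 ltac:(lra) E2 SS hle o').
  by rewrite ltNge le.
split; first by rewrite leNgt; apply/negP => l; apply: contra; [exact: ltW|left].
move=> E; apply/eqP; rewrite eq_le pp andbT leNgt; apply/negP => l.
by apply: contra; [rewrite E|right].
Qed.

Section ChainBound.
Variables (k : curvature) (n : nat) (A N0 r0 : R).
Hypothesis n2 : (2 < n)%N.
Hypothesis A0 : 0 < A.
Hypothesis N0_gt0 : 0 < N0.
Hypothesis r0_gt0 : 0 < r0.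
Hypothesis Nr0 : N0 ^+ 2 + K k * r0 ^+ 2 = 1.
Local Notation phi0 := (2 * @pi R / n%:R).
Hypothesis AE : 2 * n%:R * gatan k (corner k N0 r0 phi0) = A.
Let n0 : (0 < n)%N. Proof. exact: ltnW (ltnW n2). Qed.
Let nR : 0 < n%:R :> R. Proof. by rewrite ltr0n. Qed.

Definition regular_side : R := 2 * gasin k (r0 * sin (phi0 / 2)).

Lemma central_angle_itv : (0 : R) < phi0 < pi.
Proof.
have p0 := @pi_gt0 R; apply/andP; split; first by rewrite !mulr_gt0// invr_gt0.
rewrite ltr_pdivrMr//; have : (2 : R) < n%:R by rewrite (ltr_nat R 2 n).
nra.
Qed.

Lemma half_side_le1 N r phi : N ^+ 2 + K k * r ^+ 2 = 1 -> 0 < r -> 0 <= sin (phi / 2) ->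
  k = Spherical -> -1 <= r * sin (phi / 2) <= 1.
Proof.
move=> e r1 s0 E; rewrite E /= mul1r in e; have s1 := sin_le1 (phi / 2).
have r2 : r <= 1 by have := sqr_ge0 N; nra.
by clear E; apply/andP; split; nra.
Qed.

Lemma circle_chain_bound (c : 'I_n -> space) m w N r phi : surface k m -> unit_tangent k m w ->
  0 < N -> 0 < r -> N ^+ 2 + K k * r ^+ 2 = 1 -> 0 < phi < pi ->
  (forall j : nat, c (windex n0 j) = circ k m w N r (j%:R * phi)) ->
  phi0 <= phi /\ (forall i, chord2 k (c i) (c (ordS i)) = (2 * (r * sin (phi / 2))) ^+ 2) /\
  (forall i, tri3 k m (c i) (c (ordS i)) = 2 * gatan k (corner k N r phi)).
Proof.
move=> sm hw N1 r1 e /andP[p0 ppi] cE; have pi0 := @pi_gt0 R.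
have cS i : c (ordS i) = circ k m w N r (i.+1%:R * phi) by rewrite -{1}(windex_ord n0 i) -windexS cE.
have cI i : c i = circ k m w N r (i%:R * phi) by rewrite -cE windex_ord.
have dph (i : 'I_n) : i.+1%:R * phi - i%:R * phi = phi by rewrite -natr1; ring.
have dph' (i : 'I_n) : i%:R * phi - i.+1%:R * phi = - phi by rewrite -natr1; ring.
split; [|split].
- rewrite leNgt; apply/negP => l; have := cE n; rewrite -[n in windex _ n]add0n windexDn cE mul0r.
  move=> /esym/(circ_period sm hw r1); rewrite subr0; apply: cos_eq1; first by rewrite mulr_gt0.
  by move: l; rewrite ltr_pdivlMr// mulrC.
- move=> i; rewrite cI cS circ_chord2// dph' cosN.
  have : cos phi = 1 - 2 * sin (phi / 2) ^+ 2.
    by rewrite {1}(_ : phi = phi / 2 + phi / 2) ?cosD -?expr2 ?cos2sin2; [ring|field].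
  by move=> ->; ring.
- move=> i; rewrite cI cS /tri3 /corner circ_det_pole// dph; congr (_ * gatan k (_ / _)).
  by rewrite circ_pole// circ_bil// bilC circ_pole// dph' cosN; ring.
Qed.

Lemma regular_chain_bound (c : 'I_n -> space) : (forall i, upper k (c i)) -> regular_chain k c ->
  A <= chain_area k c -> n%:R * regular_side <= chain_length k c /\
  (chain_length k c = n%:R * regular_side ->
   exists m w, [/\ upper k m, unit_tangent k m w &
     forall j : nat, c (windex n0 j) = circ k m w N0 r0 (j%:R * phi0)]).
Proof.
move=> uc rc Ac.
have [m [w [N [r [phi [[sm hw [N1 r1] pp e] [cE om]]]]]]] := regular_chain_circle n0 (fun i => (uc i).1)
  (fun i => upper_bilN1 (uc i) (uc (ordS i))) rc.
have [le [ch tr]] := circle_chain_bound sm hw N1 r1 e pp cE.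
have /andP[q0 qpi] := central_angle_itv; have /andP[p0 ppi] := pp.
have um : upper k m.
  split=> //; rewrite -(bil_origin k); apply: om => i; rewrite bil_origin; exact: (uc i).2.
have mc i : 0 < bil k m (c i) by rewrite -(windex_ord n0 i) cE circ_pole.
have corn : corner k N0 r0 phi0 <= corner k N r phi.
  rewrite -(ler_gatan k) -(ler_pM2l (_ : 0 < 2 * n%:R)) ?mulr_gt0// AE.
  move: Ac; rewrite (chain_area_from um uc mc) (eq_bigr _ (fun i _ => tr i)) sumr_const card_ord -mulr_natl; lra.
have [h1 h2] := corner_compare N1 r1 N0_gt0 r0_gt0 e Nr0 q0 le ppi corn.
have sp t : 0 < t -> t < pi -> 0 < sin (t / 2) by move=> t0 t1; apply: sin_gt0_pi; between.
have d i : dist k (c i) (c (ordS i)) = 2 * gasin k (r * sin (phi / 2)).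
  rewrite /dist ch sqrtr_sqr ger0_norm; last by rewrite !mulr_ge0// ltW// sp.
  by congr (_ * gasin k _); field.
have L : chain_length k c = n%:R * (2 * gasin k (r * sin (phi / 2))).
  by rewrite /chain_length (eq_bigr _ (fun i _ => d i)) sumr_const card_ord -[LHS]mulr_natl.
have le0 : k = Spherical -> -1 <= r0 * sin (phi0 / 2) <= 1 by apply: half_side_le1 Nr0 r0_gt0 (ltW (sp _ q0 qpi)).
have le1 : k = Spherical -> -1 <= r * sin (phi / 2) <= 1 by apply: half_side_le1 e r1 (ltW (sp _ p0 ppi)).
split; first by rewrite L ler_pM2l// /regular_side ler_pM2l// ler_gasin.
rewrite L => /(mulfI (lt0r_neq0 nR))/(mulfI (lt0r_neq0 (ltr0Sn R 1)))/(congr1 (gsin k)).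
rewrite !gasinK// => E; have phE := h2 (esym E); subst phi.
have rE : r = r0 by apply: (mulIf _ E); rewrite gt_eqF// sp.
have NE : N = N0.
  have N2 : N ^+ 2 = N0 ^+ 2 by have := Nr0; rewrite -rE; lra.
  by apply/eqP; rewrite -(@eqrXn2 _ 2) ?N2// ltW.
by subst r N; exists m, w; split.
Qed.

(** A minimizer in the cap of size [rho] is no longer than [v]; recentred, it lies strictly inside
    the cap, so it is regular and obeys the bound. In case of equality [v], recentred, is itself
    such a minimizer. *)
Lemma chain_isoperimetric (v : 'I_n -> space) : (forall i, upper k (v i)) ->
  (k = Spherical -> chain_length k v < 2 * pi) -> A <= chain_area k v ->
  n%:R * regular_side <= chain_length k v /\
  (chain_length k v = n%:R * regular_side ->
   exists m w, [/\ upper k m, unit_tangent k m w &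
     forall j : nat, v (windex n0 j) = circ k m w N0 r0 (j%:R * phi0)]).
Proof.
move=> uv short Av; have pi0 := @pi_gt0 R; set L := chain_length k v.
have L0 : 0 <= L by apply: sumr_ge0 => i _; apply: dist_ge0; exact: (uv _).1.
have [m [um mv cv]] := chain_center n0 uv short.
have [v' [[uv' Av' Lv' bv' dv'] [cv' ov']]] := recenter_chain um uv mv.
(* Strictly above [cap_bound k L], so that recentred chains are interior, and still below 2 on the
   sphere. *)
pose rho := if k is Spherical then (cap_bound k L + 2) / 2 else cap_bound k L + 1.
have rho1 : cap_bound k L < rho /\ (k = Spherical -> rho < 2).
  have : k = Spherical -> cap_bound k L < 2.
    move=> E; have := short E; rewrite -/L E /cap_bound => l.
    by have : 0 < cos (L / 4); [apply: cos_gt0_pihalf; apply/andP; split; clear E; lra|clear E; lra].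
  by rewrite /rho; case: (k) => h; split=> //; try lra; have := h erefl; lra.
have [rl rs] := rho1; have b0 := cap_bound_ge0 k L.
have capv i : cap k rho (v' i) by split=> //; rewrite ov'; apply: le_trans (cv i) (ltW rl).
have [c [cc Ac minc]] := chain_minimizer (le_trans b0 (ltW rl)) rs capv (eq_ind_r (fun x => A <= x) Av Av').
have uc i := (cc i).1; have Lc : chain_length k c <= L by rewrite /L -Lv'; apply: minc; rewrite ?Av'.
have Lc0 : 0 <= chain_length k c by apply: sumr_ge0 => i _; apply: dist_ge0; exact: (uc _).1.
have [q [uq qc cq]] := chain_center n0 uc (fun E => le_lt_trans Lc (short E)).
have [c' [[uc' Ac' Lc' _ _] [_ oc']]] := recenter_chain uq uc qc.
have cm : cap_minimizer k rho A c'.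
  split=> //; [|by rewrite Ac'|by move=> d hd Ad; rewrite Lc'; exact: minc].
  move=> i; rewrite oc'; apply: le_lt_trans (cq i) _; apply: le_lt_trans rl.
  exact: cap_bound_homo Lc0 Lc short.
have [bd _] := regular_chain_bound uc' (minimizer_regular n2 A0 cm) (eq_ind_r (fun x => A <= x) Ac Ac').
rewrite Lc' in bd; split; first exact: le_trans bd Lc.
move=> E; have vm : cap_minimizer k rho A v'.
  split=> //; [|by rewrite Av'|].
    by move=> i; rewrite ov'; apply: le_lt_trans (cv i) rl.
  by move=> d hd Ad; rewrite Lv' -/L E; apply: le_trans bd _; exact: minc.
have [x [y h]] := minimizer_regular n2 A0 vm.
have rv : regular_chain k v by exists x, y => i; rewrite -!cv' -dv'; exact: h.
by have [_] := regular_chain_bound uv rv Av; apply.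
Qed.

End ChainBound.

End RegularComparison.

(** * The convex polygon spanned by a chain *)

Lemma near_det3 (a b q : space) : 0 < det3 a b q -> \forall q' \near q, 0 < det3 a b q'.
Proof.
move=> h; have cd : {for q, continuous (fun q => det3 a b q)}.
  have cx := @continuous_x; have cy := @continuous_y; have cz := @continuous_z.
  apply: cvgD; first apply: cvgB.
  - by apply: cvgM; [exact: cvg_cst|apply: cvgB; apply: cvgM; [exact: cvg_cst|exact: cz|exact: cvg_cst|exact: cy]].
  - by apply: cvgM; [exact: cvg_cst|apply: cvgB; apply: cvgM; [exact: cvg_cst|exact: cz|exact: cvg_cst|exact: cx]].
  - by apply: cvgM; [exact: cvg_cst|apply: cvgB; apply: cvgM; [exact: cvg_cst|exact: cy|exact: cvg_cst|exact: cx]].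
exact: (cd _ (lt_nbhsr h)).
Qed.

Lemma cone_lin k p q (a b : R) : surface k p -> surface k q -> -1 < bil k p q ->
  0 <= a -> 0 <= b -> 0 < a + b -> cone k (lin a p b q).
Proof.
move=> sp sq B a0 b0 ab; split.
  rewrite !bil_lin (surface_bil sp) (surface_bil sq) (bilC k q p).
  have [b1|b1] := leP 0 (bil k p q).
    have : 0 <= a * b * bil k p q by rewrite !mulr_ge0.
    have := sqr_ge0 (a - b); have := mulr_gt0 ab ab; nra.
  have : 0 < (a + b) ^+ 2 * (1 + bil k p q) by rewrite mulr_gt0 ?exprn_gt0//; lra.
  have : 0 <= (a - b) ^+ 2 * (1 - bil k p q) by rewrite mulr_ge0 ?sqr_ge0//; lra.
  by lra.
move=> ns; have z1 := sp.2 ns; have z2 := sq.2 ns; rewrite /=.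
move: a0 b0 ab; rewrite !le_eqVlt => /predU1P[<-|a0] /predU1P[<-|b0]; first by rewrite addr0 ltxx.
- by move=> _; rewrite mul0r add0r mulr_gt0.
- by move=> _; rewrite mul0r addr0 mulr_gt0.
- by move=> _; rewrite addr_gt0// mulr_gt0.
Qed.

(* Cramer's rule. *)
Lemma det3_expand (a b c q : space) : det3 a b c != 0 ->
  q = lin 1 (lin (det3 q b c / det3 a b c) a (det3 a q c / det3 a b c) b) (det3 a b q / det3 a b c) c.
Proof.
by move=> h; apply: eq_space; move: h; rewrite /det3 /= => h; field.
Qed.

Section ToCenter.
Variables (k : curvature) (m : space).
Hypothesis sm : surface k m.

Definition to_center q t : space := nrm k (lin (1 - t) q t m).

Lemma to_center_cone q t : surface k q -> -1 < bil k m q -> 0 <= t <= 1 -> cone k (lin (1 - t) q t m).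
Proof. by move=> sq mq /andP[t0 t1]; apply: cone_lin => //; rewrite 1?bilC; lra. Qed.

Lemma to_center0 q : surface k q -> to_center q 0 = q.
Proof. by move=> sq; rewrite /to_center (_ : lin _ _ _ _ = q) ?nrm_id//; coords. Qed.

Lemma to_center1 q : to_center q 1 = m.
Proof. by rewrite /to_center (_ : lin _ _ _ _ = m) ?nrm_id//; coords. Qed.

Lemma to_center_near q t e : surface k q -> -1 < bil k m q -> 0 <= t <= 1 -> 0 < e -> exists2 d, 0 < d &
  forall s, `|t - s| < d -> near3 e (to_center q t) (to_center q s).
Proof.
move=> sq mq ht e0; have [d d0 hd] := continuous_nrm (to_center_cone sq mq ht) e0.
have [d' d'0 hd'] := nrm_segment_locally q m t d0; exists d' => // s ts.
by have [] := hd _ (hd' s ts).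
Qed.

Lemma to_center_small q e : surface k q -> -1 < bil k m q -> 0 < e -> exists2 t, 0 < t <= 1 & near3 e q (to_center q t).
Proof.
move=> sq mq e0; have [|d d0 hd] := to_center_near (t := 0) sq mq _ e0; first by rewrite lexx ler01.
exists (Num.min (d / 2) 1); first by rewrite lt_min ltr01 divr_gt0//= ge_min lexx orbT.
rewrite -{1}(to_center0 sq); apply: hd; rewrite sub0r normrN ger0_norm ?le_min ?ler01 ?divr_ge0 ?ltW//.
by rewrite gt_min; apply/orP; left; lra.
Qed.

End ToCenter.

Section ConvexPolygon.
Variables (k : curvature) (n : nat) (v : 'I_n -> space) (m : space) (E : R).
Hypothesis n2 : (2 < n)%N.
Hypothesis sm : surface k m.
Hypothesis sv : forall i, surface k (v i).
Hypothesis E0 : 0 < E.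
Local Notation side i q := (det3 (v i) (v (ordS i)) q).
Hypothesis side_pos : forall i j, j <> i -> j <> ordS i -> 0 < side i (v j).
Hypothesis side_center : forall i, 0 < side i m.
Hypothesis side_sum : forall q, \sum_i side i q = E * bil k m q.
Implicit Types (i j : 'I_n) (u w : space).

(** The intersection of the half-surfaces to the left of the edges. By [side_sum] the side functions
    add up to a multiple of [bil k m], which keeps the region on the side of its centre. *)
Definition chain_region : set space := [set q | surface k q /\ forall i, 0 <= side i q].
Local Notation C := chain_region.

Lemma ordSS_neq i : ordS (ordS i) <> i.
Proof.
move=> /(congr1 val) /= e; have := ltn_ord i; have i2 : ((i + 2) %% n = i)%N.
  by rewrite -[RHS]e -[(_ %% n).+1]addn1 modnDml addn1 addn2.
move=> il; have : (i + 2 = i %[mod n])%N by rewrite i2 modn_small.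
move/eqP; rewrite -{2}[val i]addn0 eqn_modDl mod0n modn_small//.
Qed.

Lemma ordS_neq' i : ordS i <> i.
Proof. by apply/eqP/ordS_neq; exact: ltnW. Qed.

Lemma side_ge0 i j : 0 <= side i (v j).
Proof.
have [->|/eqP ji] := eqVneq j i; first by rewrite det3_pqp.
have [->|/eqP jS] := eqVneq j (ordS i); first by rewrite det3_qpp.
exact: ltW (side_pos ji jS).
Qed.

Lemma vertex_region j : C (v j).
Proof. by split=> // i; exact: side_ge0. Qed.

Lemma side_next i : 0 < side i (v (ordS (ordS i))).
Proof. by apply: side_pos; [exact: ordSS_neq|exact: ordS_neq']. Qed.

(** Expand [q] in three consecutive vertices. The third coefficient is zero, and the other two are
    nonnegative by the following and the preceding side. *)
Lemma face_on_edge i q : C q -> side i q = 0 -> on_edge v i q.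
Proof.
move=> [sq hq] q0; set w := v (ordS (ordS i)); have D := side_next i; rewrite -/w in D.
have qE := det3_expand q (lt0r_neq0 D); rewrite q0 mul0r in qE.
exists (det3 q (v (ordS i)) w / side i w), (det3 (v i) q w / side i w); split.
- by rewrite divr_ge0 ?(ltW D)// det3_cycle; exact: hq (ordS i).
- have [p pE] : exists p : 'I_n, ordS p = i by exists (ord_pred i); rewrite ord_predK.
  have p0 : 0 < det3 (v p) (v i) (v (ordS i)) by have := side_next p; rewrite pE.
  have := hq p; rewrite pE {1}qE !det3_lin3 mul0r !addr0 mul1r det3_qpp mulr0 add0r.
  by rewrite pmulr_lge0.
- by rewrite {1}qE; coords.
Qed.

Lemma edge_face i q : surface k q -> on_edge v i q -> C q /\ side i q = 0.
Proof.
move=> sq [a [c [a0 c0 qE]]]; split; last by rewrite qE det3_lin3 det3_pqp det3_qpp; ring.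
by split=> // j; rewrite qE det3_lin3 addr_ge0// mulr_ge0// side_ge0.
Qed.

(** [side_sum] leaves only the value 0 to exclude; there all side functions vanish, and the
    expansion in three consecutive vertices gives [q = 0]. *)
Lemma region_pole q : C q -> 0 < bil k m q.
Proof.
move=> [sq hq]; have : 0 <= E * bil k m q by rewrite -side_sum sumr_ge0// => i _; exact: hq.
rewrite pmulr_rge0// le_eqVlt => /predU1P[e|//]; exfalso.
have all0 i : side i q = 0.
  have := side_sum q; rewrite -e mulr0 => /eqP; rewrite psumr_eq0 => [|j _]; last exact: hq.
  by move=> /allP/(_ i (mem_index_enum _))/eqP.
have i : 'I_n by exact: Ordinal (ltnW (ltnW n2)).
have D := side_next i; have qE := det3_expand q (lt0r_neq0 D).
have [p pE] : exists p : 'I_n, ordS p = i by exists (ord_pred i); rewrite ord_predK.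
have p0 : 0 < det3 (v p) (v i) (v (ordS i)) by have := side_next p; rewrite pE.
have h2 := all0 p; rewrite pE in h2; rewrite (all0 i) in qE.
have z1 : det3 q (v (ordS i)) (v (ordS (ordS i))) = 0 by rewrite det3_cycle (all0 (ordS i)).
move: qE; rewrite z1 !mul0r => qE.
move: h2; rewrite {1}qE !det3_lin3 det3_qpp => h2.
have z2 : det3 (v i) q (v (ordS (ordS i))) / side i (v (ordS (ordS i))) = 0.
  by move: h2; rewrite !mul0r !add0r addr0 mul1r => /eqP; rewrite mulf_eq0 (gt_eqF p0) orbF => /eqP.
have := surface_bil sq; rewrite {1}qE z2 !bil_linl; lra.
Qed.

Lemma region_side_near q : (forall i, 0 < side i q) -> exists2 e, 0 < e &
  forall q', near3 e q q' -> forall i, 0 < side i q'.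
Proof.
move=> h; apply/nbhs_near3P; suff each i : \forall q' \near q, 0 < side i q' by exact: filter_forall each.
exact: near_det3.
Qed.

Lemma region_interior q : rel_interior k C q <-> surface k q /\ forall i, 0 < side i q.
Proof.
split=> [|[sq hq]]; last first.
  by apply/(rel_interiorP _ sq); have [e e0 h] := region_side_near hq; exists e => // q' sq' /h hq'; split=> // i; exact/ltW.
move=> qi; have sq : surface k q.
  have [sq _] : C q by apply: (interior_subset qi).
  exact: sq.
split=> // i; have /(rel_interiorP _ sq)[e e0 h] := qi.
have [_ hq] : C q by apply: h => //; exact: near3_refl.
rewrite lt_neqAle hq andbT eq_sym; apply/eqP => s0.
have Cq : C q by split.
have mq := region_pole Cq.
have [d d0 hd] := continuous_nrm (surface_cone sq) e0.
(* A point with a vanishing side function is pushed away from [m]: this makes the side function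
   negative, so the point is not interior. *)
have [t t0 ht] := push_near (lin 1 q (-1) m) d0.
have [cq' nq'] := hd _ (ht q t ltac:(by rewrite gtr0_norm)).
set q' := lin _ _ _ _ in cq' nq'.
have [_ /(_ i)] : C (nrm k q') by apply: h; [exact: nrm_surface|rewrite -(nrm_id sq)].
rewrite det3_nrm pmulr_rge0 ?invr_gt0 ?sqrtr_gt0; last exact: cq'.1.
by rewrite /q' !det3_lin3 s0; have := mulr_gt0 t0 (side_center i); lra.
Qed.

Lemma to_center_region q t : C q -> 0 < t <= 1 -> surface k (to_center k m q t) /\ forall i, 0 < side i (to_center k m q t).
Proof.
move=> Cq /andP[t0 t1]; have mq := region_pole Cq; have [sq hq] := Cq.
have cn : cone k (lin (1 - t) q t m) by apply: cone_lin => //; rewrite 1?bilC; lra.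
split=> [|i]; first exact: nrm_surface.
rewrite det3_nrm mulr_gt0 ?invr_gt0 ?sqrtr_gt0//; first exact: cn.1.
by rewrite det3_lin3 ltr_wpDl ?mulr_ge0 ?mulr_gt0//; lra.
Qed.

Lemma region_closed_set q : surface k q -> ~ C q -> exists2 e, 0 < e & forall q', surface k q' -> near3 e q q' -> ~ C q'.
Proof.
move=> sq nC; have [i] : exists i, side i q < 0.
  apply: contrapT => h; apply: nC; split=> // i; rewrite leNgt; apply/negP => l; apply: h; by exists i.
move=> l; have l' : 0 < det3 (v (ordS i)) (v i) q by rewrite det3_swap oppr_gt0.
have /nbhs_near3P[e e0 h] := near_det3 l'; exists e => // q' _ /h; rewrite det3_swap oppr_gt0 => h' [_ /(_ i)].
by rewrite leNgt h'.
Qed.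

Lemma region_closure : C = rel_closure k (rel_interior k C).
Proof.
apply/seteqP; split=> q.
  move=> Cq; have [sq hq] := Cq; apply/(rel_closureP _ sq) => e e0.
  have mq := region_pole Cq.
  have [t ht nt] := to_center_small sm sq (lt_trans (ltrN10 R) mq) e0.
  have [s1 s2] := to_center_region Cq ht; exists (to_center k m q t); split=> //.
  exact/region_interior.
move=> qc; apply: contrapT => nC; have sq : surface k q.
  (* In [subspace (surface k)] points off the surface are isolated, so a closure does not acquire
     such points. *)
  apply: contrapT => ns; have : nbhs (q : subspace (surface k)) [set q].
    by rewrite /nbhs /= -(nbhs_subspace_out ns) => x.
  by move=> /qc[q' [iq' /= E']]; apply: ns; rewrite -E'; exact: (interior_subset iq').1.
have [e e0 h] := region_closed_set sq nC; have /(rel_closureP _ sq)/(_ e e0)[q' [sq' nq' iq']] := qc.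
by apply: (h q' sq' nq'); exact: (interior_subset iq').
Qed.

(** The interior is star-shaped around [m]. *)
Lemma region_connected : connected (rel_interior k C : set (subspace (surface k))).
Proof.
move=> B [b Bb] [U oU BU] [V cV BV]; apply/seteqP; split; first by rewrite BU => q [].
have loc q : rel_interior k C q -> B q <-> B m.
  move=> /region_interior[sq hq]; have Cq : C q by split=> // i; exact: ltW.
  have mq := region_pole Cq.
  have mq' : -1 < bil k m q by lra.
  have tc t : 0 <= t <= 1 -> rel_interior k C (to_center k m q t).
    move=> /andP[t0 t1]; apply/region_interior; move: t0; rewrite le_eqVlt => /predU1P[<-|t0].
      by rewrite to_center0.
    by apply: to_center_region => //; apply/andP.
  have := @segment_locally_constant (fun t => B (to_center k m q t)) 0 1 ler01 _.
  rewrite to_center0// to_center1//.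
  apply=> t ht; have it := tc t ht; have [st _] := (region_interior _).1 it.
  have [e e0 he] : exists2 e, 0 < e & forall q', rel_interior k C q' -> near3 e (to_center k m q t) q' -> (B q' <-> B (to_center k m q t)).
    case: (pselect (B (to_center k m q t))) => Bt.
      have : nbhs (to_center k m q t : subspace (surface k)) U by apply: open_nbhs_nbhs; split=> //; move: Bt; rewrite BU => -[].
      move=> /(nbhs_surfaceP _ st)[e e0 h]; exists e => // q' iq' nq'; split=> // _; rewrite BU; split=> //.
      by apply: h => //; exact: ((region_interior _).1 iq').1.
    have : nbhs (to_center k m q t : subspace (surface k)) (~` V).
      by apply: open_nbhs_nbhs; split; [exact: closed_openC|move=> Vt; apply: Bt; rewrite BV; split].
    move=> /(nbhs_surfaceP _ st)[e e0 h]; exists e => // q' iq' nq'; split=> // Bq'; exfalso.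
    by move: Bq'; rewrite BV => -[_]; apply: h => //; exact: ((region_interior _).1 iq').1.
  have [d d0 hd] := to_center_near sm sq mq' ht e0; exists d => // s hs ts.
  by apply: he; [exact: tc|exact: hd].
move=> q iq; apply/(loc q iq); apply/(loc b); last exact: Bb.
by move: Bb; rewrite BU => -[].
Qed.

Lemma region_is_closed_region : closed_region k C.
Proof. by split; [move=> q []|exact: region_connected|exact: region_closure]. Qed.

Lemma region_boundary q : boundary k C q <-> surface k q /\ exists i, on_edge v i q.
Proof.
rewrite /boundary; split=> [[qc ni]|[sq [i oe]]].
  have Cq : C q.
    rewrite region_closure; have ci : closed (C : set (subspace (surface k))).
      by rewrite {1}region_closure; exact: closed_closure.
    by rewrite -region_closure; move: qc; rewrite /rel_closure -(closure_id _).1.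
  have [sq hq] := Cq; split=> //; apply: contrapT => ne; apply: ni; apply/region_interior; split=> // i.
  rewrite lt_neqAle hq andbT eq_sym; apply/eqP => s0; apply: ne; exists i; exact: face_on_edge.
have [Cq s0] := edge_face sq oe; split; last by move=> /region_interior[_ /(_ i)]; rewrite s0 ltxx.
by apply: subset_closure.
Qed.

Lemma region_proper : Defs.proper C.
Proof.
move=> x /region_pole h1 /region_pole; have -> : bil k m (- x) = - bil k m x by rewrite /bil /=; ring.
by lra.
Qed.

Lemma region_convex : convex k C.
Proof.
move=> x y Cx Cy xy na q [u [l [[hu l0 yE] lmin [t /= ht qE]]]].
rewrite in_itv /= in ht; have /andP[t0 tl] := ht.
have [sx hx] := Cx; have [sy hy] := Cy.
have [u' hu' yE'] := exists_join sx sy na.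
have ld : l <= dist k x y by apply: (lmin u'); split=> //; exact: dist_ge0.
have lpi : k = Spherical -> l < pi by move=> e; apply: le_lt_trans ld _; exact: dist_ltpi.
have lpos : 0 < l.
  rewrite lt_neqAle l0 andbT; apply/eqP => e; apply: xy; by rewrite -yE -e geodesic0.
have sl : 0 < gsin k l by exact: gsin_gt0.
have a0 : 0 <= gsin k (l - t) by apply: gsin_ge0; [lra|move=> e; have := lpi e; clear e; lra].
have b0 : 0 <= gsin k t by apply: gsin_ge0 => // e; have := lpi e; clear e; lra.
split=> [|i]; first by rewrite -qE; exact: geodesic_surface.
rewrite -(pmulr_rge0 _ sl); have -> : gsin k l * side i q = gsin k (l - t) * side i x + gsin k t * side i y.
  by rewrite -qE -yE !geodesicE !det3_lin3 gsinB; ring.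
by rewrite addr_ge0// mulr_ge0.
Qed.

Lemma side_within i j q : within_edge v i q -> j <> i -> 0 < side j q.
Proof.
move=> [a [c [a0 c0 ->]]] ji; rewrite det3_lin3.
have [e|/eqP nS] := eqVneq i (ordS j).
  by rewrite {1}e det3_qpp mulr0 add0r mulr_gt0// e; exact: side_next.
by rewrite ltr_pwDl ?mulr_ge0 ?mulr_gt0 ?side_ge0 ?ltW// side_pos// => /esym.
Qed.

Lemma region_bounded_by : bounded_by k C v true.
Proof.
split.
- by move=> q; exact: region_closed_set.
- by move=> q [].
- move=> q sq ne; case: (pselect (C q)) => Cq; last first.
    by have [e e0 h] := region_closed_set sq Cq; exists e => // q' sq' /(h _ sq').
  have [|e e0 h] := @region_side_near q.
    move=> i; have [_ /(_ i)] := Cq; rewrite le_eqVlt => /predU1P[z|//]; exfalso.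
    exact: (ne i (face_on_edge Cq (esym z))).
  by exists e => // q' sq' /h hq'; split=> // _; split=> // i; exact/ltW/hq'.
- move=> i q sq wq; have oth j : j <> i -> \forall q' \near q, 0 < side j q'.
    by move=> ji; exact: near_det3 (side_within wq ji).
  have : \forall q' \near q, forall j, j <> i -> 0 < side j q'.
    suff each j : \forall q' \near q, j <> i -> 0 < side j q' by exact: filter_forall each.
    case: (pselect (j = i)) => [e|ji]; first by apply: filterE => q' /(_ e).
    by apply: filterS (oth j ji).
  move=> /nbhs_near3P[e e0 h]; exists e => // q' sq' /h hq'; split=> s0; split=> //.
    move=> _; split=> // j; case: (pselect (j = i)) => [->|/hq']; exact: ltW.
  by move=> [_ /(_ i)]; rewrite leNgt s0.
- move=> i j q sq wq oq; apply: contrapT => ij.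
  by have := side_within wq (fun e => ij (esym e)); have [_ ->] := edge_face sq oq; rewrite ltxx.
Qed.

Section Area.
Hypothesis mean0 : forall q, \sum_i det3 m (v i) q = 0.

Let bil_pos : k <> Spherical -> forall q u, surface k q -> surface k u -> 0 < bil k q u.
Proof. by move=> ns q u sq su; rewrite (bil_dist sq su); apply: gcos_gt0 => /ns. Qed.

(** The values [det3 m (v i) q] have sum zero, so around the cycle they pass somewhere from
    nonnegative to nonpositive: [q] is in that sector. *)
Lemma region_fan q : exists i, 0 <= det3 m (v i) q /\ det3 m (v (ordS i)) q <= 0.
Proof.
have i0 : 'I_n by exact: Ordinal (ltnW (ltnW n2)).
apply: contrapT => h.
have step i : 0 <= det3 m (v i) q -> 0 < det3 m (v (ordS i)) q.
  by move=> s0; rewrite ltNge; apply/negP => s1; apply: h; exists i.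
have [j hj] : exists j, 0 <= det3 m (v j) q.
  apply: contrapT => hn; have neg i : det3 m (v i) q < 0.
    by rewrite ltNge; apply/negP => s0; apply: hn; exists i.
  have := mean0 q; rewrite (bigD1 i0)//= => e.
  have : \sum_(i | i != i0) det3 m (v i) q <= 0 by apply: sumr_le0 => i _; exact: ltW.
  by have := neg i0; lra.
have pos : forall i, 0 < det3 m (v i) q by apply: (ordS_ind (step j hj)) => i /ltW; exact: step.
have := mean0 q; rewrite (bigD1 i0)//= => e.
have : 0 <= \sum_(i | i != i0) det3 m (v i) q by apply: sumr_ge0 => i _; exact: ltW.
by have := pos i0; lra.
Qed.

(** Bounds the meridian slices, as [green_area] requires before the area is known. Off the sphere
    [q] is a nonnegative combination of [m] and two consecutive vertices, with coefficients at most
    1 because all values of [bil] are positive. *)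
Lemma region_bounded : exists M, forall q, C q -> `|q.1.1| <= M.
Proof.
case: (pselect (k = Spherical)) => [e|ns].
  exists 1 => q [[h _] _]; move: h; rewrite e /= mul1r => h.
  rewrite ler_norml; have := sqr_ge0 q.1.2; have := sqr_ge0 q.2; move: h.
  by move: q.1.1 q.1.2 q.2 => x y z h h1 h2; apply/andP; split; nra.
exists (`|m.1.1| + (\sum_i `|(v i).1.1| + \sum_i `|(v i).1.1|)) => q [sq hq].
have [i [s1 s2]] := region_fan q; have D' : 0 < det3 m (v i) (v (ordS i)) by rewrite det3_cycle; exact: side_center.
have qE := det3_expand q (lt0r_neq0 D').
set a := _ / _ in qE; set b := det3 m q _ / _ in qE; set c := det3 m (v i) q / _ in qE.
have a0 : 0 <= a by rewrite divr_ge0 ?(ltW D')// det3_cycle.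
have b0 : 0 <= b by rewrite divr_ge0 ?(ltW D')// det3_swap23 oppr_ge0.
have c0 : 0 <= c by rewrite divr_ge0 ?(ltW D').
have one : a ^+ 2 + b ^+ 2 + c ^+ 2 <= 1.
  have := surface_bil sq; rewrite qE !bil_lin (surface_bil sm) !(surface_bil (sv _)).
  rewrite (bilC k (v i) m) (bilC k (v (ordS i)) m) (bilC k (v (ordS i)) (v i)).
  have := bil_pos ns sm (sv i); have := bil_pos ns sm (sv (ordS i)); have := bil_pos ns (sv i) (sv (ordS i)).
  move=> /ltW h1 /ltW h2 /ltW h3.
  have := mulr_ge0 (mulr_ge0 b0 c0) h1; have := mulr_ge0 (mulr_ge0 a0 c0) h2; have := mulr_ge0 (mulr_ge0 a0 b0) h3.
  by lra.
have [a1 b1 c1] : [/\ a <= 1, b <= 1 & c <= 1] by split; nra.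
have vb j : `|(v j).1.1| <= \sum_i `|(v i).1.1|.
  by rewrite (bigD1 j)//= lerDl sumr_ge0// => *; exact: normr_ge0.
have tri1 (x y : R) : 0 <= x -> x <= 1 -> `|x * y| <= `|y|.
  by move=> x0 x1; rewrite normrM (ger0_norm x0) ler_piMl.
rewrite {1}qE /= !mul1r; apply: le_trans (ler_normD _ _) _; rewrite addrA.
apply: lerD; last exact: le_trans (tri1 _ _ c0 c1) (vb _).
apply: le_trans (ler_normD _ _) _; apply: lerD; first exact: tri1.
exact: le_trans (tri1 _ _ b0 b1) (vb _).
Qed.

Lemma region_area : (forall i, upper k (v i)) -> (forall q, C q -> 0 < q.2) ->
  area k C = (\sum_i tri k (v i) (v (ordS i)))%:E.
Proof.
move=> uv Cup; have [M hM] := region_bounded.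
rewrite (green_area uv region_bounded_by Cup) ?mul1r//.
have muI : (@lebesgue_measure R [set` `[(- M)%R, M]] < +oo)%E.
  by rewrite lebesgue_measure_itv /= lte_fin; case: ifP => _; rewrite ?ltry// -EFinB ltry.
apply: aeW => s; have sub : meridian_slice k C s `<=` `[- M, M]%classic.
  by move=> x [_ /= /hM /=]; rewrite in_itv /= ler_norml.
rewrite ge0_fin_numE//; apply: le_lt_trans (le_measure _ _ _ sub) _; rewrite ?inE.
- by apply: measurable_meridian_slice; exact: bounded_closed region_bounded_by.
- exact: measurable_itv.
- exact: muI.
Qed.

End Area.

Section Edges.
Variables (dr : 'I_n -> space) (ln : 'I_n -> R).
Hypothesis drU : forall i, unit_tangent k (v i) (dr i).
Hypothesis ln0 : forall i, 0 < ln i.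
Hypothesis lnE : forall i, geodesic k (v i) (dr i) (ln i) = v (ordS i).
Hypothesis ln_pi : k = Spherical -> forall i, ln i < pi.
Let segE := @segment_edge k n v dr ln ln0 lnE ln_pi.
Let edgS := @edge_segment k n v dr ln sv drU ln0 lnE ln_pi.
Let sl := gsin_len_gt0 ln0 ln_pi.

Lemma region_simple i j s t : 0 <= s < ln i -> 0 <= t < ln j ->
  geodesic k (v i) (dr i) s = geodesic k (v j) (dr j) t -> i = j /\ s = t.
Proof.
move=> /andP[s0 sl1] /andP[t0 tl] e.
have diff a b (x y : R) : 0 <= x < ln a -> 0 <= y < ln b ->
    geodesic k (v a) (dr a) x = geodesic k (v b) (dr b) y -> a = b \/ a = ordS b.
  move=> /andP[x0 xl] /andP[y0 yl] eq; apply: contrapT => /not_orP[n1 n2'].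
  have : side b (geodesic k (v b) (dr b) y) = 0.
    have oe : on_edge v b (geodesic k (v b) (dr b) y).
      by apply: segE; exists y => //=; rewrite in_itv /= y0 ltW.
    by have [] := edge_face (geodesic_surface y (sv b) (drU b)) oe.
  rewrite -eq (gam_lin ln0 lnE ln_pi) det3_lin3; apply/eqP; rewrite gt_eqF// ltr_pwDl//.
    rewrite mulr_gt0 ?side_pos// divr_gt0// gsin_gt0//; first by lra.
    by move=> ks; have := ln_pi ks a; clear ks; lra.
  rewrite mulr_ge0 ?side_ge0// divr_ge0 ?(ltW (sl _))// gsin_ge0// => ks.
  by have := ln_pi ks a; clear ks; lra.
have ij : i = j.
  have [//|h1] := diff i j s t ltac:(by rewrite s0) ltac:(by rewrite t0) e.
  have [//|h2] := diff j i t s ltac:(by rewrite t0) ltac:(by rewrite s0) (esym e).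
  by exfalso; apply: (@ordSS_neq j); rewrite -h1.
split=> //; subst j; move/(congr1 (dist k (v i))): e.
rewrite !dist_geodesic// => ks; have := ln_pi ks i; clear ks; lra.
Qed.

Lemma region_boundaryE : boundary k C = \bigcup_i segment k (v i) (dr i) (ln i).
Proof.
apply/seteqP; split=> q.
  move=> /region_boundary[sq [i [a [c [a0 c0 qE]]]]].
  exists i => //; rewrite qE in sq *; have [t [ht tE _]] := edgS a0 c0 sq.
  by exists t => //=; rewrite in_itv.
move=> [i _ sq]; apply/region_boundary; split; last by exists i; exact: segE.
by case: sq => t _ <-; exact: geodesic_surface.
Qed.

(** The radius has to serve all directions at once: in the frame at the vertex, [side j] of a unit
    vector is bounded below by [- B j]. *)
Lemma region_near_vertex i p : ordS p = i -> exists2 r, 0 < r & forall u t j, unit_tangent k (v i) u ->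
  0 <= t < r -> j <> i -> j <> p -> 0 < side j (geodesic k (v i) u t).
Proof.
move=> pi'; pose B j := `|side j (dr i)| + `|side j (trot k (v i) (dr i))|.
have B0 j : 0 <= B j by rewrite addr_ge0.
have bnd u j : unit_tangent k (v i) u -> - B j <= side j u.
  move=> hu; rewrite (frame_tangent (sv i) (drU i) hu.1) det3_lin3.
  have cs := cauchy_tangent (sv i) (drU i) hu.
  have le (x y : R) : x ^+ 2 <= 1 -> - `|y| <= x * y.
    move=> x1; have : `|x * y| <= `|y|.
      by rewrite normrM ler_piMl// ler_norml; apply/andP; split; nra.
    by rewrite ler_norml => /andP[].
  have h1 : metric k (dr i) u ^+ 2 <= 1 by have := sqr_ge0 (det3 (v i) (dr i) u); lra.
  have h2 : det3 (v i) (dr i) u ^+ 2 <= 1 by have := sqr_ge0 (metric k (dr i) u); lra.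
  by have := le _ (side j (dr i)) h1; have := le _ (side j (trot k (v i) (dr i))) h2; rewrite /B; lra.
have : \forall t \near (0 : R), forall j, j <> i -> j <> p -> 0 < gcos k t * side j (v i) - gsin k t * B j.
  suff each j : \forall t \near (0 : R), j <> i -> j <> p -> 0 < gcos k t * side j (v i) - gsin k t * B j by exact: filter_forall each.
  case: (pselect (j = i)) => [e|ji]; first by apply: filterE => t /(_ e).
  case: (pselect (j = p)) => [e|jp]; first by apply: filterE => t _ /(_ e).
  have s0 : 0 < side j (v i).
    by apply: side_pos => e; [exact: ji|apply: jp; apply: (@ordS_inj n); rewrite -e].
  have cf : {for 0, continuous (fun t => gcos k t * side j (v i) - gsin k t * B j)}.
    apply: (@has_der_continuous _ _ (- K k * gsin k 0 * side j (v i) - gcos k 0 * B j)).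
    apply: der_eq; first by apply: derB; apply: derM; [exact: der_gcos|exact: der_cst|exact: der_gsin|exact: der_cst].
    by rewrite /=; ring.
  have c0 : 0 < gcos k 0 * side j (v i) - gsin k 0 * B j by rewrite gcos0 gsin0 mul1r mul0r subr0.
  by have := cf _ (lt_nbhsr c0); rewrite nbhs_simpl /=; apply: filterS => t ht _ _.
move=> /nbhs_ballP[r /= r0 hr]; exists (Num.min r pi); first by rewrite lt_min r0 pi_gt0.
move=> u t j hu /andP[t0]; rewrite lt_min => /andP[tr tpi] ji jp.
have tb : ball (0 : R) r t by rewrite -ball_normE /= sub0r normrN ger0_norm.
have := hr t tb j ji jp; rewrite geodesicE det3_lin3 => h.
have g0 : 0 <= gsin k t by apply: gsin_ge0 => // _; exact: ltW.
by have := bnd u j hu; have := ler_wpM2l g0 (bnd u j hu); lra.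
Qed.

Lemma edge_backward i p : ordS p = i -> exists e', unit_tangent k (v i) e' /\
  geodesic k (v i) e' (ln p) = v p.
Proof.
move=> <-; exists (lin (-1) (vel k (v p) (dr p) (ln p)) 0 (v p)).
have hu := vel_unit (ln p) (sv p) (drU p); rewrite lnE in hu; split.
  have := unit_tangentN hu; congr unit_tangent; coords.
rewrite -{1}lnE; have := geodesic_shift k (v p) (dr p) (ln p) (- ln p); rewrite subrr.
have -> : geodesic k (v p) (dr p) 0 = v p.
  exact: geodesic0.
move=> e; rewrite -[RHS]e; move: (geodesic _ _ _ _) (vel _ _ _ _) => x y.
by rewrite !geodesicE gcosN gsinN; coords.
Qed.

(** Within this radius only the two adjacent sides matter, and along a ray from the vertex the signs
    of their side functions depend on the direction alone. *)
Lemma vertex_frame i : exists p e' r, [/\ ordS p = i, unit_tangent k (v i) e', 0 < r,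
  0 < det3 (v i) (dr i) e' & geodesic k (v i) e' (ln p) = v p] /\
  [/\ r <= ln i, r <= ln p, forall u t, unit_tangent k (v i) u -> 0 < t < r ->
    (C (geodesic k (v i) u t) <-> 0 <= det3 (v i) (dr i) u /\ 0 <= det3 (v i) u e'),
    forall u t, unit_tangent k (v i) u -> 0 < t < r -> (exists j, on_edge v j (geodesic k (v i) u t)) ->
      u = dr i \/ u = e' &
    forall u t, u = dr i \/ u = e' -> 0 <= t < r -> exists j, on_edge v j (geodesic k (v i) u t)].
Proof.
have [p pi'] : exists p : 'I_n, ordS p = i by exists (ord_pred i); rewrite ord_predK.
have [e' [he' eE]] := edge_backward pi'.
have [r r0 hr] := region_near_vertex pi'.
pose r' := Num.min r (Num.min (ln i) (ln p)).
have sSi u t : side i (geodesic k (v i) u t) = gsin k t * (gsin k (ln i) * det3 (v i) (dr i) u).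
  by rewrite (det3_edge lnE) geodesicE det3_lin3 det3_pqp; ring.
have sSp u t : side p (geodesic k (v i) u t) = gsin k t * (gsin k (ln p) * det3 (v i) u e').
  by rewrite pi' -eE !geodesicE /det3 /lin /=; ring.
have D : 0 < det3 (v i) (dr i) e'.
  have pi1 : p <> i by move=> e; apply: (ordS_neq' (i := i)); rewrite -{1}e.
  have pi2 : p <> ordS i by move=> e; apply: (@ordSS_neq i); rewrite -e.
  have := side_pos pi1 pi2; rewrite -eE sSi pmulr_rgt0 ?sl// pmulr_rgt0 ?sl//.
have rpi t : 0 < t < r' -> 0 < gsin k t.
  move=> /andP[t0]; rewrite !lt_min => /and3P[_ ti _]; apply: gsin_gt0 => // ks.
  by have := ln_pi ks i; clear ks; lra.
have dC u t : unit_tangent k (v i) u -> 0 < t < r' -> (C (geodesic k (v i) u t) <->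
    0 <= det3 (v i) (dr i) u /\ 0 <= det3 (v i) u e').
  move=> hu ht; have gt := rpi _ ht; have /andP[t0 tr] := ht; have tr' : t < r by move: tr; rewrite lt_min => /andP[].
  split=> [[_ hs]|[h1 h2]].
    by have := hs i; have := hs p; rewrite sSi sSp !(pmulr_rge0 _ gt) !(pmulr_rge0 _ (sl _)).
  split=> [|j]; first exact: geodesic_surface.
  case: (pselect (j = i)) => [->|ji]; first by rewrite sSi !mulr_ge0// ltW// sl.
  case: (pselect (j = p)) => [->|jp]; first by rewrite sSp !mulr_ge0// ltW// sl.
  by rewrite ltW// hr// (ltW t0).
have unitP w u : unit_tangent k (v i) w -> unit_tangent k (v i) u -> det3 (v i) w u = 0 -> u = w \/ u = lin (-1) w 0 w.
  move=> hw hu d0; have := cauchy_tangent (sv i) hw hu; rewrite d0 expr0n addr0 => /eqP.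
  have uE := frame_tangent (sv i) hw hu.1; rewrite d0 in uE.
  rewrite sqrf_eq1 => /orP[]/eqP e; rewrite e in uE; [left|right]; rewrite uE; coords.
exists p, e', r'; split; first by split=> //; rewrite !lt_min r0 !ln0.
split=> //.
- by rewrite !ge_min lexx orbT.
- by rewrite !ge_min lexx !orbT.
- move=> u t hu ht [j oj]; have gt := rpi _ ht; have /andP[t0 tr] := ht; have tr' : t < r by move: tr; rewrite lt_min => /andP[].
  have [Cq s0] := edge_face (geodesic_surface t (sv i) hu) oj.
  have [h1 h2] := (dC u t hu ht).1 Cq.
  case: (pselect (j = i)) => [e|ji].
    have d0 : det3 (v i) (dr i) u = 0.
      by move: s0; rewrite e sSi => /eqP; rewrite !mulf_eq0 (gt_eqF gt) (gt_eqF (sl i)) /= => /eqP.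
    have [->|uE] := unitP _ _ (drU i) hu d0; first by left.
    by exfalso; move: h2; rewrite uE det3_lin2 mulN1r mul0r addr0 oppr_ge0 leNgt D.
  case: (pselect (j = p)) => [e|jp].
    have d0 : det3 (v i) e' u = 0.
      by move: s0; rewrite e sSp => /eqP; rewrite !mulf_eq0 (gt_eqF gt) (gt_eqF (sl p)) /= => /eqP; rewrite (det3_swap23 _ e') => ->; rewrite oppr0.
    have [->|uE] := unitP _ _ he' hu d0; first by right.
    by exfalso; move: h1; rewrite uE det3_lin3 mulN1r mul0r addr0 oppr_ge0 leNgt D.
  by have := hr u t j hu ltac:(by rewrite ltW) ji jp; rewrite s0 ltxx.
- move=> u t [->|->] /andP[t0]; rewrite !lt_min => /and3P[_ ti tp].
    by exists i; apply: segE; exists t => //=; rewrite in_itv /= t0 ltW.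
  exists p; exists (gsin k t / gsin k (ln p)), (gsin k (ln p - t) / gsin k (ln p)); split.
  + by rewrite divr_ge0 ?(ltW (sl _))// gsin_ge0// => ks; have := ln_pi ks p; clear ks; lra.
  + by rewrite divr_ge0 ?(ltW (sl _))// gsin_ge0//; [lra|move=> ks; have := ln_pi ks p; clear ks; lra].
  + rewrite pi' -eE !geodesicE gsinB; have := sl p => s0.
    by apply: eq_space => /=; field; rewrite gt_eqF.
Qed.

Lemma region_vertex i : is_vertex k C (v i).
Proof.
have bP := region_boundary.
have [p [e' [r [[pi' he' r0 D eE] [ri rp dC dE dE']]]]] := vertex_frame i.
split.
  apply/bP; split=> //; have [j oj] := dE' (dr i) 0 (or_introl erefl) ltac:(by rewrite lexx).
  by exists j; rewrite geodesic0 in oj.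
exists r, (dr i), e'; split=> //.
  split=> e; first by move: D; rewrite e det3_qpp ltxx.
  move: D; rewrite e; have -> : det3 (v i) (- e') e' = 0 by rewrite /det3 /=; ring.
  by rewrite ltxx.
apply/seteqP; split=> q.
  move=> [/bP[sq [j oj]] [u hu [t /= ht qE]]]; rewrite in_itv /= in ht; have /andP[t0 tr] := ht.
  move: t0; rewrite le_eqVlt => /predU1P[t0|t0].
    by left; exists 0; rewrite /= ?in_itv/= ?lexx// -qE -t0 !geodesic0.
  have ht' : 0 < t < r by rewrite t0.
  have oj' : exists j, on_edge v j (geodesic k (v i) u t) by exists j; rewrite qE.
  have [uE|uE] := dE u t hu ht' oj'.
    by left; exists t; rewrite /= ?in_itv//= -?uE.
  by right; exists t; rewrite /= ?in_itv//= -?uE.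
have main u : unit_tangent k (v i) u -> u = dr i \/ u = e' -> radial k (v i) u r q -> boundary k C q /\ disc k (v i) r q.
  move=> hu hor [t /= ht qE]; rewrite in_itv /= in ht; split; last by exists u => //; exists t; rewrite /= ?in_itv.
  by apply/bP; rewrite -qE; split; [exact: geodesic_surface|exact: dE'].
by move=> [|]; apply: main => //; [left|right].
Qed.

Lemma region_angle i p e' a : ordS p = i -> unit_tangent k (v i) e' -> geodesic k (v i) e' (ln p) = v p ->
  0 < a < pi -> metric k (dr i) e' = cos a -> interior_angle k C (v i) a.
Proof.
move=> pi1 h1 E1 a_itv ca; have /andP[a0 api] := a_itv; have pi0 := @pi_gt0 R.
have [p2 [e2 [r [[pi' he' r0 D eE] [_ _ dC _ _]]]]] := vertex_frame i.
have pp : p2 = p by apply: (@ordS_inj n); rewrite pi'.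
have ee : e2 = e'.
  have := eE; rewrite pp -E1 !geodesicE => e; have s0 := sl p.
  apply: eq_space; apply: (mulfI (lt0r_neq0 s0)).
  - by have := congr1 (fun z => z.1.1) e; rewrite /=; lra.
  - by have := congr1 (fun z => z.1.2) e; rewrite /=; lra.
  - by have := congr1 (fun z => z.2) e; rewrite /=; lra.
subst p2 e2; split; first by between.
have ht := unit_rot (sv i) (drU i); have mt := metric_rot (sv i) (drU i).1.
have DE : det3 (v i) (dr i) e' = sin a.
  have := cauchy_tangent (sv i) (drU i) he'; rewrite ca => e; have sa : 0 < sin a by exact: sin_gt0_pi.
  have := cos2Dsin2 a => e3; have : (det3 (v i) (dr i) e' - sin a) * (det3 (v i) (dr i) e' + sin a) = 0 by lra.
  have nz : det3 (v i) (dr i) e' + sin a != 0 by rewrite gt_eqF// addr_gt0.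
  by move/eqP; rewrite mulf_eq0 (negbTE nz) orbF => /eqP; lra.
pose u (t : R) := lin (cos t) (dr i) (sin t) (trot k (v i) (dr i)).
have uE t : (cos t * (dr i).1.1 + sin t * (trot k (v i) (dr i)).1.1, cos t * (dr i).1.2 + sin t * (trot k (v i) (dr i)).1.2,
   cos t * (dr i).2 + sin t * (trot k (v i) (dr i)).2) = u t by [].
have hu t : unit_tangent k (v i) (u t).
  split; first by rewrite tangentE bil_linr [bil _ _ _](drU i).1 [bil _ _ _]ht.1; ring.
  rewrite /u !(metric_linl, metric_linr) (metricC k (trot _ _ _)) mt (drU i).2 ht.2.
  by have := cos2Dsin2 t; lra.
have d1 t : det3 (v i) (dr i) (u t) = sin t.
  by rewrite /u det3_lin3 det3_qpp (det3_rot_unit (sv i) (drU i)); ring.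
have eu : e' = u a by rewrite {1}(frame_tangent (sv i) (drU i) he'.1) ca DE.
have d2 t : det3 (v i) (u t) e' = sin (a - t).
  rewrite eu /u !(det3_lin2, det3_lin3) !det3_qpp (det3_rot_unit (sv i) (drU i)) (det3_swap23 _ (trot _ _ _)).
  by rewrite (det3_rot_unit (sv i) (drU i)) sinB; ring.
exists r, (dr i), (trot k (v i) (dr i)); split=> //.
apply/seteqP; split=> q.
  move=> [Cq [w hw [t /= ht' qE]]]; rewrite in_itv /= in ht'; have /andP[t0 tr] := ht'.
  move: t0; rewrite le_eqVlt => /predU1P[t0|t0].
    exists 0 => /=; first by rewrite in_itv /= lexx ltW.
    by exists 0; rewrite /= ?in_itv/= ?lexx// uE -qE -t0 !geodesic0.
  have [psi [/andP[ps0 ps2] cps sps]] := cos_sin_exists (cauchy_tangent (sv i) (drU i) hw).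
  have wE : w = u psi by rewrite /u cps sps; exact: frame_tangent (sv i) (drU i) hw.1.
  have ht2 : 0 < t < r by rewrite t0.
  have Cg : C (geodesic k (v i) w t) by rewrite qE.
  have [h2 h3] := (dC w t hw ht2).1 Cg.
  rewrite wE d1 in h2; rewrite wE d2 in h3.
  have fin b : 0 <= b <= a -> u psi = u b -> (\bigcup_(phi in `[0, a]) radial k (v i) (u phi) r) q.
    by move=> hb ub; exists b => //=; exists t; rewrite /= ?in_itv//= -ub -wE.
  (* The sector conditions are [0 <= sin psi] and [0 <= sin (a - psi)]. Beyond [pi] only
     [psi = 2 * pi] satisfies the first, and it is the direction of angle 0. *)
  have [p1|p1] := leP psi pi; last first.
    have : 0 <= - sin (psi - pi).
      by rewrite sinB cospi sinpi; lra.
    have [p3|p3] := eqVneq psi (2 * pi).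
      move=> _; apply: (fin 0); first by rewrite lexx ltW.
      by rewrite /u p3 mulr_natl cos2pi sin2pi cos0 sin0.
    have : 0 < sin (psi - pi).
      apply: sin_gt0_pi; have p4 : psi < 2 * pi by rewrite lt_neqAle p3.
      by between.
    by lra.
  apply: (fin psi) => //; rewrite ps0 /= leNgt; apply/negP => ap.
  have : 0 < sin (psi - a) by apply: sin_gt0_pi; between.
  by move: h3; rewrite -opprB sinN; lra.
move=> [b /=]; rewrite in_itv /= => /andP[b0 ba] [t /= ht']; rewrite uE => qE; rewrite in_itv /= in ht'.
split; last by exists (u b) => //; exists t; rewrite /= ?in_itv.
have /andP[t0 tr] := ht'; move: t0; rewrite le_eqVlt => /predU1P[t0|t0].
  by rewrite -qE -t0 geodesic0; exact: vertex_region.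
rewrite -qE; apply/(dC (u b) t (hu b)); first by rewrite t0.
by rewrite d1 d2; split; apply: sin_ge0_pi; between.
Qed.

Definition region_polygon : polygon R k n := @Polygon R k n C v dr ln
  region_is_closed_region sv drU ln0 lnE region_simple region_boundaryE region_vertex.

End Edges.
End ConvexPolygon.

(** * A region is determined by its boundary curve *)

Section RegionUnique.
Variables (k : curvature) (n : nat) (v : 'I_n -> space) (m : space) (E : R) (F : set space).
Hypothesis n2 : (2 < n)%N.
Hypothesis um : upper k m.
Hypothesis uv : forall i, upper k (v i).
Hypothesis E0 : 0 < E.
Local Notation side i q := (det3 (v i) (v (ordS i)) q).
Hypothesis side_pos : forall i j : 'I_n, j <> i -> j <> ordS i -> 0 < side i (v j).
Hypothesis side_center : forall i, 0 < side i m.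
Hypothesis side_sum : forall q, \sum_i side i q = E * bil k m q.
Hypothesis Fv : bounded_by k F v true.
Hypothesis Fup : forall q, F q -> 0 < q.2.
Implicit Types (i j p : 'I_n) (u w : space).
Local Notation C := (chain_region k v).
Let sm := um.1.
Local Notation pth := (to_center k m).

Let pth_side i q t : surface k q -> -1 < bil k m q -> 0 <= t <= 1 -> exists2 c, 0 < c &
  side i (pth q t) = c * ((1 - t) * side i q + t * side i m).
Proof.
move=> sq mq ht; have [b0 _] := to_center_cone sm sq mq ht; rewrite /to_center det3_nrm det3_lin3.
by eexists; [|reflexivity]; rewrite invr_gt0 sqrtr_gt0.
Qed.

Let pth_const q b : surface k q -> -1 < bil k m q -> 0 <= b <= 1 ->
  (forall t, 0 <= t <= b -> forall i, ~ on_edge v i (pth q t)) -> F q <-> F (pth q b).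
Proof.
move=> sq mq /andP[b0 b1] ne; rewrite -{1}(to_center0 m sq).
apply: (@segment_locally_constant (fun t => F (pth q t)) 0 b b0) => t ht.
have /andP[t0 tb] := ht; have ht1 : 0 <= t <= 1 by between.
have [e e0 he] := bounded_flat Fv (nrm_surface (to_center_cone sm sq mq ht1)) (ne t ht).
have [d d0 hd] := to_center_near sm sq mq ht1 e0; exists d => // s /andP[s0 sb] /hd; apply: he.
by apply/nrm_surface/(to_center_cone sm) => //; between.
Qed.

(** Just to the left of the middle of an edge [F] is known to be present. Paths to the centre meet
    no edge inside [C], so [F] contains [m], then the interior of [C], and the rest by
    closedness. *)
Lemma region_sub : C `<=` F.
Proof.
have mid q : C q -> -1 < bil k m q by move=> /(region_pole n2 E0 side_pos side_sum); lra.
have inner q t i : C q -> 0 < t <= 1 -> ~ on_edge v i (pth q t).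
  move=> Cq ht oe; have [sp /(_ i)] := to_center_region n2 sm E0 side_pos side_center side_sum Cq ht.
  by have [_ ->] := edge_face side_pos sp oe; rewrite ltxx.
have i : 'I_n by exact: Ordinal (ltnW (ltnW n2)).
have Fm : F m.
  have cn : cone k (lin 1 (v i) 1 (v (ordS i))).
    by apply: cone_lin => //; [exact: (uv _).1|exact: (uv _).1|exact: upper_bilN1].
  pose p := nrm k (lin 1 (v i) 1 (v (ordS i))); have sp : surface k p by exact: nrm_surface.
  have c0 : 0 < (Num.sqrt (bil k (lin 1 (v i) 1 (v (ordS i))) (lin 1 (v i) 1 (v (ordS i)))))^-1.
    by rewrite invr_gt0 sqrtr_gt0; exact: cn.1.
  have wp : within_edge v i p.
    by eexists; eexists; split; [exact: c0|exact: c0|rewrite /p /nrm; coords].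
  have oe : on_edge v i p by have [a [c [/ltW a0 /ltW c0' h]]] := wp; exists a, c.
  have [Cp s0] := edge_face side_pos sp oe.
  have [e e0 he] := bounded_jump Fv sp wp.
  have [t ht nt] := to_center_small sm sp (mid _ Cp) e0.
  have [st hs] := to_center_region n2 sm E0 side_pos side_center side_sum Cp ht.
  have Ft : F (pth p t).
    by have [h _] := he _ st nt; apply/(h (hs i)).
  have Ct : C (pth p t) by split=> // j; exact: ltW.
  have := @pth_const _ 1 st (mid _ Ct) ltac:(by rewrite lexx ler01) _.
  rewrite to_center1// => <- // s /andP[s0' s1] j; move: s0'; rewrite le_eqVlt => /predU1P[<-|s0'].
    by rewrite to_center0//; exact: inner.
  by apply: inner => //; rewrite s0'.
have Fint q : C q -> (forall j, ~ on_edge v j q) -> F q.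
  move=> Cq nq; have [sq _] := Cq.
  have := @pth_const _ 1 sq (mid _ Cq) ltac:(by rewrite lexx ler01) _.
  rewrite to_center1// => -> // s /andP[s0' s1] j; move: s0'; rewrite le_eqVlt => /predU1P[<-|s0'].
    by rewrite to_center0.
  by apply: inner => //; rewrite s0'.
move=> q Cq; apply: contrapT => nF; have [sq hq] := Cq.
have [e e0 he] := bounded_closed Fv sq nF.
have [t ht nt] := to_center_small sm sq (mid _ Cq) e0.
have [st hs] := to_center_region n2 sm E0 side_pos side_center side_sum Cq ht.
apply: (he _ st nt); apply: Fint; first by split=> // j; exact: ltW.
by move=> j; exact: inner.
Qed.

(** Perturbs the point until the segment from it to [m] meets no vertex, so that [bounded_jump]
    applies where this segment enters [C]. *)
Let generic (s : seq 'I_n) q : F q -> ~ C q -> exists q', [/\ F q', ~ C q' & forall j, j \in s -> det3 m (v j) q' != 0].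
Proof.
move=> Fq nq; elim: s => [|a s [q' [Fq' nq' hs]]]; first by exists q.
have sq' := bounded_surface Fv Fq'.
have [d0|d0] := eqVneq (det3 m (v a) q') 0; last first.
  by exists q'; split=> // j; rewrite inE => /predU1P[->//|]; exact: hs.
have noe i : ~ on_edge v i q' by move=> /(edge_face side_pos sq')[/nq'].
have [e e0 he] := bounded_flat Fv sq' noe.
have [e' e'0 he'] := region_closed_set sq' nq'.
have each : \forall q2 \near q', forall j, j \in s -> det3 m (v j) q2 != 0.
  suff ej j : \forall q2 \near q', j \in s -> det3 m (v j) q2 != 0 by exact: filter_forall ej.
  have [js|js] := boolP (j \in s); last by apply: filterE.
  have := hs j js; rewrite neq_lt => /orP[l|l].
    have l' : 0 < det3 (v j) m q' by rewrite det3_swap oppr_gt0.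
    by apply: filterS (near_det3 l') => q2; rewrite det3_swap oppr_gt0 => h _; rewrite lt_eqF.
  by apply: filterS (near_det3 l) => q2 h _; rewrite gt_eqF.
have [e2 e20 he2] := (nbhs_near3P _ _).1 each.
pose u := v (ordS a); have du : 0 < det3 m (v a) u by rewrite det3_cycle; exact: side_center.
pose e3 := Num.min e (Num.min e' e2); have e30 : 0 < e3 by rewrite !lt_min e0 e'0.
have [d d0' hd] := continuous_nrm (surface_cone sq') e30.
have [t t0 ht] := push_near u d0'.
have [cq nq2] := hd _ (ht q' t ltac:(by rewrite gtr0_norm)).
rewrite nrm_id// in nq2; have s2 := nrm_surface cq.
have [l1 l2 l3] : [/\ e3 <= e, e3 <= e' & e3 <= e2] by rewrite /e3 !ge_min !lexx !orbT.
exists (nrm k (lin 1 q' t u)); split.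
- by apply/(he _ s2 (near3_le l1 nq2)).
- exact: he' s2 (near3_le l2 nq2).
- move=> j; rewrite inE => /predU1P[->|]; last by apply: he2; exact: near3_le l3 nq2.
  have c0 : 0 < (Num.sqrt (bil k (lin 1 q' t u) (lin 1 q' t u)))^-1 by rewrite invr_gt0 sqrtr_gt0; exact: cq.1.
  by rewrite det3_nrm det3_lin3 d0 mulr0 add0r gt_eqF// mulr_gt0// mulr_gt0.
Qed.

(* Outside [C], follow the segment towards [m] up to the boundary of [C]. *)
Lemma region_sup : F `<=` C.
Proof.
move=> q0 Fq0; apply: contrapT => nq0.
have [q [Fq nq gq]] := generic (enum 'I_n) Fq0 nq0.
have sq := bounded_surface Fv Fq; have uq : upper k q by split=> //; exact: Fup.
have mq := upper_bilN1 um uq.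
have [i1 l1] : exists i, side i q < 0.
  apply: contrapT => h; apply: nq; split=> // i; rewrite leNgt; apply/negP => l; apply: h; by exists i.
(* Parameter at which the path to [m] crosses the line of edge [i]. The largest one belongs to the
   last crossing, which is the entry into [C]. *)
pose T i := - side i q / (side i m - side i q).
have TE i : side i q < 0 -> 0 < T i < 1.
  move=> l; have c0 := side_center i; rewrite /T ltr_pdivrMr ?divr_gt0; lra.
pose i0 := [arg max_(i > i1 | side i q < 0) T i]%O.
have [l0 Tmax] : side i0 q < 0 /\ forall j, side j q < 0 -> T j <= T i0.
  by rewrite /i0; case: arg_maxP.
have /andP[T0 T1] := TE i0 l0; set t := T i0 in T0 T1.
have ht : 0 <= t <= 1 by rewrite !ltW.
have lin_side i s : side i q < 0 -> (1 - s) * side i q + s * side i m = (s - T i) * (side i m - side i q).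
  move=> l; have nz : side i m - side i q != 0 by rewrite gt_eqF//; have := side_center i; lra.
  by rewrite /T; field; exact: nz.
have st := nrm_surface (to_center_cone sm sq mq ht).
have s0 : side i0 (pth q t) = 0.
  by have [c c0 ->] := pth_side i0 sq mq ht; rewrite lin_side// subrr mul0r mulr0.
have Ct : C (pth q t).
  split=> // i; have [c c0 ->] := pth_side i sq mq ht; rewrite pmulr_rge0//.
  have [l|l] := ltP (side i q) 0; last by rewrite addr_ge0// mulr_ge0//; [lra|exact: ltW|exact: ltW].
  by rewrite lin_side// mulr_ge0 ?subr_ge0 ?Tmax//; have := side_center i; lra.
have [a [c [a0 c0 qE]]] := face_on_edge n2 side_pos Ct s0.
have nz j : det3 m (v j) (pth q t) != 0.
  have [b0 _] := to_center_cone sm sq mq ht; rewrite /to_center det3_nrm det3_lin3 det3_pqp mulr0 addr0.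
  by rewrite !mulf_neq0 ?gq ?mem_enum// gt_eqF ?invr_gt0 ?sqrtr_gt0//; lra.
have wt : within_edge v i0 (pth q t).
  exists a, c; split=> //.
    rewrite lt_neqAle a0 andbT eq_sym; apply/eqP => z; have := nz (ordS i0).
    by rewrite qE z det3_lin3 det3_qpp mul0r mulr0 addr0 eqxx.
  rewrite lt_neqAle c0 andbT eq_sym; apply/eqP => z; have := nz i0.
  by rewrite qE z det3_lin3 det3_qpp mul0r mulr0 addr0 eqxx.
have [e e0 he] := bounded_jump Fv st wt.
have [d d0 hd] := to_center_near sm sq mq ht e0.
(* A parameter just before the entry: on the outer side of the edge, where [F] is absent. *)
pose s := Num.max 0 (t - d / 2).
have s1 : 0 <= s by rewrite le_max lexx.
have s2 : s < t by rewrite gt_max T0; lra.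
have s3 : t - d / 2 <= s by rewrite le_max lexx orbT.
have hs : 0 <= s <= 1 by between.
have neg r : 0 <= r <= s -> side i0 (pth q r) < 0.
  move=> /andP[r0 rs]; have hr : 0 <= r <= 1 by between.
  have [c' c'0 ->] := pth_side i0 sq mq hr; rewrite pmulr_rlt0// lin_side// nmulr_rlt0 ?subr_lt0; last by rewrite -/t; lra.
  by have := side_center i0; lra.
have nF : ~ F (pth q s).
  have [|_ h] := he _ (nrm_surface (to_center_cone sm sq mq hs)); first by apply: hd; rewrite gtr0_norm; lra.
  by move=> /(h (neg s ltac:(by rewrite s1 lexx))).
apply: nF; apply/(pth_const sq mq hs) => // r hr i oe.
have hr1 : 0 <= r <= 1 by move: hr => /andP[? ?]; between.
have [[_ hC] _] := edge_face side_pos (nrm_surface (to_center_cone sm sq mq hr1)) oe; move: (hC i0).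
by rewrite leNgt neg.
Qed.

Lemma region_unique : F = C.
Proof. by apply/seteqP; split; [exact: region_sup|exact: region_sub]. Qed.

End RegionUnique.

(** * Motions, orientation reversing ones included *)

Section Motions.
Implicit Types (p u : space) (C : set space) (r a : R).

Record motion k (f g : space -> space) : Prop := Motion {
  iso_fg : forall q, g (f q) = q;
  iso_gf : forall q, f (g q) = q;
  iso_lin : forall a p c q, f (lin a p c q) = lin a (f p) c (f q);
  iso_surface : forall q, surface k (f q) <-> surface k q;
  iso_bil : forall p q, bil k (f p) (f q) = bil k p q;
  iso_metric : forall p q, metric k (f p) (f q) = metric k p q;
  iso_det : exists2 e, e = 1 \/ e = -1 & forall p q u, det3 (f p) (f q) (f u) = e * det3 p q u }.

Lemma swapK q : swap (swap q) = q. Proof. by case: q => -[]. Qed.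

Lemma rigid_motion k f g : rigid k f g -> motion k f g.
Proof.
move=> rg; split; [exact: (rigid_fg rg)|exact: (rigid_gf rg)|exact: (rigid_lin rg)|exact: (rigid_surface rg)|
  exact: (rigid_bil rg)|exact: (rigid_metric rg)|exists 1; first by left].
by move=> p q u; rewrite (rigid_det rg) mul1r.
Qed.

Lemma motion_swap k f g : motion k f g -> motion k (swap \o f) (g \o swap).
Proof.
move=> [h1 h2 h3 h4 h5 h6 [e he h7]]; split.
- by move=> q; rewrite /= swapK.
- by move=> q; rewrite /= h2 swapK.
- by move=> a p c q; rewrite /= h3.
- by move=> q; rewrite /= surface_swap.
- by move=> p q; rewrite -[RHS]h5 /=; move: (f p) (f q) => x y; rewrite /bil /=; ring.
- by move=> p q; rewrite -[RHS]h6 /=; move: (f p) (f q) => x y; rewrite /metric /=; ring.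
- exists (- e); first by case: he => ->; [right|left; rewrite opprK].
  by move=> p q u; rewrite /= det3_swapped h7; ring.
Qed.

Lemma motion_sym k f g : motion k f g -> motion k g f.
Proof.
move=> [h1 h2 h3 h4 h5 h6 [e he h7]]; split=> //.
- by move=> a p c q; rewrite -{1}(h2 p) -{1}(h2 q) -h3 h1.
- by move=> q; rewrite -h4 h2.
- by move=> p q; rewrite -h5 !h2.
- by move=> p q; rewrite -h6 !h2.
- exists e => // p q u; rewrite -[in RHS](h2 p) -[in RHS](h2 q) -[in RHS](h2 u) h7 mulrA.
  by case: he => ->; ring.
Qed.

Section Transport.
Variables (k : curvature) (f g : space -> space).
Hypothesis fg : motion k f g.

Lemma iso_geodesic p u t : f (geodesic k p u t) = geodesic k (f p) (f u) t.
Proof. by rewrite !geodesicE (iso_lin fg). Qed.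

Lemma iso_unit_tangent p u : unit_tangent k (f p) (f u) <-> unit_tangent k p u.
Proof. by rewrite /unit_tangent !tangentE (iso_bil fg) (iso_metric fg). Qed.

Lemma iso_opp q : f (- q) = - f q.
Proof.
have E u : - u = lin (-1) u 0 u by coords.
by rewrite !E (iso_lin fg).
Qed.

Lemma iso_inj p q : f p = f q -> p = q.
Proof. by move=> e; rewrite -(iso_fg fg p) e (iso_fg fg). Qed.

Lemma iso_chord2 p q : chord2 k (f p) (f q) = chord2 k p q.
Proof. by rewrite !chord2_metric !(iso_metric fg). Qed.

Lemma iso_radial p u r q : radial k (f p) (f u) r (f q) <-> radial k p u r q.
Proof.
by split=> -[t ht e]; exists t => //; [apply: iso_inj|rewrite -e]; rewrite iso_geodesic.
Qed.

Lemma iso_joins x u l y : joins k (f x) (f u) l (f y) <-> joins k x u l y.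
Proof.
by split=> -[/iso_unit_tangent h1 h2 h3]; split=> //; [apply: iso_inj; rewrite iso_geodesic|rewrite -iso_geodesic h3].
Qed.

Lemma iso_disc p r q : disc k (f p) r (f q) <-> disc k p r q.
Proof.
split=> -[u hu h].
  exists (g u); first by apply/iso_unit_tangent; rewrite (iso_gf fg).
  by apply/iso_radial; rewrite (iso_gf fg).
by exists (f u); [apply/iso_unit_tangent|apply/iso_radial].
Qed.

Lemma iso_convex C : convex k C -> convex k (f @^-1` C).
Proof.
move=> cv x y Cx Cy xy na q [u [l [j1 jm [t ht qE]]]].
apply: (cv (f x) (f y) Cx Cy); first by move/iso_inj.
  by move=> e; rewrite -iso_opp => /iso_inj; exact: na.
exists (f u), l; split; first by apply/iso_joins.
  by move=> u' l'; rewrite -(iso_gf fg u') => /iso_joins; exact: jm.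
by exists t => //; rewrite -iso_geodesic qE.
Qed.

Lemma iso_proper C : Defs.proper C -> Defs.proper (f @^-1` C).
Proof. by move=> pC x /pC; rewrite /= iso_opp. Qed.

Lemma iso_angle C p a : interior_angle k C (f p) a -> interior_angle k (f @^-1` C) p a.
Proof.
move=> [ha [r [e1 [e2 [r0 h1 h2 h12 hs]]]]]; split=> //; exists r, (g e1), (g e2); split=> //.
- by apply/iso_unit_tangent; rewrite (iso_gf fg).
- by apply/iso_unit_tangent; rewrite (iso_gf fg).
- by rewrite (iso_metric (motion_sym fg)).
have dirE phi : f (lin (cos phi) (g e1) (sin phi) (g e2)) = lin (cos phi) e1 (sin phi) e2.
  by rewrite (iso_lin fg) !(iso_gf fg).
apply/seteqP; split=> q.
  move=> [Cq /iso_disc dq]; have : (C `&` disc k (f p) r) (f q) by split.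
  by rewrite hs => -[phi hphi /= rad]; exists phi => //; apply/iso_radial; rewrite dirE.
move=> [phi hphi /iso_radial]; rewrite dirE => rad.
have : (C `&` disc k (f p) r) (f q) by rewrite hs; exists phi.
by move=> [Cq /iso_disc].
Qed.

End Transport.

Lemma chain_area_swap k n (c : 'I_n -> space) : chain_area k (swap \o c) = - chain_area k c.
Proof.
rewrite /chain_area -sumrN; apply: eq_bigr => i _; rewrite -triC /tri /bil /=.
by congr (_ * gatan k (_ / _)); ring.
Qed.

(** If the region lies on the right of its boundary, composing with a reflection puts it on the left
    and makes the signed sum positive. *)
Lemma polygon_left_chain k n (P : polygon R k n) (A : R) : (0 < n)%N -> area k (region P) = A%:E ->
  (k = Spherical -> A < 2 * pi) -> (k = Spherical -> perimeter P < 2 * pi) ->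
  exists f g, [/\ motion k f g, forall i, upper k (f (vtx P i)),
    bounded_by k (g @^-1` region P) (f \o vtx P) true /\ (forall q, (g @^-1` region P) q -> 0 < q.2),
    forall i, dist k (f (vtx P i)) (f (vtx P (ordS i))) = len P i &
    A = chain_area k (f \o vtx P)].
Proof.
move=> n0 aP A2 short; have [f [g [b [rg up bd dE AE]]]] := polygon_chain n0 aP A2 short.
have Fup q : (g @^-1` region P) q -> 0 < q.2.
  apply: (bounded_upper up bd) => e; rewrite (rigid_area rg) ?aP ?lte_fin; first exact: A2.
    move=> q' sq' nq'; have [e' e0 h] := region_outside sq' nq'; by exists e'.
  by move=> q'; exact: region_surface.
case: b bd AE => bd AE.
  by exists f, g; split=> //; [exact: rigid_motion|rewrite AE mul1r].
exists (swap \o f), (g \o swap); split.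
- exact/motion_swap/rigid_motion.
- by move=> i; have [s z] := up i; split=> //; apply/surface_swap.
- by split; [exact: (bounded_swap bd)|move=> q /= /Fup].
- by move=> i; rewrite -dE /dist /=; congr (_ * gasin k (Num.sqrt _ / _)); rewrite /chord2 /=; ring.
- by rewrite AE mulN1r chain_area_swap.
Qed.

End Motions.

(** * The regular polygon inscribed in a circle *)

Lemma sin_triple (b y : R) :
  sin (b + b) + sin (y + y - (b + b)) + sin (- (y + y)) = 4 * sin b * sin y * sin (y - b).
Proof.
have c (t : R) : cos t ^+ 2 = 1 - sin t ^+ 2 by have := cos2Dsin2 t; lra.
rewrite sinN opprD addrACA !sinD !cosN !sinN; have hy := c y; have hb := c b.
by rewrite !cosD !cosN !sinN; ring: hy hb.
Qed.

Section RegularCircle.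
Variables (k : curvature) (n : nat) (m w : space) (N r : R) (v : 'I_n -> space).
Hypothesis n2 : (2 < n)%N.
Hypothesis sm : surface k m.
Hypothesis hw : unit_tangent k m w.
Hypothesis N0 : 0 < N.
Hypothesis r0 : 0 < r.
Hypothesis Nr : N ^+ 2 + K k * r ^+ 2 = 1.
Hypothesis n0 : (0 < n)%N.
Variable phi : R.
Hypothesis phiE : phi = 2 * pi / n%:R.
Hypothesis vE : forall j : nat, v (windex n0 j) = circ k m w N r (j%:R * phi).
Implicit Types (i j p : 'I_n) (u : space).
Local Notation side i q := (det3 (v i) (v (ordS i)) q).

Let vI i : v i = circ k m w N r (i%:R * phi). Proof. by rewrite -vE windex_ord. Qed.
Let vS i : v (ordS i) = circ k m w N r (i.+1%:R * phi). Proof. by rewrite -{1}(windex_ord n0 i) -windexS vE. Qed.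
Let phi0 : 0 < phi. Proof. by rewrite phiE; have /andP[] := @central_angle_itv n n2. Qed.
Let phi_pi : phi < pi. Proof. by rewrite phiE; have /andP[] := @central_angle_itv n n2. Qed.
Let nphi : n%:R * phi = 2 * pi.
Proof. by rewrite phiE mulrC divfK// pnatr_eq0 -lt0n. Qed.
Let sin0 : 0 < sin phi. Proof. by apply: sin_gt0_pi; rewrite phi0. Qed.

Let s0 : 0 < sin (phi / 2). Proof. by have h1 := phi0; have h2 := phi_pi; apply: sin_gt0_pi; between. Qed.

Let pos (x : R) : 0 < x -> x < n%:R -> 0 < sin (x * phi / 2).
Proof.
move=> x0 xn; have nE := nphi; have x1 : 0 < x * phi by rewrite mulr_gt0.
have x2 : x * phi < n%:R * phi by rewrite ltr_pM2r.
by apply: sin_gt0_pi; between.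
Qed.

Lemma circ_side (j l : nat) : det3 (circ k m w N r (j%:R * phi)) (circ k m w N r (j.+1%:R * phi)) (circ k m w N r (l%:R * phi)) =
  N * r ^+ 2 * (4 * sin (phi / 2) * sin ((l%:R - j%:R) * phi / 2) * sin ((l%:R - j%:R - 1) * phi / 2)).
Proof.
rewrite circ_det// -natr1; congr (_ * _).
rewrite (_ : (l%:R - j%:R - 1) * phi / 2 = (l%:R - j%:R) * phi / 2 - phi / 2); last by field.
by rewrite -sin_triple; congr (sin _ + sin _ + sin _); field.
Qed.

(** In the factorization of [circ_side], the two sine factors that depend on the vertex have the
    same sign: both index differences are between 0 and [n], or both between [- n] and 0. *)
Lemma circ_side_pos i j : j <> i -> j <> ordS i -> 0 < side i (v j).
Proof.
move=> ji jS; rewrite vI vS (vI j) circ_side.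
have Nr0 : 0 < N * r ^+ 2 by rewrite mulr_gt0// exprn_gt0.
rewrite (pmulr_rgt0 _ Nr0) -mulrA pmulr_rgt0; last by rewrite mulr_gt0// s0.
have := ler0n R i; have := ler0n R j => hj hi.
have [l|l|e] := ltngtP (j : nat) (i : nat); last by exfalso; apply: ji; exact: val_inj.
  have h1 : (j%:R : R) < i%:R by rewrite ltr_nat.
  have h2 : (i%:R : R) < n%:R by rewrite ltr_nat.
  have h3 : (i%:R + 1 : R) < n%:R + j%:R.
    rewrite natr1 -natrD ltr_nat.
    have := ltn_ord i; rewrite leq_eqVlt => /predU1P[e|h]; last by apply: ltn_addr.
    rewrite e -[ltnLHS]addn0 ltn_add2l lt0n; apply/eqP => j0; apply: jS; apply/val_inj.
    by rewrite /= e modnn.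
  have neg (x : R) : 0 < - x -> - x < n%:R -> sin (x * phi / 2) < 0.
    by move=> x0 x1; rewrite -oppr_gt0 -sinN -!mulNr; exact: pos.
  by rewrite nmulr_rgt0; apply: neg; lra.
have l2 : (i.+1 < j)%N.
  rewrite ltn_neqAle l andbT; apply/eqP => e; apply: jS; apply/val_inj; rewrite /= e modn_small//.
have ji' : (i%:R + 1 : R) < j%:R by rewrite natr1 ltr_nat.
have jn : (j%:R : R) < n%:R by rewrite ltr_nat.
by rewrite mulr_gt0//; apply: pos; lra.
Qed.

Lemma circ_side_center i : 0 < side i m.
Proof.
rewrite vI vS -det3_cycle circ_det_pole// mulr_gt0 ?exprn_gt0//.
by rewrite -natr1 (_ : _ - _ = phi) //; ring.
Qed.

Lemma det3_frame q : det3 w (trot k m w) q = bil k m q.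
Proof.
pose q' := lin 1 q (- bil k m q) m.
have tq : tangent k m q' by rewrite tangentE /q' bil_linr (surface_bil sm); ring.
have e := frame_tangent sm hw tq.
have : det3 w (trot k m w) q' = 0.
  by rewrite e; move: (trot k m w) (metric _ _ _) (det3 m _ _) => t a b; rewrite det3_lin3 det3_pqp det3_qpp; ring.
rewrite /q' det3_lin3 -(det3_cycle m) (det3_rot_unit sm hw); lra.
Qed.

Lemma circ_side_sum q : \sum_i side i q = n%:R * (r ^+ 2 * sin phi) * bil k m q.
Proof.
rewrite (eq_bigr (fun i => N * (det3 m (v (ordS i)) q - det3 m (v i) q) + r ^+ 2 * sin phi * bil k m q)).
  rewrite big_split/= -mulr_sumr sumrB (sum_ordS (fun i => det3 m (v i) q)) subrr mulr0 add0r.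
  by rewrite sumr_const card_ord -[LHS]mulr_natl; ring.
move=> i _; rewrite -det3_frame vI vS /circ.
rewrite (_ : sin phi = sin (i.+1%:R * phi - i%:R * phi)); last by congr sin; rewrite -natr1; ring.
rewrite sinB; move: (i.+1%:R * phi) (i%:R * phi) (trot k m w) => s t x.
by rewrite /det3 /lin /=; ring.
Qed.

(** The trigonometric recurrence, summed over the cycle, gives [(1 - cos phi)] times the sum equal
    to zero. *)
Lemma circ_mean0 q : \sum_i det3 m (v i) q = 0.
Proof.
pose g i := det3 m (v i) q.
have rec i : g (ordS (ordS i)) + g i = 2 * cos phi * g (ordS i).
  have vSS : v (ordS (ordS i)) = circ k m w N r (i.+2%:R * phi) by rewrite -{1}(windex_ord n0 i) -!windexS vE.
  rewrite /g vSS vS vI /circ -!natr1.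
  rewrite (_ : (i%:R + 1 + 1) * phi = (i%:R + 1) * phi + phi); last by ring.
  rewrite (_ : i%:R * phi = (i%:R + 1) * phi - phi); last by ring.
  rewrite !cosD !sinD cosN sinN; move: ((i%:R + 1) * phi) (trot k m w) => s x.
  by rewrite /det3 /lin /=; ring.
have : \sum_i (g (ordS (ordS i)) + g i) = \sum_i (2 * cos phi * g (ordS i)) by apply: eq_bigr => i _; exact: rec.
rewrite big_split/= -mulr_sumr (sum_ordS (fun i => g (ordS i))) (sum_ordS g) -/(g _) => e.
have c1 : cos phi < 1.
  rewrite lt_neqAle cos_le1 andbT; apply/eqP => h; apply: (@cos_eq1 phi) => //.
  by have := @pi_gt0 R; have := phi_pi; lra.
have : (1 - cos phi) * \sum_i g i = 0 by lra.
by move/eqP; rewrite mulf_eq0 subr_eq0 eq_sym (lt_eqF c1) => /eqP.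
Qed.

Lemma circ_edge i : chord2 k (v i) (v (ordS i)) = (2 * (r * sin (phi / 2))) ^+ 2.
Proof.
have hp : 0 < phi < pi by rewrite phi0.
have vE' (n0' : (0 < n)%N) (j : nat) : v (windex n0' j) = circ k m w N r (j%:R * phi).
  by rewrite -vE; congr v; exact: val_inj.
by have [_ [h _]] := @circle_chain_bound k n n2 v m w N r phi sm hw N0 r0 Nr hp (vE' _).
Qed.

Lemma circ_dist i : dist k (v i) (v (ordS i)) = regular_side k n r.
Proof.
rewrite /dist circ_edge sqrtr_sqr ger0_norm; last first.
  by rewrite !mulr_ge0 ?(ltW r0)// sin_ge0_pi//; apply/andP; split; have := phi0; have := phi_pi; lra.
by rewrite /regular_side -phiE; congr (_ * gasin k _); field.
Qed.

Section Sides.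
Hypothesis uv : forall i, upper k (v i).
Let sv i : surface k (v i) := (uv i).1.
Variables (dr : 'I_n -> space).
Local Notation l := (regular_side k n r).
Hypothesis drU : forall i, unit_tangent k (v i) (dr i).
Hypothesis lnE : forall i, geodesic k (v i) (dr i) l = v (ordS i).

Lemma regular_side_gt0 : 0 < l.
Proof.
have i : 'I_n by exact: Ordinal n0.
rewrite lt_neqAle -(circ_dist i) dist_ge0// andbT eq_sym; apply/eqP => /(dist_eq0 (sv _) (sv _)) e.
by have := circ_side_center i; rewrite -e det3pp ltxx.
Qed.

Lemma regular_side_ltpi : k = Spherical -> l < pi.
Proof.
move=> ks; have i : 'I_n by exact: Ordinal n0.
rewrite -(circ_dist i); apply: dist_ltpi ks => // ks e; have [_ z1] := uv i; have [_ z2] := uv (ordS i).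
by move: z2; rewrite e /= oppr_gt0 ltNge (ltW z1).
Qed.

(* The cosine law gives the same angle at all vertices. *)
Lemma circ_angle : exists a, forall i, interior_angle k (chain_region k v) (v i) a.
Proof.
have lp := regular_side_gt0; have lpi := regular_side_ltpi.
have sl : 0 < gsin k l by exact: gsin_gt0.
pose y := 2 * r ^+ 2 * (1 - cos (2 * phi)).
pose c := 1 - y / (2 * gsin k l ^+ 2).
have back p : exists e', [/\ unit_tangent k (v (ordS p)) e', geodesic k (v (ordS p)) e' l = v p,
    metric k (dr (ordS p)) e' = c & det3 (v (ordS p)) (dr (ordS p)) e' != 0].
  have [e' [he eE]] := edge_backward sv drU (ln := fun=> l) lnE (erefl (ordS p)); exists e'; split=> //.
    have : chord2 k (v p) (v (ordS (ordS p))) = y.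
      have vSS : v (ordS (ordS p)) = circ k m w N r (p.+2%:R * phi) by rewrite -{1}(windex_ord n0 p) -!windexS vE.
      by rewrite vSS vI circ_chord2//; congr (_ * (1 - _)); rewrite -cosN; congr cos; rewrite -!natr1; ring.
    rewrite -(lnE (ordS p)) -[in chord2 _ (v p)]eE => ch.
    have : y = gsin k l ^+ 2 * (2 - 2 * metric k (dr (ordS p)) e').
      have h1 := (drU (ordS p)).2; have h2 := he.2.
      rewrite -ch !geodesicE; transitivity (gsin k l ^+ 2 * (metric k (dr (ordS p)) (dr (ordS p)) + metric k e' e' - 2 * metric k (dr (ordS p)) e')).
        by rewrite /chord2 /metric /=; ring.
      by rewrite h1 h2; ring.
    by rewrite /c => ->; field; rewrite gt_eqF.
  apply/eqP => d0; have := @circ_side_pos (ordS p) p.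
  rewrite -(lnE (ordS p)) -eE !geodesicE det3_lin2 det3pp !det3_lin3 det3_pqp d0.
  rewrite (_ : gcos _ _ * 0 + _ = 0); last by ring.
  rewrite ltxx => h.
  have [] // : (false : Prop); apply: h; first by move/esym; exact: (ordS_neq' n2).
  by move/esym; exact: (@ordSS_neq n n2).
have [t [t0 tp ct]] : exists t, [/\ 0 < t, t < pi & cos t = c].
  have i : 'I_n by exact: Ordinal n0.
  have [e' [he _ mc nz]] := back i; have := cauchy_tangent (sv _) (drU _) he; rewrite mc => cs.
  have p0 : 0 < det3 (v (ordS i)) (dr (ordS i)) e' ^+ 2 by rewrite lt_neqAle sqr_ge0 eq_sym sqrf_eq0 nz.
  have c1 : -1 < c < 1 by apply/andP; split; nra.
  have /andP[c2 c3] := c1; exists (acos c); split.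
  - by rewrite acos_gt0// ltW.
  - by rewrite acos_ltpi// c2 ltW.
  - by rewrite acosK// in_itv /= !ltW.
exists t => i; have [p pi'] : exists p : 'I_n, ordS p = i by exists (ord_pred i); rewrite ord_predK.
have [e' [he eE mc _]] := back p; rewrite pi' in he eE mc.
have ht : 0 < t < pi by rewrite t0.
exact: (region_angle n2 sv circ_side_pos (ln := fun=> l) drU (fun=> lp) lnE (fun e _ => lpi e) pi' he eE ht (etrans mc (esym ct))).
Qed.

End Sides.

End RegularCircle.

(** * The circle of the regular polygon of given area *)

(** The sine of half a side is [r * sin (phi / 2)] with [r < 1], so half a side is shorter than
    [phi / 2], its value on a great circle. *)
Lemma regular_side_short n (N r : R) : (2 < n)%N -> 0 < N -> 0 < r -> N ^+ 2 + r ^+ 2 = 1 ->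
  n%:R * regular_side Spherical n r < 2 * pi.
Proof.
move=> n2 N0 r0 Nr; have /andP[p0 ppi] := @central_angle_itv n n2; have pi0 := @pi_gt0 R.
have nR : 0 < n%:R :> R by rewrite ltr0n; exact: ltnW (ltnW n2).
rewrite mulrC -ltr_pdivlMr// /regular_side; move: (2 * pi / n%:R) p0 ppi => phi p0 ppi.
have r1 : r < 1 by have := exprn_gt0 2 N0; nra.
have s0 : 0 < sin (phi / 2) by apply: sin_gt0_pi; between.
have s1 := sin_le1 (phi / 2).
have lt : asin (r * sin (phi / 2)) < asin (sin (phi / 2)).
  rewrite -[X in X < _]/(gasin Spherical _) -[X in _ < X]/(gasin Spherical _) ltr_gasin.
  - by rewrite gtr_pMl.
  - by move=> _; have := mulr_gt0 r0 s0; have : r * sin (phi / 2) < sin (phi / 2) by [rewrite gtr_pMl|]; lra.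
  - by move=> _; between.
rewrite sinK in lt; last by rewrite in_itv /=; between.
by rewrite /=; lra.
Qed.

Lemma exists_circle k n (A : R) : (2 < n)%N ->
  match k with
  | Flat => 0 < A
  | Spherical => 0 < A < 2 * pi
  | Hyperbolic => 0 < A < (n%:R - 2) * pi
  end -> exists N r, [/\ 0 < N, 0 < r, N ^+ 2 + K k * r ^+ 2 = 1 &
    2 * n%:R * gatan k (corner k N r (2 * pi / n%:R)) = A].
Proof.
move=> n2 hA; have /andP[p0 ppi] := @central_angle_itv n n2; have pi0 := @pi_gt0 R.
have nR : 0 < n%:R :> R by rewrite ltr0n; exact: ltnW (ltnW n2).
have nphi : n%:R * (2 * pi / n%:R) = 2 * pi :> R by rewrite mulrC divfK// gt_eqF.
move: (2 * pi / n%:R) nphi p0 ppi => phi nphi p0 ppi.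
have s0 : 0 < sin phi by apply: sin_gt0_pi; rewrite p0.
(* Half the area of one of the [n] triangles around the centre. *)
pose th := A / (2 * n%:R).
have thE : 2 * n%:R * th = A by rewrite /th mulrC divfK// gt_eqF// mulr_gt0.
have A0 : 0 < A by move: hA; case: (k) => // /andP[].
have th0 : 0 < th by rewrite /th divr_gt0// mulr_gt0.
(* [x] is the squared tangent of half the radius, hyperbolic and with a minus sign for negative
   curvature, whence [N = (1 - x) / (1 + x)]. In this parameter the area equation is linear. *)
have nonflat (x : R) : K k * K k = 1 -> @gatan k =1 @atan R -> 0 < K k * x -> -1 < x -> x < 1 -> th < pi / 2 ->
    x * (K k * (sin phi * cos th) - cos phi * sin th) = sin th ->
    exists N r, [/\ 0 < N, 0 < r, N ^+ 2 + K k * r ^+ 2 = 1 & 2 * n%:R * gatan k (corner k N r phi) = A].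
  move=> KK ga Kx x1 x2 t2 xe; have q0 : 0 < 1 + x by lra.
  pose N := (1 - x) / (1 + x).
  have N0 : 0 < N by rewrite divr_gt0//; lra.
  have rr : 0 < 4 * (K k * x) / (1 + x) ^+ 2 by rewrite divr_gt0 ?exprn_gt0// pmulr_rgt0.
  exists N, (Num.sqrt (4 * (K k * x) / (1 + x) ^+ 2)).
  have r2 := sqr_sqrtr (ltW rr); split=> //; first by rewrite sqrtr_gt0.
    rewrite r2 /N; transitivity (((1 - x) ^+ 2 + 4 * x * (K k * K k)) / (1 + x) ^+ 2).
      by field; rewrite gt_eqF.
    by rewrite KK; field; rewrite gt_eqF.
  have c0 : 0 < cos th by apply: cos_gt0_pihalf; between.
  have d0 : 0 < 1 + x * cos phi.
    have cs := cos2Dsin2 phi; have s2 := exprn_gt0 2 s0.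
    have [h|h] := leP 0 (cos phi).
      have h1 : cos phi < 1 by nra.
      by have := mulr_ge0 (ltW q0) h; lra.
    have h1 : -1 < cos phi by nra.
    by have : 0 <= (1 - x) * - cos phi by [rewrite mulr_ge0; lra|]; lra.
  have -> : corner k N (Num.sqrt (4 * (K k * x) / (1 + x) ^+ 2)) phi = tan th.
    rewrite /corner r2 /tan.
    have -> : 1 + 2 * N + (N ^+ 2 + K k * (4 * (K k * x) / (1 + x) ^+ 2) * cos phi) = 4 * (1 + x * cos phi) / (1 + x) ^+ 2.
      transitivity ((4 + 4 * x * cos phi * (K k * K k)) / (1 + x) ^+ 2).
        by rewrite /N; field; rewrite gt_eqF.
      by rewrite KK; field; rewrite gt_eqF.
    apply/eqP; rewrite -subr_eq0; apply/eqP.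
    transitivity ((x * (K k * (sin phi * cos th) - cos phi * sin th) - sin th) / ((1 + x * cos phi) * cos th)).
      by field; rewrite !gt_eqF.
    by rewrite xe subrr mul0r.
  by rewrite ga tanK// in_itv /=; between.
have ratio y : th < y -> th + y < pi -> [/\ 0 < sin y, 0 < sin th / sin y & sin th / sin y < 1].
  move=> ty yp; have sy : 0 < sin y by apply: sin_gt0_pi; between.
  have st : 0 < sin th by apply: sin_gt0_pi; between.
  split=> //; first by rewrite divr_gt0.
  rewrite ltr_pdivrMr// mul1r -subr_gt0.
  rewrite (_ : sin y = sin ((y + th) / 2 + (y - th) / 2)); last by congr sin; field.
  rewrite (_ : sin th = sin ((y + th) / 2 - (y - th) / 2)); last by congr sin; field.
  rewrite (_ : _ - _ = 2 * cos ((y + th) / 2) * sin ((y - th) / 2)); last by rewrite sinD sinB; ring.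
  by rewrite !mulr_gt0//; [apply: cos_gt0_pihalf|apply: sin_gt0_pi]; between.
have th_lt (B : R) : A < B * pi -> th < B * phi / 4.
  move=> l; rewrite /th ltr_pdivrMr ?mulr_gt0//; suff : B * phi / 4 * (2 * n%:R) = B * pi by move=> ->.
  transitivity (B * (n%:R * phi) / 2); first by field.
  by rewrite nphi; field.
case: k hA nonflat => /= hA nonflat.
(* The upper bound on the area enters here; it gives [x] absolute value below 1. In the spherical
   case the corresponding inequality is [th < phi / 2]. *)
- have t1 : th + phi / 2 < pi / 2.
    have l : A < n%:R * pi - 2 * pi by move: hA => /andP[_]; lra.
    rewrite -(ltr_pM2l nR); lra.
  have [sp x0 x1] := ratio (th + phi) ltac:(lra) ltac:(lra).
  apply: (nonflat (- (sin th / sin (th + phi)))) => //; try lra.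
  rewrite (_ : -1 * _ - _ = - sin (th + phi)); last by rewrite sinD; ring.
  by rewrite mulrNN divfK ?gt_eqF.
- exists 1, (Num.sqrt (2 * A / (n%:R * sin phi))).
  have rr : 0 < 2 * A / (n%:R * sin phi) by rewrite divr_gt0 ?mulr_gt0.
  split=> //; [by rewrite sqrtr_gt0|by ring|].
  rewrite /corner /= sqr_sqrtr ?ltW// (_ : 1 + 2 * 1 + _ = 4); last by ring.
  by field; rewrite !gt_eqF.
- have t1 : th < phi / 2 by have := th_lt 2 ltac:(by move: hA => /andP[]); lra.
  have [sp x0 x1] := ratio (phi - th) ltac:(lra) ltac:(lra).
  apply: (nonflat (sin th / sin (phi - th))) => //; try lra.
  by rewrite mul1r -sinB divfK ?gt_eqF.
Qed.

(** * Existence of the regular polygon and the isoperimetric inequality for polygons *)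

Section Fixed.
Variables (k : curvature) (n : nat) (A N0 r0 : R).
Hypothesis n2 : (2 < n)%N.
Hypothesis A0 : 0 < A.
Hypothesis N0_gt0 : 0 < N0.
Hypothesis r0_gt0 : 0 < r0.
Hypothesis Nr0 : N0 ^+ 2 + K k * r0 ^+ 2 = 1.
Hypothesis AE : 2 * n%:R * gatan k (corner k N0 r0 (2 * pi / n%:R)) = A.
Let n0 : (0 < n)%N. Proof. exact: ltnW (ltnW n2). Qed.
Local Notation phi := (2 * @pi R / n%:R).
Let phi_itv : 0 < phi < pi. Proof. exact: central_angle_itv. Qed.
Let E_gt0 : 0 < n%:R * (r0 ^+ 2 * sin phi).
Proof. by have h := phi_itv; rewrite mulr_gt0 ?ltr0n// mulr_gt0 ?exprn_gt0// sin_gt0_pi. Qed.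

Let choose_dir (v : 'I_n -> space) l : (forall i, upper k (v i)) ->
  (forall i, dist k (v i) (v (ordS i)) = l) -> exists dr : 'I_n -> space,
  (forall i, unit_tangent k (v i) (dr i)) /\ forall i, geodesic k (v i) (dr i) l = v (ordS i).
Proof.
move=> uv vl; have ex i : exists u, unit_tangent k (v i) u /\ geodesic k (v i) u l = v (ordS i).
  have [|u hu <-] := exists_join (uv i).1 (uv (ordS i)).1; last by exists u; rewrite vl.
  move=> _ e; have := (uv (ordS i)).2; rewrite e /= oppr_gt0 ltNge => /negP; apply.
  exact/ltW/(uv i).2.
by have [dr hdr] := choice ex; exists dr; split=> i; have [] := hdr i.
Qed.

Lemma exists_regular_polygon : exists Q : polygon R k n,
  area k (region Q) = A%:E /\ perimeter Q = n%:R * regular_side k n r0.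
Proof.
pose w : space := (1, 0, 0); pose m : space := origin.
have um : upper k m by exact: upper_origin.
have hw : unit_tangent k m w by split; rewrite /tangent /metric /=; ring.
pose v (i : 'I_n) := circ k m w N0 r0 (i%:R * phi).
have nphi : n%:R * phi = 2 * pi by rewrite mulrC divfK// pnatr_eq0 -lt0n.
have vE (j : nat) : v (windex n0 j) = circ k m w N0 r0 (j%:R * phi).
  elim/ltn_ind: j => j IH; have [jn|nj] := ltnP j n; first by rewrite /v /= modn_small.
  rewrite -(subnK nj) windexDn IH; last by rewrite ltn_subrL n0 (leq_trans n0 nj).
  rewrite (_ : (j - n + n)%:R * phi = (j - n)%:R * phi + pi *+ 2); last first.
    by have <- : n%:R * phi = pi *+ 2; [rewrite nphi mulr_natl|rewrite natrD; ring].
  by rewrite /circ cosD2pi sinD2pi.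
have uv i : upper k (v i).
  have z : (v i).2 = N0 by rewrite /v /circ /=; ring.
  split; last by rewrite z.
  split; last by rewrite z.
  by have := circ_bil N0 r0 um.1 hw (i%:R * phi) (i%:R * phi); rewrite subrr cos0 mulr1 Nr0 /bil => <-; rewrite !expr2.
have sv i : surface k (v i) := (uv i).1.
have vl := circ_dist n2 um.1 hw N0_gt0 r0_gt0 Nr0 erefl vE.
have [dr [drU lnE]] := choose_dir uv vl.
have lp := regular_side_gt0 n2 um.1 hw N0_gt0 r0_gt0 Nr0 erefl vE uv.
have lpi := regular_side_ltpi n2 um.1 hw N0_gt0 r0_gt0 Nr0 erefl vE uv.
have sp := @circ_side_pos k n m w N0 r0 v n2 um.1 hw N0_gt0 r0_gt0 n0 _ erefl vE.
have sc := @circ_side_center k n m w N0 r0 v n2 um.1 hw r0_gt0 n0 _ erefl vE.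
have ss := @circ_side_sum k n m w N0 r0 v um.1 hw n0 _ vE.
exists (region_polygon n2 um.1 sv E_gt0 sp sc ss (ln := fun=> _) drU (fun=> lp) lnE (fun e _ => lpi e)).
split; last by rewrite /perimeter /= sumr_const card_ord -[LHS]mulr_natl.
have Cup q : chain_region k v q -> 0 < q.2.
  by move=> /(region_pole n2 E_gt0 sp ss); rewrite bil_origin.
rewrite /= (region_area n2 um.1 sv sp sc (circ_mean0 n2 erefl vE) uv Cup); congr EFin.
have [_ [_ tr]] := @circle_chain_bound k n n2 v m w N0 r0 phi um.1 hw N0_gt0 r0_gt0 Nr0 phi_itv
  (fun j => etrans (congr1 v (val_inj erefl)) (vE j)).
rewrite -AE -[LHS]/(chain_area k v) (chain_area_from um uv); last by move=> i; rewrite bil_origin; exact: (uv i).2.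
by rewrite (eq_bigr _ (fun i _ => tr i)) sumr_const card_ord -[LHS]mulr_natl; ring.
Qed.

(** By [regular_side_short], a spherical polygon of perimeter at least [2 * pi] satisfies the strict
    inequality; all others are reduced to chains. In case of equality, regularity is read off the
    inscribed polygon and carried back by the motion. *)
Lemma polygon_isoperimetric (P : polygon R k n) : area k (region P) = A%:E -> (k = Spherical -> A < 2 * pi) ->
  n%:R * regular_side k n r0 <= perimeter P /\
  (perimeter P = n%:R * regular_side k n r0 -> regular_ngon P).
Proof.
move=> aP A2; have short : k = Spherical -> n%:R * regular_side k n r0 < 2 * pi.
  move=> e; have := Nr0; rewrite e /= mul1r => Nr1; exact: regular_side_short N0_gt0 r0_gt0 Nr1.
case: (pselect (k = Spherical -> perimeter P < 2 * pi)) => [sh|long]; last first.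
  have [ks lp] : k = Spherical /\ 2 * pi <= perimeter P.
    by split; [apply: contrapT => h; apply: long|rewrite leNgt; apply/negP => h; apply: long].
  have := short ks; clear ks; split; first by lra.
  by move=> e; exfalso; clear aP; lra.
have [f [g [fg up [bd Fup] dE AE']]] := polygon_left_chain n0 aP A2 sh.
have L : chain_length k (f \o vtx P) = perimeter P by apply: eq_bigr => i _; exact: dE.
have [] := chain_isoperimetric n2 A0 N0_gt0 r0_gt0 Nr0 AE up (fun e => eq_ind_r (fun x => x < 2 * pi) (sh e) L)
  (eq_ind _ (fun x => A <= x) (lexx A) _ AE').
rewrite L => le eq; split=> // /eq[m [w [um hw vE]]].
have sp := @circ_side_pos k n m w N0 r0 (f \o vtx P) n2 um.1 hw N0_gt0 r0_gt0 _ _ erefl vE.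
have sc := @circ_side_center k n m w N0 r0 (f \o vtx P) n2 um.1 hw r0_gt0 _ _ erefl vE.
have ss := @circ_side_sum k n m w N0 r0 (f \o vtx P) um.1 hw _ _ vE.
have FC := region_unique n2 um up E_gt0 sp sc ss bd Fup.
have PE : region P = f @^-1` chain_region k (f \o vtx P).
  by rewrite -FC; apply/seteqP; split=> q /=; rewrite (iso_fg fg).
have vl := @circ_dist k n m w N0 r0 (f \o vtx P) n2 um.1 hw N0_gt0 r0_gt0 Nr0 _ _ erefl vE.
have [dr [drU lnE]] := choose_dir up vl.
split.
- by rewrite PE; apply: (iso_convex fg); exact: region_convex.
- by move=> i j; rewrite -!dE -[LHS]/(dist k ((f \o vtx P) i) ((f \o vtx P) (ordS i))) vl -(vl j).
- have [a ha] := @circ_angle k n m w N0 r0 (f \o vtx P) n2 um.1 hw N0_gt0 r0_gt0 Nr0 _ _ erefl vE up dr drU lnE.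
  by exists a => i; rewrite PE; apply: (iso_angle fg); exact: ha.
- by move=> _; rewrite PE; apply: (iso_proper fg); exact: region_proper n2 E_gt0 sp ss.
Qed.

End Fixed.

(** * Sides and angles of convex polygons *)

(** Identifies an interior angle [a], a priori up to [2 * pi], with the angle between the sides of
    directions [x] and [y]. If [x] or [y] were not at the proper end of [[0, a]], a direction
    slightly beyond it would be in the sector with the wrong sign. [D] is the orientation of the
    frame. *)
Lemma sector_ends (D a x y : R) : D = 1 \/ D = -1 -> 0 < a < 2 * pi -> 0 <= x <= a -> 0 <= y <= a ->
  (forall t, 0 <= t <= a -> 0 <= D * sin (t - x)) -> (forall t, 0 <= t <= a -> 0 <= D * sin (y - t)) ->
  cos (y - x) = cos a.
Proof.
move=> hD /andP[a0 a2] /andP[x0 xa] /andP[y0 ya] hx hy; have pi1 := @pihalf_ge1 R.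
have step (d : R) : 0 < d -> d <= 1 -> 0 < sin d by move=> d0 d1; apply: sin_gt0_pi; between.
have below (z : R) : 0 < z -> exists2 d : R, 0 < d & d <= 1 /\ d <= z.
  by move=> z0; exists (Num.min z 1); [rewrite lt_min z0 ltr01|rewrite !ge_min !lexx orbT].
case: hD => D1; rewrite D1 in hx hy.
  have ex : x = 0.
    apply/eqP; rewrite eq_le x0 andbT leNgt; apply/negP => l; have [d d0 [d1 dz]] := below _ l.
    have := hx (x - d) ltac:(by between); rewrite (_ : x - d - x = - d) ?sinN; last by ring.
    by have := step _ d0 d1; lra.
  have ey : y = a.
    apply/eqP; rewrite eq_le ya leNgt; apply/negP => l; have [|d d0 [d1 dz]] := below (a - y); first by lra.
    have := hy (y + d) ltac:(by between); rewrite (_ : y - (y + d) = - d) ?sinN; last by ring.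
    by have := step _ d0 d1; lra.
  by rewrite ex ey subr0.
have ex : x = a.
  apply/eqP; rewrite eq_le xa leNgt; apply/negP => l; have [|d d0 [d1 dz]] := below (a - x); first by lra.
  have := hx (x + d) ltac:(by between); rewrite (_ : x + d - x = d); last by ring.
  by have := step _ d0 d1; lra.
have ey : y = 0.
  apply/eqP; rewrite eq_le y0 andbT leNgt; apply/negP => l; have [d d0 [d1 dz]] := below _ l.
  have := hy (y - d) ltac:(by between); rewrite (_ : y - (y - d) = d); last by ring.
  by have := step _ d0 d1; lra.
by rewrite ex ey sub0r cosN.
Qed.

Lemma geodesic_antipode k (q u : R * R * R) : k = Spherical -> geodesic k q u pi = - q.
Proof. by move=> ->; rewrite geodesicE /= cospi sinpi; coords. Qed.

Section ConvexPolygonShape.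
Variables (k : curvature) (n : nat) (P : polygon R k n).
Hypothesis cP : convex k P.
Hypothesis pP : k = Spherical -> Defs.proper P.
Implicit Types (i j p : 'I_n) (u : space).
Local Notation v := (vtx P).

Let gamP i t : 0 <= t <= len P i -> region P (geodesic k (v i) (dir P i) t).
Proof.
move=> ht; have : boundary k P (geodesic k (v i) (dir P i) t).
  by apply/boundary_edge; exists i; exists t; rewrite /= ?in_itv.
by move=> /boundary_region[].
Qed.

Let vtxP i : region P (v i).
Proof.
by have := @gamP i 0; rewrite geodesic0; apply; rewrite lexx ltW// polygon_len.
Qed.

(** A longer side would contain the antipode of its origin, which properness forbids. *)
Lemma convex_len_ltpi i : k = Spherical -> len P i < pi.
Proof.
move=> ks; rewrite ltNge; apply/negP => lp; apply: (pP ks (vtxP i)).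
have := @gamP i pi; rewrite lp (pi_ge0 R) => /(_ isT); congr (region P _).
exact: geodesic_antipode.
Qed.

Let len_pi : k = Spherical -> forall i, len P i < pi := fun e i => convex_len_ltpi i e.

(** A point on the wrong side would be joined within the region to the middle of the edge, and the
    joining segment would arrive there from the side on which [two_sided] excludes the region. *)
Lemma convex_side (b : bool) : (forall i t, 0 < t < len P i -> two_sided P i t b) ->
  forall i q, region P q -> 0 <= (if b then 1 else -1) * det3 (v i) (dir P i) q.
Proof.
move=> ts i q Pq; rewrite leNgt; apply/negP; set o : R := if b then 1 else -1 => neg.
have li := polygon_len P i; have hi : 0 < len P i / 2 < len P i by between.
pose x := geodesic k (v i) (dir P i) (len P i / 2).
have Px : region P x by apply: gamP; between.
have sx : surface k x by exact: region_surface Px.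
have sq : surface k q by exact: region_surface Pq.
have side0 : det3 (v i) (dir P i) x = 0 by rewrite /x geodesicE det3_lin3 det3_pqp det3_qpp; ring.
have xq : x <> q by move=> e; rewrite -e side0 mulr0 ltxx in neg.
have na : k = Spherical -> q <> - x by move=> ks e; apply: (pP ks Px); rewrite -e.
have [u hu jq] := exists_join sx sq na.
set l := dist k x q in jq.
have l0 : 0 < l.
  rewrite lt_neqAle dist_ge0// andbT eq_sym; apply/eqP => /(dist_eq0 sx sq); exact: xq.
have lpi : k = Spherical -> l < pi by exact: dist_ltpi.
have seg t : 0 <= t <= l -> region P (geodesic k x u t).
  move=> ht; apply: (cP Px Pq xq na); exists u, l; split=> //; first by split=> //; exact: ltW.
    move=> u' l' [hu' l'0 e]; have [h|h] := pselect (k = Spherical -> l' <= pi).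
      by rewrite /l -e dist_geodesic.
    have [ks lp] : k = Spherical /\ pi < l'.
      by split; [apply: contrapT => h'; apply: h|rewrite ltNge; apply/negP => h'; apply: h].
    by apply: ltW; apply: lt_trans (lpi ks) lp.
  by exists t; rewrite /= ?in_itv.
have sE t : det3 (v i) (dir P i) (geodesic k x u t) = gsin k t * det3 (v i) (dir P i) u.
  by rewrite geodesicE det3_lin3 side0 mulr0 add0r.
have un : o * det3 (v i) (dir P i) u < 0.
  move: neg; rewrite -jq sE mulrCA pmulr_rlt0//; exact: gsin_gt0.
have [e e0 he] := ts i _ hi; have [d d0 hd] := near3_geodesic k x u 0 e0.
pose t := Num.min (d / 2) l; have t0 : 0 < t by rewrite lt_min l0 divr_gt0.
have tl : t <= l by rewrite ge_min lexx orbT.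
have td : t < d by rewrite gt_min; apply/orP; left; lra.
have nt : near3 e x (geodesic k x u t).
  have := hd t; rewrite sub0r normrN gtr0_norm// => /(_ td).
  by rewrite geodesic0.
have [_ h1 h2] := he _ nt; have Pt : region P (geodesic k x u t) by apply: seg; rewrite ltW.
rewrite nrm_id in h1 h2; last exact: region_surface Pt.
have g0 : 0 < gsin k t by apply: gsin_gt0 => // ks; have := lpi ks; clear ks; lra.
rewrite sE in h1 h2; move: h1 h2 un; rewrite /o; case: (b) => h1 h2; rewrite ?mul1r ?mulN1r ?oppr_lt0 => un.
  by have := (h2 ltac:(by rewrite pmulr_rlt0)).1 Pt.
by have := (h1 ltac:(by rewrite pmulr_rgt0)).1 Pt.
Qed.

Lemma polar_inj q u w (s t r : R) : surface k q -> unit_tangent k q u -> unit_tangent k q w ->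
  (k = Spherical -> r <= pi) -> 0 <= s < r -> 0 < t < r ->
  geodesic k q u s = geodesic k q w t -> u = w.
Proof.
move=> sq hu hw rpi /andP[s0 sr] /andP[t0 tr] e.
have st : s = t.
  have := congr1 (dist k q) e; rewrite !dist_geodesic ?(ltW t0)// => ks; have := rpi ks; clear ks; lra.
move: e; rewrite st !geodesicE => e.
have g0 : gsin k t != 0 by rewrite gt_eqF//; apply: gsin_gt0 => // ks; have := rpi ks; clear ks; lra.
apply: eq_space; apply: (mulfI g0).
- by have := congr1 (fun z => z.1.1) e; rewrite /=; lra.
- by have := congr1 (fun z => z.1.2) e; rewrite /=; lra.
- by have := congr1 (fun z => z.2) e; rewrite /=; lra.
Qed.

(** [interior_angle] describes the region near the vertex in some frame; here it becomes a relation
    between the directions of the two sides. Both directions belong to the sector, and by convexity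
    the sector lies on the inner side of both lines. *)
Lemma convex_turn (b : bool) i p a : (forall i t, 0 < t < len P i -> two_sided P i t b) ->
  ordS p = i -> interior_angle k P (v i) a ->
  let w := vel k (v p) (dir P p) (len P p) in metric k (dir P i) (lin (-1) w 0 w) = cos a.
Proof.
move=> ts pi' [ha [r [e1 [e2 [r0 h1 h2 h12 hs]]]]] w; have sv := polygon_vtx P i.
have /andP[a0 a2] := ha.
pose o : R := if b then 1 else -1; pose u (x : R) := lin (cos x) e1 (sin x) e2.
have oo : o * o = 1 by rewrite /o; case: (b); ring.
have hs' q : (region P q /\ disc k (v i) r q) <-> exists2 x, 0 <= x <= a & radial k (v i) (u x) r q.
  split=> [[Pq dq]|[x hx rq]].
    have : (P `&` disc k (v i) r) q by split.
    by rewrite hs => -[x /= hx rq]; exists x.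
  have : (P `&` disc k (v i) r) q by rewrite hs; exists x.
  by [].
have mu (x y : R) : metric k (u x) (u y) = cos (y - x).
  by rewrite /u !(metric_linl, metric_linr) (metricC k e2 e1) h12 h1.2 h2.2 cosB; ring.
have hu (x : R) : unit_tangent k (v i) (u x).
  split; last by rewrite mu subrr cos0.
  by rewrite tangentE /u bil_linr (bil_tangent h1.1) (bil_tangent h2.1); ring.
have du (x y : R) : det3 (v i) (u x) (u y) = det3 (v i) e1 e2 * sin (y - x).
  by rewrite /u !(det3_lin2, det3_lin3) !det3_qpp (det3_swap23 _ e2 e1) sinB; ring.
(* A larger disc would put the antipode of the vertex into the region; below [pi] polar coordinates
   are injective. *)
have rpi : k = Spherical -> r <= pi.
  move=> ks; rewrite leNgt; apply/negP => lt; apply: (pP ks (vtxP i)).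
  have [] : region P (- v i) /\ disc k (v i) r (- v i); last by [].
  apply/hs'; exists 0; first by rewrite lexx ltW.
  exists pi; first by rewrite /= in_itv /= pi_ge0.
  exact: geodesic_antipode.
have inside (y : space) l : unit_tangent k (v i) y -> 0 < l -> (forall t, 0 < t < l -> region P (geodesic k (v i) y t)) ->
    exists2 x, 0 <= x <= a & y = u x.
  move=> hy l0 hl; pose t := Num.min l r / 2.
  have t0 : 0 < t by rewrite divr_gt0// lt_min l0.
  have tl : t < l by have : Num.min l r <= l by [rewrite ge_min lexx|]; rewrite /t in t0 *; lra.
  have tr : t < r by have : Num.min l r <= r by [rewrite ge_min lexx orbT|]; rewrite /t in t0 *; lra.
  have [|x hx [s /= hs1 e]] := (hs' (geodesic k (v i) y t)).1.
    split; first by apply: hl; rewrite t0.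
    by exists y => //; exists t; rewrite /= ?in_itv/= ?ltW.
  exists x => //; rewrite in_itv /= in hs1; apply/esym.
  by apply: (polar_inj sv (hu x) hy rpi hs1 _ e); rewrite t0.
have [x hx dE] := inside _ _ (polygon_dir P i) (polygon_len P i) (fun t ht => gamP (introT andP (conj (ltW (andP ht).1) (ltW (andP ht).2)))).
have hw : unit_tangent k (v i) w := unit_w P pi'.
have [y hy wE] : exists2 y, 0 <= y <= a & lin (-1) w 0 w = u y.
  apply: (inside _ (len P p)); [exact: unit_tangentN|exact: polygon_len|].
  move=> t /andP[t0 tl]; rewrite (geodesic_back P pi'); apply: gamP; between.
pose D := o * det3 (v i) e1 e2.
have hD : D = 1 \/ D = -1.
  have := cauchy_tangent sv h1 h2; rewrite h12 expr0n /= add0r => e.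
  have : D ^+ 2 = 1 by rewrite /D exprMn e expr2 oo mulr1.
  by move=> /eqP; rewrite sqrf_eq1 => /orP[]/eqP ->; [left|right].
have small (z : R) : 0 <= z <= a -> exists t, 0 < gsin k t /\ region P (geodesic k (v i) (u z) t).
  move=> hz; exists (r / 2); split.
    by apply: gsin_gt0; [lra|move=> ks; have := rpi ks; clear ks; lra].
  have [] : region P (geodesic k (v i) (u z) (r / 2)) /\ disc k (v i) r (geodesic k (v i) (u z) (r / 2)); last by [].
  have hr : 0 <= r / 2 < r by apply/andP; split; clear wE; lra.
  by apply/hs'; exists z => //; exists (r / 2); rewrite /= ?in_itv.
rewrite wE dE mu; apply: (sector_ends hD ha hx hy) => z hz; have [t [g0 Pt]] := small z hz.
  have := convex_side ts i Pt; rewrite -/o geodesicE det3_lin3 det3_pqp mulr0 add0r dE du.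
  rewrite (_ : o * _ = gsin k t * (D * sin (z - x))); last by rewrite /D; ring.
  by rewrite pmulr_rge0.
have := convex_side ts p Pt; rewrite -/o (side_w P pi') geodesicE det3_lin3 det3_pqp mulr0 add0r -/w.
have -> : det3 (v i) w (u z) = det3 (v i) (u z) (u y).
  by rewrite -wE; move: (u z) (w) => b1 b2; rewrite /det3 /=; ring.
rewrite du (_ : o * _ = gsin k t * (D * sin (y - z))); last by rewrite /D; ring.
by rewrite pmulr_rge0.
Qed.

End ConvexPolygonShape.

Lemma windex_irr n (h h' : (0 < n)%N) j : windex h j = windex h' j.
Proof. exact: val_inj. Qed.

(** * Every regular polygon is inscribed in a circle *)

Section RegularNgon.
Variables (k : curvature) (n : nat).
Hypothesis n2 : (2 < n)%N.
Let n0 : (0 < n)%N. Proof. exact: ltnW (ltnW n2). Qed.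
Implicit Types (i j : 'I_n) (p u : space).
Local Notation phi0 := (2 * @pi R / n%:R).

(* If the central angle were larger, the first point past a full turn would lie
   strictly on the wrong side of the first edge. *)
Lemma simple_chain_circle (c : 'I_n -> space) : (forall i, surface k (c i)) ->
  (forall i, -1 < bil k (c i) (c (ordS i))) -> regular_chain k c -> injective c ->
  (forall i j, 0 <= det3 (c i) (c (ordS i)) (c j)) ->
  exists m w N r, [/\ surface k m, unit_tangent k m w, 0 < N /\ 0 < r, N ^+ 2 + K k * r ^+ 2 = 1 &
    forall j : nat, c (windex n0 j) = circ k m w N r (j%:R * phi0)] /\
    (forall o, (forall i, 0 < bil k o (c i)) -> 0 < bil k o m).
Proof.
move=> sc bc rc ic dc; have pi0 := @pi_gt0 R.
have [m [w [N [r [phi [[sm hw [N1 r1] pp e] [cE om]]]]]]] := regular_chain_circle n0 sc bc rc.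
have cE' (j : nat) : c (windex n0 j) = circ k m w N r (j%:R * phi) := cE j.
have [le _] := @circle_chain_bound k n n2 c m w N r phi sm hw N1 r1 e pp
  (fun j : nat => etrans (congr1 c (windex_irr _ _ _)) (cE' j)).
have /andP[p0 ppi] := pp; have nR : 0 < n%:R :> R by rewrite ltr0n.
exists m, w, N, r; split=> //; suff <- : phi = phi0 by split.
apply/eqP; rewrite eq_le le andbT leNgt; apply/negP => lt.
have full : 2 * pi < n%:R * phi by move: lt; rewrite ltr_pdivrMr// (mulrC phi).
have ex : exists j : nat, 2 * pi <= j%:R * phi by exists n; exact: ltW.
case: (ex_minnP ex) => j hj jmin.
have j1 : (0 < j)%N by rewrite lt0n; apply/eqP => j0; move: hj; rewrite j0 mul0r; lra.
have jn : (j <= n)%N by apply: jmin; exact: ltW.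
have hj1 : j.-1%:R * phi < 2 * pi.
  by rewrite ltNge; apply/negP => /jmin; rewrite -ltnS prednK// ltnn.
have jE : (j%:R : R) = j.-1%:R + 1 by rewrite natr1 prednK.
move: hj; rewrite le_eqVlt => /predU1P[turn|past].
  have : windex n0 j = windex n0 0.
    apply: ic; rewrite !cE' -turn mul0r /circ mulr_natl cos2pi sin2pi cos0 sin0.
    by [].
  move/(congr1 val) => /=; rewrite mod0n.
  move: jn; rewrite leq_eqVlt => /predU1P[jn|jn].
    by move: full; rewrite -jn -turn ltxx.
  by rewrite modn_small// => j0; rewrite j0 in j1.
have := dc (windex n0 0) (windex n0 j); rewrite -windexS !cE' circ_side// subr0 !(mulr_ge0_le0, mulrA) => h.
have Nr0 : 0 < N * r ^+ 2 by rewrite mulr_gt0// exprn_gt0.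
have s1 : 0 < sin (phi / 2) by apply: sin_gt0_pi; between.
have s2 : sin (j%:R * phi / 2) < 0.
  have -> : j%:R * phi / 2 = (j%:R * phi / 2 - pi) + pi by ring.
  rewrite sinDpi oppr_lt0; apply: sin_gt0_pi; apply/andP; split; first by lra.
  by rewrite jE mulrDl mul1r; lra.
have s3 : 0 < sin ((j%:R - 1) * phi / 2).
  have e3 : (j%:R - 1 : R) = j.-1%:R by rewrite jE; ring.
  rewrite e3; apply: sin_gt0_pi; apply/andP; split; last by lra.
  have : phi < j%:R * phi by lra.
  by rewrite jE; lra.
move: h; rewrite leNgt => /negP; apply.
by rewrite nmulr_rlt0 ?nmulr_llt0 ?pmulr_rlt0 ?mulr_gt0// !pmulr_rlt0 ?mulr_gt0.
Qed.

(** Equal sides and equal angles give the equal chords of [regular_chain], and convexity puts all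
    vertices on one side of each edge. The motion reverses orientation exactly when the region lies
    on the right, so that the image chain turns left. *)
Lemma regular_ngon_circle (P : polygon R k n) (b : bool) (f g : space -> space) :
  (forall i t, 0 < t < len P i -> two_sided P i t b) -> regular_ngon P -> motion k f g ->
  (forall p q u, det3 (f p) (f q) (f u) = (if b then 1 else -1) * det3 p q u) ->
  exists m w N r, [/\ surface k m, unit_tangent k m w, 0 < N /\ 0 < r, N ^+ 2 + K k * r ^+ 2 = 1 &
    forall j : nat, f (vtx P (windex n0 j)) = circ k m w N r (j%:R * phi0)] /\
    [/\ (forall o, (forall i, 0 < bil k o (f (vtx P i))) -> 0 < bil k o m) &
     perimeter P = n%:R * regular_side k n r].
Proof.
move=> ts [cP eq [a ha] pP] fg fd.
have sv i : surface k (f (vtx P i)) by apply/(iso_surface fg); exact: polygon_vtx.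
pose i0 : 'I_n := Ordinal n0; pose l := len P i0; have lE i : len P i = l by exact: eq.
have l0 : 0 < l by exact: polygon_len.
have lpi : k = Spherical -> l < pi by exact: (convex_len_ltpi pP).
have sl : 0 < gsin k l by exact: gsin_gt0.
have next i : geodesic k (vtx P i) (dir P i) l = vtx P (ordS i) by rewrite -(lE i) polygon_next.
have dE i : dist k (f (vtx P i)) (f (vtx P (ordS i))) = l.
  rewrite /dist (iso_chord2 fg) -/(dist k _ _) -next dist_geodesic ?(ltW l0)//;
    [exact: polygon_vtx|exact: polygon_dir|by move/lpi/ltW].
have vP i : region P (vtx P i).
  have : boundary k P (vtx P i).
    apply/boundary_edge; exists i; exists 0; first by rewrite /= in_itv /= lexx ltW// polygon_len.
    exact: geodesic0.
  by move=> /boundary_region[].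
have ed i q : det3 (vtx P i) (vtx P (ordS i)) q = gsin k l * det3 (vtx P i) (dir P i) q.
  by rewrite (det3_edge (polygon_next P)) lE.
have dets i j : 0 <= det3 (f (vtx P i)) (f (vtx P (ordS i))) (f (vtx P j)).
  by rewrite fd ed mulrCA pmulr_rge0//; apply: (convex_side cP pP ts); exact: vP.
have rc : regular_chain k (f \o vtx P).
  exists (4 * gsin k (l / 2) ^+ 2), (gsin k l ^+ 2 * (2 - 2 * cos a)) => i /=; split.
  - by rewrite (iso_chord2 fg) -next chord2_geodesic//; [exact: polygon_vtx|exact: polygon_dir].
  - rewrite (iso_chord2 fg); have [x [hx back mx]] : exists x, [/\ unit_tangent k (vtx P (ordS i)) x,
        geodesic k (vtx P (ordS i)) x l = vtx P i & metric k (dir P (ordS i)) x = cos a].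
      have hw := unit_w P (erefl (ordS i)).
      exists (lin (-1) (vel k (vtx P i) (dir P i) (len P i)) 0 (vel k (vtx P i) (dir P i) (len P i))); split.
      + exact: unit_tangentN.
      + by rewrite (geodesic_back P (erefl (ordS i))) lE subrr geodesic0.
      + exact: (convex_turn cP pP ts (erefl (ordS i)) (ha _)).
    rewrite -(next (ordS i)) -[in LHS]back -mx !geodesicE.
    have hx2 := hx.2; have := (polygon_dir P (ordS i)).2; move: (dir P (ordS i)) (vtx P (ordS i)) => y z hy.
    transitivity (gsin k l ^+ 2 * (metric k x x + metric k y y - 2 * metric k y x)).
      by rewrite /chord2 /metric /=; ring.
    by rewrite hx2 hy; ring.
  - rewrite lt_neqAle dets andbT eq_sym fd ed (side_w P (erefl (ordS i))) -(next (ordS i)) geodesicE.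
    rewrite det3_lin3 det3_pqp mulr0 add0r; have tn := turn_neq0 P (erefl (ordS i)).
    have sn : gsin k l != 0 by rewrite gt_eqF.
    apply: mulf_neq0; first by case: (b); rewrite ?oppr_eq0 oner_eq0.
    by apply: (mulf_neq0 sn); exact: mulf_neq0.
have bc i : -1 < bil k ((f \o vtx P) i) ((f \o vtx P) (ordS i)).
  rewrite /= (bil_dist (sv _) (sv _)) dE gcos_half'.
  have c0 : 0 < gcos k (l / 2) by apply: gcos_gt0 => ks; have := lpi ks; clear ks; move=> h; between.
  by have := exprn_gt0 2 c0; lra.
have ic : injective (f \o vtx P).
  move=> i j /= /(iso_inj fg) e; have z (i' : 'I_n) : (0 : R) <= 0 < len P i' by rewrite lexx polygon_len.
  have [] // := polygon_simple (p := P) (z i) (z j).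
  by rewrite !geodesic0.
have [m [w [N [r [[sm hw [N1 r1] e cE] om]]]]] := simple_chain_circle sv bc rc ic dets.
exists m, w, N, r; split; [by split|split=> //].
have lr : l = regular_side k n r.
  by rewrite -(circ_dist (v := f \o vtx P) n2 sm hw N1 r1 e erefl cE i0) -(dE i0).
by rewrite /perimeter (eq_bigr (fun=> l) (fun i _ => lE i)) sumr_const card_ord -[LHS]mulr_natl lr.
Qed.

(** The circle is found twice. The first time, with the identity or a plain reflection, it bounds
    the perimeter on the sphere, which gives access to the area formula; the second time, in the
    position of that formula, it relates the area to [corner]. Equal values of [corner] then force
    equal sides, by [corner_compare] in both directions. *)
Lemma regular_ngon_perimeter (P : polygon R k n) (A N0 r0 : R) : 0 < A -> 0 < N0 -> 0 < r0 ->
  N0 ^+ 2 + K k * r0 ^+ 2 = 1 -> 2 * n%:R * gatan k (corner k N0 r0 phi0) = A ->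
  area k (region P) = A%:E -> (k = Spherical -> A < 2 * pi) -> regular_ngon P ->
  perimeter P = n%:R * regular_side k n r0.
Proof.
move=> A0 N00 r00 Nr0 AE aP A2 reg; have [b ts] := polygon_orientation P.
have nR : 0 < n%:R :> R by rewrite ltr0n.
have hphi := @central_angle_itv n n2; have /andP[q0 qpi] := hphi.
have short : k = Spherical -> perimeter P < 2 * pi.
  have [f [g [fg fd]]] : exists f g, motion k f g /\
      forall p q u, det3 (f p) (f q) (f u) = (if b then 1 else -1) * det3 p q u.
    case: (b); [exists id, id|exists (swap \o id), (id \o swap)].
      by split=> [|p q u]; [exact/rigid_motion/rigid_id|rewrite mul1r].
    by split=> [|p q u]; [exact/motion_swap/rigid_motion/rigid_id|rewrite det3_swapped mulN1r].
  have [m [w [N [r [[sm hw [N1 r1] e cE] [om pE]]]]]] := regular_ngon_circle ts reg fg fd.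
  by move=> ks; move: e; rewrite pE ks /= mul1r => e; exact: regular_side_short N1 r1 e.
have [f [g [fg up _ dE AC]]] := polygon_left_chain n0 aP A2 short.
(* The orientation of [f] is adjusted to [b]. This may reverse the sign of the chain area, which is
   settled below by the nonnegativity of [corner]. *)
have [f' [g' [fg' fd' [up' CA']]]] : exists f' g', [/\ motion k f' g',
    forall p q u, det3 (f' p) (f' q) (f' u) = (if b then 1 else -1) * det3 p q u &
    (forall i, upper k (f' (vtx P i))) /\ (chain_area k (f' \o vtx P) = A \/ chain_area k (f' \o vtx P) = - A)].
  have [e he fd] := iso_det fg; have [eo|eo] := eqVneq e (if b then 1 else -1).
    by exists f, g; split=> //; [move=> p q u; rewrite fd eo|split=> //; left].
  exists (swap \o f), (g \o swap); split; first exact: motion_swap.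
    move=> p q u; rewrite /= det3_swapped fd -mulNr; congr (_ * _).
    by move: eo; case: (b); case: he => -> //; rewrite ?opprK ?eqxx.
  split; first by move=> i; have [s z] := up i; split=> //; apply/surface_swap.
  by right; rewrite AC chain_area_swap.
have [m [w [N [r [[sm hw [N1 r1] e cE] [om pE]]]]]] := regular_ngon_circle ts reg fg' fd'.
have um : upper k m.
  split=> //; rewrite -(bil_origin k); apply: om => i; rewrite bil_origin; exact: (up' i).2.
have mc i : 0 < bil k m ((f' \o vtx P) i) by rewrite /= -(windex_ord n0 i) cE circ_pole.
have [_ [_ tr]] := @circle_chain_bound k n n2 (f' \o vtx P) m w N r phi0 sm hw N1 r1 e hphi
  (fun j : nat => etrans (congr1 (f' \o vtx P) (windex_irr _ _ _)) (cE j)).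
have C : chain_area k (f' \o vtx P) = 2 * n%:R * gatan k (corner k N r phi0).
  by rewrite (chain_area_from um up' mc) (eq_bigr _ (fun i _ => tr i)) sumr_const card_ord -[LHS]mulr_natl; ring.
have corner0 : 0 <= corner k N r phi0.
  have s0 : 0 < sin phi0 by exact: sin_gt0_pi.
  have i : 'I_n by exact: Ordinal n0.
  have := upper_bilN1 (up' i) (up' (ordS i)); rewrite -{1}(windex_ord n0 i) -{2}(windex_ord n0 i) -windexS !cE circ_bil//.
  rewrite (_ : i%:R * phi0 - i.+1%:R * phi0 = - phi0) ?cosN; last by rewrite -natr1; ring.
  by move=> h; rewrite /corner divr_ge0 ?mulr_ge0 ?sqr_ge0 ?(ltW s0)//; lra.
have CA : corner k N r phi0 = corner k N0 r0 phi0.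
  have gA : 2 * n%:R * gatan k (corner k N r phi0) = A.
    have : 0 <= 2 * n%:R * gatan k (corner k N r phi0).
      by rewrite mulr_ge0 ?mulr_ge0 ?(ltW nR)// -(gatan0 k) ler_gatan.
    by case: CA'; rewrite C => -> //; lra.
  have nz : 2 * n%:R != 0 :> R by rewrite mulf_neq0 ?gt_eqF.
  have /(mulfI nz) gE : 2 * n%:R * gatan k (corner k N r phi0) = 2 * n%:R * gatan k (corner k N0 r0 phi0) by rewrite gA AE.
  move: (corner k N r phi0) (corner k N0 r0 phi0) gE => x y gE.
  by apply/eqP; rewrite eq_le -(ler_gatan k x y) -(ler_gatan k y x) gE lexx.
have [h1 _] := corner_compare N1 r1 N00 r00 e Nr0 q0 (lexx _) qpi (eq_ind_r (fun x => x <= _) (lexx _) (esym CA)).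
have [h2 _] := corner_compare N00 r00 N1 r1 Nr0 e q0 (lexx _) qpi (eq_ind_r (fun x => x <= _) (lexx _) CA).
by rewrite pE /regular_side; congr (_ * (_ * gasin k _)); apply/eqP; rewrite eq_le h1 h2.
Qed.

End RegularNgon.

End Surface.

Theorem theorem1 (R : realType) (k : curvature) (n : nat) (A : R) :
  (3 <= n)%N ->
  match k with
  | Flat => 0 < A
  | Spherical => 0 < A < 2 * pi
  | Hyperbolic => 0 < A < (n%:R - 2) * pi
  end ->
  forall P : polygon R k n, area k (region P) = A%:E ->
    ((forall Q : polygon R k n, area k (region Q) = A%:E ->
        perimeter P <= perimeter Q)
     <-> regular_ngon P).
Proof.
move=> n2 hA P aP; have A0 : 0 < A by move: hA; case: (k) => // /andP[].
have A2 : k = Spherical -> A < 2 * pi by move: hA => /[swap] -> /andP[].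
have [N [r [N0 r0 Nr AE]]] := exists_circle n2 hA.
split=> [minP|reg Q aQ]; last first.
  by rewrite (regular_ngon_perimeter n2 A0 N0 r0 Nr AE aP A2 reg); exact: (polygon_isoperimetric n2 A0 N0 r0 Nr AE aQ A2).1.
have [Q [aQ pQ]] := exists_regular_polygon n2 N0 r0 Nr AE.
have [le eq] := polygon_isoperimetric n2 A0 N0 r0 Nr AE aP A2.
by apply: eq; apply/eqP; rewrite eq_le le -pQ andbT; exact: minP.
Qed.
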